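(* Let $l,d,m\in\mathbb N$ with $l\ge2$, $d\ge1$, and let $\omega\in\mathbb R^d$ satisfy $k\cdot\omega\ne0$ for all $k\in\mathbb Z^d\setminus\{0\}$. Consider $$\ddot x+\delta\dot x=x^l+h(\omega t,x)+\varepsilon f(\omega t,x),\qquad x\in\mathbb R,\qquad(\ast)$$ with real parameters $\delta,\varepsilon$, where $h$ vanishes to order $l+1$ at $x=0$ and $\overline f(0)\neq0$. Suppose one of the following. (i) (Analytic case) $\rho>0$, $m>d$, $f,h$ are analytic in $\mathbb T^d_\rho\times B$ with $B\subset\mathbb C$ an open ball around the origin, real for real arguments, and $\widetilde f(\cdot,0)\in X:=H^{\rho,m}$. (ii) (Finitely differentiable case) $m>\frac d2$, $f,h\in C^{m+p}(\mathbb T^d\times\mathbb R,\mathbb R)$ for an integer $p\ge1$, and $\widetilde f(\cdot,0)\in X:=H^m(\mathbb T^d,\mathbb R)$. Suppose moreover that $\|\widetilde f(\cdot,0)\|_X$ is small enough compared to $|\overline f(0)|$. Then there exists $\varepsilon_0>0$ such that, with $$\mathcal I=\begin{cases}(-\varepsilon_0,\varepsilon_0) & l \text{ odd},\\ (-\varepsilon_0,0)& l\text{ even and }\overline f(0)>0,\\ (0,\varepsilon_0)& l\text{ even and }\overline f(0)<0,\end{cases}$$ for every $\varepsilon\in\mathcal I$, every $a\in\mathbb R$ solving $a^l+\varepsilon\overline f(0)=0$ and every $\delta\in\mathbb R$ with $$\delta^2+2l\,a^{l-1}\ge0,$$ equation $(\ast)$ has a solution of the form $x(t)=a+V(\omega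 t)$ with $V\in X$. Moreover, this solution is locally unique.
   Context: $\mathbb T^d=\mathbb R^d/(2\pi\mathbb Z)^d$, $\mathbb T^d_\rho=\{\theta\in\mathbb C^d/(2\pi\mathbb Z)^d:|\mathrm{Im}\,\theta_j|\le\rho,\ j=1,\dots,d\}$. For $V(\theta)=\sum_{k\in\mathbb Z^d}\widehat V_ke^{\mathrm ik\cdot\theta}$, $\|V\|^2_{H^{\rho,m}}=\sum_k|\widehat V_k|^2e^{2\rho|k|}(|k|^2+1)^m$ with $|k|=|k_1|+\dots+|k_d|$. $H^{\rho,m}$ ($\rho>0$) is the space of analytic functions on $\mathbb T^d_\rho$ with finite norm, taken real for real arguments; $H^m=H^{0,m}(\mathbb T^d,\mathbb R)$ is the usual Sobolev space. For $f(\theta,x)$, $\overline f(x)=\int_{\mathbb T^d}f(\theta,x)\,d\theta$ (normalized measure) and $\widetilde f(\theta,x)=f(\theta,x)-\overline f(x)$. ''$h$ vanishes to order $l+1$'' means $h(\theta,x)=x^{l+1}H(\theta,x)$ with $H$ analytic in case (i), and $\partial_x^jh(\theta,0)=0$ for $j=0,\dots,l$, with all derivatives of $h$ up to a sufficiently high order (depending only on $l,d,m$) bounded for $x$ near the origin, in case (ii). ''Small enough compared to $|\overline f(0)|$'' means $\|\widetilde f(\cdot,0)\|_X\le\kappa|\overline f(0)|$ for a suitable constant $\kappa>0$ depending only on $l,d,m$ (and $\rho$ in case (i)). ''Locally unique'' means: with $a$ fixed, there is a constant $A>0$ independent of $\varepsilon$ such that $V$ is the only function in the closed ball of radius $A|\varepsilon|^{1/l}$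 around $0$ in $X$ for which $a+V(\omega t)$ solves $(\ast)$. *)

(* Defs.v *)
From HB Require Import structures.
From mathcomp Require Import all_boot all_order all_algebra.
From mathcomp Require Import all_classical all_reals all_analysis.
From mathcomp Require Import complex.

Set Implicit Arguments.
Unset Strict Implicit.
Unset Printing Implicit Defensive.

Import Order.TTheory GRing.Theory Num.Theory.
Import numFieldNormedType.Exports.

Local Open Scope classical_set_scope.
Local Open Scope ring_scope.
Local Open Scope complex_scope.

(* R[i] as an abstract numFieldType, so that the generic topological and
   normed-module instances of numFieldType apply to it. *)
Definition Cx (R : realType) : numFieldType := R[i].

Definition toCx (R : realType) (x : R) : Cx R := x%:C.

(* Functions on the torus T^d are 2 pi Z^d-periodic functions on 'rV[R]_d, and
   functions f(theta, x) on T^d x R are functions on the normed module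
   'rV[R]_d * R, periodic in the first component. *)

Definition dotp (R : realType) (d : nat) (k : 'rV[int]_d) (v : 'rV[R]_d) : R :=
  \sum_j (k 0 j)%:~R * v 0 j.

Definition nonresonant (R : realType) (d : nat) (omega : 'rV[R]_d) : Prop :=
  forall k : 'rV[int]_d, k != 0 -> dotp k omega != 0.

Definition period (K : numFieldType) (R : realType) (inj : R -> K) (d : nat)
    (k : 'rV[int]_d) : 'rV[K]_d :=
  \row_j inj (2 * pi * (k 0 j)%:~R).

Definition torus_periodic (R : realType) (d : nat) (V : 'rV[R]_d -> R) : Prop :=
  forall (k : 'rV[int]_d) theta, V (theta + period id k) = V theta.

(* Mean over T^d for the normalized measure, as an iterated Lebesgue integral;
   all the integrands it is used for are continuous. *)
Fixpoint torus_mean (R : realType) (d : nat) : ('rV[R]_d -> R) -> R :=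
  match d with
  | 0 => fun g => g 0
  | n.+1 => fun g =>
      (2 * pi)^-1 *
      \int[lebesgue_measure]_(s in `[0, 2 * pi])
        torus_mean (fun theta : 'rV[R]_n => g (row_mx (s%:M : 'rV[R]_1) theta))
  end.

(* overline f and widetilde f *)
Definition avg (R : realType) (d : nat) (f : 'rV[R]_d * R -> R) (x : R) : R :=
  torus_mean (fun theta => f (theta, x)).

Definition osc (R : realType) (d : nat) (f : 'rV[R]_d * R -> R) (x : R) :
    'rV[R]_d -> R :=
  fun theta => f (theta, x) - avg f x.

(* The mean of V(theta) e^{- i k . theta} *)
Definition fourier (R : realType) (d : nat) (V : 'rV[R]_d -> R)
    (k : 'rV[int]_d) : R[i] :=
  torus_mean (fun theta => V theta * cos (dotp k theta)) -i*
  torus_mean (fun theta => V theta * sin (dotp k theta)).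

Definition norm1 (d : nat) (k : 'rV[int]_d) : nat := (\sum_j absz (k ord0 j))%N.

Definition Hnorm2 (R : realType) (d : nat) (rho : R) (m : nat)
    (V : 'rV[R]_d -> R) : \bar R :=
  \esum_(k in [set: 'rV[int]_d])
    ((complex.Re (fourier V k) ^+ 2 + complex.Im (fourier V k) ^+ 2)
     * expR (2 * rho * (norm1 k)%:R) * ((norm1 k)%:R ^+ 2 + 1) ^+ m)%:E.

Definition Hnorm (R : realType) (d : nat) (rho : R) (m : nat)
    (V : 'rV[R]_d -> R) : R :=
  Num.sqrt (fine (Hnorm2 rho m V)).

Definition strip (R : realType) (d : nat) (rho : R) : set 'rV[Cx R]_d :=
  [set z | forall j, `|complex.Im (z 0 j)| <= rho].

Definition open_strip (R : realType) (d : nat) (rho : R) : set 'rV[Cx R]_d :=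
  [set z | forall j, `|complex.Im (z 0 j)| < rho].

(* A finite norm in H^{rho,m}, m > d / 2, yields an extension holomorphic in the
   interior of T^d_rho and continuous up to the boundary, but in general not
   beyond it: this is the sense in which members of H^{rho,m} are analytic on
   T^d_rho (H^{rho,m} would not be complete otherwise). *)
Definition strip_extension (R : realType) (d : nat) (rho : R)
    (V : 'rV[R]_d -> R) : Prop :=
  exists U : 'rV[Cx R]_d -> Cx R,
    [/\ forall z, open_strip rho z -> differentiable U z,
        {within strip rho, continuous U},
        forall (k : 'rV[int]_d) z, strip rho z ->
          U (z + period (@toCx R) k) = U z
      & forall theta : 'rV[R]_d,
          U (map_mx (@toCx R) theta) = toCx (V theta)].

(* Membership in H^{rho,m}, a member being given by its restriction to real
   arguments. For rho = 0 this is the Sobolev space H^m(T^d, R) as soon as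
   m > d / 2, each class being represented by its continuous member. *)
Definition in_H (R : realType) (d : nat) (rho : R) (m : nat)
    (V : 'rV[R]_d -> R) : Prop :=
  [/\ continuous V, torus_periodic V, (Hnorm2 rho m V < +oo)%E
    & 0 < rho -> strip_extension rho V].

(* f is the restriction to real arguments of a function F analytic on
   T^d_rho x B, with B the open disc of radius r: since T^d_rho is closed, F is
   holomorphic in a neighbourhood of each point. Nothing is said about
   f (theta, x) for |x| >= r. *)
Definition analytic_on (R : realType) (d : nat) (rho r : R)
    (f : 'rV[R]_d * R -> R) : Prop :=
  exists F : 'rV[Cx R]_d * Cx R -> Cx R,
    [/\ forall p, strip rho p.1 -> `|p.2| < toCx r ->
          \forall q \near p, differentiable F q,
        forall (k : 'rV[int]_d) p, strip rho p.1 -> `|p.2| < toCx r ->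
          F (p.1 + period (@toCx R) k, p.2) = F p
      & forall (theta : 'rV[R]_d) (x : R), `|x| < r ->
          F (map_mx (@toCx R) theta, toCx x) = toCx (f (theta, x))].

Definition vanishes_analytic (R : realType) (d l : nat) (rho r : R)
    (h : 'rV[R]_d * R -> R) : Prop :=
  exists H : 'rV[R]_d * R -> R, analytic_on rho r H /\
    forall theta x, `|x| < r -> h (theta, x) = x ^+ l.+1 * H (theta, x).

Definition dirD (R : realType) (E : normedModType R) (vs : seq E)
    (g : E -> R) : E -> R :=
  foldr (fun v g => 'D_v g) g vs.

(* g is of class C^n on the open set U: its iterated directional derivatives of
   order at most n exist and are continuous on U. *)
Definition Cn_on (R : realType) (E : normedModType R) (n : nat) (U : set E)
    (g : E -> R) : Prop :=
  forall vs : seq E, (size vs <= n)%N ->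
    (forall p, U p -> {for p, continuous (dirD vs g)}) /\
    ((size vs < n)%N -> forall p v, U p -> derivable (dirD vs g) p v).

Definition Cn_torus (R : realType) (d n : nat) (f : 'rV[R]_d * R -> R) : Prop :=
  Cn_on n setT f /\ forall x, torus_periodic (fun theta => f (theta, x)).

Definition vanishes_smooth (R : realType) (d l N : nat)
    (h : 'rV[R]_d * R -> R) : Prop :=
  (forall theta j, (j <= l)%N -> derive1n j (fun x => h (theta, x)) 0 = 0) /\
  exists2 r : R, 0 < r &
    let U := [set p : 'rV[R]_d * R | `|p.2| < r] in
    Cn_on N U h /\
    forall vs : seq ('rV[R]_d * R)%type, (size vs <= N)%N ->
      exists M : R, forall p, U p -> `|dirD vs h p| <= M.

(* x is a solution, with values in D, of
   x'' + delta x' = x^l + h(omega t, x) + eps f(omega t, x). *)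
Definition solves (R : realType) (d l : nat) (omega : 'rV[R]_d)
    (f h : 'rV[R]_d * R -> R) (D : set R) (delta eps : R) (x : R -> R) : Prop :=
  forall t : R,
    [/\ D (x t), derivable x t 1, derivable (derive1 x) t 1
      & derive1 (derive1 x) t + delta * derive1 x t =
        x t ^+ l + h (t *: omega, x t) + eps * f (t *: omega, x t)].

Definition eps_range (R : realType) (l : nat) (f0 eps0 : R) : set R :=
  if odd l then [set e | - eps0 < e < eps0]
  else if 0 < f0 then [set e | - eps0 < e < 0]
  else [set e | 0 < e < eps0].

(* V is a member of H^{rho,m} with a + V(omega t) a solution, and is the only
   such function in the closed ball of radius A |eps|^(1/l). *)
Definition locally_unique_response (R : realType) (d l m : nat) (rho : R)
    (omega : 'rV[R]_d) (f h : 'rV[R]_d * R -> R) (D : set R)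
    (delta eps a A : R) (V : 'rV[R]_d -> R) : Prop :=
  let good W :=
    [/\ in_H rho m W, Hnorm rho m W <= A * `|eps| `^ (l%:R^-1)
      & solves l omega f h D delta eps (fun t => a + W (t *: omega))] in
  good V /\ forall W, good W -> W = V.

(* Main.v *)
Require Import Defs.
From HB Require Import structures.
From mathcomp Require Import all_boot all_order all_algebra.
From mathcomp Require Import all_classical all_reals all_analysis.
From mathcomp Require Import complex ring lra zify.

(** Write f0 for the mean of f(., 0). With x = a + V(omega t) and a^l + eps f0 = 0, the equation
    becomes an equation on the torus,
      (omega . d)^2 V + delta (omega . d) V - c V = G(V),      c = l a^(l-1),
    where G(V) collects the terms of (a + V)^l of order at least two in V, h(., a + V) and
    eps (f(., a + V) - f0). On the mode e^(i k theta) the left-hand side is the multiplication by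
    - s^2 - c + i delta s with s = k . omega, of squared modulus
      s^4 + (delta^2 + 2 c) s^2 + c^2.
    The hypothesis on delta says that the middle coefficient is nonnegative: there are no small
    divisors, and the inverse has norm at most 1 / |c| in every norm given by weights on the
    Fourier coefficients ([symbol2_ge], [lin_eq_solvable]).

    On the ball of radius eta |a| in the weighted space, |c V| is at most a constant times
    eta |a|^l. Since |eps f0| = |a|^l, every term of G(V) is smaller than that: the Taylor
    remainder by a factor eta, the terms h(., a + V) and eps (f(., a + V) - f(., 0)) by a factor
    |a|, and eps (f(., 0) - f0) by the assumed smallness of the oscillation. Hence V |-> L^(-1) G(V)
    preserves this ball. That it is a contraction has to be checked in L^2 only, where pointwise
    Lipschitz bounds suffice ([lin_eq_contract]); the ball of the weighted norm is closed under the
    resulting limits ([fixed_point]). A solution of the Fourier equations solves the differential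
    equation because its second derivative along the flow is controlled by G ([lin_eq_regular]).
    Conversely any solution of the differential equation satisfies the Fourier equations, by an
    averaging argument along the flow in which the nonresonance of omega enters ([ode_lin_eq]); so
    the uniqueness of the fixed point is the uniqueness of the response ([nonzero_response]).

    Apart from that smallness, all that is needed of f and h is gathered in the predicate
    [admissible], which consists of pointwise Lipschitz bounds and bounds on f(., a + V) - f(., 0)
    and h(., a + V) in the weighted norm. It is verified separately in the two cases.

    In the finitely differentiable case ([smooth_admissible]) the m-th derivatives of g(., a + V)
    are bounded in L^2 by induction: one derivative produces terms of the same shape with an extra
    factor among the derivatives of V, and products are controlled by the embedding of H^s1 H^s2 in
    H^(s1+s2-m), valid for m > d/2 ([Hle_tp_mul], [Dle_comp]).

    In the analytic case ([analytic_admissible]) the forcing is expanded in powers of x and in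
    Fourier modes. With x = R0 e^(i zeta) the continuation of f is a periodic holomorphic function of
    d + 1 angles, and its Fourier coefficients are estimated by moving the angles into the complex
    domain one at a time ([strip_shift], [cm_shift], [ccoef_bound]). The decay e^(- rho |k|) obtained
    at the boundary of the strip is improved by any power of |k|, because by compactness the function
    continues to a neighbourhood of fixed size ([F_uniform], [ccoef_decay]). So the coefficients of
    the powers of x lie in a ball of the weighted space, and composition is the substitution in a
    power series with coefficients in a Banach algebra ([power_series_Hle]).

    The members of the weighted space with rho > 0 extend to the complex strip by their Fourier
    series ([Hle_strip_extension]). The Fourier analysis used throughout rests on the uniform density
    of trigonometric polynomials ([trig_dense]), obtained from a Korovkin kernel. *)

Set Implicit Arguments.
Unset Strict Implicit.
Unset Printing Implicit Defensive.

Import Order.TTheory GRing.Theory Num.Theory.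
Import numFieldNormedType.Exports.
Local Open Scope classical_set_scope.
Local Open Scope ring_scope.

(** * Continuous periodic functions and their means *)

Section ContinuousPeriodic.
Context {R : realType}.

Definition CP d (g : 'rV[R]_d -> R) := continuous g /\ torus_periodic g.

Lemma twopi_gt0 : 0 < 2 * pi :> R.
Proof. by rewrite mulr_gt0 ?pi_gt0. Qed.

Lemma shift_into_box (c : R) d (th : 'rV[R]_d) : exists k : 'rV[int]_d,
  forall j, c <= (th + period id k) 0 j <= c + 2 * pi.
Proof.
exists (\row_j - Num.floor ((th 0 j - c) / (2 * pi))) => j.
rewrite !mxE mulrNz.
have p := twopi_gt0.
have aux (f x q : R) : 0 < q -> f <= x / q < f + 1 -> f * q <= x < f * q + q.
  by move=> q0; rewrite ler_pdivlMr // ltr_pdivrMr // mulrDl mul1r.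
have := floor_itv ((th 0 j - c) / (2 * pi)).
rewrite intrD => /(aux _ _ _ p); move: (_%:~R) => z; rewrite (mulrC z) mulrN.
by move: (2 * pi * z) => y /andP[? ?]; apply/andP; split; lra.
Qed.

Lemma near_continuous d (g : 'rV[R]_d -> R) (th : 'rV[R]_d) (e : R) : continuous g -> 0 < e ->
  exists2 dl : R, 0 < dl & forall th' : 'rV[R]_d, (forall j, `|th 0 j - th' 0 j| < dl) ->
    `|g th - g th'| < e.
Proof.
move=> gc e0; have /cvgrPdist_lt/(_ e e0)/nbhs_ballP[dl /= dl0 H] := gc th.
exists dl => // th' h.
apply: H; rewrite /ball/=; split=> // i j; rewrite ord1; exact: h.
Qed.

Lemma rV_continuous d (g : 'rV[R]_d -> R) : (forall (th : 'rV[R]_d) (e : R), 0 < e ->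
  exists2 dl : R, 0 < dl & forall th' : 'rV[R]_d, (forall j, `|th 0 j - th' 0 j| < dl) ->
    `|g th - g th'| < e) -> continuous g.
Proof.
move=> H th; apply/(@cvgrPdist_lt R R 'rV[R]_d (nbhs th) _ g (g th)) => e e0.
have [dl dl0 h] := H th e e0; apply/nbhs_ballP; exists dl => // th' [_ h'].
by apply: h => j; exact: h'.
Qed.

(** Compactness of the period box turns continuity into uniform continuity. *)
Lemma CP_uniform d (g : 'rV[R]_d -> R) : CP g -> forall e : R, 0 < e ->
  exists2 dl : R, 0 < dl & forall th th' : 'rV[R]_d, (forall j, `|th 0 j - th' 0 j| < dl) ->
    `|g th - g th'| < e.
Proof.
move=> [gc gp] e e0.
pose K : set 'rV[R]_d := [set v | forall i, `[0, 2 * pi]%classic (v ord0 i)].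
have cK : compact K by apply: (rV_compact (A := fun=> `[0, 2 * pi]%classic)) => i;
  exact: segment_compact.
have nK := (compact_near_coveringP K).1 cK.
have := nK R (at_right (0:R)) (fun dl th => forall th' : 'rV[R]_d, (forall j, `|th 0 j - th' 0 j| < dl) ->
    `|g th - g th'| < e) _.
case.
- move=> th _.
  have [dl dl0 H] := near_continuous th gc (divr_gt0 e0 (ltr0n _ 2)).
  exists (ball th (dl / 2), [set x | 0 < x < dl / 2]) => /=.
    split; first by apply: nbhsx_ballx; lra.
    near=> x; rewrite /=; apply/andP; split; near: x; first exact: nbhs_right_gt.
    by apply: nbhs_right_lt; lra.
  move=> [th1 x] /= [/= [_ h1] /andP[x0 xd]] th' h'.
  have a1 : `|g th - g th1| < e / 2.
    by apply: H => j; apply: (lt_trans (h1 0 j)); lra.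
  have a2 : `|g th - g th'| < e / 2.
    apply: H => j; have := h1 0 j; have := h' j; rewrite /ball/=.
    rewrite !ltr_norml => /andP[? ?] /andP[? ?]; apply/andP; split; lra.
  move: a1 a2; rewrite !ltr_norml => /andP[? ?] /andP[? ?]; apply/andP; split; lra.
- move=> dl /= dl0 H.
  exists (dl / 2); first by rewrite divr_gt0.
  move=> th th' h.
  have [k hk] := shift_into_box 0 th.
  rewrite -(gp k th) -(gp k th'); apply: (H (dl / 2)) => //.
  + by rewrite /= sub0r normrN gtr0_norm ?divr_gt0 //; lra.
  + by rewrite divr_gt0.
  + by move=> i; rewrite /= in_itv /=; have := hk i; rewrite add0r.
  + by move=> j; have := h j; rewrite !mxE opprD addrACA subrr addr0.
Unshelve. all: by end_near.
Qed.

Lemma CP_bounded d (g : 'rV[R]_d -> R) : CP g -> exists2 M, 0 < M & forall th, `|g th| <= M.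
Proof.
move=> cg; have [gc gp] := cg.
pose K : set 'rV[R]_d := [set v | forall i, `[0, 2 * pi]%classic (v ord0 i)].
have cK : compact K by apply: (rV_compact (A := fun=> `[0, 2 * pi]%classic)) => i;
  exact: segment_compact.
have := compact_bounded (continuous_compact (continuous_subspaceT gc) cK).
move=> [M0 [_ /(_ (Num.max 1 (M0 + 1)))]]; set M := Num.max _ _ => H.
exists M; first by rewrite /M lt_max ltr01.
move=> th; have [k hk] := shift_into_box 0 th.
rewrite -(gp k th); apply: H; first by rewrite /M lt_max ltrDl ltr01 orbT.
exists (th + period id k) => //.
by move=> i; rewrite /= in_itv /=; have := hk i; rewrite add0r.
Qed.

Lemma CP_cst d c : @CP d (fun=> c).
Proof. by split=> // x; exact: cst_continuous. Qed.

Lemma CPD d (f g : 'rV[R]_d -> R) : CP f -> CP g -> CP (fun x => f x + g x).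
Proof.
move=> [fc fp] [gc gp]; split; last by move=> k x; rewrite fp gp.
by move=> x; apply: (@continuousD R R _ f g x) (fc x) (gc x).
Qed.

Lemma CPM d (f g : 'rV[R]_d -> R) : CP f -> CP g -> CP (fun x => f x * g x).
Proof.
move=> [fc fp] [gc gp]; split; last by move=> k x; rewrite fp gp.
by move=> x; apply: (@continuousM R _ f g x) (fc x) (gc x).
Qed.

Lemma CPZ d c (f : 'rV[R]_d -> R) : CP f -> CP (fun x => c * f x).
Proof. by move=> h; apply: CPM => //; exact: CP_cst. Qed.

Lemma CPN d (f : 'rV[R]_d -> R) : CP f -> CP (fun x => - f x).
Proof. by move=> /(CPZ (-1)); under eq_fun do rewrite mulN1r. Qed.

Lemma CPB d (f g : 'rV[R]_d -> R) : CP f -> CP g -> CP (fun x => f x - g x).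
Proof. by move=> cf /CPN; exact: CPD. Qed.

Lemma CPX d n (f : 'rV[R]_d -> R) : CP f -> CP (fun x => f x ^+ n).
Proof.
move=> cf; elim: n => [|n IH]; first by under eq_fun do rewrite expr0; exact: CP_cst.
by under eq_fun do rewrite exprS; exact: CPM.
Qed.

Lemma CP_sum d I (r : seq I) (F : I -> 'rV[R]_d -> R) : (forall i, CP (F i)) ->
  CP (fun x => \sum_(i <- r) F i x).
Proof.
move=> h; elim: r => [|a r IH].
  by under eq_fun do rewrite big_nil; exact: CP_cst.
by under eq_fun do rewrite big_cons; exact: CPD.
Qed.

Lemma CP_shift d (f : 'rV[R]_d -> R) v : CP f -> CP (fun x => f (x + v)).
Proof.
move=> [fc fp]; split; last by move=> k x; rewrite addrAC fp.
move=> x; apply: (@continuous_comp 'rV[R]_d 'rV[R]_d R (fun y => y + v) f x); last exact: fc.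
by apply: (@continuousD R 'rV[R]_d _ id (cst v) x); [exact: cvg_id|exact: cst_continuous].
Qed.

Lemma dotpDr d (k : 'rV[int]_d) (u v : 'rV[R]_d) : dotp k (u + v) = dotp k u + dotp k v.
Proof. by rewrite /dotp -big_split; apply: eq_bigr => j _; rewrite mxE mulrDr. Qed.

Lemma dotpDl d (k l : 'rV[int]_d) (u : 'rV[R]_d) : dotp (k + l) u = dotp k u + dotp l u.
Proof. by rewrite /dotp -big_split; apply: eq_bigr => j _; rewrite mxE intrD mulrDl. Qed.

Lemma dotpNl d (k : 'rV[int]_d) (u : 'rV[R]_d) : dotp (- k) u = - dotp k u.
Proof. by rewrite /dotp -sumrN; apply: eq_bigr => j _; rewrite mxE mulrNz mulNr. Qed.

Lemma dotpNr d (k : 'rV[int]_d) (u : 'rV[R]_d) : dotp k (- u) = - dotp k u.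
Proof. by rewrite /dotp -sumrN; apply: eq_bigr => j _; rewrite mxE mulrN. Qed.

Lemma dotpZ d (k : 'rV[int]_d) t (u : 'rV[R]_d) : dotp k (t *: u) = t * dotp k u.
Proof. by rewrite /dotp big_distrr; apply: eq_bigr => j _; rewrite mxE /= mulrCA. Qed.

Lemma dotp0l d (u : 'rV[R]_d) : dotp 0 u = 0.
Proof. by rewrite /dotp big1 // => j _; rewrite mxE mul0r. Qed.

Lemma dotp0r d (k : 'rV[int]_d) : dotp k (0 : 'rV[R]_d) = 0.
Proof. by rewrite /dotp big1 // => j _; rewrite mxE mulr0. Qed.

Lemma dotp_continuous d (k : 'rV[int]_d) : continuous (@dotp R d k).
Proof.
move=> x; rewrite /dotp; elim: (index_enum _) => [|a r IH].
  by under eq_fun do rewrite big_nil; exact: cst_continuous.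
under eq_fun do rewrite big_cons; apply: (@continuousD R R 'rV[R]_d) => //.
by apply: (@continuousM R 'rV[R]_d); [exact: cst_continuous|exact: coord_continuous].
Qed.

Lemma dotp_period d (k l : 'rV[int]_d) : dotp k (period id l : 'rV[R]_d) =
  2 * pi * (\sum_j (k 0 j * l 0 j))%:~R.
Proof.
have -> : period id l = \row_j (2 * pi * (l 0 j)%:~R) :> 'rV[R]_d by [].
move: (2 * pi) => p; rewrite /dotp.
elim: (index_enum _) => [|a r IH]; first by rewrite !big_nil mulr0.
by rewrite !big_cons IH intrD mulrDr mxE intrM mulrCA.
Qed.

Lemma cosDint (x : R) (n : int) : cos (x + 2 * pi * n%:~R) = cos x.
Proof.
have H (y : R) (m : nat) : cos (y + 2 * pi * m%:R) = cos y.
  elim: m => [|m IH]; first by rewrite mulr0 addr0.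
  by rewrite -[m.+1%:R]natr1 mulrDr mulr1 addrA -[RHS]IH -[in RHS]trigo.cosD2pi mulr_natl.
case: n => n; first exact: H.
by rewrite NegzE mulrNz -pmulrn mulrN -[LHS](H _ n.+1) subrK.
Qed.

Lemma sinDint (x : R) (n : int) : sin (x + 2 * pi * n%:~R) = sin x.
Proof.
have H (y : R) (m : nat) : sin (y + 2 * pi * m%:R) = sin y.
  elim: m => [|m IH]; first by rewrite mulr0 addr0.
  by rewrite -[m.+1%:R]natr1 mulrDr mulr1 addrA -[RHS]IH -[in RHS]trigo.sinD2pi mulr_natl.
case: n => n; first exact: H.
by rewrite NegzE mulrNz -pmulrn mulrN -[LHS](H _ n.+1) subrK.
Qed.

Lemma CP_cos d (k : 'rV[int]_d) : CP (fun th : 'rV[R]_d => cos (dotp k th)).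
Proof.
split; last by move=> l x; rewrite dotpDr dotp_period cosDint.
by move=> x; apply: (@continuous_comp _ _ _ (dotp k) cos x);
  [exact: dotp_continuous|exact: continuous_cos].
Qed.

Lemma CP_sin d (k : 'rV[int]_d) : CP (fun th : 'rV[R]_d => sin (dotp k th)).
Proof.
split; last by move=> l x; rewrite dotpDr dotp_period sinDint.
by move=> x; apply: (@continuous_comp _ _ _ (dotp k) sin x);
  [exact: dotp_continuous|exact: continuous_sin].
Qed.

End ContinuousPeriodic.
(** The normalised mean over one period, the building block of [torus_mean]. *)
Section MeanOverPeriod.
Context {R : realType}.
Implicit Types g h : R -> R.

Definition M1 g : R := (2 * pi)^-1 * \int[lebesgue_measure]_(s in `[0, 2 * pi]) g s.

Lemma continuous_integrable_itv (a b : R) g : {within `[a, b], continuous g} ->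
  lebesgue_measure.-integrable `[a, b] (EFin \o g).
Proof. by move=> gc; apply: continuous_compact_integrable => //; exact: segment_compact. Qed.

Lemma integrable_itv (a b : R) g : continuous g ->
  lebesgue_measure.-integrable `[a, b] (EFin \o g).
Proof. by move=> gc; apply/continuous_integrable_itv/continuous_subspaceT. Qed.

Lemma M1_lin c g h : continuous g -> continuous h ->
  M1 (fun s => c * g s + h s) = c * M1 g + M1 h.
Proof.
move=> gc hc; rewrite /M1 RintegralD //; last 2 first.
- by apply: integrable_itv => x; apply: (@continuousM R R (cst c) g x);
    [exact: cst_continuous|exact: gc].
- exact: integrable_itv.
rewrite RintegralZl //; last exact: integrable_itv.
by rewrite mulrDr mulrCA.
Qed.

Lemma M1_cst c : M1 (fun=> c) = c.
Proof.
rewrite /M1 Rintegral_cst //= lebesgue_measure_itv /= lte_fin twopi_gt0 /= subr0.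
by rewrite mulrCA mulVf ?mulr1 // gt_eqF // twopi_gt0.
Qed.

Lemma M1_le g h : continuous g -> continuous h -> (forall s, g s <= h s) ->
  M1 g <= M1 h.
Proof.
move=> gc hc gh; rewrite /M1 ler_pM2l ?invr_gt0 ?twopi_gt0 //.
by apply: le_Rintegral => //; exact: integrable_itv.
Qed.

(** A derivative on the half-line is enough, and is all that integration from a base point gives. *)
Lemma M1_antiderivative g f : (forall s : R, 0 <= s -> is_derive s (1 : R) f (g s)) -> continuous g ->
  M1 g = (2 * pi)^-1 * (f (2 * pi) - f 0).
Proof.
move=> fg gc; rewrite /M1 /Rintegral (@continuous_FTC2 _ g f) ?twopi_gt0 //.
- exact: continuous_subspaceT.
- have fc (x : R) : 0 <= x -> f @ x --> f x.
    by move=> /fg fx; apply: differentiable_continuous; apply/derivable1_diffP; exact: fx.(@ex_derive _ _ _ _ _ _ _).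
  split=> [x||]; last first.
  + by apply/cvg_at_left_filter/fc/ltW/twopi_gt0.
  + exact/cvg_at_right_filter/fc.
  by rewrite in_itv /= => /andP[/ltW/fg fx _]; exact: fx.(@ex_derive _ _ _ _ _ _ _).
- by move=> x; rewrite in_itv /= => /andP[/ltW/fg fx _]; rewrite derive1E; apply: derive_val.
Qed.

Lemma is_derive_cosM (c x : R) : is_derive x 1 (fun s => cos (c * s)) (- c * sin (c * x)).
Proof.
rewrite (_ : - c * _ = - sin (c * x) * c); last by rewrite !mulNr mulrC.
apply: (@is_derive1_comp R cos ( *%R c)).
by rewrite -[X in is_derive _ _ _ X](mulr1 c); apply: is_deriveZ.
Qed.

Lemma is_derive_sinM (c x : R) : is_derive x 1 (fun s => sin (c * s)) (c * cos (c * x)).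
Proof.
rewrite [c * cos _]mulrC; apply: (@is_derive1_comp R sin ( *%R c)).
by rewrite -[X in is_derive _ _ _ X](mulr1 c); apply: is_deriveZ.
Qed.

Lemma continuous_cosM (c : R) : continuous (fun s => cos (c * s)).
Proof.
move=> x; apply: (@continuous_comp R R R ( *%R c) cos x); last exact: continuous_cos.
exact: mulrl_continuous.
Qed.

Lemma continuous_sinM (c : R) : continuous (fun s => sin (c * s)).
Proof.
move=> x; apply: (@continuous_comp R R R ( *%R c) sin x); last exact: continuous_sin.
exact: mulrl_continuous.
Qed.

Lemma M1_cosn (n : int) : M1 (fun s => cos (n%:~R * s)) = (n == 0)%:R.
Proof.
case: eqVneq => [->|n0].
  by under eq_fun do rewrite mul0r cos0; rewrite M1_cst.
have H (s : R) : is_derive s 1 (fun s => (n%:~R)^-1 * sin (n%:~R * s)) (cos (n%:~R * s)).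
  have := is_deriveZ (n%:~R)^-1 (is_derive_sinM n%:~R s).
  by rewrite /GRing.scale /= mulrA mulVf ?mul1r // intr_eq0.
rewrite (M1_antiderivative (fun s _ => H s)); last exact: continuous_cosM.
by rewrite mulr0 sin0 mulr0 subr0 [n%:~R * _]mulrC -[X in sin X]add0r sinDint sin0 !mulr0.
Qed.

Lemma M1_sinn (n : int) : M1 (fun s => sin (n%:~R * s)) = 0.
Proof.
case: (eqVneq n 0) => [->|n0].
  by under eq_fun do rewrite mul0r sin0; rewrite M1_cst.
have H (s : R) : is_derive s 1 (fun s => - (n%:~R)^-1 * cos (n%:~R * s)) (sin (n%:~R * s)).
  have := is_deriveZ (- (n%:~R)^-1) (is_derive_cosM n%:~R s).
  by rewrite /GRing.scale /= mulrA mulrNN mulVf ?mul1r // intr_eq0.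
rewrite (M1_antiderivative (fun s _ => H s)); last exact: continuous_sinM.
by rewrite mulr0 cos0 [n%:~R * _]mulrC -[X in cos X]add0r cosDint cos0 subrr mulr0.
Qed.

Lemma M1_comb (a b : R) (n : int) :
  M1 (fun s => a * cos (n%:~R * s) + b * sin (n%:~R * s)) = a * (n == 0)%:R.
Proof.
rewrite M1_lin; [|exact: continuous_cosM|].
  rewrite M1_cosn -[RHS]addr0; congr (_ + _).
  have -> : (fun s => b * sin (n%:~R * s)) = fun s => b * sin (n%:~R * s) + 0.
    by apply/funext => s; rewrite addr0.
  by rewrite M1_lin ?M1_sinn ?M1_cst ?mulr0 ?addr0 //; [exact: continuous_sinM|exact: cst_continuous].
by move=> x; apply: (@continuousM R R (cst b)); [exact: cst_continuous|exact: continuous_sinM].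
Qed.

End MeanOverPeriod.

(** [torus_mean] puts the first angle in front by [row_mx]; a casewise definition computes better. *)
Definition consrv (T : Type) n (s : T) (th : 'rV[T]_n) : 'rV[T]_n.+1 :=
  \row_j if unlift ord0 j is Some i then th 0 i else s.

Lemma consrv0 (T : Type) n s (th : 'rV[T]_n) : consrv s th 0 ord0 = s.
Proof. by rewrite mxE unlift_none. Qed.

Lemma consrvS (T : Type) n s (th : 'rV[T]_n) j : consrv s th 0 (lift ord0 j) = th 0 j.
Proof. by rewrite mxE liftK. Qed.

Lemma consrv_ext (T : Type) n (u v : 'rV[T]_n.+1) : u 0 ord0 = v 0 ord0 ->
  (forall j, u 0 (lift ord0 j) = v 0 (lift ord0 j)) -> u = v.
Proof.
move=> h0 hS; apply/rowP => j; case: (unliftP ord0 j) => [i ->|->]; [exact: hS|exact: h0].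
Qed.

Section TorusMean.
Context {R : realType}.

Lemma torus_meanS n (g : 'rV[R]_n.+1 -> R) :
  torus_mean g = M1 (fun s => torus_mean (fun th => g (consrv s th))).
Proof.
congr M1; apply/funext => s; congr torus_mean; apply/funext => th; congr g.
apply/rowP => j; rewrite [RHS]mxE [LHS]mxE; case: splitP => k hk.
  have -> : j = ord0 by apply: val_inj => /=; rewrite ord1 in hk.
  by rewrite unlift_none mxE ord1 eqxx.
have -> : j = lift ord0 k by apply: val_inj; exact: hk.
by rewrite liftK.
Qed.

Lemma CP_slice n (g : 'rV[R]_n.+1 -> R) s : CP g -> CP (fun th => g (consrv s th)).
Proof.
move=> cg; split.
  apply: rV_continuous => th e e0; have [dl dl0 H] := CP_uniform cg e0.
  exists dl => // th' h; apply: H => j.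
  by case: (unliftP ord0 j) => [i ->|->]; rewrite ?consrvS ?consrv0 ?subrr ?normr0.
move=> k th; rewrite -(cg.2 (\row_j if unlift ord0 j is Some i then k 0 i else 0) (consrv s th)).
congr g; apply: consrv_ext => [|j].
  by rewrite !mxE unlift_none mulr0 addr0.
by rewrite !mxE liftK !mxE.
Qed.

(** The three properties go through one induction: the inner mean has to be continuous in the outer
    variable, which follows from linearity and monotonicity one dimension below. *)
Lemma torus_mean_spec d : [/\ forall c (g h : 'rV[R]_d -> R), CP g -> CP h ->
    torus_mean (fun th => c * g th + h th) = c * torus_mean g + torus_mean h,
  forall g h : 'rV[R]_d -> R, CP g -> CP h -> (forall th, g th <= h th) ->
    torus_mean g <= torus_mean h
  & forall c, torus_mean (fun _ : 'rV[R]_d => c) = c].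
Proof.
elim: d => [|d [IHl IHm IHc]]; first by split=> // g h _ _ H; exact: H.
have slice_cont (g : 'rV[R]_d.+1 -> R) : CP g ->
    continuous (fun s => torus_mean (fun th => g (consrv s th))).
  move=> cg s; apply/cvgrPdist_lt => e e0.
  have [dl dl0 H] := CP_uniform cg (divr_gt0 e0 (ltr0n R 2)).
  apply/nbhs_ballP; exists dl => // s' hs /=.
  have A u v : `|u - v| < dl ->
    torus_mean (fun th => g (consrv u th)) <= e / 2 + torus_mean (fun th => g (consrv v th)).
    move=> uv.
    have -> : e / 2 = e / 2 * torus_mean (fun _ : 'rV[R]_d => 1) by rewrite IHc mulr1.
    rewrite -IHl; [|exact: CP_cst|exact: CP_slice].
    apply: IHm; [exact: CP_slice|apply: CPD; [apply: CPZ; exact: CP_cst|exact: CP_slice]|].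
    move=> th; have /ltW : `|g (consrv u th) - g (consrv v th)| < e / 2.
      by apply: H => j; case: (unliftP ord0 j) => [i ->|->];
        rewrite ?consrvS ?consrv0 ?subrr ?normr0.
    by move/(le_trans (ler_norm _)); rewrite mulr1 lerBlDr.
  have h1 := A _ _ hs; have h2 : `|s' - s| < dl by rewrite distrC.
  have {h2}h2 := A _ _ h2.
  rewrite ltr_norml; apply/andP; split; lra.
split.
- move=> c g h cg ch; rewrite !torus_meanS -M1_lin; try exact: slice_cont.
  congr M1; apply/funext => s; apply: IHl; exact: CP_slice.
- move=> g h cg ch gh; rewrite !torus_meanS; apply: M1_le; try exact: slice_cont.
  by move=> s; apply: IHm => //; exact: CP_slice.
- by move=> c; rewrite torus_meanS; under eq_fun do rewrite IHc; exact: M1_cst.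
Qed.

Context {d : nat}.
Implicit Types g h : 'rV[R]_d -> R.
Local Notation mean := (@torus_mean R d).

Lemma mean_lin c g h : CP g -> CP h -> mean (fun th => c * g th + h th) = c * mean g + mean h.
Proof. by have [H _ _] := torus_mean_spec d; exact: H. Qed.

Lemma mean_le g h : CP g -> CP h -> (forall th, g th <= h th) -> mean g <= mean h.
Proof. by have [_ H _] := torus_mean_spec d; exact: H. Qed.

Lemma mean_cst c : mean (fun=> c) = c.
Proof. by have [_ _ H] := torus_mean_spec d; exact: H. Qed.

Lemma meanD g h : CP g -> CP h -> mean (fun th => g th + h th) = mean g + mean h.
Proof. by move=> cg ch; rewrite -[mean g]mul1r -mean_lin //; congr mean; apply/funext => x; rewrite mul1r. Qed.

Lemma meanZ c g : CP g -> mean (fun th => c * g th) = c * mean g.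
Proof.
move=> cg; rewrite -[RHS]addr0 -(mean_cst 0) -mean_lin //; last exact: CP_cst.
by congr mean; apply/funext => x; rewrite addr0.
Qed.

Lemma mean_lin2 a b g h : CP g -> CP h ->
  mean (fun th => a * g th + b * h th) = a * mean g + b * mean h.
Proof. by move=> cg ch; rewrite mean_lin ?meanZ //; exact: CPZ. Qed.

Lemma meanN g : CP g -> mean (fun th => - g th) = - mean g.
Proof. by move=> cg; rewrite -mulN1r -meanZ //; congr mean; apply/funext => x; rewrite mulN1r. Qed.

Lemma meanB g h : CP g -> CP h -> mean (fun th => g th - h th) = mean g - mean h.
Proof. by move=> cg ch; rewrite meanD ?meanN //; exact: CPN. Qed.

Lemma mean_sum I (r : seq I) (F : I -> 'rV[R]_d -> R) : (forall i, CP (F i)) ->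
  mean (fun th => \sum_(i <- r) F i th) = \sum_(i <- r) mean (F i).
Proof.
move=> h; elim: r => [|a r IH].
  by under eq_fun do rewrite big_nil; rewrite big_nil mean_cst.
under eq_fun do rewrite big_cons; rewrite big_cons meanD ?IH //; exact: CP_sum.
Qed.

Lemma mean_ge0 g : CP g -> (forall th, 0 <= g th) -> 0 <= mean g.
Proof. by move=> cg g0; rewrite -(mean_cst 0); apply: mean_le => //; exact: CP_cst. Qed.

Lemma mean_norm_le g M : CP g -> (forall th, `|g th| <= M) -> `|mean g| <= M.
Proof.
move=> cg gM; rewrite ler_norml; apply/andP; split.
  rewrite -(mean_cst (- M)); apply: mean_le => [||th]; [exact: CP_cst|exact: cg|].
  by have := gM th; rewrite ler_norml => /andP[].
rewrite -(mean_cst M); apply: mean_le => [||th]; [exact: cg|exact: CP_cst|].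
by have := gM th; rewrite ler_norml => /andP[].
Qed.

Lemma mean_abs_le g h : CP g -> CP h -> (forall th, `|g th| <= h th) -> `|mean g| <= mean h.
Proof.
move=> cg ch gh; rewrite ler_norml -meanN //; apply/andP; split; apply: mean_le => //;
  try exact: CPN; by move=> th; have := gh th; rewrite ler_norml => /andP[].
Qed.

Lemma mean_dist_le g h M : CP g -> CP h -> (forall th, `|g th - h th| <= M) ->
  `|mean g - mean h| <= M.
Proof. by move=> cg ch gM; rewrite -meanB //; apply: mean_norm_le => //; exact: CPB. Qed.

End TorusMean.

Section MeanCharacters.
Context {R : realType}.

Lemma dotp_consrv n (k : 'rV[int]_n.+1) (s : R) (th : 'rV[R]_n) :
  dotp k (consrv s th) = (k 0 ord0)%:~R * s + dotp (\row_j k 0 (lift ord0 j)) th.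
Proof.
rewrite /dotp big_ord_recl consrv0; congr (_ + _); apply: eq_bigr => j _.
by rewrite consrvS mxE.
Qed.

Lemma mean_cos_sin d (k : 'rV[int]_d) :
  torus_mean (fun th : 'rV[R]_d => cos (dotp k th)) = (k == 0)%:R /\
  torus_mean (fun th : 'rV[R]_d => sin (dotp k th)) = 0.
Proof.
elim: d k => [|d IH] k.
  have -> : k = 0 by apply/rowP => -[].
  by rewrite /= !dotp0l cos0 sin0 eqxx.
pose k' : 'rV[int]_d := \row_j k 0 (lift ord0 j).
have [IHc IHs] := IH k'.
have k0 : (k == 0) = (k 0 ord0 == 0) && (k' == 0).
  apply/eqP/andP => [h|[/eqP h0 /eqP h']].
    by rewrite /k' h mxE; split => //; apply/eqP/rowP => j; rewrite !mxE.
  by apply/rowP => j; case: (unliftP ord0 j) => [i ->|->]; rewrite ?h0 mxE //;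
    have := congr1 (fun v : 'rV_d => v 0 i) h'; rewrite !mxE.
rewrite !torus_meanS; split.
  transitivity (M1 (fun s : R => (k' == 0)%:R * cos ((k 0 ord0)%:~R * s) + 0)).
    congr M1; apply/funext => s.
    under eq_fun do rewrite dotp_consrv -/k' cosD -mulNr.
    rewrite mean_lin ?IHc; [|exact: CP_cos|by apply: CPZ; exact: CP_sin].
    by rewrite meanZ ?IHs ?mulr0 1?mulrC //; exact: CP_sin.
  rewrite M1_lin ?M1_cst ?addr0 ?M1_cosn ?k0 ?mulrb; [|exact: continuous_cosM|exact: cst_continuous].
  by case: (_ == 0); case: (_ == 0); rewrite ?mulr1 ?mulr0 ?mul0r ?mul1r.
transitivity (M1 (fun s : R => (k' == 0)%:R * sin ((k 0 ord0)%:~R * s) + 0)).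
  congr M1; apply/funext => s.
  under eq_fun do rewrite dotp_consrv -/k' sinD.
  rewrite mean_lin ?IHc; [|exact: CP_cos|by apply: CPZ; exact: CP_sin].
  by rewrite meanZ ?IHs ?mulr0 1?mulrC //; exact: CP_sin.
rewrite M1_lin ?M1_cst ?addr0 ?M1_sinn ?mulr0 //; [exact: continuous_sinM|exact: cst_continuous].
Qed.

End MeanCharacters.
(** * Trigonometric polynomials and their density *)

Section Trigonometric.
Context {R : realType} {d : nat}.
Local Notation rV := 'rV[R]_d.
Local Notation mean := (@torus_mean R d).

Definition tp (X : seq 'rV[int]_d) (al be : 'rV[int]_d -> R) (th : rV) : R :=
  \sum_(k <- X) (al k * cos (dotp k th) + be k * sin (dotp k th)).

Lemma CP_tp X al be : CP (tp X al be).
Proof.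
by apply: CP_sum => k; apply: CPD; apply: CPZ; [exact: CP_cos|exact: CP_sin].
Qed.

(** Membership in the span of the characters, as an inductive predicate so that
    closure under products and derivatives is proved by structural induction. *)
Inductive trig : (rV -> R) -> Prop :=
| trig_cos k : trig (fun th => cos (dotp k th))
| trig_sin k : trig (fun th => sin (dotp k th))
| trig_lin c g h : trig g -> trig h -> trig (fun th => c * g th + h th).

Lemma trig_CP g : trig g -> CP g.
Proof.
elim=> [k|k|c g1 g2 _ ? _ ?]; [exact: CP_cos|exact: CP_sin|].
by apply: CPD => //; exact: CPZ.
Qed.

Lemma eq_trig g h : g =1 h -> trig g -> trig h.
Proof. by move=> /funext ->. Qed.

Lemma trig_cst c : trig (fun=> c).
Proof.
apply: (eq_trig _ (trig_lin (c - 1) (trig_cos 0) (trig_cos 0))) => th.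
by rewrite dotp0l cos0 mulr1 subrK.
Qed.

Lemma trigZ c g : trig g -> trig (fun th => c * g th).
Proof.
by move=> tg; apply: (eq_trig _ (trig_lin c tg (trig_cst 0))) => th; rewrite addr0.
Qed.

Lemma trigD g h : trig g -> trig h -> trig (fun th => g th + h th).
Proof.
by move=> tg th; apply: (eq_trig _ (trig_lin 1 tg th)) => x; rewrite mul1r.
Qed.

Lemma trigM g h : trig g -> trig h -> trig (fun th => g th * h th).
Proof.
have half (x y z : R) : x + y = 2 * z -> z = 2^-1 * x + 2^-1 * y by lra.
have cc k l : trig (fun th => cos (dotp k th) * cos (dotp l th)).
  apply: (eq_trig _ (trig_lin 2^-1 (trig_cos (k + l)) (trigZ 2^-1 (trig_cos (k - l))))) => th.
  by apply/esym/half; rewrite !dotpDl dotpNl cosD cosB; ring.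
have ss k l : trig (fun th => sin (dotp k th) * sin (dotp l th)).
  apply: (eq_trig _ (trig_lin 2^-1 (trig_cos (k - l)) (trigZ (- 2^-1) (trig_cos (k + l))))) => th.
  by rewrite !dotpDl dotpNl !cosD cosN sinN; field.
have sc k l : trig (fun th => sin (dotp k th) * cos (dotp l th)).
  apply: (eq_trig _ (trig_lin 2^-1 (trig_sin (k + l)) (trigZ 2^-1 (trig_sin (k - l))))) => th.
  by apply/esym/half; rewrite !dotpDl dotpNl sinD sinB; ring.
move=> tg; elim: tg h => [k|k|c g1 g2 _ IH1 _ IH2] h th.
- elim: th => [l|l|c h1 h2 _ H1 _ H2]; first exact: cc.
    by apply: (eq_trig _ (sc l k)) => x; rewrite mulrC.
  by apply: (eq_trig _ (trig_lin c H1 H2)) => x; ring.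
- elim: th => [l|l|c h1 h2 _ H1 _ H2]; [exact: sc|exact: ss|].
  by apply: (eq_trig _ (trig_lin c H1 H2)) => x; ring.
- by apply: (eq_trig _ (trig_lin c (IH1 _ th) (IH2 _ th))) => x; ring.
Qed.

Lemma trigX n g : trig g -> trig (fun th => g th ^+ n).
Proof.
move=> tg; elim: n => [|n IH]; first exact: trig_cst.
by apply: (eq_trig _ (trigM tg IH)) => x; rewrite exprS.
Qed.

Lemma trig_prod I (r : seq I) (F : I -> rV -> R) : (forall i, trig (F i)) ->
  trig (fun th => \prod_(i <- r) F i th).
Proof.
move=> h; elim: r => [|a r IH].
  by apply: (eq_trig _ (trig_cst 1)) => x; rewrite big_nil.
by apply: (eq_trig _ (trigM (h a) IH)) => x; rewrite big_cons.
Qed.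

Lemma trig_sum I (r : seq I) (F : I -> rV -> R) : (forall i, trig (F i)) ->
  trig (fun th => \sum_(i <- r) F i th).
Proof.
move=> h; elim: r => [|a r IH].
  by apply: (eq_trig _ (trig_cst 0)) => x; rewrite big_nil.
by apply: (eq_trig _ (trigD (h a) IH)) => x; rewrite big_cons.
Qed.

Lemma trig_tp X al be : trig (tp X al be).
Proof. by apply: trig_sum => k; apply: trig_lin; [exact: trig_cos|apply: trigZ; exact: trig_sin]. Qed.

(** A trigonometric polynomial involves finitely many frequencies: being
    orthogonal to those suffices to be orthogonal to it. *)
Lemma trig_frequencies T : trig T -> exists X : seq 'rV[int]_d, forall h, CP h ->
  (forall k, k \in X -> mean (fun th => h th * cos (dotp k th)) = 0 /\
                        mean (fun th => h th * sin (dotp k th)) = 0) ->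
  mean (fun th => h th * T th) = 0.
Proof.
elim=> [k|k|c g1 g2 t1 [X1 H1] t2 [X2 H2]].
- by exists [:: k] => h _ /(_ k (mem_head _ _))[].
- by exists [:: k] => h _ /(_ k (mem_head _ _))[].
- exists (X1 ++ X2) => h ch H.
  under eq_fun do rewrite mulrDr mulrCA.
  rewrite mean_lin ?H1 ?H2 ?mulr0 ?addr0 //; try (by apply: CPM => //; exact: trig_CP).
  + by move=> k kX; apply: H; rewrite mem_cat kX orbT.
  + by move=> k kX; apply: H; rewrite mem_cat kX.
Qed.

Lemma trig_shift g v : trig g -> trig (fun th => g (th + v)).
Proof.
elim=> [k|k|c g1 g2 _ h1 _ h2]; last exact: trig_lin.
- apply: (eq_trig _ (trig_lin (cos (dotp k v)) (trig_cos k)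
    (trigZ (- sin (dotp k v)) (trig_sin k)))) => th.
  by rewrite dotpDr cosD; ring.
- apply: (eq_trig _ (trig_lin (cos (dotp k v)) (trig_sin k)
    (trigZ (sin (dotp k v)) (trig_cos k)))) => th.
  by rewrite dotpDr sinD; ring.
Qed.

Lemma mean_cos (k : 'rV[int]_d) : mean (fun th => cos (dotp k th)) = (k == 0)%:R.
Proof. by have [] := mean_cos_sin (R := R) k. Qed.

Lemma mean_sin (k : 'rV[int]_d) : mean (fun th => sin (dotp k th)) = 0.
Proof. by have [] := mean_cos_sin (R := R) k. Qed.

Lemma mean_trig_shift g v : trig g -> mean (fun th => g (th + v)) = mean g.
Proof.
elim=> [k|k|c g1 g2 t1 h1 t2 h2].
- under eq_fun do rewrite dotpDr cosD [cos _ * cos _]mulrC [sin _ * _]mulrC -mulNr.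
  rewrite mean_lin ?meanZ ?mean_cos ?mean_sin ?mulr0 ?addr0; try exact: CP_cos;
    try exact: CP_sin; try (by apply: CPZ; exact: CP_sin).
  by case: eqVneq => [->|_]; rewrite ?mulr0 // dotp0l cos0 mulr1.
- under eq_fun do rewrite dotpDr sinD [sin _ * cos _]mulrC [cos _ * sin _]mulrC.
  rewrite mean_lin ?meanZ ?mean_cos ?mean_sin ?mulr0 ?add0r; try exact: CP_cos;
    try exact: CP_sin; try (by apply: CPZ; exact: CP_cos).
  by case: eqVneq => [->|_]; rewrite ?mulr0 // dotp0l sin0 mul0r.
- rewrite !mean_lin ?h1 ?h2 //; try exact: trig_CP;
  by apply: CP_shift; exact: trig_CP.
Qed.

Definition evec j : rV := delta_mx 0 j.

(** A relation rather than a derivative operator, so that trigonometric polynomials come with their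
    derivatives by structural induction and no differentiability side conditions arise. *)
Definition ider j (g g' : rV -> R) :=
  forall th, is_derive (0 : R) (1 : R) (fun t : R => g (th + t *: evec j)) (g' th).

Lemma dotp_evec (k : 'rV[int]_d) j : dotp k (evec j) = (k 0 j)%:~R.
Proof.
rewrite /dotp (bigD1 j) //= mxE !eqxx mulr1 big1 ?addr0 // => i ij.
by rewrite mxE eqxx (negbTE ij) mulr0.
Qed.

Lemma is_derive_affine (f : R -> R) (a c x df : R) :
  is_derive (a + c * x) (1 : R) f df -> is_derive x (1 : R) (fun t => f (a + c * t)) (df * c).
Proof.
move=> fd; apply: (@is_derive1_comp R f (fun t => a + c * t)).
rewrite -[X in is_derive _ _ _ X]add0r; apply: is_deriveD.
by rewrite -[X in is_derive _ _ _ X](mulr1 c); apply: is_deriveZ.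
Qed.

Lemma ider_cos (k : 'rV[int]_d) j :
  ider j (fun th => cos (dotp k th)) (fun th => - (k 0 j)%:~R * sin (dotp k th)).
Proof.
move=> th; under eq_fun do rewrite dotpDr dotpZ dotp_evec mulrC.
rewrite mulNr mulrC -mulNr; apply: is_derive_affine; rewrite mulr0 addr0.
exact: is_derive_cos.
Qed.

Lemma ider_sin (k : 'rV[int]_d) j :
  ider j (fun th => sin (dotp k th)) (fun th => (k 0 j)%:~R * cos (dotp k th)).
Proof.
move=> th; under eq_fun do rewrite dotpDr dotpZ dotp_evec mulrC.
rewrite mulrC; apply: is_derive_affine; rewrite mulr0 addr0.
exact: is_derive_sin.
Qed.

Lemma trig_derive g j : trig g -> exists g', [/\ trig g', ider j g g' & mean g' = 0].
Proof.
elim=> [k|k|c g1 g2 _ [g1' [t1 d1 m1]] _ [g2' [t2 d2 m2]]].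
- exists (fun th => - (k 0 j)%:~R * sin (dotp k th)); split.
  + by apply: trigZ; exact: trig_sin.
  + exact: ider_cos.
  + by rewrite meanZ ?mean_sin ?mulr0 //; exact: CP_sin.
- exists (fun th => (k 0 j)%:~R * cos (dotp k th)); split.
  + by apply: trigZ; exact: trig_cos.
  + exact: ider_sin.
  + rewrite meanZ ?mean_cos; last exact: CP_cos.
    by case: eqVneq => [->|_]; rewrite ?mulr0 // mxE mul0r.
- exists (fun th => c * g1' th + g2' th); split; first exact: trig_lin.
  + by move=> th; apply: is_deriveD; [exact: (is_deriveZ c (d1 th))|exact: d2].
  + by rewrite mean_lin ?m1 ?m2 ?mulr0 ?addr0 //; exact: trig_CP.
Qed.


(** Korovkin kernel: the n-th power of the nonnegative trigonometric polynomial
    prod (1 + cos) concentrates at p = th as n grows. *)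
Definition kern n (th p : rV) : R := \prod_(j < d) (1 + cos (p 0 j - th 0 j)) ^+ n.

Lemma trig_cosj (th : rV) j : trig (fun p : rV => cos (p 0 j - th 0 j)).
Proof.
pose k : 'rV[int]_d := delta_mx 0 j.
have dk (p : rV) : dotp k p = p 0 j.
  rewrite /dotp (bigD1 j) //= mxE !eqxx mul1r big1 ?addr0 // => i ij.
  by rewrite mxE eqxx (negbTE ij) mul0r.
apply: (eq_trig _ (trig_shift (- th) (trig_cos k))) => p.
by rewrite dk !mxE.
Qed.

Lemma trig_sinj (th : rV) j : trig (fun p : rV => sin (p 0 j - th 0 j)).
Proof.
pose k : 'rV[int]_d := delta_mx 0 j.
have dk (p : rV) : dotp k p = p 0 j.
  rewrite /dotp (bigD1 j) //= mxE !eqxx mul1r big1 ?addr0 // => i ij.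
  by rewrite mxE eqxx (negbTE ij) mul0r.
apply: (eq_trig _ (trig_shift (- th) (trig_sin k))) => p.
by rewrite dk !mxE.
Qed.

Lemma trig_kern n th : trig (kern n th).
Proof.
apply: trig_prod => j; apply: trigX; apply: trigD; first exact: trig_cst.
exact: trig_cosj.
Qed.

Lemma kern_ge0 n th p : 0 <= kern n th p.
Proof.
by apply: prodr_ge0 => j _; apply: exprn_ge0; have := cos_geN1 (p 0 j - th 0 j); lra.
Qed.

Lemma kern_shift n th p : kern n th p = kern n 0 (p + - th).
Proof. by apply: eq_bigr => j _; rewrite !mxE subr0. Qed.

Lemma mean_kern_shift n th : mean (kern n th) = mean (kern n 0).
Proof.
rewrite -[RHS](mean_trig_shift (- th)); last exact: trig_kern.
by congr mean; apply/funext => p; exact: kern_shift.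
Qed.

(** A quotient-free form of an integration by parts: the derivative of
    sin (p_j - th_j) kern has mean zero. *)
Lemma mean_kern_moment n th j :
  mean (fun p => kern n th p * (1 - cos (p 0 j - th 0 j))) = mean (kern n th) / n.+1%:R.
Proof.
pose rest (p : rV) := \prod_(i < d | i != j) (1 + cos (p 0 i - th 0 i)) ^+ n.
have kE p : kern n th p = rest p * (1 + cos (p 0 j - th 0 j)) ^+ n.
  by rewrite /kern (bigD1 j) //= mulrC.
pose g p := kern n th p * sin (p 0 j - th 0 j).
have tg : trig g by apply: trigM; [exact: trig_kern|exact: trig_sinj].
have [g' [tg' dg' mg']] := trig_derive j tg.
have g'E p : g' p = kern n th p - n.+1%:R * (kern n th p * (1 - cos (p 0 j - th 0 j))).
  have := @derive_val _ _ _ _ _ _ _ (dg' p).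
  pose u := p 0 j - th 0 j.
  have -> : (fun t : R => g (p + t *: evec j)) =
      fun t => rest p * ((1 + cos (u + 1 * t)) ^+ n * sin (u + 1 * t)).
    apply/funext => t; rewrite /g kE.
    have -> : (p + t *: evec j) 0 j = p 0 j + t by rewrite !mxE !eqxx mulr1.
    have -> : rest (p + t *: evec j) = rest p.
      by apply: eq_bigr => i ij; rewrite !mxE eqxx (negbTE ij) mulr0 addr0.
    by rewrite -mulrA mul1r addrAC.
  have H : is_derive (0 : R) (1 : R) (fun t : R => rest p * ((1 + cos (u + 1 * t)) ^+ n * sin (u + 1 * t)))
     (rest p * ((1 + cos u) ^+ n * cos u - n%:R * (1 + cos u) ^+ n.-1 * sin u * sin u)).
    have h1 : is_derive (0 : R) (1 : R) (fun t => 1 + cos (u + 1 * t)) (- sin u).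
      have h : is_derive (0 : R) (1 : R) (fun t : R => cos (u + 1 * t)) (- sin u).
        by rewrite -[X in is_derive _ _ _ X]mulr1; apply: is_derive_affine; rewrite mul1r addr0;
          exact: is_derive_cos.
      by rewrite -[X in is_derive _ _ _ X]add0r; apply: is_deriveD.
    have h2 : is_derive (0 : R) (1 : R) (fun t : R => sin (u + 1 * t)) (cos u).
      by rewrite -[X in is_derive _ _ _ X]mulr1; apply: is_derive_affine; rewrite mul1r addr0;
        exact: is_derive_sin.
    have h3 := is_deriveM (is_deriveX n h1) h2.
    have := is_deriveZ (rest p) h3; set v := (X in is_derive _ _ _ X).
    suff -> : v = rest p * ((1 + cos u) ^+ n * cos u - n%:R * (1 + cos u) ^+ n.-1 * sin u * sin u) by rewrite exprfctE.
    rewrite {}/v exprfctE /GRing.scale /= mulr0 addr0.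
    by ring.
  rewrite (@derive_val _ _ _ _ _ _ _ H) => <-.
  rewrite kE -/u -mulrA -[sin u * sin u]expr2 sin2cos2.
  have -> : n.+1%:R = n%:R + 1 :> R by rewrite -natr1.
  have [->|n0] := eqVneq n 0%N; first by rewrite !expr0; ring.
  have -> : (1 + cos u) ^+ n = (1 + cos u) * (1 + cos u) ^+ n.-1 by rewrite -exprS prednK ?lt0n.
  by ring.
have n0 : n.+1%:R != 0 :> R by rewrite pnatr_eq0.
have ck : CP (kern n th) by exact/trig_CP/trig_kern.
have cm : CP (fun p => kern n th p * (1 - cos (p 0 j - th 0 j))).
  by apply: CPM => //; apply: CPB; [exact: CP_cst|exact/trig_CP/trig_cosj].
apply: (mulfI n0); rewrite mulrCA mulfV // mulr1; apply/eqP; rewrite -subr_eq0 -oppr_eq0 opprB.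
rewrite -meanZ // -meanB //; last exact: CPZ.
by rewrite -[X in _ == X]mg'; apply/eqP; congr mean; apply/funext => p; rewrite g'E.
Qed.

(** Nonnegative combinations of cosines form a semiring on which the mean is
    nonnegative; the kernel is 1 plus such a combination. *)
Inductive ptrig : (rV -> R) -> Prop :=
| ptrig0 : ptrig (fun=> 0)
| ptrig_cos k : ptrig (fun th => cos (dotp k th))
| ptrig_lin c g h : 0 <= c -> ptrig g -> ptrig h -> ptrig (fun th => c * g th + h th).

Lemma ptrig_trig g : ptrig g -> trig g.
Proof. by elim=> *; [exact: trig_cst|exact: trig_cos|exact: trig_lin]. Qed.

Lemma eq_ptrig g h : g =1 h -> ptrig g -> ptrig h.
Proof. by move=> /funext ->. Qed.

Lemma ptrigD g h : ptrig g -> ptrig h -> ptrig (fun th => g th + h th).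
Proof.
by move=> pg ph; apply: (eq_ptrig _ (ptrig_lin ler01 pg ph)) => x; rewrite mul1r.
Qed.

Lemma ptrigM g h : ptrig g -> ptrig h -> ptrig (fun th => g th * h th).
Proof.
have h0 : (0 : R) <= 2^-1 by [].
have cc k l : ptrig (fun th => cos (dotp k th) * cos (dotp l th)).
  apply: (eq_ptrig _ (ptrig_lin h0 (ptrig_cos (k + l)) (ptrig_lin h0 (ptrig_cos (k - l))
    ptrig0))) => th.
  by rewrite !dotpDl dotpNl !cosD cosN sinN; field.
move=> pg; elim: pg h => [|k|c g1 g2 c0 _ IH1 _ IH2] h ph.
- by apply: (eq_ptrig _ ptrig0) => x; rewrite mul0r.
- elim: ph => [|l|c h1 h2 c0 _ H1 _ H2]; [|exact: cc|].
    by apply: (eq_ptrig _ ptrig0) => x; rewrite mulr0.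
  by apply: (eq_ptrig _ (ptrig_lin c0 H1 H2)) => x; ring.
- by apply: (eq_ptrig _ (ptrig_lin c0 (IH1 _ ph) (IH2 _ ph))) => x; ring.
Qed.

Lemma mean_ptrig g : ptrig g -> 0 <= mean g.
Proof.
elim=> [|k|c g1 g2 c0 p1 h1 p2 h2]; rewrite ?mean_cst ?mean_cos ?ler0n //.
rewrite mean_lin; try exact/trig_CP/ptrig_trig.
by rewrite addr_ge0 // mulr_ge0.
Qed.

(** Expanding the product, the kernel is 1 plus a nonnegative combination of cosines, so its mean
    is at least 1. *)
Lemma mean_kern_gt0 n th : 0 < mean (kern n th).
Proof.
rewrite mean_kern_shift.
pose one g := ptrig (fun p : rV => g p - 1).
have oneM g h : one g -> one h -> one (fun p => g p * h p).
  move=> og oh; apply: (eq_ptrig _ (ptrigD (ptrigM og oh) (ptrigD og oh))) => p; ring.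
have one1 : one (fun=> 1) by apply: (eq_ptrig _ ptrig0) => p; rewrite subrr.
have onec j : one (fun p => 1 + cos (p 0 j)).
  pose k : 'rV[int]_d := delta_mx 0 j.
  apply: (eq_ptrig _ (ptrig_cos k)) => p; rewrite [RHS]addrAC subrr add0r.
  rewrite /dotp (bigD1 j) //= mxE !eqxx mul1r big1 ?addr0 // => i ij.
  by rewrite mxE eqxx (negbTE ij) mul0r.
have : one (kern n 0).
  rewrite /kern; elim: (index_enum _) => [|a r IH].
    by apply: (eq_ptrig _ one1) => p; rewrite big_nil.
  apply: (eq_ptrig _ (oneM (fun p => (1 + cos (p 0 a - (0 : rV) 0 a)) ^+ n) _ _ IH)) => [p|].
    by rewrite big_cons.
  elim: n {IH} => [|n IH]; first by apply: (eq_ptrig _ one1) => p; rewrite expr0.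
  by apply: (eq_ptrig _ (oneM _ _ (onec a) IH)) => p; rewrite exprS mxE subr0.
move/mean_ptrig; rewrite meanB ?mean_cst ?subr_ge0; [|exact/trig_CP/trig_kern|exact: CP_cst].
by apply: lt_le_trans.
Qed.

(** Far from p the factor 1 - cos is bounded below (modulo periods), near p the
    modulus of continuity applies. *)
Lemma CP_cos_modulus g : CP g -> forall e : R, 0 < e -> exists2 C : R, 0 < C &
  forall th p : rV, `|g p - g th| <= e + C * \sum_(j < d) (1 - cos (p 0 j - th 0 j)).
Proof.
move=> cg e e0; have [dl0 dl00 H] := CP_uniform cg e0.
pose dl := Num.min dl0 pi.
have dlp : 0 < dl by rewrite lt_min dl00 pi_gt0.
have dlpi : dl <= pi by rewrite ge_min lexx orbT.
have [M M0 hM] := CP_bounded cg.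
have c1 : cos dl < 1.
  rewrite -cos0 (ltr_cos _ _) //; rewrite in_itv /= ?lexx ?pi_ge0 ?(ltW dlp) //.
have c0 : 0 < 1 - cos dl by lra.
exists (2 * M / (1 - cos dl)); first by rewrite divr_gt0 // mulr_gt0.
move=> th p.
have nn j : 0 <= 1 - cos (p 0 j - th 0 j) by have := cos_le1 (p 0 j - th 0 j); lra.
have Sn : 0 <= \sum_(j < d) (1 - cos (p 0 j - th 0 j)) by apply: sumr_ge0.
have C0 : 0 <= 2 * M / (1 - cos dl) by rewrite ltW // divr_gt0 // mulr_gt0.
have [k hk] := shift_into_box (- pi) (p - th).
pose v := p - th + period id k.
have vE j : cos (p 0 j - th 0 j) = cos (v 0 j) by rewrite !mxE cosDint.
have pE : g p = g (th + v).
  by rewrite -(cg.2 k p); congr g; rewrite /v addrA addrCA subrr addr0.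
case: (pselect (forall j, `|v 0 j| < dl)) => [near|/existsNP[j /negP]].
  apply: (@le_trans _ _ e); last by rewrite lerDl mulr_ge0.
  rewrite pE distrC ltW //; apply: H => j.
  rewrite mxE opprD addNKr normrN; apply: lt_le_trans (near j) _.
  by rewrite ge_min lexx.
rewrite -leNgt => far.
apply: (@le_trans _ _ (2 * M)).
  by have := ler_normB (g p) (g th); have := hM p; have := hM th; lra.
have vpi : `|v 0 j| <= pi by have := hk j; rewrite -/v ler_norml => /andP[? ?]; apply/andP; split; lra.
apply: (@le_trans _ _ (2 * M / (1 - cos dl) * (1 - cos (p 0 j - th 0 j)))); last first.
  rewrite -[leLHS]add0r lerD ?(ltW e0) //; apply: ler_wpM2l => //.
  by rewrite (bigD1 j) //= lerDl sumr_ge0.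
rewrite mulrAC ler_pdivlMr // ler_pM2l ?mulr_gt0 // vE lerD2l lerN2 -(cos_norm (v 0 j)).
by rewrite leNgt ltr_cos -?leNgt // in_itv /= ?normr_ge0 ?vpi ?(ltW dlp) ?dlpi.
Qed.

(** Convolution with the kernel approximates uniformly. *)
Lemma kern_approx g : CP g -> forall e : R, 0 < e ->
  exists n, forall th, `|g th - (mean (kern n 0))^-1 * mean (fun p => g p * kern n th p)| <= e.
Proof.
move=> cg e e0; have e20 : 0 < e / 2 by rewrite divr_gt0.
have [C C0 HC] := CP_cos_modulus cg e20.
pose n := Num.trunc (2 * C * d%:R / e); exists n => th.
have hn : C * (d%:R / n.+1%:R) <= e / 2.
  have h : 0 <= 2 * C * d%:R / e by apply: divr_ge0; [apply: mulr_ge0 => //; apply: mulr_ge0|]; rewrite ?ltW.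
  have /andP[_] := trunc_itv h; rewrite -/n ltr_pdivrMr // => /ltW h'.
  by rewrite mulrA ler_pdivrMr ?ltr0Sn //; lra.
have k0 := mean_kern_gt0 n 0.
have ck : CP (kern n th) by exact/trig_CP/trig_kern.
have -> : g th - (mean (kern n 0))^-1 * mean (fun p => g p * kern n th p)
    = (mean (kern n 0))^-1 * mean (fun p => (g th - g p) * kern n th p).
  under [in RHS]eq_fun do rewrite mulrBl.
  rewrite meanB; [|exact: CPZ|exact: CPM].
  by rewrite meanZ // mean_kern_shift mulrBr mulrCA mulVf ?mulr1 // gt_eqF.
have c1 j : CP (fun p : rV => 1 - cos (p 0 j - th 0 j)).
  by apply: CPB; [exact: CP_cst|exact/trig_CP/trig_cosj].
have cs : CP (fun p : rV => \sum_(j < d) kern n th p * (1 - cos (p 0 j - th 0 j))).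
  by apply: CP_sum => j; apply: CPM.
rewrite normrM gtr0_norm ?invr_gt0 // ler_pdivrMl //.
apply: (@le_trans _ _ (mean (fun p => e / 2 * kern n th p + C * (\sum_(j < d) kern n th p * (1 - cos (p 0 j - th 0 j)))))).
  apply: mean_abs_le.
  - by apply: CPM => //; apply: CPB => //; exact: CP_cst.
  - by apply: CPD; apply: CPZ.
  - move=> p; rewrite normrM [X in _ * X]ger0_norm ?kern_ge0 // -mulr_sumr mulrCA.
    rewrite (mulrC (e / 2)) -mulrDr mulrC ler_wpM2l ?kern_ge0 //.
    by rewrite distrC; exact: HC.
rewrite mean_lin ?meanZ //; last exact: CPZ.
rewrite mean_sum => [|j]; last exact: CPM.
under eq_bigr do rewrite mean_kern_moment mean_kern_shift.
rewrite mean_kern_shift sumr_const card_ord -[_ *+ d]mulr_natr.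
rewrite (_ : C * _ = mean (kern n 0) * (C * (d%:R / n.+1%:R))); last by ring.
rewrite (_ : e / 2 * _ = mean (kern n 0) * (e / 2)); last by ring.
by rewrite -mulrDr ler_pM2l //; move: hn; set z := C * _; lra.
Qed.

(** The convolution is a trigonometric polynomial in th, because so is the kernel. *)
Lemma trig_dense g : CP g -> forall e : R, 0 < e ->
  exists2 T, trig T & forall th, `|g th - T th| <= e.
Proof.
move=> cg e e0; have [n Hn] := kern_approx cg e0.
exists (fun th => (mean (kern n 0))^-1 * mean (fun p => g p * kern n th p)) => //.
apply: trigZ.
have : forall K, trig K -> trig (fun th => mean (fun p => g p * K (p + - th))).
  move=> K; elim=> [k|k|c g1 g2 t1 H1 t2 H2].
  - apply: (eq_trig _ (trig_lin (mean (fun p => g p * cos (dotp k p))) (trig_cos k)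
      (trigZ (mean (fun p => g p * sin (dotp k p))) (trig_sin k)))) => th.
    rewrite mulrC [_ * sin _]mulrC -mean_lin2.
    + by congr mean; apply/funext => p; rewrite dotpDr dotpNr cosB; ring.
    + by apply: CPM => //; exact: CP_cos.
    + by apply: CPM => //; exact: CP_sin.
  - apply: (eq_trig _ (trig_lin (mean (fun p => g p * sin (dotp k p))) (trig_cos k)
      (trigZ (- mean (fun p => g p * cos (dotp k p))) (trig_sin k)))) => th.
    rewrite mulNr -mulrN mulrC [_ * - _]mulrC -mean_lin2.
    + by congr mean; apply/funext => p; rewrite dotpDr dotpNr sinB; ring.
    + by apply: CPM => //; exact: CP_sin.
    + by apply: CPM => //; exact: CP_cos.
  - apply: (eq_trig _ (trig_lin c H1 H2)) => th; rewrite -mean_lin.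
    + by congr mean; apply/funext => p; ring.
    + by apply: CPM => //; apply: CP_shift; exact: trig_CP.
    + by apply: CPM => //; apply: CP_shift; exact: trig_CP.
move=> /(_ _ (trig_kern n 0)); apply: eq_trig => th.
by congr mean; apply/funext => p; rewrite [in RHS]kern_shift.
Qed.

End Trigonometric.
(** * Fourier coefficients of continuous functions on the torus *)

Section MeanValue.
Context {R : realType}.

Lemma eps_eq0 (x : R) : (forall e : R, 0 < e -> `|x| <= e) -> x = 0.
Proof.
move=> h; apply/eqP; rewrite -normr_le0; apply/ler_addgt0Pr => e e0.
by rewrite add0r; exact: h.
Qed.

Lemma eps_le (x y C : R) : (forall e : R, 0 < e -> x <= y + C * e) -> x <= y.
Proof.
move=> h; apply/ler_addgt0Pr => e e0.
have C0 : 0 < `|C| + 1 by rewrite ltr_wpDl.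
apply: le_trans (h (e / (`|C| + 1)) _) _; first by rewrite divr_gt0.
rewrite lerD2l mulrCA ger_pMr // ler_pdivrMr // mul1r.
by apply: le_trans (ler_norm _) _; rewrite lerDl.
Qed.

Lemma MVT_local (f df : R -> R) (a b : R) :
  (forall x : R, Num.min a b <= x <= Num.max a b -> is_derive x (1 : R) f (df x)) ->
  exists2 c, Num.min a b <= c <= Num.max a b & f b - f a = df c * (b - a).
Proof.
have mvt (u v : R) : u <= v -> (forall x : R, u <= x <= v -> is_derive x (1 : R) f (df x)) ->
    exists2 c, u <= c <= v & f v - f u = df c * (v - u).
  move=> uv fd.
  have fc : {within `[u, v], continuous f}.
    by apply: derivable_within_continuous => x; rewrite in_itv /= => /fd[].
  have fo (x : R) : x \in `]u, v[ -> is_derive x (1 : R) f (df x).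
    by rewrite in_itv /= => /andP[h1 h2]; apply: fd; rewrite !ltW.
  by have [c] := MVT_segment uv fo fc; rewrite in_itv /=; exists c.
move=> fd; have [ab|ab] := leP a b.
  by apply: mvt => // x hx; apply: fd; rewrite min_l ?max_r.
have [|c hc e] := mvt b a (ltW ab).
  by move=> x hx; apply: fd; rewrite min_r ?max_l ?(ltW ab).
by exists c => //; rewrite -opprB e -mulrN opprB.
Qed.

Lemma MVT_between (f df : R -> R) (a b : R) : (forall x, is_derive x (1 : R) f (df x)) ->
  exists2 c, Num.min a b <= c <= Num.max a b & f b - f a = df c * (b - a).
Proof. by move=> fd; apply: MVT_local => x _; exact: fd. Qed.

Lemma derive_lipschitz (f df : R -> R) (a b M : R) : (forall x, is_derive x (1 : R) f (df x)) ->
  (forall x, Num.min a b <= x <= Num.max a b -> `|df x| <= M) -> `|f b - f a| <= M * `|b - a|.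
Proof.
move=> fd h; have [c cab ->] := MVT_between a b fd.
by rewrite normrM ler_wpM2r // h.
Qed.

End MeanValue.

Section Coefficients.
Context {R : realType} {d : nat}.
Local Notation rV := 'rV[R]_d.
Local Notation mean := (@torus_mean R d).
Local Notation Zd := 'rV[int]_d.
Implicit Types g u : rV -> R.

(** A translation rotates the pair cos, sin of each frequency and leaves the mean of a trigonometric
    polynomial unchanged; density does the rest. *)
Lemma mean_shift g v : CP g -> mean (fun th => g (th + v)) = mean g.
Proof.
move=> cg; apply/eqP; rewrite -subr_eq0; apply/eqP/eps_eq0 => e e0.
have [T tT hT] := trig_dense cg (divr_gt0 e0 (ltr0n R 2)).
have cT := trig_CP tT.
have h1 : `|mean (fun th => g (th + v)) - mean (fun th => T (th + v))| <= e / 2.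
  by apply: mean_dist_le => [||th]; [exact: CP_shift|exact: CP_shift|exact: hT].
have h2 : `|mean g - mean T| <= e / 2 by apply: mean_dist_le.
move: h1 h2; rewrite (mean_trig_shift _ tT) !ler_norml => /andP[? ?] /andP[? ?].
apply/andP; split; lra.
Qed.

(** The Korovkin approximation of g at each point is a mean of g against a nonnegative bounded
    kernel, hence zero. *)
Lemma mean_eq0 g : CP g -> (forall th, 0 <= g th) -> mean g = 0 -> forall th, g th = 0.
Proof.
move=> cg g0 mg th; apply: eps_eq0 => e e0.
have [n /(_ th)] := kern_approx cg e0.
suff -> : mean (fun p => g p * kern n th p) = 0 by rewrite mulr0 subr0.
have ck : CP (kern n th) by exact/trig_CP/trig_kern.
have [M M0 hM] := CP_bounded ck.
apply/eqP; rewrite eq_le; apply/andP; split.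
  rewrite -(mulr0 M) -mg -meanZ //; apply: mean_le; [exact: CPM|exact: CPZ|].
  by move=> p; rewrite mulrC ler_wpM2r //; apply: le_trans (ler_norm _) (hM p).
by apply: mean_ge0 => [|p]; [exact: CPM|apply: mulr_ge0; [|exact: kern_ge0]].
Qed.

(** A substitute for Fubini's theorem: an extra average in one direction does not change the mean.
    It reduces by density to trigonometric polynomials. *)
Lemma mean_swap g j : CP g ->
  CP (fun th => M1 (fun tau => g (th + tau *: evec j))) /\
  mean (fun th => M1 (fun tau => g (th + tau *: evec j))) = mean g.
Proof.
have line g' (th : rV) : CP g' -> continuous (fun tau : R => g' (th + tau *: evec j)).
  move=> [gc _] t; apply: (@continuous_comp R rV R (fun tau => th + tau *: evec j) g' t).
    apply: (@continuousD R rV R (cst th)); first exact: cst_continuous.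
    exact: scalel_continuous.
  exact: gc.
have M1cst : forall (u v : R -> R) (M : R), continuous u -> continuous v -> (forall s, `|u s - v s| <= M) ->
    `|M1 u - M1 v| <= M.
  move=> u v M cu cv h.
  have cM : continuous (fun _ : R => M) by move=> ?; exact: cst_continuous.
  have A (u' v' : R -> R) : continuous u' -> continuous v' -> (forall s, u' s <= v' s + M) -> M1 u' <= M1 v' + M.
    move=> cu' cv' h'; rewrite -[M1 v']mul1r -[X in _ + X](M1_cst M) -M1_lin //.
    apply: M1_le; [exact: cu'| |by move=> s; rewrite mul1r].
    move=> x; apply: (@continuousD R R R (fun s => 1 * v' s)); last exact: cM.
    by apply: (@continuousM R R (cst 1)); [exact: cst_continuous|exact: cv'].
  have h1 := A u v cu cv _; have h2 := A v u cv cu _.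
  rewrite ler_norml; apply/andP; split.
    by have := h2 _; rewrite lerNl opprB lerBlDl; apply=> s; have := h s; rewrite ler_norml => /andP[? _]; lra.
  by have := h1 _; rewrite lerBlDl; apply=> s; have := h s; rewrite ler_norml => /andP[_ ?]; lra.
have cpM g' : CP g' -> CP (fun th => M1 (fun tau => g' (th + tau *: evec j))).
  move=> cg; split; last first.
    by move=> k th; congr M1; apply/funext => tau; rewrite addrAC cg.2.
  apply: rV_continuous => th e e0; have [dl dl0 H] := CP_uniform cg (divr_gt0 e0 (ltr0n R 2)).
  exists dl => // th' h; apply: (@le_lt_trans _ _ (e / 2)); last by lra.
  apply: M1cst; [exact: line|exact: line|move=> s].
  by apply/ltW/H => i; rewrite !mxE opprD addrACA subrr addr0.
move=> cg; split; first exact: cpM.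
apply/eqP; rewrite -subr_eq0; apply/eqP/eps_eq0 => e e0.
have [T tT hT] := trig_dense cg (divr_gt0 e0 (ltr0n R 2)).
have cT := trig_CP tT.
have E : mean (fun th => M1 (fun tau => T (th + tau *: evec j))) = mean T.
  elim: tT {hT cT} => [k|k|c g1 g2 t1 IH1 t2 IH2].
  - transitivity (mean (fun th => (k 0 j == 0)%:R * cos (dotp k th))).
      congr mean; apply/funext => th; rewrite mulrC -(M1_comb _ (- sin (dotp k th))).
      by congr M1; apply/funext => s; rewrite dotpDr dotpZ dotp_evec cosD [s * _]mulrC mulNr.
    rewrite meanZ ?mean_cos; last exact: CP_cos.
    by case: (eqVneq k) => [->|_]; rewrite ?mulr0 // mxE eqxx mulr1.
  - transitivity (mean (fun th => (k 0 j == 0)%:R * sin (dotp k th))).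
      congr mean; apply/funext => th; rewrite mulrC -(M1_comb _ (cos (dotp k th))).
      by congr M1; apply/funext => s; rewrite dotpDr dotpZ dotp_evec sinD [s * _]mulrC.
    by rewrite meanZ ?mean_sin ?mulr0 //; exact: CP_sin.
  - have c1 := trig_CP t1; have c2 := trig_CP t2.
    rewrite (_ : (fun th => M1 _) = fun th => c * M1 (fun tau => g1 (th + tau *: evec j)) + M1 (fun tau => g2 (th + tau *: evec j))).
      by rewrite !mean_lin ?IH1 ?IH2 //; exact: cpM.
    by apply/funext => th; rewrite M1_lin //; exact: line.
have h1 : `|mean (fun th => M1 (fun tau => g (th + tau *: evec j))) -
            mean (fun th => M1 (fun tau => T (th + tau *: evec j)))| <= e / 2.
  by apply: mean_dist_le => [||th]; [exact: cpM|exact: cpM|apply: M1cst => //; exact: line].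
have h2 : `|mean g - mean T| <= e / 2 by apply: mean_dist_le.
move: h1 h2; rewrite E !ler_norml => /andP[? ?] /andP[? ?].
apply/andP; split; lra.
Qed.

Definition fc g (k : Zd) := mean (fun th => g th * cos (dotp k th)).
Definition fs g (k : Zd) := mean (fun th => g th * sin (dotp k th)).

Lemma fourierE g k : fourier g k = (fc g k -i* fs g k)%C.
Proof. by []. Qed.

Lemma CP_gcos g k : CP g -> CP (fun th => g th * cos (dotp k th)).
Proof. by move=> cg; apply: CPM => //; exact: CP_cos. Qed.

Lemma CP_gsin g k : CP g -> CP (fun th => g th * sin (dotp k th)).
Proof. by move=> cg; apply: CPM => //; exact: CP_sin. Qed.

Lemma fc_lin c g u k : CP g -> CP u -> fc (fun th => c * g th + u th) k = c * fc g k + fc u k.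
Proof.
move=> cg cu; rewrite -mean_lin; [|exact: CP_gcos|exact: CP_gcos].
by congr mean; apply/funext => th; rewrite mulrDl mulrA.
Qed.

Lemma fs_lin c g u k : CP g -> CP u -> fs (fun th => c * g th + u th) k = c * fs g k + fs u k.
Proof.
move=> cg cu; rewrite -mean_lin; [|exact: CP_gsin|exact: CP_gsin].
by congr mean; apply/funext => th; rewrite mulrDl mulrA.
Qed.

Lemma fcB g u k : CP g -> CP u -> fc (fun th => g th - u th) k = fc g k - fc u k.
Proof.
move=> cg cu; rewrite addrC -mulN1r -fc_lin //.
by congr fc; apply/funext => th; rewrite mulN1r addrC.
Qed.

Lemma fsB g u k : CP g -> CP u -> fs (fun th => g th - u th) k = fs g k - fs u k.
Proof.
move=> cg cu; rewrite addrC -mulN1r -fs_lin //.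
by congr fs; apply/funext => th; rewrite mulN1r addrC.
Qed.

Lemma fcN g k : fc g (- k) = fc g k.
Proof. by congr mean; apply/funext => th; rewrite dotpNl cosN. Qed.

Lemma fsN g k : CP g -> fs g (- k) = - fs g k.
Proof.
move=> cg; rewrite -meanN; last exact: CP_gsin.
by congr mean; apply/funext => th; rewrite dotpNl sinN mulrN.
Qed.

Lemma fc_norm_le g k M : CP g -> (forall th, `|g th| <= M) -> `|fc g k| <= M.
Proof.
move=> cg h; apply: mean_norm_le => [|th]; first exact: CP_gcos.
rewrite normrM -[leRHS]mulr1; apply: ler_pM => //; exact: cos_max.
Qed.

Lemma fs_norm_le g k M : CP g -> (forall th, `|g th| <= M) -> `|fs g k| <= M.
Proof.
move=> cg h; apply: mean_norm_le => [|th]; first exact: CP_gsin.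
rewrite normrM -[leRHS]mulr1; apply: ler_pM => //; exact: sin_max.
Qed.

Lemma mean_mul_tp g X al be : CP g ->
  mean (fun th => g th * tp X al be th) = \sum_(k <- X) (al k * fc g k + be k * fs g k).
Proof.
move=> cg; rewrite (_ : (fun th => _) = fun th => \sum_(k <- X)
    (al k * (g th * cos (dotp k th)) + be k * (g th * sin (dotp k th)))).
  rewrite mean_sum => [|k]; last by apply: CPD; apply: CPZ; [exact: CP_gcos|exact: CP_gsin].
  apply: eq_bigr => k _; rewrite mean_lin ?meanZ //; try exact: CP_gsin; try exact: CP_gcos.
  by apply: CPZ; exact: CP_gsin.
apply/funext => th; rewrite mulr_sumr; apply: eq_bigr => k _; ring.
Qed.

(** Such a g is orthogonal to its own trigonometric approximations, hence to itself. *)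
Lemma coef_eq0 g : CP g -> (forall k, fc g k = 0 /\ fs g k = 0) -> g = fun=> 0.
Proof.
move=> cg h; have cg2 := CPM cg cg.
have [M M0 hM] := CP_bounded cg.
have m0 : mean (fun th => g th * g th) = 0.
  apply: eps_eq0 => e e0.
  have [T tT hT] := trig_dense cg (divr_gt0 e0 M0).
  have [X HX] := trig_frequencies tT.
  have <- : mean (fun th => g th * g th) - mean (fun th => g th * T th) = mean (fun th => g th * g th).
    by rewrite (HX _ cg) ?subr0 // => k _; exact: h.
  apply: mean_dist_le => [||th] //; first by apply: CPM => //; exact: trig_CP.
  rewrite -mulrBr normrM -[leRHS](divfK (lt0r_neq0 M0)) mulrC; apply: ler_pM => //.
apply/funext => th; have /eqP := mean_eq0 cg2 (fun th => sqr_ge0 (g th)) m0 th.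
by rewrite mulf_eq0 orbb => /eqP.
Qed.

Lemma coef_inj g u : CP g -> CP u -> (forall k, fc g k = fc u k /\ fs g k = fs u k) -> g = u.
Proof.
move=> cg cu h; suff e : (fun th => g th - u th) = fun=> 0.
  by apply/funext => th; apply/eqP; rewrite -subr_eq0 (congr1 (@^~ th) e).
by apply: coef_eq0 => [|k]; [exact: CPB|have [e1 e2] := h k; rewrite fcB // fsB // e1 e2 !subrr].
Qed.

Definition symm (X : seq Zd) := forall k, k \in X -> - k \in X.

Lemma mean_coscos (k l : Zd) : mean (fun th => cos (dotp k th) * cos (dotp l th)) =
  2^-1 * (k == l)%:R + 2^-1 * (k == - l)%:R.
Proof.
have -> : (k == l) = (k - l == 0) by rewrite subr_eq0.
have -> : (k == - l) = (k + l == 0) by rewrite addr_eq0.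
rewrite -!mean_cos -mean_lin2; try exact: CP_cos.
by congr mean; apply/funext => th; rewrite !dotpDl dotpNl !cosD cosN sinN; field.
Qed.

Lemma mean_sinsin (k l : Zd) : mean (fun th => sin (dotp k th) * sin (dotp l th)) =
  2^-1 * (k == l)%:R - 2^-1 * (k == - l)%:R.
Proof.
have -> : (k == l) = (k - l == 0) by rewrite subr_eq0.
have -> : (k == - l) = (k + l == 0) by rewrite addr_eq0.
rewrite -!mean_cos -mulNr -mean_lin2; try exact: CP_cos.
by congr mean; apply/funext => th; rewrite !dotpDl dotpNl !cosD cosN sinN; field.
Qed.

Lemma mean_sincos (k l : Zd) : mean (fun th => sin (dotp k th) * cos (dotp l th)) = 0.
Proof.
transitivity (2^-1 * mean (fun th => sin (dotp (k + l) th)) + 2^-1 * mean (fun th => sin (dotp (k - l) th))); last first.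
  by rewrite !mean_sin mulr0 addr0.
rewrite -mean_lin2; try exact: CP_sin.
by congr mean; apply/funext => th; rewrite !dotpDl dotpNl !sinD cosN sinN; field.
Qed.

Lemma sum_delta (X : seq Zd) (a : Zd -> R) l : uniq X ->
  \sum_(k <- X) a k * (k == l)%:R = a l *+ (l \in X).
Proof.
move=> uX; case: (boolP (l \in X)) => lX.
  rewrite (bigD1_seq l) //= eqxx mulr1 big1 ?addr0 // => i /negbTE ->; exact: mulr0.
rewrite mulr0n big1_seq // => k /andP[_ kX].
by case: eqP kX lX => [->->//|_ _ _]; rewrite mulr0.
Qed.

Lemma tp_coef X al be l : uniq X -> symm X -> (forall k, al (- k) = al k) ->
  (forall k, be (- k) = - be k) ->
  fc (tp X al be) l = al l *+ (l \in X) /\ fs (tp X al be) l = be l *+ (l \in X).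
Proof.
move=> uX sX ea ob.
have lX : (- l \in X) = (l \in X).
  by apply/idP/idP => /sX //; rewrite opprK.
split.
  transitivity (mean (fun th => cos (dotp l th) * tp X al be th)).
    by congr mean; apply/funext => th; rewrite mulrC.
  rewrite mean_mul_tp; last exact: CP_cos.
  under eq_bigr => k _.
    have -> : fc (fun th => cos (dotp l th)) k = 2^-1 * (k == l)%:R + 2^-1 * (k == - l)%:R.
      by rewrite -mean_coscos; congr mean; apply/funext => th; rewrite mulrC.
    have -> : fs (fun th => cos (dotp l th)) k = 0.
      by rewrite -(mean_sincos k l); congr mean; apply/funext => th; rewrite mulrC.
    rewrite mulr0 addr0 mulrDr !mulrA; over.
  rewrite big_split /= !(sum_delta (fun k => al k * 2^-1)) // lX ea.
  by case: (l \in X); rewrite ?mulr0n ?mulr1n ?addr0 //; field.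
transitivity (mean (fun th => sin (dotp l th) * tp X al be th)).
  by congr mean; apply/funext => th; rewrite mulrC.
rewrite mean_mul_tp; last exact: CP_sin.
under eq_bigr => k _.
  have -> : fc (fun th => sin (dotp l th)) k = 0 by rewrite -(mean_sincos l k).
  have -> : fs (fun th => sin (dotp l th)) k = 2^-1 * (k == l)%:R - 2^-1 * (k == - l)%:R.
    by rewrite -mean_sinsin; congr mean; apply/funext => th; rewrite mulrC.
  rewrite mulr0 add0r mulrDr mulrN !mulrA -mulNr; over.
rewrite big_split /= (sum_delta (fun k => be k * 2^-1)) // (sum_delta (fun k => - (be k * 2^-1))) // lX ob.
by case: (l \in X); rewrite ?mulr0n ?mulr1n ?addr0 //; field.
Qed.

Definition energy g (X : seq Zd) := \sum_(k <- X) (fc g k ^+ 2 + fs g k ^+ 2).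

(** Pythagoras for the orthogonal projection on the frequencies in X. *)
Lemma mean_sub_proj g X : CP g -> uniq X -> symm X ->
  mean (fun th => (g th - tp X (fc g) (fs g) th) ^+ 2) = mean (fun th => g th ^+ 2) - energy g X.
Proof.
move=> cg uX sX; set T := tp _ _ _; have cT : CP T := CP_tp _ _ _.
have e1 : mean (fun th => g th * T th) = energy g X.
  by rewrite mean_mul_tp //; apply: eq_bigr => k _; rewrite !expr2.
have e2 : mean (fun th => T th * T th) = energy g X.
  rewrite mean_mul_tp //; apply: eq_big_seq => k kX.
  have [-> ->] := tp_coef k uX sX (fcN g) (fun l => fsN l cg).
  by rewrite kX !mulr1n !expr2.
rewrite (_ : (fun th => _) = fun th => g th ^+ 2 + (- 2 * (g th * T th) + T th * T th)); last first.
  by apply/funext => th; ring.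
have c1 := CPX 2 cg; have c2 := CPM cg cT; have c3 := CPM cT cT.
rewrite meanD //; last by apply: CPD => //; exact: CPZ.
by rewrite mean_lin // e1 e2; ring.
Qed.

Definition symmetrize (X : seq Zd) := undup (X ++ map -%R X).

Lemma symm_symmetrize X : symm (symmetrize X).
Proof.
move=> k; rewrite !mem_undup !mem_cat => /orP[kX|/mapP[l lX ->]].
  by rewrite map_f ?orbT.
by rewrite opprK lX.
Qed.

Lemma ler_sum_subset (X Y : seq Zd) (F : Zd -> R) : uniq X -> uniq Y ->
  {subset X <= Y} -> (forall k, 0 <= F k) -> \sum_(k <- X) F k <= \sum_(k <- Y) F k.
Proof.
move=> uX uY sub F0; rewrite [leRHS](bigID (mem X)) /= -[X in _ <= X + _]big_filter.
rewrite [X in _ <= X + _](perm_big X); first by rewrite lerDl sumr_ge0.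
apply: uniq_perm; rewrite ?filter_uniq // => k; rewrite mem_filter.
by case: (boolP (k \in X)) => //= /sub.
Qed.

Lemma bessel g X : CP g -> uniq X -> energy g X <= mean (fun th => g th ^+ 2).
Proof.
move=> cg uX.
apply: (@le_trans _ _ (energy g (symmetrize X))).
  apply: ler_sum_subset => //; first exact: undup_uniq.
    by move=> k kX; rewrite mem_undup mem_cat kX.
  by move=> k; rewrite addr_ge0 // sqr_ge0.
rewrite -subr_ge0 -mean_sub_proj //; [|exact: undup_uniq|exact: symm_symmetrize].
apply: mean_ge0 => [|th]; last exact: sqr_ge0.
by apply: CPX; apply: CPB => //; exact: CP_tp.
Qed.

(** The projection on sufficiently many frequencies is at least as good as any
    given trigonometric approximation, whence Parseval. *)
Lemma parseval_le g B : CP g -> (forall X, uniq X -> energy g X <= B) ->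
  mean (fun th => g th ^+ 2) <= B.
Proof.
move=> cg h.
apply: (@eps_le R _ _ 1) => e e0.
pose e1 := Num.min e 1; have e10 : 0 < e1 by rewrite lt_min e0 ltr01.
have e1e : e1 ^+ 2 <= e.
  rewrite expr2 (@le_trans _ _ (e1 * 1)) // ?ler_wpM2l ?(ltW e10) ?mulr1 //;
  by rewrite ge_min lexx ?orbT.
have [T tT hT] := trig_dense cg e10.
have [X0 HX] := trig_frequencies tT.
pose X := symmetrize X0.
have uX : uniq X by exact: undup_uniq.
have sX : symm X by exact: symm_symmetrize.
pose S := tp X (fc g) (fs g); have cS : CP S := CP_tp _ _ _.
pose u th := g th - S th; have cu : CP u by exact: CPB.
have u0 k : k \in X -> fc u k = 0 /\ fs u k = 0.
  move=> kX; have [p1 p2] := tp_coef k uX sX (fcN g) (fun l => fsN l cg).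
  by rewrite fcB // fsB // p1 p2 kX !mulr1n !subrr.
have cT := trig_CP tT.
have uT : mean (fun th => u th * T th) = 0.
  by apply: HX => // k kX; apply: u0; rewrite mem_undup mem_cat kX.
have uS : mean (fun th => u th * S th) = 0.
  rewrite mean_mul_tp // big1_seq // => k /andP[_ /u0[-> ->]].
  by rewrite !mulr0 addr0.
have uu : mean (fun th => u th ^+ 2) = mean (fun th => u th * (g th - T th)).
  rewrite (_ : (fun th => u th ^+ 2) = fun th => u th * g th - u th * S th); last first.
    by apply/funext => th; rewrite expr2 -mulrBr.
  rewrite (_ : (fun th => u th * (g th - T th)) = fun th => u th * g th - u th * T th); last first.
    by apply/funext => th; rewrite mulrBr.
  by rewrite !meanB ?uT ?uS //; exact: CPM.
have cu2 := CPX 2 cu; have cgT : CP (fun th => g th - T th) by exact: CPB.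
have cgT2 := CPX 2 cgT.
have um : mean (fun th => u th ^+ 2) <= e1 ^+ 2.
  have : mean (fun th => u th * (g th - T th)) <=
         2^-1 * mean (fun th => u th ^+ 2) + 2^-1 * mean (fun th => (g th - T th) ^+ 2).
    rewrite -mean_lin2 //; apply: mean_le => [||th]; first exact: CPM.
      by apply: CPD; exact: CPZ.
    by have := sqr_ge0 (u th - (g th - T th)); rewrite !expr2; lra.
  have : mean (fun th => (g th - T th) ^+ 2) <= e1 ^+ 2.
    rewrite -[leRHS](mean_cst (d := d)); apply: mean_le => // [|th]; first exact: CP_cst.
    by rewrite -[leLHS]real_normK ?num_real // ler_sqr ?nnegrE // ltW.
  by rewrite uu; lra.
have := mean_sub_proj cg uX sX; rewrite -/S => E.
have {E}E : mean (fun th => g th ^+ 2) = energy g X + mean (fun th => u th ^+ 2).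
  by rewrite E addrC subrK.
by rewrite E mul1r lerD //; [exact: h|exact: le_trans um _].
Qed.

Lemma iderM j (f f' g g' : rV -> R) : ider j f f' -> ider j g g' ->
  ider j (fun th => f th * g th) (fun th => f' th * g th + f th * g' th).
Proof.
move=> hf hg th; have := is_deriveM (hf th) (hg th).
rewrite scale0r addr0 /GRing.scale /= => h.
by apply: (is_derive_eq h); ring.
Qed.

Lemma is_derive_ider j (u u' : rV -> R) : ider j u u' -> forall th (x : R),
  is_derive x (1 : R) (fun t => u (th + t *: evec j)) (u' (th + x *: evec j)).
Proof.
move=> hu th x; have := hu (th + x *: evec j) => h.
pose f t := u (th + x *: evec j + t *: evec j).
have -> : (fun t => u (th + t *: evec j)) = (fun t : R => f (- x + 1 * t)).
  by apply/funext => t; rewrite /f -addrA -scalerDl mul1r addNKr.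
rewrite -[X in is_derive _ _ _ X]mulr1; apply: is_derive_affine.
by rewrite mul1r addNr.
Qed.

Lemma mean_ider j u u' : CP u -> CP u' -> ider j u u' -> mean u' = 0.
Proof.
move=> cu cu' hu; apply: eps_eq0 => e e0.
have [dl dl0 H] := CP_uniform cu' e0.
pose t := dl / 2; have t0 : 0 < t by rewrite divr_gt0.
have <- : mean u' - mean (fun th => t^-1 * (u (th + t *: evec j) - u th)) = mean u'.
  by rewrite meanZ ?meanB ?mean_shift ?subrr ?mulr0 ?subr0 //; [exact: CP_shift|apply: CPB => //; exact: CP_shift].
apply: mean_dist_le => // [|th].
  by apply: CPZ; apply: CPB => //; exact: CP_shift.
have [c] := MVT_between 0 t (is_derive_ider hu th).
rewrite scale0r addr0 subr0 min_l ?max_r ?(ltW t0) // => /andP[c0 ct] ->.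
rewrite mulrCA mulVf ?mulr1 ?gt_eqF // ltW // H // => i.
rewrite !mxE opprD addNKr normrN normrM ger0_norm //.
apply: (@le_lt_trans _ _ (c * 1)); last by rewrite mulr1; apply: (le_lt_trans ct); rewrite /t; lra.
by rewrite ler_wpM2l //; case: (_ && _); rewrite ?normr1 ?normr0.
Qed.

(** Integration by parts against a character. *)
Lemma coef_ider j u u' k : CP u -> CP u' -> ider j u u' ->
  fc u' k = (k 0 j)%:~R * fs u k /\ fs u' k = - (k 0 j)%:~R * fc u k.
Proof.
move=> cu cu' hu; have cc := CP_cos (R := R) k; have ss := CP_sin (R := R) k.
have c1 := CP_gcos k cu; have c2 := CP_gsin k cu.
have c1' := CP_gcos k cu'; have c2' := CP_gsin k cu'.
have h1 := mean_ider c1 _ (iderM hu (ider_cos k j)).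
have h2 := mean_ider c2 _ (iderM hu (ider_sin k j)).
split; apply/eqP.
  rewrite -subr_eq0 -[X in _ == X]h1; last first.
    by apply: CPD => //; apply: CPM => //; exact: CPZ.
  rewrite meanD //; last by apply: CPM => //; exact: CPZ.
  rewrite (_ : (fun th => u th * _) = fun th => - (k 0 j)%:~R * (u th * sin (dotp k th))); last first.
    by apply/funext => th; ring.
  by rewrite meanZ // mulNr.
rewrite -subr_eq0 -[X in _ == X]h2; last first.
  by apply: CPD => //; apply: CPM => //; exact: CPZ.
rewrite meanD //; last by apply: CPM => //; exact: CPZ.
rewrite (_ : (fun th => u th * _) = fun th => (k 0 j)%:~R * (u th * cos (dotp k th))); last first.
  by apply/funext => th; ring.
by rewrite meanZ // mulNr opprK.
Qed.

(** Weyl's averaging: by nonresonance every nonzero mode of g has a bounded primitive along the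
    flow, so the primitive of g grows like the mean of g times t. A bound along a sequence of
    times suffices, and is what the mean value theorem provides for derivatives of solutions. *)
Lemma mean_primitive (om : rV) g (phi : R -> R) C : nonresonant om -> CP g ->
  (forall t : R, is_derive t (1 : R) phi (g (t *: om))) ->
  (forall N : R, exists2 t, N < t & `|phi t| <= C) -> mean g = 0.
Proof.
move=> nr cg hphi hC; apply: (eps_eq0) => e e0.
have e40 : 0 < e / 4 by rewrite divr_gt0.
have [T tT hT] := trig_dense cg e40; have cT := trig_CP tT.
have [Psi [D hPsi hD]] : exists Psi : R -> R, exists2 D : R,
    (forall t : R, is_derive t (1 : R) Psi (T (t *: om))) &
    forall t, `|Psi t - mean T * t| <= D.
  elim: tT {hT cT} => [k|k|c g1 g2 t1 [P1 [D1 d1 h1]] t2 [P2 [D2 d2 h2]]].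
  - have [k0|k0] := eqVneq k 0.
      exists id, 0 => [t|t]; first by rewrite k0 dotp0l cos0; exact: is_derive_id.
      by rewrite mean_cos k0 eqxx mul1r subrr normr0.
    pose s := dotp k om; have s0 : s != 0 by exact: nr.
    exists (fun t => s^-1 * sin (s * t)), (`|s^-1|) => t.
      rewrite dotpZ -/s [t * s]mulrC; have := is_deriveZ s^-1 (is_derive_sinM s t).
      by rewrite /GRing.scale /= mulrA mulVf // mul1r.
    rewrite mean_cos (negbTE k0) mul0r subr0 normrM -[leRHS]mulr1 ler_wpM2l //.
    exact: sin_max.
  - have [k0|k0] := eqVneq k 0.
      exists (fun=> 0), 0 => [t|t]; first by rewrite k0 dotp0l sin0; exact: is_derive_cst.
      by rewrite mean_sin mul0r subrr normr0.
    pose s := dotp k om; have s0 : s != 0 by exact: nr.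
    exists (fun t => - s^-1 * cos (s * t)), (`|s^-1|) => t.
      rewrite dotpZ -/s [t * s]mulrC; have := is_deriveZ (- s^-1) (is_derive_cosM s t).
      by rewrite /GRing.scale /= mulrA mulrNN mulVf // mul1r.
    rewrite mean_sin mul0r subr0 normrM normrN -[leRHS]mulr1 ler_wpM2l //.
    exact: cos_max.
  - exists (fun t => c * P1 t + P2 t), (`|c| * D1 + D2) => t.
      exact: (is_deriveD (is_deriveZ c (d1 t)) (d2 t)).
    rewrite mean_lin; [|exact: trig_CP|exact: trig_CP].
    rewrite (_ : _ - _ = c * (P1 t - mean g1 * t) + (P2 t - mean g2 * t)); last by ring.
    by apply: le_trans (ler_normD _ _) _; rewrite normrM lerD // ler_wpM2l.
pose K := `|phi 0| + `|Psi 0| + C + D.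
have [t tN pt] := hC (Num.max 1 (4 * K / e)).
have t1 : 1 < t by apply: le_lt_trans tN; rewrite le_max lexx.
have t0 : 0 < t by lra.
have tK : 4 * K / e < t by apply: le_lt_trans tN; rewrite le_max lexx orbT.
have dif x : is_derive x (1 : R) (fun t => phi t - Psi t) (g (x *: om) - T (x *: om)).
  by apply: is_deriveB.
have := @derive_lipschitz R _ _ 0 t _ dif (fun x _ => hT (x *: om)).
rewrite subr0 (gtr0_norm t0) => L.
have mT : `|mean T| <= e / 2.
  have : `|mean T| * t <= e / 4 * t + K.
    rewrite -{1}(gtr0_norm t0) -normrM.
    have -> : mean T * t = - (phi t - Psi t - (phi 0 - Psi 0)) + phi t - phi 0 + Psi 0 - (Psi t - mean T * t).
      by ring.
    rewrite /K; move: L pt (hD t) => L pt hDt.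
    apply: le_trans (ler_normB _ _) _; apply: le_trans (lerD (ler_normD _ _) hDt) _.
    apply: le_trans (lerD (lerD (ler_normB _ _) (lexx _)) (lexx _)) _.
    apply: le_trans (lerD (lerD (lerD (ler_normD _ _) (lexx _)) (lexx _)) (lexx _)) _.
    rewrite normrN; lra.
  move: tK; rewrite ltr_pdivrMr // => tK h.
  rewrite -(ler_pM2r t0); lra.
have := mean_dist_le cg cT hT; have := ler_normD (mean g - mean T) (mean T).
by rewrite subrK; lra.
Qed.

End Coefficients.
(** * Weighted sequence spaces over the integer lattice *)

Section Boxes.

Definition zrange N : seq int :=
  [seq i%:Z | i <- iota 0 N.+1] ++ [seq - i.+1%:Z | i <- iota 0 N].

Lemma mem_zrange N (p : int) : (p \in zrange N) = (`|p| <= N)%N.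
Proof.
rewrite mem_cat; apply/orP/idP => [[]/mapP[i hi ->]|h].
- by move: hi; rewrite mem_iota; lia.
- by move: hi; rewrite mem_iota; lia.
- case: p h => n h; [left|right]; apply/mapP; exists n => //; rewrite mem_iota; lia.
Qed.

Lemma uniq_zrange N : uniq (zrange N).
Proof.
rewrite cat_uniq !map_inj_uniq ?iota_uniq ?andbT /=; [|by move=> i j; lia|by move=> i j; lia].
by apply/hasPn => p /mapP[i _ ->]; apply/mapP => -[n _]; lia.
Qed.

Arguments zrange : simpl never.

(** Frequencies with all coordinates at most N, by recursion on the dimension so
    that sums over it are iterated sums. *)
Fixpoint box d N : seq 'rV[int]_d :=
  if d is n.+1 then [seq consrv p k | p <- zrange N, k <- box n N] else [:: 0].

Arguments box : simpl never.

Lemma boxS d N : box d.+1 N = [seq consrv p k | p <- zrange N, k <- box d N].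
Proof. by []. Qed.

Lemma mem_box d N (k : 'rV[int]_d) : (k \in box d N) = [forall j, (`|k 0%R j| <= N)%N].
Proof.
elim: d k => [|d IH] k.
  by rewrite inE; apply/eqP/forallP => [_ []//|_]; apply/rowP => -[].
rewrite boxS; apply/allpairsP/forallP => [[[p l] /= [hp hl ->]] j|h].
  case: (unliftP ord0 j) => [i ->|->]; rewrite ?consrv0 ?consrvS -?mem_zrange //.
  by rewrite mem_zrange; move: hl; rewrite IH => /forallP.
exists (k 0 ord0, \row_j k 0 (lift ord0 j)); split; rewrite /= ?mem_zrange ?IH //.
  by apply/forallP => j; rewrite mxE.
by apply: consrv_ext => [|j]; rewrite ?consrv0 ?consrvS ?mxE.
Qed.

Lemma consrv_inj (T : Type) d (p p' : T) (k k' : 'rV[T]_d) : consrv p k = consrv p' k' -> (p, k) = (p', k').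
Proof.
move=> e; congr pair; first by have := congr1 (fun v : 'rV_d.+1 => v 0 ord0) e; rewrite !consrv0.
by apply/rowP => j; have := congr1 (fun v : 'rV_d.+1 => v 0 (lift ord0 j)) e; rewrite !consrvS.
Qed.

Lemma uniq_box d N : uniq (box d N).
Proof.
elim: d => [//|d IH]; rewrite boxS; apply: allpairs_uniq => //; first exact: uniq_zrange.
by move=> [p k] [p' k'] _ _ /=; exact: consrv_inj.
Qed.

Lemma symm_box d N : symm (box d N).
Proof. by move=> k; rewrite !mem_box => /forallP h; apply/forallP => j; rewrite mxE abszN. Qed.

Lemma box_subset d N M : (N <= M)%N -> {subset box d N <= box d M}.
Proof.
move=> NM k; rewrite !mem_box => /forallP h; apply/forallP => j.
exact: leq_trans (h j) NM.
Qed.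

Lemma norm1_ge d (k : 'rV[int]_d) j : (`|k 0%R j| <= norm1 k)%N.
Proof. by rewrite /norm1 (bigD1 j) //= leq_addr. Qed.

Lemma subset_box d (X : seq 'rV[int]_d) : exists N, {subset X <= box d N}.
Proof.
elim: X => [|k X [N IH]]; first by exists 0%N.
exists (maxn N (norm1 k)) => l; rewrite inE => /orP[/eqP ->|/IH].
  by rewrite mem_box; apply/forallP => j; apply: leq_trans (norm1_ge k j) (leq_maxr _ _).
by apply: box_subset; exact: leq_maxl.
Qed.

Lemma norm1D d (k l : 'rV[int]_d) : (norm1 (k + l) <= norm1 k + norm1 l)%N.
Proof. by rewrite /norm1 -big_split; apply: leq_sum => j _; rewrite mxE /=; move: (k _ j) (l _ j) => x y; lia. Qed.

Lemma norm1N d (k : 'rV[int]_d) : norm1 (- k) = norm1 k.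
Proof. by apply: eq_bigr => j _; rewrite mxE abszN. Qed.

Lemma norm1_consrv d p (k : 'rV[int]_d) : norm1 (consrv p k) = (`|p| + norm1 k)%N.
Proof.
by rewrite /norm1 big_ord_recl consrv0; congr addn; apply: eq_bigr => j _; rewrite consrvS.
Qed.

End Boxes.

Section Lattice.
Context {R : realType}.

Lemma sum_inv_sqr (x : R) N : 1 <= x ->
  \sum_(i < N) (x + i%:R)^-1 ^+ 2 <= 2 / x - 2 / (x + N%:R).
Proof.
move=> x1; have p i : 0 < x + i%:R :> R by rewrite ltr_wpDr // (lt_le_trans ltr01).
elim: N => [|N IH]; first by rewrite big_ord0 addr0 subrr.
rewrite big_ord_recr /=; apply: le_trans (lerD IH (lexx _)) _.
rewrite -addrA lerD2l.
have -> : x + N.+1%:R = x + N%:R + 1 by rewrite -addrA natr1.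
have : 1 <= x + N%:R by rewrite ler_wpDr.
move: (x + N%:R) (p N) => y y0 y1.
rewrite -subr_ge0 (_ : _ - _ = (y - 1) / (y ^+ 2 * (y + 1))).
  by rewrite divr_ge0 ?subr_ge0 // mulr_ge0 ?sqr_ge0 // addr_ge0 // ltW.
by field; rewrite !gt_eqF // addr_gt0.
Qed.

Lemma sum_zrange_le N (f : nat -> R) : (forall i, 0 <= f i) ->
  \sum_(p <- zrange N) f `|p|%N <= 2 * \sum_(i < N.+1) f i.
Proof.
move=> f0; rewrite /zrange big_cat !big_map /= mulr_natl mulr2n; apply: lerD.
  by rewrite -[leRHS](big_mkord xpredT f) /index_iota subn0.
rewrite big_ord_recl /= -[leLHS]add0r; apply: lerD => //.
rewrite -[leRHS](big_mkord xpredT (fun i => f i.+1)) /index_iota subn0.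
exact: lexx.
Qed.

(** Summing one coordinate costs one power, for tails starting at any c >= 0. *)
Lemma sum_box_power d : forall n, (d < n)%N -> forall (c : R) N, 0 <= c ->
  \sum_(k <- box d N) (1 + c + (norm1 k)%:R)^-1 ^+ n <= 4 ^+ d * (1 + c)^-1 ^+ (n - d).
Proof.
elim: d => [|d IH] n dn c N c0.
  by rewrite /box big_seq1 /norm1 big_ord0 addr0 subn0 expr0 mul1r.
rewrite boxS big_allpairs_dep.
have c1 (p : int) : 0 <= c + `|p|%:R by rewrite addr_ge0.
apply: (@le_trans _ _ (\sum_(p <- zrange N) 4 ^+ d * (1 + c + `|p|%:R)^-1 ^+ (n - d))).
  apply: ler_sum => p _; rewrite -[1 + c + _]addrA; apply: le_trans (IH n _ _ N (c1 p)); last exact: ltnW.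
  by apply: ler_sum => k _; rewrite norm1_consrv natrD !addrA.
rewrite -mulr_sumr exprS -mulrA mulrCA ler_wpM2l ?exprn_ge0 //.
have n2 : (n - d = (n - d.+1).-1 + 2)%N by lia.
have -> : (n - d.+1 = (n - d.+1).-1 + 1)%N by lia.
set q := (n - d.+1).-1 in n2 *; rewrite n2.
have c10 : 0 < 1 + c by rewrite ltr_wpDr.
have ph i : 0 < 1 + c + i%:R :> R by rewrite ltr_wpDr.
apply: le_trans (sum_zrange_le N (f := fun i => (1 + c + i%:R)^-1 ^+ (q + 2)) _) _.
  by move=> i; rewrite exprn_ge0 // invr_ge0 ltW.
have : \sum_(i < N.+1) (1 + c + i%:R)^-1 ^+ (q + 2) <= (1 + c)^-1 ^+ q * (2 / (1 + c)).
  apply: (@le_trans _ _ ((1 + c)^-1 ^+ q * \sum_(i < N.+1) (1 + c + i%:R)^-1 ^+ 2)).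
    rewrite mulr_sumr; apply: ler_sum => i _; rewrite exprD ler_wpM2r ?sqr_ge0 //.
    by rewrite lerXn2r ?nnegrE ?invr_ge0 ?(ltW c10) ?(ltW (ph i)) // lef_pV2 ?posrE // lerDl.
  rewrite ler_wpM2l ?exprn_ge0 ?invr_ge0 ?(ltW c10) //.
  apply: le_trans (sum_inv_sqr _ _) _; first by rewrite lerDl.
  by rewrite gerBl divr_ge0 // ltW.
by rewrite exprD expr1; set z := _ ^+ q; set y := _^-1; nra.
Qed.

Definition jb d (k : 'rV[int]_d) : R := (norm1 k)%:R ^+ 2 + 1.

Lemma jb_ge1 d (k : 'rV[int]_d) : 1 <= jb k.
Proof. by rewrite lerDr sqr_ge0. Qed.

Lemma jb_gt0 d (k : 'rV[int]_d) : 0 < jb k.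
Proof. exact: lt_le_trans ltr01 (jb_ge1 k). Qed.

Lemma jbN d (k : 'rV[int]_d) : jb (- k) = jb k.
Proof. by rewrite /jb norm1N. Qed.

Definition Sjb (m d : nat) : R := 2 ^+ m * 4 ^+ d.

Lemma Sjb_gt0 m d : 0 < Sjb m d.
Proof. by rewrite mulr_gt0 // exprn_gt0. Qed.

(** The power sum over boxes with exponent 2 m > d. *)
Lemma sum_jb d m (X : seq 'rV[int]_d) : (d < 2 * m)%N -> uniq X ->
  \sum_(k <- X) (jb k)^-1 ^+ m <= Sjb m d.
Proof.
move=> dm uX; have [N XN] := subset_box X.
apply: (@le_trans _ _ (\sum_(k <- box d N) (jb k)^-1 ^+ m)).
  apply: ler_sum_subset => //; first exact: uniq_box.
  by move=> k; rewrite exprn_ge0 // invr_ge0 ltW // jb_gt0.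
apply: (@le_trans _ _ (2 ^+ m * \sum_(k <- box d N) (1 + 0 + (norm1 k)%:R)^-1 ^+ (2 * m))).
  rewrite mulr_sumr; apply: ler_sum => k _.
  rewrite exprM -exprMn lerXn2r ?nnegrE ?invr_ge0 ?(ltW (jb_gt0 k)) ?mulr_ge0 ?sqr_ge0 //.
  have y0 : 0 < 1 + (norm1 k)%:R :> R by rewrite ltr_pwDl.
  rewrite addr0 exprVn ler_pdivlMr ?exprn_gt0 // mulrC ler_pdivrMr ?jb_gt0 //.
  by rewrite /jb; move: (_%:R) => y; have := sqr_ge0 (y - 1); rewrite !expr2; lra.
rewrite ler_wpM2l ?exprn_ge0 //; apply: le_trans (sum_box_power dm N (lexx 0)) _.
by rewrite addr0 invr1 expr1n mulr1.
Qed.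

Lemma CS_step (A a P p Q q : R) : 0 <= P -> 0 <= p -> 0 <= Q -> 0 <= q ->
  A ^+ 2 <= P * Q -> a ^+ 2 <= p * q -> (A + a) ^+ 2 <= (P + p) * (Q + q).
Proof.
move=> P0 p0 Q0 q0 h1 h2.
have : 2 * (A * a) <= P * q + p * Q.
  apply: le_trans (ler_norm _) _.
  rewrite -(ler_pXn2r (n := 2)) ?nnegrE ?addr_ge0 ?mulr_ge0 // real_normK ?num_real //.
  have h3 : A ^+ 2 * a ^+ 2 <= P * Q * (p * q) by apply: ler_pM => //; exact: sqr_ge0.
  have := sqr_ge0 (P * q - p * Q).
  rewrite !expr2 in h3 *; lra.
by rewrite !expr2 in h1 h2 *; lra.
Qed.

Lemma cauchy_schwarz I (r : seq I) (a w : I -> R) : (forall i, 0 < w i) ->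
  (\sum_(i <- r) a i) ^+ 2 <= (\sum_(i <- r) (w i)^-1) * \sum_(i <- r) a i ^+ 2 * w i.
Proof.
move=> w0; elim: r => [|i r IH]; first by rewrite !big_nil expr0n mul0r.
rewrite !big_cons addrC [X in _ <= X * _]addrC [X in _ <= _ * X]addrC.
apply: CS_step => //.
- by apply: sumr_ge0 => j _; rewrite invr_ge0 ltW.
- by rewrite invr_ge0 ltW.
- by apply: sumr_ge0 => j _; rewrite mulr_ge0 ?sqr_ge0 ?ltW.
- by rewrite mulr_ge0 ?sqr_ge0 ?ltW.
- by rewrite mulrCA mulVf ?mulr1 // gt_eqF.
Qed.

Section Weight.
Variables (d m : nat) (rho : R).
Hypothesis rho0 : 0 <= rho.
Hypothesis dm : (d < 2 * m)%N.
Local Notation Zd := 'rV[int]_d.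

Definition wt s (k : Zd) : R := expR (2 * rho * (norm1 k)%:R) * jb k ^+ s.

Lemma wt_gt0 s k : 0 < wt s k.
Proof. by rewrite mulr_gt0 ?expR_gt0 ?exprn_gt0 ?jb_gt0. Qed.

Lemma wt_ge_jb s k : jb k ^+ s <= wt s k.
Proof.
rewrite ler_peMl ?exprn_ge0 ?(ltW (jb_gt0 k)) //.
by rewrite -expR0 ler_expR !mulr_ge0.
Qed.

Lemma wt_ge1 s k : 1 <= wt s k.
Proof. by apply: le_trans (wt_ge_jb s k); exact/exprn_ege1/jb_ge1. Qed.

Lemma wtN s k : wt s (- k) = wt s k.
Proof. by rewrite /wt norm1N jbN. Qed.

Lemma sum_wt X : uniq X -> \sum_(k <- X) (wt m k)^-1 <= Sjb m d.
Proof.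
move=> uX; apply: le_trans (sum_jb dm uX); apply: ler_sum => k _.
by rewrite exprVn lef_pV2 ?posrE ?wt_gt0 ?exprn_gt0 ?jb_gt0 // wt_ge_jb.
Qed.

(** The weights are submultiplicative up to the smaller of the two factors; that
    factor is what makes the convolution sum converge. *)
Lemma wt_split s1 s2 (j l : Zd) : (s1 <= m)%N -> (s2 <= m)%N -> (m <= s1 + s2)%N ->
  wt (s1 + s2 - m) (j + l) * ((wt s1 j)^-1 * (wt s2 l)^-1) <=
  4 ^+ m * ((jb j)^-1 ^+ m + (jb l)^-1 ^+ m).
Proof.
wlog jl : s1 s2 j l / (norm1 j <= norm1 l)%N.
  move=> W h1 h2 h3; have [jl|/ltnW lj] := leqP (norm1 j) (norm1 l); first exact: W.
  by rewrite [j + l]addrC [(s1 + s2)%N]addnC [_^-1 * _]mulrC [_ + (jb l)^-1 ^+ m]addrC;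
    apply: W; rewrite 1?addnC.
move=> h1 h2 h3; set s := (s1 + s2 - m)%N.
have ex : expR (2 * rho * (norm1 (j + l))%:R) <=
    expR (2 * rho * (norm1 j)%:R) * expR (2 * rho * (norm1 l)%:R).
  rewrite -expRD ler_expR -mulrDr ler_wpM2l ?mulr_ge0 // -natrD ler_nat; exact: norm1D.
have jbl : jb (j + l) <= 4 * jb l.
  have h : (norm1 (j + l))%:R <= 2 * (norm1 l)%:R :> R.
    by rewrite -natrM ler_nat; apply: leq_trans (norm1D _ _) _; lia.
  have : (norm1 (j + l))%:R ^+ 2 <= (2 * (norm1 l)%:R) ^+ 2 :> R by rewrite lerXn2r ?nnegrE ?mulr_ge0.
  by rewrite /jb exprMn; lra.
have j0 := jb_gt0 j; have l0 := jb_gt0 l.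
have jlb : jb j <= jb l by rewrite /jb lerD2r lerXn2r ?nnegrE // ler_nat.
have e1 := expR_gt0 (2 * rho * (norm1 j)%:R); have e2 := expR_gt0 (2 * rho * (norm1 l)%:R).
apply: (@le_trans _ _ (4 ^+ m * (jb j)^-1 ^+ m)); last first.
  by rewrite ler_wpM2l ?exprn_ge0 // lerDl exprn_ge0 // invr_ge0 ltW.
rewrite /wt -invfM ler_pdivrMr; last by rewrite !mulr_gt0 ?exprn_gt0.
apply: (@le_trans _ _ (expR (2 * rho * (norm1 j)%:R) * expR (2 * rho * (norm1 l)%:R) * (4 * jb l) ^+ s)).
  by apply: ler_pM => //; rewrite ?expR_ge0 ?exprn_ge0 ?(ltW (jb_gt0 _)) // lerXn2r ?nnegrE ?mulr_ge0 ?(ltW (jb_gt0 _)).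
rewrite [leRHS](_ : _ = expR (2 * rho * (norm1 j)%:R) * expR (2 * rho * (norm1 l)%:R) *
   (4 ^+ m * ((jb j)^-1 ^+ m * (jb j ^+ s1 * jb l ^+ s2)))); last by ring.
rewrite ler_wpM2l ?mulr_ge0 ?expR_ge0 // exprMn; apply: ler_pM; rewrite ?exprn_ge0 ?(ltW l0) //.
  by rewrite ler_weXn2l // ?leq_subLR //; [rewrite ler1n|lia].
have -> : (jb j)^-1 ^+ m = (jb j)^-1 ^+ (m - s1) * (jb j)^-1 ^+ s1 by rewrite -exprD subnK.
rewrite [leRHS](_ : _ = (jb j)^-1 ^+ (m - s1) * ((jb j)^-1 ^+ s1 * jb j ^+ s1) * jb l ^+ s2); last by ring.
rewrite -exprMn mulVf ?gt_eqF // expr1n mulr1.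
have -> : (s2 = (m - s1) + s)%N by rewrite /s; lia.
rewrite exprD mulrA -exprMn ler_peMl ?exprn_ge0 ?(ltW l0) // exprn_ege1 //.
by rewrite ler_pdivlMl ?mulr1.
Qed.

Definition Kconv : R := 4 ^+ m * (2 * Sjb m d).

Lemma Kconv_gt0 : 0 < Kconv.
Proof. by rewrite !mulr_gt0 ?exprn_gt0 // Sjb_gt0. Qed.

Lemma sum_wt_split s1 s2 (k : Zd) X : (s1 <= m)%N -> (s2 <= m)%N -> (m <= s1 + s2)%N -> uniq X ->
  wt (s1 + s2 - m) k * \sum_(j <- X) (wt s1 j * wt s2 (k - j))^-1 <= Kconv.
Proof.
move=> h1 h2 h3 uX; rewrite mulr_sumr.
apply: (@le_trans _ _ (\sum_(j <- X) 4 ^+ m * ((jb j)^-1 ^+ m + (jb (k - j))^-1 ^+ m))).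
  apply: ler_sum => j _; rewrite invfM -{1}(subrK j k) addrC; exact: wt_split.
rewrite -mulr_sumr ler_wpM2l ?exprn_ge0 // big_split mulr_natl mulr2n; apply: lerD; first exact: sum_jb.
rewrite -(big_map (fun j => k - j) xpredT (fun i => (jb i)^-1 ^+ m)); apply: sum_jb => //.
by rewrite map_inj_uniq // => x y /addrI /oppr_inj.
Qed.

(** Cauchy-Schwarz in the convolution against the weights of both factors, then summation over the
    output frequency. *)
Lemma conv_le s1 s2 (X Z : seq Zd) (a b : Zd -> R) (A B : R) :
  (s1 <= m)%N -> (s2 <= m)%N -> (m <= s1 + s2)%N -> uniq X -> uniq Z ->
  \sum_(j <- X) a j ^+ 2 * wt s1 j <= A ->
  (forall Y, uniq Y -> \sum_(j <- Y) b j ^+ 2 * wt s2 j <= B) ->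
  \sum_(k <- Z) (\sum_(j <- X) a j * b (k - j)) ^+ 2 * wt (s1 + s2 - m) k <= Kconv * (A * B).
Proof.
move=> h1 h2 h3 uX uZ hA hB; set s := (s1 + s2 - m)%N.
have t0 j k : 0 <= a j ^+ 2 * b k ^+ 2 * (wt s1 j * wt s2 k).
  exact: (mulr_ge0 (mulr_ge0 (sqr_ge0 _) (sqr_ge0 _)) (mulr_ge0 (ltW (wt_gt0 _ _)) (ltW (wt_gt0 _ _)))).
apply: (@le_trans _ _ (\sum_(k <- Z) Kconv * \sum_(j <- X) a j ^+ 2 * b (k - j) ^+ 2 * (wt s1 j * wt s2 (k - j)))).
  apply: ler_sum => k _.
  have := cauchy_schwarz X (fun j => a j * b (k - j)) (w := fun j => wt s1 j * wt s2 (k - j)) _.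
  move=> /(_ (fun j => mulr_gt0 (wt_gt0 _ _) (wt_gt0 _ _))).
  move=> /(ler_wpM2r (ltW (wt_gt0 s k)))/le_trans; apply.
  rewrite mulrAC mulrC [X in X <= _]mulrC [_ * wt s k]mulrC.
  apply: ler_pM.
  - by rewrite mulr_ge0 ?(ltW (wt_gt0 _ _)) // sumr_ge0 // => j _; rewrite invr_ge0 mulr_ge0 ?(ltW (wt_gt0 _ _)).
  - by rewrite sumr_ge0 // => j _; rewrite exprMn.
  - exact: sum_wt_split.
  - by apply: ler_sum => j _; rewrite exprMn.
rewrite -mulr_sumr ler_wpM2l ?(ltW Kconv_gt0) // exchange_big /=.
have B0 : 0 <= B by have := hB [::] isT; rewrite big_nil.
apply: (@le_trans _ _ (\sum_(j <- X) a j ^+ 2 * wt s1 j * B)); last by rewrite -mulr_suml ler_wpM2r.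
apply: ler_sum => j _.
rewrite (eq_bigr (fun k => a j ^+ 2 * wt s1 j * (b (k - j) ^+ 2 * wt s2 (k - j)))); last by move=> k _; ring.
rewrite -mulr_sumr; apply: ler_wpM2l; first exact: (mulr_ge0 (sqr_ge0 _) (ltW (wt_gt0 _ _))).
rewrite -(big_map (fun k => k - j) xpredT (fun i => b i ^+ 2 * wt s2 i)); apply: hB.
by rewrite map_inj_uniq // => x y /addIr.
Qed.

End Weight.
End Lattice.
(** * Functions with weighted square-summable coefficients *)

Section UniformLimits.
Context {R : realType} {d : nat}.
Local Notation rV := 'rV[R]_d.

Lemma CP_of_approx (V : rV -> R) :
  (forall e : R, 0 < e -> exists2 g, CP g & forall th, `|V th - g th| <= e) -> CP V.
Proof.
move=> hV; split.
  apply: rV_continuous => x e e0.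
  have [g [cg _] hg] := hV (e / 4) (divr_gt0 e0 (ltr0n R 4)).
  have [dl dl0 H] := near_continuous x cg (divr_gt0 e0 (ltr0n R 4)).
  exists dl => // y /H hy; have h1 := hg x; have := hg y; rewrite distrC => h2.
  have := ler_distD (g x) (V x) (V y); have := ler_distD (g y) (g x) (V y).
  by move: hy h1 h2 e0; lra.
move=> k th; apply: (@subr0_eq R); apply/eqP; rewrite -normr_eq0 eq_le normr_ge0 andbT.
apply/ler_addgt0Pl => e e0; rewrite addr0.
have [g [_ pg] hg] := hV (e / 2) (divr_gt0 e0 (ltr0n R 2)).
have h1 := hg (th + period id k); have := hg th; rewrite -(pg k th) distrC => h2.
by have := ler_distD (g (th + period id k)) (V (th + period id k)) (V th); move: h1 h2; lra.
Qed.

Lemma uniform_limit (g : nat -> rV -> R) : (forall n, CP (g n)) ->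
  (forall e : R, 0 < e -> exists N0, forall N, (N0 <= N)%N -> forall th, `|g N0 th - g N th| <= e) ->
  exists2 V, CP V & forall e : R, 0 < e -> exists N0, forall N, (N0 <= N)%N ->
    forall th, `|V th - g N th| <= e.
Proof.
move=> cg hc.
have cvg th : cvgn (fun n => g n th).
  apply/cauchy_cvgP/cauchy_exP => e e0.
  have [N0 hN] := hc (e / 2) (divr_gt0 e0 (ltr0n R 2)).
  exists (g N0 th), N0 => // N /= N0N; rewrite /ball /=.
  by apply: le_lt_trans (hN N N0N th) _; lra.
pose V th := limn (fun n => g n th).
have VE e : 0 < e -> exists N0, forall N, (N0 <= N)%N -> forall th, `|V th - g N th| <= e.
  move=> e0; have [N0 hN] := hc (e / 2) (divr_gt0 e0 (ltr0n R 2)); exists N0 => N N0N th.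
  have h : `|V th - g N0 th| <= e / 2.
    have cn : (fun n => `|g n th - g N0 th|) @ \oo --> `|V th - g N0 th|.
      by apply: cvg_norm; apply: cvgB; [exact: cvg|exact: cvg_cst].
    rewrite -(cvg_lim _ cn) //; apply: limr_le; first exact: cvgP cn.
    by exists N0 => // n /= hn; rewrite distrC; exact: hN.
  have := hN N N0N th; move: h; rewrite !ler_norml => /andP[? ?] /andP[? ?].
  apply/andP; split; lra.
exists V => //; apply: CP_of_approx => e e0; have [N0 hN] := VE e e0.
by exists (g N0) => // th; exact: hN.
Qed.

(** A box that nearly attains the supremum of the finite sums leaves little outside. *)
Lemma bounded_series (a : 'rV[int]_d -> R) C : (forall k, 0 <= a k) ->
  (forall X, uniq X -> \sum_(k <- X) a k <= C) ->
  forall e : R, 0 < e -> exists N0, forall X, uniq X ->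
    (forall k, k \in X -> k \notin box d N0) -> \sum_(k <- X) a k <= e.
Proof.
move=> a0 h e e0.
pose E : set R := [set x | exists2 X, uniq X & x = \sum_(k <- X) a k].
have sE : has_sup E.
  split; first by exists 0; exists [::]; rewrite ?big_nil.
  by exists C => x [X uX ->]; exact: h.
have [x [X0 uX0 ->] hx] := sup_adherent e0 sE.
have [N0 hN] := subset_box X0; exists N0 => X uX hX.
have : \sum_(k <- X0 ++ X) a k <= sup E.
  apply: sup_ubound; first exact: sE.2.
  exists (X0 ++ X) => //; rewrite cat_uniq uX0 uX andbT; apply/hasPn => k kX.
  by apply/negP => /hN; apply/negP; exact: hX.
by rewrite big_cat /=; lra.
Qed.

Lemma tp_norm_le X al be (th : rV) : `|tp X al be th| <= \sum_(k <- X) (`|al k| + `|be k|).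
Proof.
apply: le_trans (ler_norm_sum _ _ _) _; apply: ler_sum => k _.
apply: le_trans (ler_normD _ _) _; rewrite !normrM.
by apply: lerD; rewrite -[leRHS]mulr1 ler_wpM2l // ?cos_max ?sin_max.
Qed.

Definition outer N M : seq 'rV[int]_d := [seq k <- box d M | k \notin box d N].

Lemma box_outer (V : zmodType) N M (a : 'rV[int]_d -> V) : (N <= M)%N ->
  \sum_(k <- box d M) a k = \sum_(k <- box d N) a k + \sum_(k <- outer N M) a k.
Proof.
move=> NM; rewrite (bigID (mem (box d N))) /= [in RHS]big_filter; congr (_ + _).
rewrite -big_filter; apply: perm_big; apply: uniq_perm; rewrite ?filter_uniq ?uniq_box // => k.
rewrite mem_filter; case: (boolP (k \in box d N)) => //= kN; exact: (box_subset NM).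
Qed.

Lemma uniq_outer N M : uniq (outer N M).
Proof. by rewrite filter_uniq // uniq_box. Qed.

Lemma outer_out N M k : k \in outer N M -> k \notin box d N.
Proof. by rewrite mem_filter => /andP[]. Qed.

Lemma tp_box_sub N M al be : (N <= M)%N -> exists X, [/\ uniq X,
  (forall k, k \in X -> k \notin box d N) &
  forall th : rV, tp (box d M) al be th = tp (box d N) al be th + tp X al be th].
Proof.
move=> NM; exists (outer N M); split; [exact: uniq_outer|exact: outer_out|].
by move=> th; rewrite /tp (box_outer _ NM).
Qed.

(** Absolutely summable coefficients with the parity of a real
    function are the Fourier coefficients of a continuous function. *)
Lemma synthesis (al be : 'rV[int]_d -> R) C : (forall k, al (- k) = al k) ->
  (forall k, be (- k) = - be k) ->
  (forall X, uniq X -> \sum_(k <- X) (`|al k| + `|be k|) <= C) ->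
  exists V, [/\ CP V, forall k, fc V k = al k /\ fs V k = be k,
    forall e : R, 0 < e -> exists N0, forall N, (N0 <= N)%N ->
      forall th : rV, `|V th - tp (box d N) al be th| <= e
    & forall th, `|V th| <= C].
Proof.
move=> ea ob h.
have tail := bounded_series (a := fun k => `|al k| + `|be k|) (fun k => addr_ge0 (normr_ge0 _) (normr_ge0 _)) h.
have [V cV hV] : exists2 V, CP V & forall e : R, 0 < e -> exists N0, forall N, (N0 <= N)%N ->
    forall th : rV, `|V th - tp (box d N) al be th| <= e.
  apply: uniform_limit => [n|e e0]; first exact: CP_tp.
  have [N0 hN] := tail e e0; exists N0 => N NN th.
  have [X [uX nX ->]] := tp_box_sub al be NN.
  rewrite opprD addNKr normrN; apply: le_trans (tp_norm_le _ _ _ _) _; exact: hN.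
exists V; split=> // [k|th].
  have [N1 /(_ k)] := subset_box [:: k]; rewrite inE eqxx => /(_ isT) kN1.
  split; apply/eqP; rewrite -subr_eq0; apply/eqP/eps_eq0 => e e0; have [N0 hN] := hV e e0;
    have kN : k \in box d (maxn N0 N1) by apply: box_subset kN1; exact: leq_maxr.
    have [hc _] := tp_coef k (uniq_box d (maxn N0 N1)) (@symm_box d _) ea ob.
    rewrite -[al k]mulr1n -[1%N]/(nat_of_bool true) -kN -hc -fcB //; last exact: CP_tp.
    by apply: fc_norm_le => [|th]; [apply: CPB => //; exact: CP_tp|apply: hN; exact: leq_maxl].
  have [_ hs] := tp_coef k (uniq_box d (maxn N0 N1)) (@symm_box d _) ea ob.
  rewrite -[be k]mulr1n -[1%N]/(nat_of_bool true) -kN -hs -fsB //; last exact: CP_tp.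
  by apply: fs_norm_le => [|th]; [apply: CPB => //; exact: CP_tp|apply: hN; exact: leq_maxl].
apply: (@eps_le R _ _ 1) => e e0; have [N0 /(_ N0 (leqnn _) th) hN] := hV e e0.
rewrite -(subrK (tp (box d N0) al be th) (V th)) mul1r addrC.
apply: le_trans (ler_normD _ _) _; apply: lerD => //.
by apply: le_trans (tp_norm_le _ _ _ _) (h _ (uniq_box _ _)).
Qed.

Lemma fourier_series (V : rV -> R) C : CP V ->
  (forall X, uniq X -> \sum_(k <- X) (`|fc V k| + `|fs V k|) <= C) ->
  (forall e : R, 0 < e -> exists N0, forall N, (N0 <= N)%N ->
      forall th : rV, `|V th - tp (box d N) (fc V) (fs V) th| <= e) /\
  (forall th, `|V th| <= C).
Proof.
move=> cV h; have [V' [cV' hk hl hb]] := synthesis (fcN V) (fun k => fsN k cV) h.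
by have e := coef_inj cV' cV hk; rewrite e in hl hb.
Qed.

End UniformLimits.

Section WeightedFunctions.
Context {R : realType}.
Variables (d m : nat) (rho : R).
Hypothesis rho0 : 0 <= rho.
Hypothesis dm : (d < 2 * m)%N.
Local Notation rV := 'rV[R]_d.
Local Notation Zd := 'rV[int]_d.
Local Notation W := (wt rho).
Local Notation S := (Sjb (R := R) m d).
Local Notation K := (Kconv (R := R) d m).
Local Notation mean := (@torus_mean R d).

(** A bound on all finite sums instead of a norm: sums, limits and truncations never raise the
    question whether a norm is finite. The bound is on the square of the norm. *)
Definition Hle s (V : rV -> R) (B : R) := forall X : seq Zd, uniq X ->
  \sum_(k <- X) (fc V k ^+ 2 + fs V k ^+ 2) * W s k <= B.

Lemma Hle_ge0 s V B : Hle s V B -> 0 <= B.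
Proof. by move=> /(_ [::] isT); rewrite big_nil. Qed.

Lemma Hle_weaken s V B B' : B <= B' -> Hle s V B -> Hle s V B'.
Proof. by move=> BB h X uX; apply: le_trans (h X uX) BB. Qed.

Lemma Hle_c s V B : Hle s V B -> forall X, uniq X -> \sum_(k <- X) fc V k ^+ 2 * W s k <= B.
Proof.
move=> h X uX; apply: le_trans (h X uX); apply: ler_sum => k _.
by rewrite ler_wpM2r ?(ltW (wt_gt0 _ _ _)) // lerDl sqr_ge0.
Qed.

Lemma Hle_s s V B : Hle s V B -> forall X, uniq X -> \sum_(k <- X) fs V k ^+ 2 * W s k <= B.
Proof.
move=> h X uX; apply: le_trans (h X uX); apply: ler_sum => k _.
by rewrite ler_wpM2r ?(ltW (wt_gt0 _ _ _)) // lerDr sqr_ge0.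
Qed.

Definition Csup : R := 2 * (1 + S).

Lemma Csup_gt0 : 0 < Csup.
Proof. by rewrite mulr_gt0 // addr_gt0 // Sjb_gt0. Qed.

(** Cauchy-Schwarz against the summable weights. *)
Lemma sum_abs_le (a : Zd -> R) B : 0 <= B ->
  (forall X, uniq X -> \sum_(k <- X) a k ^+ 2 * W m k <= B ^+ 2) ->
  forall X, uniq X -> \sum_(k <- X) `|a k| <= (1 + S) * B.
Proof.
move=> B0 h X uX.
have S0 : 0 < 1 + S by rewrite addr_gt0 // Sjb_gt0.
rewrite -(ler_pXn2r (n := 2)) ?nnegrE ?sumr_ge0 ?mulr_ge0 ?(ltW S0) //.
apply: le_trans (cauchy_schwarz X (fun k => `|a k|) (wt_gt0 rho m (d := d))) _.
rewrite exprMn; apply: ler_pM.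
- by apply: sumr_ge0 => k _; rewrite invr_ge0 ltW // wt_gt0.
- by apply: sumr_ge0 => k _; rewrite mulr_ge0 ?sqr_ge0 // ltW // wt_gt0.
- apply: le_trans (sum_wt rho0 dm uX) _; rewrite expr2.
  by have := Sjb_gt0 (R := R) m d; nra.
- rewrite (eq_bigr (fun k => a k ^+ 2 * W m k)); first exact: h.
  by move=> k _; rewrite real_normK ?num_real.
Qed.

Lemma Hle_abs V B : 0 <= B -> Hle m V (B ^+ 2) -> forall X, uniq X ->
  \sum_(k <- X) (`|fc V k| + `|fs V k|) <= Csup * B.
Proof.
move=> B0 h X uX; rewrite big_split /= /Csup -mulrA mulr_natl mulr2n.
by apply: lerD; apply: sum_abs_le => //; [exact: Hle_c|exact: Hle_s].
Qed.

Lemma Hle_sup V B : CP V -> 0 <= B -> Hle m V (B ^+ 2) -> forall th, `|V th| <= Csup * B.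
Proof. by move=> cV B0 h; exact: (fourier_series cV (Hle_abs B0 h)).2. Qed.

(** Lower semicontinuity under uniform convergence. *)
Lemma Hle_lim s V B : CP V ->
  (forall e : R, 0 < e -> exists2 V', CP V' & (forall th, `|V th - V' th| <= e) /\ Hle s V' B) ->
  Hle s V B.
Proof.
move=> cV h X uX.
have [M M0 hM] := CP_bounded cV.
pose D := \sum_(k <- X) W s k.
have D0 : 0 <= D by apply: sumr_ge0 => k _; rewrite ltW // wt_gt0.
apply: (@eps_le R _ _ (D * (2 * (2 * M + 1)))) => e0' e0'0.
pose e := Num.min e0' 1.
have e0 : 0 < e by rewrite lt_min e0'0 ltr01.
have e1 : e <= 1 by rewrite ge_min lexx orbT.
have ee : e <= e0' by rewrite ge_min lexx.
have [V' cV' [h1 h2]] := h e e0.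
have key (x x' : R) : `|x| <= M -> `|x - x'| <= e -> x ^+ 2 <= x' ^+ 2 + (2 * M + 1) * e.
  rewrite !ler_norml => /andP[? ?] /andP[? ?]; rewrite !expr2; nra.
apply: (@le_trans _ _ (B + D * (2 * (2 * M + 1)) * e)); last first.
  by rewrite lerD2l ler_wpM2l // mulr_ge0 // mulr_ge0 // addr_ge0 // mulr_ge0 // ltW.
apply: le_trans (lerD (h2 X uX) (lexx _)).
rewrite /D 2!mulr_suml -big_split; apply: ler_sum => k _ /=.
have W0 := wt_gt0 rho s k.
have hc : fc V k ^+ 2 <= fc V' k ^+ 2 + (2 * M + 1) * e.
  apply: key; first exact: fc_norm_le.
  by rewrite -fcB //; apply: fc_norm_le => //; exact: CPB.
have hs : fs V k ^+ 2 <= fs V' k ^+ 2 + (2 * M + 1) * e.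
  apply: key; first exact: fs_norm_le.
  by rewrite -fsB //; apply: fs_norm_le => //; exact: CPB.
rewrite (_ : W s k * _ * e = 2 * ((2 * M + 1) * e) * W s k); last by ring.
by rewrite -mulrDl ler_wpM2r ?(ltW W0) //; lra.
Qed.

Lemma HleD s U V a b : CP U -> CP V -> 0 < a -> 0 < b -> Hle s U (a ^+ 2) -> Hle s V (b ^+ 2) ->
  Hle s (fun th => U th + V th) ((a + b) ^+ 2).
Proof.
move=> cU cV a0 b0 hU hV X uX.
have eU k : fc (fun th => U th + V th) k = fc U k + fc V k.
  by rewrite -[fc U k]mul1r -fc_lin //; congr fc; apply/funext => th; rewrite mul1r.
have eV k : fs (fun th => U th + V th) k = fs U k + fs V k.
  by rewrite -[fs U k]mul1r -fs_lin //; congr fs; apply/funext => th; rewrite mul1r.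
have key (x y : R) : (x + y) ^+ 2 <= (1 + b / a) * x ^+ 2 + (1 + a / b) * y ^+ 2.
  rewrite -subr_ge0 (_ : _ - _ = (b * x - a * y) ^+ 2 / (a * b)).
    by rewrite divr_ge0 ?sqr_ge0 // mulr_ge0 // ltW.
  by field; rewrite !gt_eqF.
apply: (@le_trans _ _ ((1 + b / a) * a ^+ 2 + (1 + a / b) * b ^+ 2)); last first.
  by rewrite le_eqVlt; apply/orP; left; apply/eqP; field; rewrite !gt_eqF.
have c1 : 0 <= 1 + b / a by rewrite addr_ge0 // divr_ge0 // ltW.
have c2 : 0 <= 1 + a / b by rewrite addr_ge0 // divr_ge0 // ltW.
apply: le_trans (lerD (ler_wpM2l c1 (hU X uX)) (ler_wpM2l c2 (hV X uX))).
rewrite 2!mulr_sumr -big_split; apply: ler_sum => k _ /=; rewrite eU eV.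
rewrite [leRHS](_ : _ = ((1 + b / a) * fc U k ^+ 2 + (1 + a / b) * fc V k ^+ 2 +
  ((1 + b / a) * fs U k ^+ 2 + (1 + a / b) * fs V k ^+ 2)) * W s k); last by ring.
by rewrite ler_wpM2r ?(ltW (wt_gt0 _ _ _)) // lerD.
Qed.

Lemma HleZ s V c b : CP V -> Hle s V (b ^+ 2) -> Hle s (fun th => c * V th) ((c * b) ^+ 2).
Proof.
move=> cV h X uX.
have e1 k : fc (fun th => c * V th) k = c * fc V k.
  by rewrite -meanZ; [congr mean; apply/funext => th; rewrite mulrA|exact: CP_gcos].
have e2 k : fs (fun th => c * V th) k = c * fs V k.
  by rewrite -meanZ; [congr mean; apply/funext => th; rewrite mulrA|exact: CP_gsin].
rewrite exprMn; apply: le_trans (ler_wpM2l (sqr_ge0 c) (h X uX)).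
rewrite mulr_sumr; apply: ler_sum => k _; rewrite e1 e2.
by rewrite le_eqVlt; apply/orP; left; apply/eqP; ring.
Qed.

Lemma HleB s U V a b : CP U -> CP V -> 0 < a -> 0 < b -> Hle s U (a ^+ 2) -> Hle s V (b ^+ 2) ->
  Hle s (fun th => U th - V th) ((a + b) ^+ 2).
Proof.
move=> cU cV a0 b0 hU hV.
have -> : (fun th => U th - V th) = (fun th => U th + -1 * V th).
  by apply/funext => th; rewrite mulN1r.
apply: HleD => //; first exact: CPZ.
by have := HleZ (-1) cV hV; rewrite mulN1r sqrrN.
Qed.

Lemma Hle_cst s c : Hle s (fun=> c) (c ^+ 2).
Proof.
have e1 k : fc (fun _ : rV => c) k = c * (k == 0)%:R.
  by rewrite -mean_cos -meanZ //; exact: CP_cos.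
have e2 k : fs (fun _ : rV => c) k = 0.
  by rewrite /fs meanZ ?mean_sin ?mulr0 //; exact: CP_sin.
move=> X uX; rewrite (eq_bigr (fun k => c ^+ 2 * W s k * (k == 0)%:R)); last first.
  by move=> k _; rewrite e1 e2 expr0n addr0 exprMn; case: (k == 0); rewrite /= ?expr1n ?expr0n /= ?mulr1 ?mulr0 ?mul0r.
rewrite sum_delta //; have -> : W s (0 : Zd) = 1.
  by rewrite /wt /jb (_ : norm1 (0 : Zd) = 0%N) ?mulr0 ?expR0 ?expr0n ?add0r ?expr1n ?mulr1 // /norm1 big1 // => j _; rewrite mxE.
by rewrite mulr1; case: (_ \in _); rewrite ?mulr1n ?mulr0n ?sqr_ge0.
Qed.

(** Multiplication by a trigonometric polynomial; U enters through its
    coefficients, P through its Fourier coefficients. *)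
Lemma Hle_tp_mul s1 s2 X al be (P : rV -> R) A B :
  (s1 <= m)%N -> (s2 <= m)%N -> (m <= s1 + s2)%N -> uniq X -> CP P ->
  \sum_(k <- X) (al k ^+ 2 + be k ^+ 2) * W s1 k <= A -> Hle s2 P B ->
  Hle (s1 + s2 - m) (fun th => tp X al be th * P th) (8 * K * (A * B)).
Proof.
move=> h1 h2 h3 uX cP hA hP Z uZ; set s := (s1 + s2 - m)%N.
have W0 k := ltW (wt_gt0 rho s1 k).
have hal : \sum_(j <- X) al j ^+ 2 * W s1 j <= A.
  apply: le_trans hA; apply: ler_sum => k _; by rewrite ler_wpM2r // lerDl sqr_ge0.
have hbe : \sum_(j <- X) be j ^+ 2 * W s1 j <= A.
  apply: le_trans hA; apply: ler_sum => k _; by rewrite ler_wpM2r // lerDr sqr_ge0.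
have hPc := Hle_c hP; have hPs := Hle_s hP.
pose conv (a b : Zd -> R) sg k := \sum_(j <- X) a j * b (if sg then k - j else k + j).
have hconv a b sg : \sum_(j <- X) a j ^+ 2 * W s1 j <= A ->
    (forall Y, uniq Y -> \sum_(j <- Y) b j ^+ 2 * W s2 j <= B) ->
    \sum_(k <- Z) conv a b sg k ^+ 2 * W s k <= K * (A * B).
  move=> ha hb; case: sg; first exact: (conv_le rho0 dm h1 h2 h3 uX uZ ha hb).
  pose X' := [seq - j | j <- X].
  have uX' : uniq X' by rewrite map_inj_uniq //; exact: oppr_inj.
  have := @conv_le _ _ _ _ rho0 dm s1 s2 X' Z (fun j => a (- j)) b A B h1 h2 h3 uX' uZ _ hb.
  rewrite big_map; under eq_bigr do rewrite opprK wtN.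
  move=> /(_ ha); under eq_bigr do rewrite big_map.
  by under eq_bigr do (under eq_bigr do rewrite !opprK).
have hc k : fc (fun th => tp X al be th * P th) k =
    2^-1 * (conv al (fc P) true k + conv al (fc P) false k + conv be (fs P) false k - conv be (fs P) true k).
  rewrite [LHS](_ : _ = mean (fun th => (P th * cos (dotp k th)) * tp X al be th)); last first.
    by congr mean; apply/funext => th; ring.
  rewrite mean_mul_tp; last exact: CP_gcos.
  rewrite /conv -!big_split -sumrB mulr_sumr; apply: eq_bigr => j _ /=.
  have -> : fc (fun th => P th * cos (dotp k th)) j = 2^-1 * fc P (k - j) + 2^-1 * fc P (k + j).
    rewrite -mean_lin2; [|exact: CP_gcos|exact: CP_gcos].
    by congr mean; apply/funext => th; rewrite !dotpDl dotpNl !cosD cosN sinN; field.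
  have -> : fs (fun th => P th * cos (dotp k th)) j = 2^-1 * fs P (k + j) + - 2^-1 * fs P (k - j).
    rewrite -mean_lin2; [|exact: CP_gsin|exact: CP_gsin].
    by congr mean; apply/funext => th; rewrite !dotpDl dotpNl !sinD cosN sinN; field.
  by ring.
have hs k : fs (fun th => tp X al be th * P th) k =
    2^-1 * (conv al (fs P) true k + conv al (fs P) false k + conv be (fc P) true k - conv be (fc P) false k).
  rewrite [LHS](_ : _ = mean (fun th => (P th * sin (dotp k th)) * tp X al be th)); last first.
    by congr mean; apply/funext => th; ring.
  rewrite mean_mul_tp; last exact: CP_gsin.
  rewrite /conv -!big_split -sumrB mulr_sumr; apply: eq_bigr => j _ /=.
  have -> : fc (fun th => P th * sin (dotp k th)) j = 2^-1 * fs P (k - j) + 2^-1 * fs P (k + j).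
    rewrite -mean_lin2; [|exact: CP_gsin|exact: CP_gsin].
    by congr mean; apply/funext => th; rewrite !dotpDl dotpNl !sinD cosN sinN; field.
  have -> : fs (fun th => P th * sin (dotp k th)) j = 2^-1 * fc P (k - j) + - 2^-1 * fc P (k + j).
    rewrite -mean_lin2; [|exact: CP_gcos|exact: CP_gcos].
    by congr mean; apply/funext => th; rewrite !dotpDl dotpNl !cosD cosN sinN; field.
  by ring.
have sq (x y z t : R) : (2^-1 * (x + y + z - t)) ^+ 2 <= x ^+ 2 + y ^+ 2 + z ^+ 2 + t ^+ 2.
  have := sqr_ge0 (x - y); have := sqr_ge0 (x - z); have := sqr_ge0 (x + t).
  have := sqr_ge0 (y - z); have := sqr_ge0 (y + t); have := sqr_ge0 (z + t).
  rewrite !expr2; lra.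
have q1 := hconv _ _ true hal hPc; have q2 := hconv _ _ false hal hPc.
have q3 := hconv _ _ false hbe hPs; have q4 := hconv _ _ true hbe hPs.
have q5 := hconv _ _ true hal hPs; have q6 := hconv _ _ false hal hPs.
have q7 := hconv _ _ true hbe hPc; have q8 := hconv _ _ false hbe hPc.
have -> : 8 * K * (A * B) = K * (A * B) + K * (A * B) + K * (A * B) + K * (A * B) +
  (K * (A * B) + K * (A * B) + K * (A * B) + K * (A * B)) by ring.
apply: le_trans (lerD (lerD (lerD (lerD q1 q2) q3) q4) (lerD (lerD (lerD q5 q6) q7) q8)).
rewrite -!big_split; apply: ler_sum => k _ /=; rewrite hc hs -!mulrDl.
by rewrite ler_wpM2r ?(ltW (wt_gt0 _ _ _)) //; apply: lerD; exact: sq.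
Qed.

Definition Kalg : R := 8 * K + 1.

Lemma Kalg_ge1 : 1 <= Kalg.
Proof. by rewrite /Kalg lerDr mulr_ge0 // ltW // Kconv_gt0. Qed.

(** [Hle_tp_mul] with s1 = s2 = m, applied to the truncations of the Fourier series of U. *)
Lemma HleM U V a b : CP U -> CP V -> 0 <= a -> 0 <= b -> Hle m U (a ^+ 2) -> Hle m V (b ^+ 2) ->
  Hle m (fun th => U th * V th) ((Kalg * a * b) ^+ 2).
Proof.
move=> cU cV a0 b0 hU hV; have cUV := CPM cU cV.
apply: Hle_lim => // e e0.
have [M M0 hM] := CP_bounded cV.
have [/(_ (e / M) (divr_gt0 e0 M0))[N /(_ N (leqnn _)) hN] _] := fourier_series cU (Hle_abs a0 hU).
set T := tp _ _ _ in hN; have cT : CP T := CP_tp _ _ _.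
exists (fun th => T th * V th); first exact: CPM.
split=> [th|].
  rewrite -mulrBl normrM -[leRHS](divfK (lt0r_neq0 M0)); exact: ler_pM.
have := Hle_tp_mul (leqnn m) (leqnn m) (leq_addr m m) (uniq_box d N) cV (hU _ (uniq_box d N)) hV.
rewrite addnK; apply: Hle_weaken.
rewrite [leRHS](_ : _ = Kalg ^+ 2 * (a ^+ 2 * b ^+ 2)); last by ring.
rewrite ler_wpM2r ?mulr_ge0 ?sqr_ge0 // /Kalg.
by have := Kconv_gt0 (R := R) d m; move: K => z z0; rewrite expr2; nra.
Qed.

Lemma HleX V b n : CP V -> 0 <= b -> Hle m V (b ^+ 2) ->
  Hle m (fun th => V th ^+ n) (((Kalg * b) ^+ n) ^+ 2).
Proof.
move=> cV b0 hV; have k1 := Kalg_ge1.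
elim: n => [|n IH].
  rewrite expr0; have := Hle_cst m 1; congr Hle; by apply/funext => th; rewrite expr0.
have := HleM cV (CPX n cV) b0 _ hV IH; rewrite [(Kalg * b) ^+ n.+1]exprS; rewrite (_ : (fun th => V th * _) = fun th => V th ^+ n.+1).
  by apply; rewrite exprn_ge0 // mulr_ge0 // (le_trans ler01).
by apply/funext => th; rewrite exprS.
Qed.

End WeightedFunctions.
(** * The linear equation along the flow *)

Section Linear.
Context {R : realType}.
Variables (d m : nat) (rho : R).
Hypothesis rho0 : 0 <= rho.
Hypothesis dm : (d < 2 * m)%N.
Local Notation rV := 'rV[R]_d.
Local Notation Zd := 'rV[int]_d.
Local Notation Hle := (@Hle R d rho).
Local Notation mean := (@torus_mean R d).
Variables (om : rV) (c delta : R).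
Hypothesis c0 : c != 0.
Hypothesis damping : 0 <= delta ^+ 2 + 2 * c.

(** Fourier form of V'' + delta V' - c V = G, derivatives along om. *)
Definition lin_eq (V G : rV -> R) := forall k : Zd, let s := dotp k om in
  (- s ^+ 2 - c) * fc V k + delta * s * fs V k = fc G k /\
  (- s ^+ 2 - c) * fs V k - delta * s * fc V k = fs G k.

Definition symbol2 (s : R) := (s ^+ 2 + c) ^+ 2 + (delta * s) ^+ 2.

(** This is where the condition on the damping enters: the squared modulus of
    the symbol expands as s^4 + (delta^2 + 2 c) s^2 + c^2. *)
Lemma symbol2_ge s : c ^+ 2 <= symbol2 s /\ (s ^+ 2) ^+ 2 <= symbol2 s.
Proof.
have -> : symbol2 s = (s ^+ 2) ^+ 2 + (delta ^+ 2 + 2 * c) * s ^+ 2 + c ^+ 2 by rewrite /symbol2; ring.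
have h : 0 <= (delta ^+ 2 + 2 * c) * s ^+ 2 by rewrite mulr_ge0 ?sqr_ge0.
have h1 := sqr_ge0 (s ^+ 2); have h2 := sqr_ge0 c.
by split; lra.
Qed.

Lemma symbol2_gt0 s : 0 < symbol2 s.
Proof. by apply: lt_le_trans (symbol2_ge s).1; rewrite exprn_even_gt0. Qed.

Lemma lin_eq_energy V G k : lin_eq V G ->
  symbol2 (dotp k om) * (fc V k ^+ 2 + fs V k ^+ 2) = fc G k ^+ 2 + fs G k ^+ 2.
Proof. by move=> /(_ k) /= [<- <-]; rewrite /symbol2; ring. Qed.

Lemma lin_eq_le V G k : lin_eq V G ->
  c ^+ 2 * (fc V k ^+ 2 + fs V k ^+ 2) <= fc G k ^+ 2 + fs G k ^+ 2.
Proof.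
move=> h; rewrite -(lin_eq_energy k h) ler_wpM2r ?addr_ge0 ?sqr_ge0 //.
exact: (symbol2_ge _).1.
Qed.

(** Division by the symbol, whose squared modulus is at least c^2. *)
Lemma lin_eq_solvable G B : CP G -> 0 <= B -> Hle m G (B ^+ 2) ->
  exists V, [/\ CP V, lin_eq V G & Hle m V ((B / `|c|) ^+ 2)].
Proof.
move=> cG B0 hG.
pose al k := let s := dotp k om in (- (s ^+ 2 + c) * fc G k - delta * s * fs G k) / symbol2 s.
pose be k := let s := dotp k om in (- (s ^+ 2 + c) * fs G k + delta * s * fc G k) / symbol2 s.
have en k : symbol2 (dotp k om) * (al k ^+ 2 + be k ^+ 2) = fc G k ^+ 2 + fs G k ^+ 2.
  rewrite /al /be /=; have := symbol2_gt0 (dotp k om); rewrite /symbol2 => p.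
  by field; rewrite gt_eqF.
have c2 : 0 < c ^+ 2 by rewrite exprn_even_gt0.
have bnd k : al k ^+ 2 + be k ^+ 2 <= (fc G k ^+ 2 + fs G k ^+ 2) / c ^+ 2.
  rewrite ler_pdivlMr // -en mulrC ler_wpM2r ?addr_ge0 ?sqr_ge0 //.
  exact: (symbol2_ge _).1.
have HX X : uniq X -> \sum_(k <- X) (al k ^+ 2 + be k ^+ 2) * wt rho m k <= (B / `|c|) ^+ 2.
  move=> uX; rewrite exprMn exprVn real_normK ?num_real // ler_pdivlMr //.
  apply: le_trans (hG X uX); rewrite mulr_suml; apply: ler_sum => k _.
  by rewrite mulrAC ler_wpM2r ?(ltW (wt_gt0 _ _ _)) // -ler_pdivlMr.
have Bc : 0 <= B / `|c| by rewrite divr_ge0.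
have ea k : al (- k) = al k by rewrite /al /symbol2 fcN (fsN _ cG) dotpNl; congr (_ / _); ring.
have ob k : be (- k) = - be k.
  by rewrite /be /symbol2 fcN (fsN _ cG) dotpNl -mulNr; congr (_ / _); ring.
have ab X : uniq X -> \sum_(k <- X) (`|al k| + `|be k|) <= (1 + Sjb m d) * (B / `|c|) + (1 + Sjb m d) * (B / `|c|).
  move=> uX; rewrite big_split /=; apply: lerD; apply: (sum_abs_le rho0 dm) => // Y uY;
  apply: le_trans (HX Y uY); apply: ler_sum => k _; rewrite ler_wpM2r ?(ltW (wt_gt0 _ _ _)) //.
    by rewrite lerDl sqr_ge0.
  by rewrite lerDr sqr_ge0.
have [V [cV hV _ _]] := synthesis ea ob ab.
exists V; split=> // [k /=|X uX].
  have [-> ->] := hV k; rewrite /al /be /=.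
  have := symbol2_gt0 (dotp k om); rewrite /symbol2 => p.
  by split; field; rewrite gt_eqF.
apply: le_trans (HX X uX); apply: ler_sum => k _; by have [-> ->] := hV k.
Qed.

(** The L^2 contraction estimate, by Parseval on one side and Bessel on the other. *)
Lemma lin_eq_contract V W G H u q : CP V -> CP W -> CP G -> CP H -> CP u ->
  lin_eq V G -> lin_eq W H -> (forall th, `|G th - H th| <= q * `|c| * `|u th|) ->
  mean (fun th => (V th - W th) ^+ 2) <= q ^+ 2 * mean (fun th => u th ^+ 2).
Proof.
move=> cV cW cG cH cu hV hW L.
have cU := CPB cV cW; have cF := CPB cG cH.
have hU : lin_eq (fun th => V th - W th) (fun th => G th - H th).
  move=> k /=; have [v1 v2] := hV k; have [w1 w2] := hW k.
  by rewrite !fcB // !fsB // -v1 -v2 -w1 -w2; split; ring.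
have c2 : 0 < c ^+ 2 by rewrite exprn_even_gt0.
apply: parseval_le => // X uX.
rewrite -(ler_pM2l c2) mulr_sumr.
apply: le_trans (_ : energy (fun th => G th - H th) X <= _).
  by apply: ler_sum => k _; exact: lin_eq_le.
apply: le_trans (bessel cF uX) _; rewrite mulrA -meanZ; last exact: CPX.
apply: mean_le; [exact: CPX|apply: CPZ; exact: CPX|move=> th].
rewrite -[leLHS]real_normK ?num_real //.
apply: (@le_trans _ _ ((q * `|c| * `|u th|) ^+ 2)).
  by rewrite ler_sqr ?nnegrE ?(le_trans (normr_ge0 _) (L th)).
by rewrite !exprMn !real_normK ?num_real // [q ^+ 2 * _]mulrC.
Qed.

(** The mean value theorem compares the difference quotients of u with the values of u'. *)
Lemma uniform_derivative (g g' : nat -> R -> R) (u u' : R -> R) :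
  (forall n (t : R), is_derive t (1 : R) (g n) (g' n t)) ->
  (forall e : R, 0 < e -> exists N0, forall N, (N0 <= N)%N -> forall t, `|u t - g N t| <= e) ->
  (forall e : R, 0 < e -> exists N0, forall N, (N0 <= N)%N -> forall t, `|u' t - g' N t| <= e) ->
  forall t : R, is_derive t (1 : R) u (u' t).
Proof.
move=> dg hu hu' t.
suff cv : h^-1 *: (u (h *: (1 : R) + t) - u t) @[h --> (0 : R)^'] --> u' t.
  by apply: DeriveDef; [apply/cvg_ex; exists (u' t)|exact: cvg_lim].
apply/cvgrPdist_le => e e0; have e40 : 0 < e / 4 by rewrite divr_gt0.
have [N0 hN0] := hu' _ e40; have hN := hN0 N0 (leqnn _).
have := (dg N0 t).(@ex_derive _ _ _ _ _ _ _).
have dv := @derive_val _ _ _ _ _ _ _ (dg N0 t).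
move=> dN.
have : h^-1 *: (g N0 (h *: (1 : R) + t) - g N0 t) @[h --> (0 : R)^'] --> g' N0 t by rewrite -dv; exact: dN.
move=> /cvgrPdist_le/(_ _ e40) near_h.
near=> h.
have h0 : h != 0 by near: h; exact: nbhs_dnbhs_neq.
have n1 : `|g' N0 t - h^-1 *: (g N0 (h *: (1 : R) + t) - g N0 t)| <= e / 4 by near: h.
have key : `|h^-1 * (u (h + t) - u t) - h^-1 * (g N0 (h + t) - g N0 t)| <= e / 2.
  rewrite -mulrBr normrM normfV ler_pdivrMl ?normr_gt0 //.
  apply: (@eps_le R _ _ 2) => e1 e10.
  have [N1 hN1] := hu _ e10; pose M := maxn N0 N1.
  have M1 := hN1 M (leq_maxr _ _); have M0 := hN0 M (leq_maxl _ _).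
  have dd x : is_derive x (1 : R) (fun x => g M x - g N0 x) (g' M x - g' N0 x) by apply: is_deriveB.
  have := @derive_lipschitz R _ _ t (h + t) (e / 2) dd _.
  rewrite addrK => /(_ _) L.
  have {}L : `|g M (h + t) - g N0 (h + t) - (g M t - g N0 t)| <= e / 2 * `|h|.
    apply: L => x _; have := M0 x; have := hN x.
    by rewrite !ler_norml => /andP[? ?] /andP[? ?]; apply/andP; split; lra.
  have := M1 (h + t); have := M1 t; move: L; rewrite [`|h| * _]mulrC.
  move: (e / 2 * `|h|) => z.
  by rewrite !ler_norml => /andP[? ?] /andP[? ?] /andP[? ?]; apply/andP; split; lra.
rewrite /GRing.scale /= mulr1 in n1 *.
by move: key n1 (hN t); rewrite !ler_norml => /andP[? ?] /andP[? ?] /andP[? ?]; apply/andP; split; lra.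
Unshelve. all: by end_near.
Qed.

Lemma is_derive_tp X al be (t : R) : is_derive t (1 : R) (fun t => tp X al be (t *: om))
  (tp X (fun k => dotp k om * be k) (fun k => - dotp k om * al k) (t *: om)).
Proof.
rewrite /tp; elim: X => [|k X IH].
  rewrite big_nil; under eq_fun do rewrite big_nil; exact: is_derive_cst.
rewrite big_cons; under eq_fun do rewrite big_cons.
apply: is_deriveD.
pose s := dotp k om.
have -> : (fun t : R => al k * cos (dotp k (t *: om)) + be k * sin (dotp k (t *: om))) =
    fun t => al k * cos (s * t) + be k * sin (s * t).
  by apply/funext => t'; rewrite dotpZ (mulrC t').
have := is_deriveD (is_deriveZ (al k) (is_derive_cosM s t)) (is_deriveZ (be k) (is_derive_sinM s t)).
by move/is_derive_eq; apply; rewrite /GRing.scale /= dotpZ [t * _]mulrC -/s; ring.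
Qed.

(** Regularity: since |symbol| >= s^2, the second derivative of the series of V
    along the flow converges absolutely with the series of G. *)
Lemma lin_eq_regular V G B : CP V -> CP G -> 0 <= B -> Hle m G (B ^+ 2) -> lin_eq V G ->
  exists w' w'' : R -> R, forall t : R, [/\ is_derive t (1 : R) (fun t => V (t *: om)) (w' t),
    is_derive t (1 : R) w' (w'' t) & w'' t + delta * w' t - c * V (t *: om) = G (t *: om)].
Proof.
move=> cV cG B0 hG hV.
pose s k := dotp k om.
have c2 : 0 < c ^+ 2 by rewrite exprn_even_gt0.
have absG := Hle_abs rho0 dm B0 hG.
have sqle (x y z : R) : 0 <= z -> x ^+ 2 + y ^+ 2 <= z ^+ 2 -> `|x| + `|y| <= 2 * z.
  move=> z0 h; have h1 : `|x| <= z.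
    by rewrite -(ler_pXn2r (n := 2)) ?nnegrE // real_normK ?num_real //; have := sqr_ge0 y; lra.
  have h2 : `|y| <= z.
    by rewrite -(ler_pXn2r (n := 2)) ?nnegrE // real_normK ?num_real //; have := sqr_ge0 x; lra.
  lra.
pose g k := `|fc G k| + `|fs G k|.
have g0 k : 0 <= g k by rewrite addr_ge0.
have gle k : fc G k ^+ 2 + fs G k ^+ 2 <= g k ^+ 2.
  rewrite /g sqrrD !real_normK ?num_real // -subr_ge0.
  by rewrite [X in 0 <= X](_ : _ = 2 * (`|fc G k| * `|fs G k|)) ?mulr_ge0 // mulr2n; ring.
have b2 k : `|s k ^+ 2 * fc V k| + `|s k ^+ 2 * fs V k| <= 2 * g k.
  apply: sqle => //; apply: le_trans (gle k); rewrite -(lin_eq_energy k hV) !exprMn -mulrDr.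
  by rewrite ler_wpM2r ?addr_ge0 ?sqr_ge0 //; exact: (symbol2_ge _).2.
have b0 k : `|fc V k| + `|fs V k| <= 2 * (g k / `|c|).
  apply: sqle; first by rewrite divr_ge0.
  rewrite exprMn exprVn real_normK ?num_real // ler_pdivlMr // mulrC.
  exact: le_trans (lin_eq_le k hV) (gle k).
have b1 k : `|s k * fs V k| + `|- s k * fc V k| <= 2 * g k + 2 * (g k / `|c|).
  apply: le_trans (lerD (b2 k) (b0 k)).
  have h x : `|s k * x| <= `|s k ^+ 2 * x| + `|x|.
    rewrite 2!normrM -[X in _ <= _ + X]mul1r -mulrDl ler_wpM2r // normrX.
    by have := sqr_ge0 (`|s k| - 1); have := normr_ge0 (s k); move: `|s k| => y; rewrite !expr2; nra.
  have h1 := h (fs V k); have h2 := h (- fc V k); move: h1 h2.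
  rewrite mulrN mulNr !normrN mulrN normrN; lra.
have S2 X : uniq X -> \sum_(k <- X) g k <= Csup d m * B by exact: absG.
have lin C1 (a : Zd -> R) : 0 <= C1 -> (forall k, a k <= C1 * g k) -> forall X, uniq X ->
   \sum_(k <- X) a k <= C1 * (Csup d m * B).
  move=> C10 h X uX; apply: le_trans (ler_wpM2l C10 (S2 X uX)).
  by rewrite mulr_sumr; apply: ler_sum => k _; exact: h.
have ic0 : 0 <= 2 / `|c| by rewrite divr_ge0.
have ic1 : 0 <= 2 + 2 / `|c| by rewrite addr_ge0.
have b0' k : `|fc V k| + `|fs V k| <= 2 / `|c| * g k by apply: le_trans (b0 k) _; rewrite mulrA mulrAC.
have [conv0 _] := fourier_series cV (lin _ _ ic0 b0').
pose al1 k := s k * fs V k; pose be1 k := - s k * fc V k.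
pose al2 k := s k * be1 k; pose be2 k := - s k * al1 k.
have b1' k : `|al1 k| + `|be1 k| <= (2 + 2 / `|c|) * g k.
  by apply: le_trans (b1 k) _; rewrite [leRHS]mulrDl lerD2l mulrA mulrAC.
have b2' k : `|al2 k| + `|be2 k| <= 2 * g k.
  apply: le_trans (b2 k); rewrite /al2 /be2 /al1 /be1 mulNr mulrN normrN mulNr normrN.
  by rewrite !mulrA -expr2.
have sN k : s (- k) = - s k by rewrite /s dotpNl.
have [V1 [cV1 f1 conv1 _]] := synthesis (al := al1) (be := be1)
  (fun k => ltac:(by rewrite /al1 sN (fsN _ cV) mulrNN)) (fun k => ltac:(by rewrite /be1 sN fcN mulNr))
  (lin _ _ ic1 b1').
have [V2 [cV2 f2 conv2 _]] := synthesis (al := al2) (be := be2)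
  (fun k => ltac:(by rewrite /al2 /be1 sN fcN; ring)) (fun k => ltac:(by rewrite /be2 /al1 sN (fsN _ cV); ring))
  (lin _ _ (ler0n R 2) b2').
have along (U : rV -> R) a b' : (forall e : R, 0 < e -> exists N0, forall N, (N0 <= N)%N ->
      forall th : rV, `|U th - tp (box d N) a b' th| <= e) ->
   forall e : R, 0 < e -> exists N0, forall N, (N0 <= N)%N ->
      forall t : R, `|U (t *: om) - tp (box d N) a b' (t *: om)| <= e.
  by move=> h e e0; have [N0 hN] := h e e0; exists N0 => N NN t; exact: hN.
exists (fun t => V1 (t *: om)), (fun t => V2 (t *: om)) => t; split.
- apply: (uniform_derivative (g := fun n t => tp (box d n) (fc V) (fs V) (t *: om))
    (g' := fun n t => tp (box d n) al1 be1 (t *: om)) _ (along _ _ _ conv0) (along _ _ _ conv1)).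
  by move=> n x; exact: is_derive_tp.
- apply: (uniform_derivative (g := fun n t => tp (box d n) al1 be1 (t *: om))
    (g' := fun n t => tp (box d n) al2 be2 (t *: om)) _ (along _ _ _ conv1) (along _ _ _ conv2)).
  by move=> n x; exact: is_derive_tp.
- have cL : CP (fun th => delta * V1 th + (V2 th - c * V th)).
    by apply: CPD; [exact: CPZ|apply: CPB => //; exact: CPZ].
  have cZ := CPZ c cV.
  suff <- : (fun th => delta * V1 th + (V2 th - c * V th)) = G by ring.
  apply: coef_inj => // k; have [h1 h2] := hV k; rewrite -h1 -h2.
  have eZ : fc (fun th => c * V th) k = c * fc V k /\ fs (fun th => c * V th) k = c * fs V k.
    split; rewrite -meanZ; try exact: CP_gcos; try exact: CP_gsin;
    by congr torus_mean; apply/funext => th; rewrite mulrA.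
  rewrite fc_lin ?fs_lin ?fcB ?fsB ?eZ.1 ?eZ.2 //; try exact: CPB.
  rewrite (f1 k).1 (f1 k).2 (f2 k).1 (f2 k).2 /al2 /be2 /al1 /be1 -/(s k).
  by split; ring.
Qed.

(** The combinations w' cos(st) + s w sin(st) + delta w cos(st) and its conjugate have derivatives
    that are quasi-periodic, so [mean_primitive] annihilates the means of these derivatives, and that
    is the k-th Fourier equation. The required bound holds at arbitrarily large times, since w' is a
    difference quotient of the bounded function w somewhere in each unit interval. *)
Lemma ode_lin_eq V G (w' w'' : R -> R) : nonresonant om -> CP V -> CP G ->
  (forall t : R, is_derive t (1 : R) (fun t => V (t *: om)) (w' t)) ->
  (forall t : R, is_derive t (1 : R) w' (w'' t)) ->
  (forall t, w'' t + delta * w' t - c * V (t *: om) = G (t *: om)) -> lin_eq V G.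
Proof.
move=> nr cV cG d1 d2 eq k /=; set s := dotp k om.
have [M M0 hM] := CP_bounded cV.
have bnd N : exists2 t, N < t & `|w' t| <= 2 * M.
  have [xi] := MVT_between (N + 1) (N + 2) d1.
  rewrite (_ : N + 2 - (N + 1) = 1); last by ring.
  rewrite min_l; last by lra.
  rewrite mulr1 => /andP[xN _] e; exists xi; first by lra.
  by rewrite -e; apply: le_trans (ler_normB _ _) _; have := hM ((N + 2) *: om); have := hM ((N + 1) *: om); lra.
have cc := CP_cos (R := R) k; have ss := CP_sin (R := R) k.
have c1 := CP_gcos k cV; have c2 := CP_gsin k cV.
have c3 := CP_gcos k cG; have c4 := CP_gsin k cG.
have bb (x y z : R) : `|x| <= 1 -> `|y| <= 1 -> `|z| <= M -> forall v, `|v| <= 2 * M ->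
    `|v * x + z * (s * y) + delta * z * x| <= 2 * M + M * `|s| + `|delta| * M.
  move=> hx hy hz v hv; apply: le_trans (ler_normD _ _) _; apply: lerD.
    apply: le_trans (ler_normD _ _) _; apply: lerD; rewrite !normrM.
      by rewrite -[leRHS]mulr1; apply: ler_pM.
    apply: ler_pM => //.
    by rewrite -[leRHS]mulr1 ler_wpM2l.
  by rewrite !normrM -[leRHS]mulr1; apply: ler_pM; rewrite ?mulr_ge0 // ler_wpM2l.
split.
- pose g th := (c + s ^+ 2) * (V th * cos (dotp k th)) + (G th * cos (dotp k th) - delta * s * (V th * sin (dotp k th))).
  have cg : CP g by apply: CPD; [exact: CPZ|apply: CPB => //; exact: CPZ].
  suff m0 : mean g = 0.
    by move: m0; rewrite /g mean_lin ?meanB ?meanZ //; try exact: CPZ; try (by apply: CPB => //; exact: CPZ);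
      rewrite -/(fc V k) -/(fs V k) -/(fc G k) => h; rewrite -[RHS]subr0 -h; ring.
  apply: (@mean_primitive R d om g (fun t => w' t * cos (s * t) + V (t *: om) * (s * sin (s * t)) + delta * V (t *: om) * cos (s * t))
     (2 * M + M * `|s| + `|delta| * M)) => // [t|N]; last first.
    by have [t Nt ht] := bnd N; exists t => //; apply: bb => //; [exact: cos_max|exact: sin_max].
  have dc := is_derive_cosM s t; have ds := is_derive_sinM s t.
  have := is_deriveD (is_deriveD (is_deriveM (d2 t) dc) (is_deriveM (d1 t) (is_deriveZ s ds)))
     (is_deriveM (is_deriveZ delta (d1 t)) dc).
  move/is_derive_eq; apply; rewrite /= /g dotpZ -/s -(eq t) [t * s]mulrC.
  by move: (V (t *: om)) => v; rewrite /GRing.scale /=; ring.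
- pose g th := (c + s ^+ 2) * (V th * sin (dotp k th)) + (G th * sin (dotp k th) - - (delta * s) * (V th * cos (dotp k th))).
  have cg : CP g by apply: CPD; [exact: CPZ|apply: CPB => //; exact: CPZ].
  suff m0 : mean g = 0.
    by move: m0; rewrite /g mean_lin ?meanB ?meanZ //; try exact: CPZ; try (by apply: CPB => //; exact: CPZ);
      rewrite -/(fc V k) -/(fs V k) -/(fs G k) => h; rewrite -[RHS]subr0 -h; ring.
  apply: (@mean_primitive R d om g (fun t => w' t * sin (s * t) + V (t *: om) * (s * - cos (s * t)) + delta * V (t *: om) * sin (s * t))
     (2 * M + M * `|s| + `|delta| * M)) => // [t|N]; last first.
    by have [t Nt ht] := bnd N; exists t => //; apply: bb => //; [exact: sin_max|rewrite normrN; exact: cos_max].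
  have dc := is_derive_cosM s t; have ds := is_derive_sinM s t.
  have := is_deriveD (is_deriveD (is_deriveM (d2 t) ds) (is_deriveM (d1 t) (is_deriveZ s (is_deriveN dc))))
     (is_deriveM (is_deriveZ delta (d1 t)) ds).
  move/is_derive_eq; apply; rewrite /= /g dotpZ -/s -(eq t) [t * s]mulrC.
  rewrite (_ : (- (fun s0 : R => cos (s * s0))) t = - cos (s * t)) //.
  by move: (V (t *: om)) => v; rewrite /GRing.scale /=; ring.
Qed.

End Linear.

(** * The fixed point *)

Section FixedPoint.
Context {R : realType}.
Variables (d m : nat) (rho : R).
Hypothesis rho0 : 0 <= rho.
Hypothesis dm : (d < 2 * m)%N.
Local Notation rV := 'rV[R]_d.
Local Notation Zd := 'rV[int]_d.
Local Notation Hle := (@Hle R d rho).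
Local Notation mean := (@torus_mean R d).

(** In a bounded set of the weighted space the high frequencies are uniformly
    small, so that coefficientwise smallness controls the sup norm. *)
Lemma Hle_tail B : 0 <= B -> forall e : R, 0 < e -> exists N, forall V : rV -> R, CP V ->
  Hle m V (B ^+ 2) -> forall th, `|V th| <= \sum_(k <- box d N) (`|fc V k| + `|fs V k|) + e.
Proof.
move=> B0 e e0.
have B1 : 0 < B + 1 by lra.
pose e2 := (e / 4 / (B + 1)) ^+ 2.
have e20 : 0 < e2 by rewrite exprn_gt0 // !divr_gt0.
have [N hN] := bounded_series (a := fun k => (wt rho m k)^-1) (fun k => ltac:(by rewrite invr_ge0 ltW // wt_gt0)) (sum_wt rho0 dm) e20.
exists N => V cV hV th.
have tail a : (forall X, uniq X -> \sum_(k <- X) a k ^+ 2 * wt rho m k <= B ^+ 2) -> forall X, uniq X ->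
    (forall k, k \in X -> k \notin box d N) -> \sum_(k <- X) `|a k| <= e / 4.
  move=> ha X uX nX.
  rewrite -(ler_pXn2r (n := 2)) ?nnegrE ?sumr_ge0 ?divr_ge0 ?(ltW e0) //.
  apply: le_trans (cauchy_schwarz X (fun k => `|a k|) (wt_gt0 rho m (d := d))) _.
  apply: (@le_trans _ _ (e2 * B ^+ 2)).
    apply: ler_pM.
    - by apply: sumr_ge0 => k _; rewrite invr_ge0 ltW // wt_gt0.
    - by apply: sumr_ge0 => k _; rewrite mulr_ge0 ?sqr_ge0 // ltW // wt_gt0.
    - exact: hN.
    - rewrite (eq_bigr (fun k => a k ^+ 2 * wt rho m k)); first exact: ha.
      by move=> k _; rewrite real_normK ?num_real.
  rewrite /e2 -exprMn lerXn2r ?nnegrE ?mulr_ge0 ?invr_ge0 ?divr_ge0 ?(ltW e0) ?(ltW B1) //.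
  by rewrite mulrAC ler_pdivrMr // ler_wpM2l ?divr_ge0 ?(ltW e0) //; lra.
apply: (@eps_le R _ _ 1) => e1 e10.
have [/(_ e1 e10)[N1 hN1] _] := fourier_series cV (Hle_abs rho0 dm B0 hV).
have := hN1 (maxn N N1) (leq_maxr _ _) th.
have [X [uX nX ->]] := tp_box_sub (fc V) (fs V) (leq_maxl N N1).
have t1 := tail _ (Hle_c hV) X uX nX; have t2 := tail _ (Hle_s hV) X uX nX.
have b1 := tp_norm_le (box d N) (fc V) (fs V) th.
have b2 := tp_norm_le X (fc V) (fs V) th.
rewrite [X in _ <= X]big_split /= in b2.
move: (tp _ _ _ _) (tp _ _ _ _) b1 b2 => x y b1 b2 h.
rewrite mul1r -[V th](subrK (y + x)).
apply: le_trans (ler_normD _ _) _; have := ler_normD y x; lra.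
Qed.

Lemma half_pow_small (C e : R) : 0 <= C -> 0 < e -> exists n, C * 2^-1 ^+ n <= e.
Proof.
move=> C0 e0; pose n := (Num.trunc (C / e)).+1; exists n.
have h : 0 <= C / e by rewrite divr_ge0 // ltW.
have /andP[_] := trunc_itv h; rewrite -/n ltr_pdivrMr // => /ltW h'.
have n2 : n%:R <= 2 ^+ n :> R by rewrite -natrX ler_nat ltnW // ltn_expl.
have p : 0 < 2 ^+ n :> R by rewrite exprn_gt0.
rewrite exprVn ler_pdivrMr // mulrC; apply: le_trans h' _.
by rewrite ler_wpM2r // ltW.
Qed.

Lemma geometric_cauchy (x : nat -> R) C : (forall n, `|x n.+1 - x n| <= C * 2^-1 ^+ n) ->
  forall n N, (n <= N)%N -> `|x N - x n| <= 2 * C * 2^-1 ^+ n.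
Proof.
move=> h n N nN; have C0 : 0 <= C by have := le_trans (normr_ge0 _) (h 0%N); rewrite expr0 mulr1.
have : `|x N - x n| <= 2 * C * (2^-1 ^+ n - 2^-1 ^+ N).
  rewrite -(subnK nN); elim: (N - n)%N => [|i IH]; first by rewrite add0n !subrr normr0 mulr0.
  rewrite addSn -[x _ - x n](subrK (x (i + n)%N - x (i + n)%N)).
  have -> : x (i + n).+1 - x n - (x (i + n)%N - x (i + n)%N) + (x (i + n)%N - x (i + n)%N) =
     (x (i + n).+1 - x (i + n)%N) + (x (i + n)%N - x n) by ring.
  apply: le_trans (ler_normD _ _) _; apply: le_trans (lerD (h _) IH) _.
  rewrite [2^-1 ^+ (i + n).+1]exprS; move: (2^-1 ^+ (i + n)) (2^-1 ^+ n) => y z; lra.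
move/le_trans; apply; rewrite ler_wpM2l ?mulr_ge0 // gerBl exprn_ge0 //.
Qed.

Variables (om : rV) (c delta : R).
Hypothesis c0 : c != 0.
Hypothesis damping : 0 <= delta ^+ 2 + 2 * c.
Variables (G : (rV -> R) -> rV -> R) (b : R).
Hypothesis b0 : 0 <= b.
Let ball V := CP V /\ Hle m V (b ^+ 2).
Hypothesis G_CP : forall V, ball V -> CP (G V).
Hypothesis G_ball : forall V, ball V -> Hle m (G V) ((`|c| * b) ^+ 2).
Hypothesis G_lip : forall V W, ball V -> ball W -> forall th,
  `|G V th - G W th| <= 2^-1 * `|c| * `|V th - W th|.

Lemma fixed_point_unique V W : ball V -> ball W -> lin_eq om c delta V (G V) ->
  lin_eq om c delta W (G W) -> W = V.
Proof.
move=> bV bW hV hW; have [cV _] := bV; have [cW _] := bW.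
have := lin_eq_contract c0 damping cW cV (G_CP bW) (G_CP bV) (CPB cW cV) hW hV (G_lip bW bV).
have c2 : CP (fun th => (W th - V th) ^+ 2) by apply: CPX; exact: CPB.
have m0 : 0 <= mean (fun th => (W th - V th) ^+ 2) by apply: mean_ge0 => // th; exact: sqr_ge0.
move=> h; have /(mean_eq0 c2 (fun th => sqr_ge0 _)) z : mean (fun th => (W th - V th) ^+ 2) = 0.
  by move: h m0; rewrite expr2; set y := mean _; lra.
by apply/funext => th; apply/eqP; rewrite -subr_eq0 -sqrf_eq0 z.
Qed.

(** The iterates converge geometrically in L^2, hence so does each Fourier coefficient; inside the
    ball the high frequencies are uniformly small, which upgrades this to uniform convergence, and the
    Fourier equations pass to the limit. *)
Lemma fixed_point : exists2 V, ball V & lin_eq om c delta V (G V).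
Proof.
have cn0 : `|c| != 0 by rewrite normr_eq0.
have step (v : {V | ball V}) : exists w : {V | ball V}, lin_eq om c delta (sval w) (G (sval v)).
  case: v => V bV /=; have cb : 0 <= `|c| * b by rewrite mulr_ge0.
  have [W [cW eW hW]] := lin_eq_solvable rho0 dm om c0 damping (G_CP bV) cb (G_ball bV).
  have bW : ball W by split=> //; move: hW; rewrite mulrAC mulfV // mul1r.
  by exists (exist _ W bW).
have [T hT] := choice step.
have b0V : ball (fun=> 0).
  split; first exact: CP_cst.
  by apply: Hle_weaken (Hle_cst rho m 0); rewrite expr0n /= sqr_ge0.
pose v n := iter n T (exist _ _ b0V); pose V n := sval (v n).
have bV n : ball (V n) by exact: (svalP (v n)).
have eV n : lin_eq om c delta (V n.+1) (G (V n)) by exact: hT.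
have cV n := (bV n).1.
pose D := mean (fun th => (V 1%N th - V 0%N th) ^+ 2).
have D0 : 0 <= D by apply: mean_ge0 => [|th]; [apply: CPX; exact: CPB|exact: sqr_ge0].
have md n : mean (fun th => (V n.+1 th - V n th) ^+ 2) <= D * (2^-1 ^+ n) ^+ 2.
  elim: n => [|n IH]; first by rewrite expr0 expr1n mulr1.
  have := lin_eq_contract c0 damping (cV n.+2) (cV n.+1) (G_CP (bV n.+1)) (G_CP (bV n))
    (CPB (cV n.+1) (cV n)) (eV n.+1) (eV n) (G_lip (bV n.+1) (bV n)).
  move/le_trans; apply; rewrite [2^-1 ^+ n.+1]exprS exprMn mulrCA ler_wpM2l ?sqr_ge0 //.
pose C := D + 1; have C0 : 0 < C by rewrite /C; lra.
have small n (x : R) : x ^+ 2 <= D * (2^-1 ^+ n) ^+ 2 -> `|x| <= C * 2^-1 ^+ n.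
  move=> h; have p0 : 0 <= 2^-1 ^+ n :> R by rewrite exprn_ge0.
  rewrite -(ler_pXn2r (n := 2)) ?nnegrE ?mulr_ge0 ?(ltW C0) // real_normK ?num_real // exprMn.
  apply: le_trans h _; rewrite ler_wpM2r ?sqr_ge0 // /C expr2; nra.
have coefs k n : `|fc (V n.+1) k - fc (V n) k| <= C * 2^-1 ^+ n /\
                 `|fs (V n.+1) k - fs (V n) k| <= C * 2^-1 ^+ n.
  have := bessel (CPB (cV n.+1) (cV n)) (_ : uniq [:: k]) => /(_ isT).
  rewrite /energy big_seq1 fcB // fsB // => /le_trans/(_ (md n)) h.
  have h1 := sqr_ge0 (fc (V n.+1) k - fc (V n) k); have h2 := sqr_ge0 (fs (V n.+1) k - fs (V n) k).
  by split; apply: small; lra.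
have b1 : 0 < b + 1 by rewrite ltr_wpDl.
have bV1 n : Hle m (V n) ((b + 1) ^+ 2).
  by apply: Hle_weaken (bV n).2; rewrite lerXn2r ?nnegrE ?(ltW b1) //; lra.
have [W cW hW] : exists2 W, CP W & forall e : R, 0 < e -> exists N0, forall N, (N0 <= N)%N ->
    forall th, `|W th - V N th| <= e.
  apply: uniform_limit => // e e0; have e20 : 0 < e / 2 by rewrite divr_gt0.
  have bb0 : 0 <= b + 1 + (b + 1) by lra.
  have [N0 hN0] := Hle_tail bb0 e20.
  pose Q := (size (box d N0))%:R * (4 * C); have Q0 : 0 <= Q by rewrite !mulr_ge0 // ltW.
  have [n hn] := half_pow_small Q0 e20.
  exists n => N nN th; apply: le_trans (hN0 _ (CPB (cV n) (cV N)) (HleB (cV n) (cV N) b1 b1 (bV1 n) (bV1 N)) th) _.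
  suff : \sum_(k <- box d N0) (`|fc (fun th => V n th - V N th) k| + `|fs (fun th => V n th - V N th) k|) <= Q * 2^-1 ^+ n by lra.
  apply: (@le_trans _ _ (\sum_(k <- box d N0) (4 * C * 2^-1 ^+ n))).
    apply: ler_sum => k _; rewrite fcB // fsB // distrC [X in _ + X]distrC.
    have h1 := geometric_cauchy (fun i => (coefs k i).1) nN.
    have h2 := geometric_cauchy (fun i => (coefs k i).2) nN.
    by move: h1 h2; move: (2^-1 ^+ n) => z; lra.
  by rewrite big_const_seq count_predT iter_addr_0 /Q -[_ *+ size _]mulr_natl mulrA.
have bW : ball W.
  split=> //; apply: Hle_lim => // e e0; have [N /(_ N (leqnn N)) hN] := hW e e0.
  by exists (V N) => //; split=> //; exact: (bV N).2.
exists W => // k; set s := dotp k om.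
pose Q := `|- s ^+ 2 - c| + `|delta * s| + 2^-1 * `|c|.
have apx e : 0 < e -> exists n, [/\ (forall th, `|W th - V n.+1 th| <= e) &
    (forall th, `|G W th - G (V n) th| <= 2^-1 * `|c| * e)].
  move=> e0; have [N hN] := hW e e0; exists N; split => th; first exact: hN.
  by apply: le_trans (G_lip bW (bV N) th) _; rewrite ler_wpM2l ?mulr_ge0 // hN.
have cGW := G_CP bW.
split; apply/eqP; rewrite -subr_eq0 -normr_le0; apply: (@eps_le R _ _ Q) => e e0;
  have [n [h1 h2]] := apx e e0; have cn := cV n.+1; have cGn := G_CP (bV n);
  have [q1 q2] := eV n k; rewrite add0r /Q.
- have := fc_norm_le k (CPB cW cn) h1; have := fs_norm_le k (CPB cW cn) h1.
  have := fc_norm_le k (CPB cGW cGn) h2; rewrite !fcB // !fsB // -q1 -/s => l1 l2 l3.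
  have -> : (- s ^+ 2 - c) * fc W k + delta * s * fs W k - fc (G W) k =
    (- s ^+ 2 - c) * (fc W k - fc (V n.+1) k) + delta * s * (fs W k - fs (V n.+1) k) -
    (fc (G W) k - ((- s ^+ 2 - c) * fc (V n.+1) k + delta * s * fs (V n.+1) k)) by ring.
  apply: le_trans (ler_normB _ _) _; rewrite [leRHS]mulrDl [X in _ <= X + _]mulrDl; apply: lerD => //.
  by apply: le_trans (ler_normD _ _) _; rewrite 2!normrM; apply: lerD; rewrite ler_wpM2l.
- have := fc_norm_le k (CPB cW cn) h1; have := fs_norm_le k (CPB cW cn) h1.
  have := fs_norm_le k (CPB cGW cGn) h2; rewrite !fcB // !fsB // -q2 -/s => l1 l2 l3.
  have -> : (- s ^+ 2 - c) * fs W k - delta * s * fc W k - fs (G W) k =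
    (- s ^+ 2 - c) * (fs W k - fs (V n.+1) k) - delta * s * (fc W k - fc (V n.+1) k) -
    (fs (G W) k - ((- s ^+ 2 - c) * fs (V n.+1) k - delta * s * fc (V n.+1) k)) by ring.
  apply: le_trans (ler_normB _ _) _; rewrite [leRHS]mulrDl [X in _ <= X + _]mulrDl; apply: lerD => //.
  by apply: le_trans (ler_normB _ _) _; rewrite 2!normrM; apply: lerD; rewrite ler_wpM2l.
Qed.

End FixedPoint.

(** * The nonlinear terms *)

Section Taylor.
Context {R : realType}.
Variables (d m : nat) (rho : R).
Hypothesis rho0 : 0 <= rho.
Hypothesis dm : (d < 2 * m)%N.
Local Notation rV := 'rV[R]_d.
Local Notation Hle := (@Hle R d rho).
Local Notation Ka := (Kalg (R := R) d m).

(** What is left of (a + y)^l after its affine part at a. *)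
Definition taylor2 l (a y : R) : R := (a + y) ^+ l - a ^+ l - l%:R * a ^+ l.-1 * y.

Lemma taylor2S l a y :
  taylor2 l.+1 a y = (a + y) * taylor2 l a y + l%:R * a ^+ l.-1 * (y * y).
Proof.
case: l => [|l]; first by rewrite /taylor2 !expr0 !expr1; ring.
rewrite /taylor2 /= [(a + y) ^+ l.+2]exprS [a ^+ l.+2]exprS [a ^+ l.+1]exprS.
have -> : l.+2%:R = l.+1%:R + 1 :> R by rewrite -natr1.
by move: ((a + y) ^+ l.+1) (a ^+ l) l.+1%:R => A B n; ring.
Qed.

(** [cN] and [eN] are the constants produced by the recursion [taylor2S] for the weighted norm and for
    the pointwise Lipschitz bound. *)
Fixpoint cN l : R := if l is n.+1 then 2 * Ka * cN n + n.+1%:R * Ka else 1.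
Fixpoint eN l : R := if l is n.+1 then 3 * eN n + 2 * n%:R else 0.

Lemma Ka_gt0 : 0 < Ka.
Proof. exact: lt_le_trans ltr01 (Kalg_ge1 _ _). Qed.

Lemma cN_gt0 l : 0 < cN l.
Proof. by elim: l => //= n IH; rewrite addr_gt0 ?mulr_gt0 ?Ka_gt0. Qed.

Lemma eN_ge0 l : 0 <= eN l.
Proof. by elim: l => //= n IH; rewrite addr_ge0 ?mulr_ge0. Qed.

Lemma CP_taylor2 l a (V : rV -> R) : CP V -> CP (fun th => taylor2 l a (V th)).
Proof.
move=> cV; apply: CPB; last exact: CPZ.
by apply: CPB; [apply: CPX; apply: CPD => //; exact: CP_cst|exact: CP_cst].
Qed.

Lemma Hle_sq_abs s V x y : `|x| <= y -> Hle s V (x ^+ 2) -> Hle s V (y ^+ 2).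
Proof.
move=> xy; apply: Hle_weaken; rewrite -[x ^+ 2]real_normK ?num_real //.
by rewrite lerXn2r ?nnegrE ?(le_trans (normr_ge0 _) xy).
Qed.

Lemma Hle_taylor2 l a eta V : a != 0 -> 0 < eta -> eta <= 1 -> CP V ->
  Hle m V ((eta * `|a|) ^+ 2) -> Hle m (fun th => taylor2 l a (V th)) ((cN l * `|a| ^+ l * eta ^+ 2) ^+ 2).
Proof.
move=> a0 e0 e1 cV hV; have aa : 0 < `|a| by rewrite normr_gt0.
have ea : 0 < eta * `|a| by rewrite mulr_gt0.
have caV : CP (fun th => a + V th) by apply: CPD => //; exact: CP_cst.
have haV : Hle m (fun th => a + V th) ((2 * `|a|) ^+ 2).
  have := HleD (CP_cst d a) cV aa ea _ hV; rewrite real_normK ?num_real // => /(_ (Hle_cst _ _ _)).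
  by apply: Hle_sq_abs; rewrite ger0_norm ?addr_ge0 ?(ltW ea) //; nra.
elim: l => [|l IH].
  apply: (Hle_sq_abs (x := 0)); first by rewrite normr0 /= expr0 !mul1r sqr_ge0.
  by have := Hle_cst rho m (0 : R) (d := d); congr Hle; apply/funext => th; rewrite /taylor2 !expr0 subrr mul0r mul0r subrr.
have -> : (fun th => taylor2 l.+1 a (V th)) =
   (fun th => (a + V th) * taylor2 l a (V th) + l%:R * a ^+ l.-1 * (V th * V th)).
  by apply/funext => th; exact: taylor2S.
have p1 : 0 < Ka * (2 * `|a|) * (cN l * `|a| ^+ l * eta ^+ 2).
  by rewrite !mulr_gt0 ?Ka_gt0 ?cN_gt0 ?exprn_gt0.
have p2 : 0 < l.+1%:R * Ka * (`|a| ^+ l.+1 * eta ^+ 2).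
  by rewrite !mulr_gt0 ?Ka_gt0 ?exprn_gt0.
rewrite (_ : cN l.+1 * _ * _ = Ka * (2 * `|a|) * (cN l * `|a| ^+ l * eta ^+ 2) + l.+1%:R * Ka * (`|a| ^+ l.+1 * eta ^+ 2)); last first.
  by rewrite /= exprS; ring.
have cVV := CPM cV cV.
apply: HleD => //.
- by apply: CPM => //; exact: CP_taylor2.
- exact: CPZ.
- apply: HleM => //; first exact: CP_taylor2.
  + by rewrite !mulr_ge0 ?exprn_ge0 ?(ltW (cN_gt0 l)) // ltW.
- apply: Hle_sq_abs (HleZ (l%:R * a ^+ l.-1) cVV (HleM rho0 dm cV cV (ltW ea) (ltW ea) hV hV)).
  rewrite !normrM normrX normr_nat (gtr0_norm Ka_gt0) (gtr0_norm e0) !normr_id.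
  case: l {IH p1 p2} => [|l]; first by rewrite mul0r mul0r !mulr_ge0 ?exprn_ge0 ?(ltW Ka_gt0) ?(ltW e0).
  rewrite /= [leLHS](_ : _ = l.+1%:R * (Ka * (`|a| ^+ l.+2 * eta ^+ 2))); last by rewrite !exprS; ring.
  rewrite -[leRHS]mulrA ler_wpM2r ?ler_nat //.
  exact: (mulr_ge0 (ltW Ka_gt0) (mulr_ge0 (exprn_ge0 _ (normr_ge0 _)) (sqr_ge0 _))).
Qed.

Lemma taylor2_lip l (a eta y z : R) : 0 <= eta -> eta <= 1 -> `|y| <= eta * `|a| -> `|z| <= eta * `|a| ->
  `|a| * `|taylor2 l a y - taylor2 l a z| <= eN l * `|a| ^+ l * eta * `|y - z|.
Proof.
move=> e0 e1; elim: l y z => [|l IH] y z hy hz.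
  by rewrite /taylor2 !expr0 !mul0r !subr0 subrr normr0 mulr0.
have ya : `|y| <= `|a| by apply: le_trans hy _; rewrite ler_piMl.
have hz0 : `|a| * `|taylor2 l a z| <= eN l * `|a| ^+ l * eta * `|z|.
  have := IH z 0 hz; rewrite normr0 mulr_ge0 // => /(_ isT).
  by rewrite {2}/taylor2 addr0 subrr mulr0 subrr !subr0.
have -> : taylor2 l.+1 a y - taylor2 l.+1 a z =
  (a + y) * (taylor2 l a y - taylor2 l a z) + (y - z) * taylor2 l a z + l%:R * a ^+ l.-1 * ((y + z) * (y - z)).
  by rewrite !taylor2S; ring.
apply: (@le_trans _ _ (2 * `|a| * (`|a| * `|taylor2 l a y - taylor2 l a z|) + `|y - z| * (`|a| * `|taylor2 l a z|)
    + l%:R * (`|a| ^+ l.-1 * `|a|) * (`|y + z| * `|y - z|))).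
  have h1 := ler_normD ((a + y) * (taylor2 l a y - taylor2 l a z) + (y - z) * taylor2 l a z) (l%:R * a ^+ l.-1 * ((y + z) * (y - z))).
  have h2 := ler_normD ((a + y) * (taylor2 l a y - taylor2 l a z)) ((y - z) * taylor2 l a z).
  apply: le_trans (ler_wpM2l (normr_ge0 a) (le_trans h1 (lerD h2 (lexx _)))) _.
  rewrite !normrM normrX normr_nat; have h3 : `|a + y| <= 2 * `|a|.
    by apply: le_trans (ler_normD _ _) _; lra.
  have h4 : `|a| * (`|a + y| * `|taylor2 l a y - taylor2 l a z|) <= 2 * `|a| * (`|a| * `|taylor2 l a y - taylor2 l a z|).
    by rewrite mulrCA; apply: ler_wpM2r => //; rewrite mulr_ge0.
  by rewrite !mulrDr; apply: lerD; [apply: lerD => //; rewrite mulrCA|]; rewrite le_eqVlt; apply/orP; left; apply/eqP; ring.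
have h1 := IH y z hy hz.
have al : l%:R * (`|a| ^+ l.-1 * `|a|) = l%:R * `|a| ^+ l.
  by case: l {IH hz0 h1} => [|l]; rewrite ?mul0r //= -exprSr.
rewrite al.
have hyz : `|y + z| <= 2 * (eta * `|a|) by apply: le_trans (ler_normD _ _) _; lra.
have an : 0 <= `|a| ^+ l by rewrite exprn_ge0.
have en := eN_ge0 l.
have t1 : 2 * `|a| * (`|a| * `|taylor2 l a y - taylor2 l a z|) <= 2 * `|a| * (eN l * `|a| ^+ l * eta * `|y - z|).
  by rewrite ler_wpM2l // mulr_ge0.
have t2 : `|y - z| * (`|a| * `|taylor2 l a z|) <= `|y - z| * (eN l * `|a| ^+ l * eta * `|a|).
  rewrite ler_wpM2l //; apply: le_trans hz0 _; rewrite ler_wpM2l ?mulr_ge0 //.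
  by apply: le_trans hz _; rewrite ler_piMl.
have t3 : l%:R * `|a| ^+ l * (`|y + z| * `|y - z|) <= l%:R * `|a| ^+ l * (2 * (eta * `|a|) * `|y - z|).
  by rewrite ler_wpM2l ?mulr_ge0 // ler_wpM2r.
apply: le_trans (lerD (lerD t1 t2) t3) _.
by rewrite /= exprS le_eqVlt; apply/orP; left; apply/eqP; ring.
Qed.

End Taylor.

(** * The response solution *)

Section SquareNorm.
Context {R : realType}.
Variables (d m : nat) (rho : R).
Local Notation rV := 'rV[R]_d.

Lemma Hnorm2E (V : rV -> R) : Hnorm2 rho m V =
  \esum_(k in [set: 'rV[int]_d]) ((fc V k ^+ 2 + fs V k ^+ 2) * wt rho m k)%:E.
Proof.
by apply: eq_esum => k _; rewrite fourierE /= sqrrN /wt -mulrA /jb.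
Qed.

Lemma Hnorm2_ge0 (V : rV -> R) : (0 <= Hnorm2 rho m V)%E.
Proof.
rewrite Hnorm2E; apply: esum_ge0 => k _.
by rewrite lee_fin mulr_ge0 ?addr_ge0 ?sqr_ge0 // ltW // wt_gt0.
Qed.

Lemma Hle_of_Hnorm (V : rV -> R) b : 0 <= b -> (Hnorm2 rho m V < +oo)%E -> Hnorm rho m V <= b ->
  Hle rho m V (b ^+ 2).
Proof.
move=> b0 fin hb X uX.
have fn : Hnorm2 rho m V \is a fin_num by rewrite ge0_fin_numE // Hnorm2_ge0.
have F0 : 0 <= fine (Hnorm2 rho m V) by rewrite fine_ge0 // Hnorm2_ge0.
have Fb : fine (Hnorm2 rho m V) <= b ^+ 2.
  by rewrite -(sqr_sqrtr F0) lerXn2r ?nnegrE ?sqrtr_ge0.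
apply: le_trans Fb; rewrite -lee_fin fineK // Hnorm2E -sumEFin.
apply: ereal_sup_ubound; exists [set` X]; first by split=> //; exact: finite_seq.
by rewrite -fsbig_seq.
Qed.

(** The extended sum is the supremum of the finite sums bounded in [Hle]. *)
Lemma Hnorm_of_Hle (V : rV -> R) b : 0 <= b -> Hle rho m V (b ^+ 2) ->
  (Hnorm2 rho m V < +oo)%E /\ Hnorm rho m V <= b.
Proof.
move=> b0 h.
have le : (Hnorm2 rho m V <= (b ^+ 2)%:E)%E.
  rewrite Hnorm2E; apply: ge_ereal_sup => _ [A [finA _] <-].
  by rewrite (fsbig_finite _ _ finA) sumEFin lee_fin; apply: h; exact: finmap.fset_uniq.
split; first by apply: le_lt_trans le _; rewrite ltry.
rewrite /Hnorm; have := sqrtr_sqr b; rewrite ger0_norm // => <-; apply: ler_wsqrtr.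
by rewrite -[leRHS]/(fine (b ^+ 2)%:E) fine_le // ge0_fin_numE ?Hnorm2_ge0 // (le_lt_trans le) // ltry.
Qed.

End SquareNorm.

Section Response.
Context {R : realType}.
Variables (l d m : nat) (rho : R).
Hypothesis hl : (2 <= l)%N.
Hypothesis rho0 : 0 <= rho.
Hypothesis dm : (d < 2 * m)%N.
Local Notation rV := 'rV[R]_d.
Local Notation Hle := (@Hle R d rho).
Local Notation Cs := (Csup (R := R) d m).

(** The relative size of the ball: V is sought with norm at most eta |a|. *)
Definition eta : R := (4 * (cN d m l + eN l * Cs + Cs + 1))^-1.

Lemma eta_spec : [/\ 0 < eta, eta * cN d m l <= 4^-1, eN l * (Cs * eta) <= 4^-1, Cs * eta <= 1 & eta <= 1].
Proof.
have c0 := cN_gt0 (R := R) d m l; have e0 := eN_ge0 (R := R) l; have s0 := Csup_gt0 (R := R) d m.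
have es : 0 <= eN l * Cs by rewrite mulr_ge0 // ltW.
pose D := cN d m l + eN l * Cs + Cs + 1; have D0 : 0 < D by rewrite /D; lra.
have eD : eta = 4^-1 / D by rewrite /eta invfM.
have p : 0 < eta by rewrite eD divr_gt0.
have k x : 0 <= x -> x <= D -> eta * x <= 4^-1.
  by move=> x0 xD; rewrite eD mulrAC ler_pdivrMr // ler_wpM2l.
split=> //.
- by apply: k; [exact: ltW|rewrite /D; lra].
- by rewrite mulrA mulrC; apply: k => //; rewrite /D; lra.
- rewrite mulrC; apply: le_trans (k _ (ltW s0) _) _; first by rewrite /D; lra.
  lra.
- by rewrite -[eta]mulr1; apply: le_trans (k 1 ler01 _) _; [rewrite /D|]; lra.
Qed.

(** Everything the fixed point argument needs to know about the forcing terms: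
    pointwise Lipschitz bounds, and bounds of the compositions in the norm, both
    with the orders of vanishing in s. *)
Definition admissible (f h : rV * R -> R) (s0 M : R) :=
  [/\ forall V, CP V -> (forall th, `|V th| <= s0) ->
        CP (fun th => f (th, V th)) /\ CP (fun th => h (th, V th)),
      forall th x y s, 0 <= s -> s <= s0 -> `|x| <= s -> `|y| <= s ->
        `|f (th, x) - f (th, y)| <= M * `|x - y| /\
        `|h (th, x) - h (th, y)| <= M * s ^+ l * `|x - y|,
      forall th, h (th, 0) = 0
    & forall a V s, 0 < s -> s <= s0 -> `|a| <= s -> CP V -> Hle m V (s ^+ 2) ->
        Hle m (fun th => f (th, a + V th) - f (th, 0)) ((M * s) ^+ 2) /\
        Hle m (fun th => h (th, a + V th)) ((M * s ^+ l.+1) ^+ 2)].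

Section Fixed.
Variables (om : rV) (f h : rV * R -> R) (D : set R) (s0 M : R).
Hypothesis nr : nonresonant om.
Hypothesis s00 : 0 < s0.
Hypothesis M0 : 0 < M.
Hypothesis adm : admissible f h s0 M.
Hypothesis sD : forall x, `|x| <= s0 -> D x.
Hypothesis f00 : avg f 0 != 0.
Hypothesis osc_CP : CP (osc f 0).
Hypothesis osc_small : Hle m (osc f 0) ((eta / 2 * `|avg f 0|) ^+ 2).
Hypothesis ext : forall V B, CP V -> 0 <= B -> Hle m V (B ^+ 2) -> 0 < rho -> strip_extension rho V.
Local Notation f0 := (avg f 0).

(* In G below, h and f together contribute at most Q |a|^(l+1) to the weighted norm and Q |a|^l to
   the Lipschitz constant; the bound on |a| by a0 makes Q |a| at most eta / 8. *)
Let Q := M * (2 ^+ l + 1) * (1 + `|f0|^-1).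
Let a0 := Num.min (s0 / (2 * (1 + Cs))) (eta / (8 * Q)).

Lemma in_H_of_Hle V b : 0 <= b -> CP V -> Hle m V (b ^+ 2) -> in_H rho m V /\ Hnorm rho m V <= b.
Proof.
move=> b0 cV hV; have [h1 h2] := Hnorm_of_Hle b0 hV; split=> //; split=> //; [exact: cV.1|exact: cV.2|].
by move=> r0; exact: ext hV r0.
Qed.

Lemma in_HP V b : 0 <= b -> in_H rho m V -> Hnorm rho m V <= b -> CP V /\ Hle m V (b ^+ 2).
Proof. by move=> b0 [Vc Vp fin _] hb; split=> //; exact: Hle_of_Hnorm. Qed.

Lemma derive_of_is_derive (x w : R -> R) : (forall t : R, is_derive t (1 : R) x (w t)) ->
  (forall t, derivable x t 1) /\ derive1 x = w.
Proof.
by move=> dx; split=> [t|]; [have [] := dx t|apply/funext => t; rewrite derive1E; apply: derive_val].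
Qed.

Section NonzeroAmplitude.
Variables (eps a delta : R).
Hypothesis aeq : a ^+ l + eps * f0 = 0.
Hypothesis an0 : a != 0.
Hypothesis aa0 : `|a| < a0.
Hypothesis damp : 0 <= delta ^+ 2 + 2 * l%:R * a ^+ l.-1.

Let c := l%:R * a ^+ l.-1.
Let b := eta * `|a|.
Let G (V : rV -> R) th := taylor2 l a (V th) + (h (th, a + V th) + eps * (f (th, a + V th) - f0)).
Let ball V := CP V /\ Hle m V (b ^+ 2).

Let ap : 0 < `|a|. Proof. by rewrite normr_gt0. Qed.
Let b0 : 0 < b. Proof. by rewrite mulr_gt0 //; have [] := eta_spec. Qed.
Let ba : b <= `|a|. Proof. by rewrite ler_piMl //; have [] := eta_spec. Qed.
Let Q0 : 0 < Q.
Proof.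
rewrite /Q; apply: mulr_gt0; first by apply: mulr_gt0 => //; rewrite ltr_wpDl ?exprn_ge0.
by rewrite ltr_pwDl ?invr_ge0.
Qed.
Let cabs : `|c| = l%:R * `|a| ^+ l.-1. Proof. by rewrite normrM normr_nat normrX. Qed.
Let cp : 0 < `|c|. Proof. by rewrite cabs mulr_gt0 ?exprn_gt0 // ltr0n; exact: ltnW. Qed.
Let cn0 : c != 0. Proof. by rewrite -normr_gt0. Qed.
Let cal : `|c| * `|a| = l%:R * `|a| ^+ l.
Proof. by rewrite cabs -mulrA -exprSr prednK //; exact: ltnW. Qed.
Let damp' : 0 <= delta ^+ 2 + 2 * c. Proof. by rewrite mulrA. Qed.
Let epsE : `|eps| = `|a| ^+ l * `|f0|^-1.
Proof.
have : eps * f0 = - a ^+ l by apply/eqP; rewrite -addr_eq0 addrC aeq.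
move=> /(congr1 Num.norm); rewrite normrM normrN normrX => <-.
by rewrite mulfK // normr_eq0.
Qed.

Let supV V th : ball V -> `|V th| <= Cs * eta * `|a|.
Proof. by move=> [cV hV]; rewrite -mulrA; exact: (Hle_sup rho0 dm cV (ltW b0) hV). Qed.

Let supaV V th : ball V -> `|a + V th| <= 2 * `|a|.
Proof.
move=> bV; have [_ _ _ h1 _] := eta_spec; have := supV th bV; have := ler_normD a (V th).
have : Cs * eta * `|a| <= `|a| by rewrite ler_piMl.
by lra.
Qed.

Let a2s0 : 2 * `|a| <= s0 /\ `|a| <= s0.
Proof.
have Cp := Csup_gt0 (R := R) d m.
have : `|a| < s0 / (2 * (1 + Cs)) by apply: lt_le_trans aa0 _; rewrite ge_min lexx.
rewrite ltr_pdivlMr; last by rewrite mulr_gt0 // addr_gt0.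
have : 0 <= `|a| * Cs by rewrite mulr_ge0 // ltW.
have := ap; move: Cs `|a| => C x x0 h1 h2; split; lra.
Qed.

Let aQ : `|a| * Q <= eta / 8.
Proof.
have : `|a| < eta / (8 * Q) by apply: lt_le_trans aa0 _; rewrite ge_min lexx orbT.
by rewrite ltr_pdivlMr ?mulr_gt0 // => /ltW; rewrite mulrA; lra.
Qed.

Let Qge : M * 2 ^+ l + M + M * `|f0|^-1 <= Q.
Proof.
have i0 : 0 <= `|f0|^-1 by rewrite invr_ge0.
have p2 : 0 <= (2 : R) ^+ l by rewrite exprn_ge0.
rewrite /Q !mulrDr !mulr1 !mulrDl.
have := mulr_ge0 (mulr_ge0 (ltW M0) p2) i0.
by lra.
Qed.

Let G_CP V : ball V -> CP (G V).
Proof.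
move=> bV; have [cV hV] := bV; have [cp' _ _ _] := adm.
have caV : CP (fun th => a + V th) by apply: CPD => //; exact: CP_cst.
have [c1 c2] := cp' _ caV (fun th => le_trans (supaV th bV) a2s0.1).
apply: CPD; first exact: CP_taylor2.
by apply: CPD => //; apply: CPZ; apply: CPB => //; exact: CP_cst.
Qed.

Let G_ball V : ball V -> Hle m (G V) ((`|c| * b) ^+ 2).
Proof.
move=> bV; have [cV hV] := bV; have [cp' _ _ hN] := adm.
have caV : CP (fun th => a + V th) by apply: CPD => //; exact: CP_cst.
have [c1 c2] := cp' _ caV (fun th => le_trans (supaV th bV) a2s0.1).
have hVa : Hle m V (`|a| ^+ 2).
  by apply: Hle_weaken hV; rewrite lerXn2r ?nnegrE ?(ltW b0).
have [hf hh] := hN a V `|a| ap a2s0.2 (lexx _) cV hVa.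
have [e0 e1 _ _ e2] := eta_spec.
have hT := Hle_taylor2 rho0 dm l an0 e0 e2 cV hV.
have cf0 : CP (fun th => f (th, a + V th) - f (th, 0)).
  by apply: CPB => //; have := CPD osc_CP (CP_cst d f0); under eq_fun do rewrite /osc subrK.
have ep : 0 < eta / 2 * `|f0| by rewrite !mulr_gt0 // normr_gt0.
have hF : Hle m (fun th => f (th, a + V th) - f0) ((M * `|a| + eta / 2 * `|f0|) ^+ 2).
  have := HleD cf0 osc_CP (mulr_gt0 M0 ap) ep hf osc_small.
  by congr Hle; apply/funext => th; rewrite /osc; ring.
have cF : CP (fun th => f (th, a + V th) - f0) by apply: CPB => //; exact: CP_cst.
have an : 0 < `|a| ^+ l by rewrite exprn_gt0.
have epn : 0 < `|eps| by rewrite epsE mulr_gt0 // invr_gt0 normr_gt0.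
have hE : Hle m (fun th => eps * (f (th, a + V th) - f0)) ((`|eps| * (M * `|a| + eta / 2 * `|f0|)) ^+ 2).
  by have := HleZ eps cF hF; rewrite !exprMn real_normK ?num_real.
have p1 : 0 < M * `|a| ^+ l.+1 by rewrite mulr_gt0 ?exprn_gt0.
have p2 : 0 < `|eps| * (M * `|a| + eta / 2 * `|f0|) by rewrite mulr_gt0 // addr_gt0 // mulr_gt0.
have p3 : 0 < cN d m l * `|a| ^+ l * eta ^+ 2 by apply: mulr_gt0; [apply: mulr_gt0 => //; exact: cN_gt0|exact: exprn_gt0].
have p12 := addr_gt0 p1 p2.
have c3 : CP (fun th => h (th, a + V th) + eps * (f (th, a + V th) - f0)) by apply: CPD => //; exact: CPZ.
have c4 : CP (fun th => eps * (f (th, a + V th) - f0)) by exact: CPZ.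
have := HleD (CP_taylor2 l a cV) c3 p3 p12 hT (HleD c2 c4 p1 p2 hh hE).
apply: Hle_weaken; rewrite lerXn2r ?nnegrE ?(ltW (addr_gt0 p3 p12)) ?(mulr_ge0 (normr_ge0 c) (ltW b0)) //.
have -> : `|c| * b = eta * (l%:R * `|a| ^+ l) by rewrite /b mulrCA cal.
rewrite epsE; have i0 : 0 < `|f0| by rewrite normr_gt0.
have -> : cN d m l * `|a| ^+ l * eta ^+ 2 +
  (M * `|a| ^+ l.+1 + `|a| ^+ l * `|f0|^-1 * (M * `|a| + eta / 2 * `|f0|)) =
  `|a| ^+ l * (eta * (eta * cN d m l) + `|a| * (M + M * `|f0|^-1) + eta / 2).
  by rewrite [`|a| ^+ l.+1]exprS; field; rewrite gt_eqF.
rewrite (_ : eta * (l%:R * `|a| ^+ l) = `|a| ^+ l * (eta * l%:R)); last by rewrite [RHS]mulrC mulrA.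
apply: (ler_wpM2l (ltW an)).
have q0 : `|a| * (M + M * `|f0|^-1) <= eta / 8.
  apply: le_trans aQ; rewrite ler_wpM2l //; apply: le_trans Qge.
  have := mulr_ge0 (ltW M0) (exprn_ge0 l (ler0n R 2)); lra.
have q1 : eta * (eta * cN d m l) <= eta * 4^-1 by rewrite ler_wpM2l // ltW.
have q2 : 2 <= l%:R :> R by rewrite ler_nat.
have : eta * 2 <= eta * l%:R by rewrite ler_wpM2l // ltW.
by lra.
Qed.

Let G_lip V W : ball V -> ball W -> forall th, `|G V th - G W th| <= 2^-1 * `|c| * `|V th - W th|.
Proof.
move=> bV bW th; have [_ lip _ _] := adm.
have [e0 _ e2 e1 _] := eta_spec.
have tV := supV th bV; have tW := supV th bW.
have e3 : 0 <= Cs * eta by rewrite mulr_ge0 ?(ltW (Csup_gt0 _ _)) // ltW.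
have T := taylor2_lip l e3 e1 tV tW.
have [L1 L2] := lip th (a + V th) (a + W th) (2 * `|a|) (mulr_ge0 (ler0n _ _) (ltW ap)) a2s0.1 (supaV th bV) (supaV th bW).
have e (x y : R) : a + x - (a + y) = x - y by ring.
rewrite !e in L1 L2.
rewrite -(ler_pM2l ap).
set u := `|V th - W th| in T L1 L2 *.
have u0 : 0 <= u by exact: normr_ge0.
have an : 0 < `|a| ^+ l by rewrite exprn_gt0.
have i0 : 0 < `|f0| by rewrite normr_gt0.
have -> : `|a| * (2^-1 * `|c| * u) = `|a| ^+ l * (l%:R / 2) * u.
  by rewrite mulrA mulrCA [`|a| * _]mulrC cal; ring.
rewrite /G; set t1 := taylor2 _ _ _ in T *; set t2 := taylor2 _ _ _ in T *.
set x1 := h _ in L2 *; set x2 := h _ in L2 *; set y1 := f _ in L1 *; set y2 := f _ in L1 *.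
have -> : t1 + (x1 + eps * (y1 - f0)) - (t2 + (x2 + eps * (y2 - f0))) = (t1 - t2) + ((x1 - x2) + eps * (y1 - y2)) by ring.
have q1 : `|a| * `|t1 - t2| <= `|a| ^+ l * 4^-1 * u.
  apply: le_trans T _; rewrite ler_wpM2r //.
  have -> : eN l * `|a| ^+ l * (Cs * eta) = `|a| ^+ l * (eN l * (Cs * eta)) by ring.
  by rewrite ler_wpM2l // ltW.
have q2 : `|a| * `|x1 - x2| <= `|a| * (M * 2 ^+ l) * `|a| ^+ l * u.
  have -> : `|a| * (M * 2 ^+ l) * `|a| ^+ l * u = `|a| * (M * (2 * `|a|) ^+ l * u) by rewrite exprMn; ring.
  by rewrite ler_wpM2l.
have q3 : `|a| * `|eps * (y1 - y2)| <= `|a| * (M * `|f0|^-1) * `|a| ^+ l * u.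
  have -> : `|a| * (M * `|f0|^-1) * `|a| ^+ l * u = `|a| * (`|eps| * (M * u)) by rewrite epsE; ring.
  by rewrite normrM ler_wpM2l // ler_wpM2l.
have q4 : `|a| * (M * 2 ^+ l + M * `|f0|^-1) <= 8^-1.
  apply: (@le_trans _ _ (eta / 8)); last by have [_ _ _ _] := eta_spec; lra.
  by apply: le_trans aQ; rewrite ler_wpM2l //; apply: le_trans Qge; have := M0; lra.
have q5 : (`|a| * (M * 2 ^+ l + M * `|f0|^-1)) * (`|a| ^+ l * u) <= 8^-1 * (`|a| ^+ l * u).
  by rewrite ler_wpM2r // mulr_ge0 // ltW.
have q6 : 2 * (`|a| ^+ l * u) <= l%:R * (`|a| ^+ l * u) by rewrite ler_wpM2r ?ler_nat // mulr_ge0 // ltW.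
have au : 0 <= `|a| ^+ l * u by rewrite mulr_ge0 // ltW.
apply: le_trans (ler_wpM2l (ltW ap) (ler_normD _ _)) _; rewrite mulrDr.
apply: le_trans (lerD (lexx _) (ler_wpM2l (ltW ap) (ler_normD _ _))) _; rewrite mulrDr.
by lra.
Qed.

Let algebra x th : (a + x) ^+ l + h (th, a + x) + eps * f (th, a + x) =
  c * x + (taylor2 l a x + (h (th, a + x) + eps * (f (th, a + x) - f0))).
Proof. have E (A P q u v z e : R) : A + e * z = 0 -> P + u + e * v = q * x + (P - A - q * x + (u + e * (v - z))).
  by move=> h0; lra.
exact: E. Qed.

(** The fixed point of V |-> L^(-1) G(V) in the ball of radius eta |a|. *)
Lemma nonzero_response : exists V, [/\ in_H rho m V, Hnorm rho m V <= b,
    solves l om f h D delta eps (fun t => a + V (t *: om)) &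
  forall W, in_H rho m W -> Hnorm rho m W <= b ->
    solves l om f h D delta eps (fun t => a + W (t *: om)) -> W = V].
Proof.
have [V bV eV] := fixed_point rho0 dm om cn0 damp' (ltW b0) G_CP G_ball G_lip.
have [cV hV] := bV; have [inV nV] := in_H_of_Hle (ltW b0) cV hV.
exists V; split=> //.
- have cb : 0 <= `|c| * b by rewrite mulr_ge0 // ltW.
  have [w' [w'' hw]] := lin_eq_regular rho0 dm cn0 damp' cV (G_CP bV) cb (G_ball bV) eV.
  have d1 (t : R) : is_derive t (1 : R) (fun t => a + V (t *: om)) (w' t).
    by have [dV _ _] := hw t; have := is_deriveD (is_derive_cst a t (1 : R)) dV; rewrite add0r.
  have d2 (t : R) : is_derive t (1 : R) w' (w'' t) by have [] := hw t.
  have [e1 e2] := derive_of_is_derive d1; have [e3 e4] := derive_of_is_derive d2.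
  move=> t; rewrite e2 e4; split=> //.
    by apply: sD; exact: le_trans (supaV _ bV) a2s0.1.
  have [_ _ e5] := hw t; rewrite algebra -/(G V (t *: om)) -e5; ring.
- move=> W inW nW sW; have [cW hW] := in_HP (ltW b0) inW nW; have bW : ball W by split.
  apply: (fixed_point_unique cn0 damp' G_CP G_lip bV bW eV).
  pose x t := a + W (t *: om).
  have d1 (t : R) : is_derive t (1 : R) (fun t => W (t *: om)) (derive1 x t).
    have [_ dx _ _] := sW t; have dx' : is_derive t (1 : R) x (derive1 x t) by rewrite derive1E; exact: derivableP.
    have := is_deriveB dx' (is_derive_cst a t (1 : R)); rewrite subr0.
    by congr is_derive; apply/funext => u; change (a + W (u *: om) - a = W (u *: om)); rewrite [a + _]addrC; exact: addrK.
  have d2 (t : R) : is_derive t (1 : R) (derive1 x) (derive1 (derive1 x) t).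
    by have [_ _ dx _] := sW t; rewrite derive1E; exact: derivableP.
  apply: (ode_lin_eq nr cW (G_CP bW) d1 d2) => t.
  have [_ _ _ ->] := sW t; rewrite algebra -/(G W (t *: om)); ring.
Qed.

End NonzeroAmplitude.

Lemma Hnorm0_eq0 (W : rV -> R) : in_H rho m W -> Hnorm rho m W <= 0 -> W = fun=> 0.
Proof.
move=> inW nW; have [cW hW] := in_HP (lexx 0) inW nW.
apply/funext => th; apply/eqP; rewrite -normr_le0.
by have := Hle_sup rho0 dm cW (lexx 0) hW th; rewrite mulr0.
Qed.

(** The threshold on eps is the one that makes |a| = (|eps| |f0|)^(1/l) smaller
    than a0, and A converts the radius eta |a| into a multiple of |eps|^(1/l). *)
Lemma response : exists eps0 A : R, [/\ 0 < eps0, 0 < A &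
  forall eps a delta : R, eps_range l f0 eps0 eps -> a ^+ l + eps * f0 = 0 ->
    0 <= delta ^+ 2 + 2 * l%:R * a ^+ l.-1 ->
    exists V, locally_unique_response l m rho om f h D delta eps a A V].
Proof.
have [e0 _ _ _ _] := eta_spec.
have i0 : 0 < `|f0| by rewrite normr_gt0.
have Q0 : 0 < Q.
  rewrite /Q; apply: mulr_gt0; first by apply: mulr_gt0 => //; rewrite ltr_wpDl ?exprn_ge0.
  by rewrite ltr_pwDl ?invr_ge0.
have Cp := Csup_gt0 (R := R) d m.
have a00 : 0 < a0.
  rewrite /a0 lt_min; apply/andP; split; apply: divr_gt0 => //; apply: mulr_gt0 => //; lra.
have l0 : (0 < l)%N by exact: ltnW.
have lR : l%:R != 0 :> R by rewrite pnatr_eq0 -lt0n.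
exists (a0 ^+ l / `|f0|), (eta * `|f0| `^ (l%:R^-1)); split.
- by rewrite divr_gt0 // exprn_gt0.
- by rewrite mulr_gt0 // powR_gt0.
move=> eps a delta er aeq damp.
have rad : eta * `|f0| `^ (l%:R^-1) * `|eps| `^ (l%:R^-1) = eta * `|a|.
  rewrite -mulrA -powRM // -normrM.
  have -> : `|f0 * eps| = `|a| ^+ l.
    have : eps * f0 = - a ^+ l by apply/eqP; rewrite -addr_eq0 addrC aeq.
    by rewrite [f0 * _]mulrC => ->; rewrite normrN normrX.
  by rewrite -powR_mulrn // -powRrM mulfV // powRr1.
have [a_eq0|an0] := eqVneq a 0.
- have eps_eq0 : eps = 0.
    by move: aeq; rewrite a_eq0 expr0n (gtn_eqF l0) /= => /eqP; rewrite add0r mulf_eq0 (negbTE f00) orbF => /eqP.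
  exists (fun=> 0); rewrite /locally_unique_response /= rad a_eq0 normr0 mulr0; split; last first.
    by move=> W [inW nW _]; exact: Hnorm0_eq0.
  have [h1 h2] := in_H_of_Hle (lexx 0) (CP_cst d 0) (Hle_cst rho m (0 : R) (d := d)).
  split=> // t; have dz : forall t : R, is_derive t (1 : R) (fun _ : R => 0 + 0 : R) 0.
    by move=> u; exact: is_derive_cst.
  have dz' : forall t : R, is_derive t (1 : R) (fun _ : R => 0 : R) 0 by move=> u; exact: is_derive_cst.
  have [e1 e2] := derive_of_is_derive dz; have [e3 e4] := derive_of_is_derive dz'.
  rewrite e2 e4; split=> //; first by apply: sD; rewrite addr0 normr0 ltW.
  have [_ _ h0 _] := adm.
  by rewrite addr0 eps_eq0 h0 mul0r mulr0 expr0n (gtn_eqF l0) /= !addr0.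
- have al : `|a| < a0.
    have : `|a| ^+ l < a0 ^+ l.
      have -> : `|a| ^+ l = `|eps| * `|f0|.
        have : eps * f0 = - a ^+ l by apply/eqP; rewrite -addr_eq0 addrC aeq.
        by rewrite -normrM => ->; rewrite normrN normrX.
      rewrite -ltr_pdivlMr //.
      move: er; rewrite /eps_range; case: ifP => _; first by rewrite /= -ltr_norml.
      by case: ifP => _ /= /andP[h1 h2]; rewrite ltr_norml; apply/andP; split; lra.
    by rewrite ltr_pXn2r ?nnegrE ?(ltW a00).
  have [V [inV nV sV uV]] := nonzero_response aeq an0 al damp.
  exists V; rewrite /locally_unique_response /= rad; split=> // W [w1 w2 w3]; exact: uV.
Qed.

End Fixed.
End Response.
(** * Functions of an angle and an amplitude *)

Section Slope.
Context {R : realType}.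

(** The epsilon form of the derivative, without division, is what limits of sums and
    compositions need. *)
Lemma is_derive_slope (f : R -> R) (x D : R) :
  (forall e : R, 0 < e -> exists2 dl : R, 0 < dl & forall h : R, `|h| < dl ->
     `|f (x + h) - f x - h * D| <= e * `|h|) -> is_derive x (1 : R) f D.
Proof.
move=> H.
suff cv : h^-1 *: (f (h *: (1 : R) + x) - f x) @[h --> (0 : R)^'] --> D.
  by apply: DeriveDef; [apply/cvg_ex; exists D|exact: cvg_lim].
apply/cvgrPdist_le => e e0; have [dl dl0 hd] := H e e0.
near=> h.
have h0 : h != 0 by near: h; exact: nbhs_dnbhs_neq.
have hh : `|h| < dl by near: h; apply: dnbhs0_lt.
have := hd h hh; rewrite /GRing.scale /= mulr1 [h + x]addrC => h1.
rewrite distrC -(ler_pM2r (_ : 0 < `|h|)) ?normr_gt0 // -normrM mulrBl mulrAC mulVf // mul1r.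
by rewrite [D * h]mulrC.
Unshelve. all: by end_near.
Qed.

End Slope.

Section Amplitude.
Context {R : realType} {d : nat}.
Local Notation rV := 'rV[R]_d.
Local Notation Zd := 'rV[int]_d.
Local Notation mean := (@torus_mean R d).

Lemma pair_near (g : rV * R -> R) (th : rV) (x e : R) : {for (th, x), continuous g} -> 0 < e ->
  exists2 dl : R, 0 < dl & forall (th' : rV) (x' : R), (forall j, `|th 0 j - th' 0 j| < dl) ->
    `|x - x'| < dl -> `|g (th, x) - g (th', x')| < e.
Proof.
move=> gc e0.
have /= := @cvgr_dist_lt _ _ _ _ _ _ _ gc e e0.
case=> -[A B] /= [/nbhs_ballP[d1 /= d10 hA] /nbhs_ballP[d2 /= d20 hB]] sub.
exists (Num.min d1 d2); first by rewrite lt_min d10.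
move=> th' x' h hx; apply: (sub (th', x')); split=> /=.
  apply: hA; rewrite /ball/=; split=> // i j; rewrite ord1.
  by apply: lt_le_trans (h j) _; rewrite ge_min lexx.
by apply: hB; apply: lt_le_trans hx _; rewrite ge_min lexx orbT.
Qed.

(** An angle that depends on one more angle through its sine: this turns
    boundedness for |x| <= 1 into boundedness on a torus of one more dimension. *)
Lemma strip_bounded (g : rV * R -> R) : continuous g ->
  (forall x, torus_periodic (fun th => g (th, x))) ->
  exists2 M, 0 < M & forall th x, `|x| <= 1 -> `|g (th, x)| <= M.
Proof.
move=> gc gp.
pose G (z : 'rV[R]_d.+1) := g (\row_j z 0 (lift ord0 j), sin (z 0 ord0)).
have cG : CP G.
  split; last first.
    move=> k z; rewrite /G mxE [period id k 0 _]mxE sinDint.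
    rewrite -[RHS](gp _ (\row_j k 0 (lift ord0 j))); congr (g (_, _)).
    by apply/rowP => j; rewrite !mxE.
  apply: rV_continuous => z e e0.
  have [dl dl0 hd] := pair_near (gc (\row_j z 0 (lift ord0 j), sin (z 0 ord0))) e0.
  exists dl => // z' hz; apply: hd => [j|]; first by rewrite !mxE.
  apply: le_lt_trans (hz ord0).
  have := @derive_lipschitz R sin cos (z' 0 ord0) (z 0 ord0) 1 (fun x => is_derive_sin x) (fun x _ => cos_max x).
  by rewrite mul1r.
have [M M0 hM] := CP_bounded cG; exists M => // th x x1.
have := hM (consrv (asin x) th); rewrite /G consrv0 asinK ?in_itv /= -?ler_norml //.
by congr (`|g (_, _)| <= _); apply/rowP => j; rewrite mxE consrvS.
Qed.

Definition pder j (g gj gx : rV * R -> R) :=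
  (forall th x, is_derive (0 : R) (1 : R) (fun t : R => g (th + t *: evec j, x)) (gj (th, x))) /\
  (forall th x, is_derive x (1 : R) (fun y : R => g (th, y)) (gx (th, x))).

Lemma chain_rule j g gj gx (X X' : rV -> R) : pder j g gj gx -> continuous gj -> CP X -> ider j X X' ->
  ider j (fun th => g (th, X th)) (fun th => gj (th, X th) + gx (th, X th) * X' th).
Proof.
move=> [dj dx] cj cX dX th.
pose psi (t : R) := g (th + t *: evec j, X (th + t *: evec j)) - g (th, X (th + t *: evec j)).
have d1 : is_derive (0 : R) (1 : R) psi (gj (th, X th)).
  apply: is_derive_slope => e e0.
  have [dl dl0 hd] := pair_near (cj (th, X th)) e0.
  have [dl' dl'0 hd'] := near_continuous th cX.1 dl0.
  exists (Num.min dl dl'); first by rewrite lt_min dl0.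
  move=> h; rewrite lt_min => /andP[h1 h2].
  have cl (c t : R) : `|t| < c -> forall i, `|th 0 i - (th + t *: evec j) 0 i| < c.
    move=> tc i; rewrite !mxE opprD addNKr normrN normrM.
    apply: le_lt_trans tc; rewrite -[leRHS]mulr1 ler_wpM2l //.
    by case: (_ && _); rewrite ?normr1 ?normr0.
  have X0 := hd' _ (cl _ _ h2).
  rewrite add0r /psi scale0r addr0 subrr subr0.
  have dd : forall t : R, is_derive t (1 : R) (fun t => g (th + t *: evec j, X (th + h *: evec j)))
      (gj (th + t *: evec j, X (th + h *: evec j))).
    apply: (@is_derive_ider R d j (fun u => g (u, X (th + h *: evec j))) (fun u => gj (u, X (th + h *: evec j)))).
    by move=> u; exact: dj.
  have [c hc] := MVT_between 0 h dd; rewrite scale0r addr0 subr0 => ->.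
  rewrite mulrC -mulrBr normrM mulrC ler_wpM2r // distrC; apply/ltW/hd => //.
  apply: cl; apply: le_lt_trans h1; move: hc; rewrite ler_norml; have [h0|h0] := lerP 0 h => /andP[a1 a2].
    by rewrite (ger0_norm h0); apply/andP; split=> //; lra.
  by rewrite (ltr0_norm h0) opprK; apply/andP; split=> //; lra.
have d2 : is_derive (0 : R) (1 : R) (fun t : R => g (th, X (th + t *: evec j))) (gx (th, X th) * X' th).
  have := @is_derive1_comp R (fun y => g (th, y)) (fun t => X (th + t *: evec j)) 0 _ _ _ (dX th).
  by rewrite scale0r addr0; apply; exact: dx.
have := is_deriveD d1 d2; congr is_derive; apply/funext => t.
by rewrite /psi /= subrK.
Qed.

(** Control of all mixed derivatives in theta_j and x up to order n, for |x| <= s0,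
    by M |x|^q, each derivative in x lowering q by one. *)
Fixpoint ctrl j (s0 M : R) n q (g : rV * R -> R) : Prop :=
  [/\ continuous g, forall x, torus_periodic (fun th => g (th, x)) &
      forall th x, `|x| <= s0 -> `|g (th, x)| <= M * `|x| ^+ q] /\
  if n is n'.+1 then exists gj gx, [/\ pder j g gj gx, ctrl j s0 M n' q gj & ctrl j s0 M n' q.-1 gx] else True.

Lemma ctrl_base j s0 M n q g : ctrl j s0 M n q g -> [/\ continuous g, forall x, torus_periodic (fun th => g (th, x)) &
      forall th x, `|x| <= s0 -> `|g (th, x)| <= M * `|x| ^+ q].
Proof. by case: n => [|n] []. Qed.

Lemma ctrl_pred j s0 M n q g : ctrl j s0 M n.+1 q g -> ctrl j s0 M n q g.
Proof.
elim: n q g => [|n IH] q g [h1 h2]; split=> //.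
by have [gj [gx [p h3 h4]]] := h2; exists gj, gx; split=> //; exact: IH.
Qed.

Lemma ctrl_weaken j s0 s1 M M' n q g : s1 <= s0 -> M <= M' -> ctrl j s0 M n q g -> ctrl j s1 M' n q g.
Proof.
move=> ss MM; elim: n q g => [|n IH] q g [[c p b] h2]; (split; first (split=> // th x hx;
  apply: le_trans (b th x (le_trans hx ss)) _; rewrite ler_wpM2r ?exprn_ge0 //)) => //.
by have [gj [gx [pd h3 h4]]] := h2; exists gj, gx; split=> //; exact: IH.
Qed.

Lemma ctrl_lip j s0 M n q g th x y s : 0 <= M -> ctrl j s0 M n.+1 q.+1 g -> s <= s0 -> `|x| <= s -> `|y| <= s ->
  `|g (th, x) - g (th, y)| <= M * s ^+ q * `|x - y|.
Proof.
move=> M0 [_ [gj [gx [[_ dx] _ cx]]]] ss hx hy; have [_ _ b] := ctrl_base cx.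
apply: (derive_lipschitz (dx th)) => z.
rewrite ge_min le_max => zz; have zs : `|z| <= s.
  by move: hx hy zz; rewrite !ler_norml => /andP[? ?] /andP[? ?] /andP[/orP[] ? /orP[] ?]; apply/andP; split; lra.
apply: le_trans (b th z (le_trans zs ss)) _; rewrite ler_wpM2l // lerXn2r ?nnegrE //.
exact: le_trans (normr_ge0 z) zs.
Qed.

Lemma ctrl_CP j s0 M n q g V : ctrl j s0 M n q g -> CP V -> CP (fun th => g (th, V th)).
Proof.
move=> /ctrl_base[gc gp _] [Vc Vp]; split; last by move=> k th; rewrite Vp gp.
apply: rV_continuous => th e e0; have [dl dl0 hd] := pair_near (gc (th, V th)) e0.
have [dl' dl'0 hd'] := near_continuous th Vc dl0.
exists (Num.min dl dl'); first by rewrite lt_min dl0.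
move=> th' h; apply: hd => [j'|]; first by have := h j'; rewrite lt_min => /andP[].
by apply: hd' => j'; have := h j'; rewrite lt_min => /andP[].
Qed.

End Amplitude.

(** * Composition in Sobolev spaces *)

Section Composition.
Context {R : realType}.
Variables (d m : nat).
Hypothesis dm : (d < 2 * m)%N.
Local Notation rV := 'rV[R]_d.
Local Notation Zd := 'rV[int]_d.
Local Notation mean := (@torus_mean R d).
Local Notation Hle := (@Hle R d 0).
Local Notation Cs := (Csup (R := R) d m).
Local Notation K := (Kconv (R := R) d m).

(** Only the derivative of highest order is bounded; the lower ones are recorded to exist and to
    be continuous. *)
Fixpoint Dle j n (F : rV -> R) (B : R) : Prop := CP F /\
  if n is n'.+1 then exists2 F', ider j F F' & Dle j n' F' B else mean (fun th => F th ^+ 2) <= B.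

Lemma Dle_CP j n F B : Dle j n F B -> CP F.
Proof. by case: n => [|n] []. Qed.

Lemma Dle_weaken j n F B B' : B <= B' -> Dle j n F B -> Dle j n F B'.
Proof.
move=> BB; elim: n F => [|n IH] F [cF h]; split=> //; first exact: le_trans BB.
by have [F' h1 h2] := h; exists F' => //; exact: IH.
Qed.

Lemma DleD j n F G A B : Dle j n F A -> Dle j n G B -> Dle j n (fun th => F th + G th) (2 * (A + B)).
Proof.
elim: n F G => [|n IH] F G [cF hF] [cG hG]; (split; first exact: CPD).
  have c2 : CP (fun th => F th ^+ 2) by exact: CPX.
  have c3 : CP (fun th => G th ^+ 2) by exact: CPX.
  apply: le_trans (_ : 2 * (mean (fun th => F th ^+ 2) + mean (fun th => G th ^+ 2)) <= _); last first.
    by rewrite ler_wpM2l // lerD.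
  rewrite -meanD // -meanZ; last exact: CPD.
  apply: mean_le; [by apply: CPX; exact: CPD|by apply: CPZ; exact: CPD|].
  by move=> th; have := sqr_ge0 (F th - G th); rewrite !expr2; lra.
have [F' f1 f2] := hF; have [G' g1 g2] := hG.
exists (fun th => F' th + G' th); last exact: IH.
by move=> th; apply: is_deriveD.
Qed.

(** Repeated integration by parts, then Bessel's inequality for the last derivative. *)
Lemma Dle_coef j n F B X : Dle j n F B -> uniq X ->
  \sum_(k <- X) (fc F k ^+ 2 + fs F k ^+ 2) * ((k 0 j)%:~R ^+ 2) ^+ n <= B.
Proof.
move=> + uX; elim: n F => [|n IH] F [cF hF].
  by apply: le_trans hF; apply: le_trans (bessel cF uX); apply: ler_sum => k _; rewrite expr0 mulr1.
have [F' f1 f2] := hF; apply: le_trans (IH F' f2).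
apply: ler_sum => k _; have [-> ->] := coef_ider k cF (Dle_CP f2) f1.
by rewrite [_ ^+ n.+1]exprS; set z := (_ ^+ 2) ^+ n; rewrite le_eqVlt; apply/orP; left; apply/eqP; ring.
Qed.

(** The largest coordinate of k controls the whole of k. *)
Lemma jb_le_coord (k : Zd) (j0 : 'I_d) : exists j : 'I_d, jb k <= (1 + d%:R ^+ 2) * Num.max 1 ((k 0 j)%:~R ^+ 2) :> R.
Proof.
have [j hj] : exists j, forall i, (`|k 0%R i| <= `|k 0%R j|)%N.
  by case: (@arg_maxnP _ j0 xpredT (fun i => `|k 0%R i|%N) isT) => j _ hj; exists j => i; exact: hj.
exists j; rewrite /jb.
have h : (norm1 k <= d * `|k 0%R j|)%N.
  apply: (@leq_trans (\sum_(i < d) `|k 0%R j|)); first by apply: leq_sum => i _; exact: hj.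
  by rewrite sum_nat_const card_ord.
have h2 : (norm1 k)%:R ^+ 2 <= d%:R ^+ 2 * ((k 0 j)%:~R ^+ 2) :> R.
  rewrite -exprMn -[leRHS]real_normK ?num_real // normrM normr_nat -intr_norm -abszE.
  by rewrite -natrM lerXn2r ?nnegrE // ler_nat.
have d0 : 0 <= d%:R ^+ 2 :> R by rewrite sqr_ge0.
rewrite mulrDl mul1r addrC; apply: lerD; first by rewrite le_max lexx.
by apply: le_trans h2 _; rewrite ler_wpM2l // le_max lexx orbT.
Qed.

(** The derivatives in the directions of the axes suffice. *)
Lemma Hle_of_Dle F B : (0 < d)%N -> CP F -> (forall j, Dle j m F B) -> (forall th, F th ^+ 2 <= B) ->
  Hle m F ((1 + d%:R ^+ 2) ^+ m * (d.+1%:R * B)).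
Proof.
move=> d0 cF hD h0 X uX.
have C0 : 0 <= (1 + d%:R ^+ 2) ^+ m :> R by rewrite exprn_ge0 // addr_ge0 ?sqr_ge0.
pose E k := fc F k ^+ 2 + fs F k ^+ 2.
have E0 k : 0 <= E k by rewrite addr_ge0 ?sqr_ge0.
apply: (@le_trans _ _ (\sum_(k <- X) (1 + d%:R ^+ 2) ^+ m * (E k + \sum_(j < d) E k * ((k 0 j)%:~R ^+ 2) ^+ m))).
  apply: ler_sum => k _; rewrite -/(E k) /wt mulr0 mul0r expR0 mul1r.
  have [j hj] := jb_le_coord k (Ordinal d0).
  apply: (@le_trans _ _ (E k * ((1 + d%:R ^+ 2) * Num.max 1 ((k 0 j)%:~R ^+ 2)) ^+ m)).
    rewrite ler_wpM2l // lerXn2r ?nnegrE ?(ltW (jb_gt0 k)) // (le_trans _ hj) // ltW // jb_gt0.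
  rewrite exprMn mulrCA ler_wpM2l // (bigD1 j) //= addrA.
  have r0 : 0 <= \sum_(i < d | i != j) E k * ((k 0 i)%:~R ^+ 2) ^+ m.
    by apply: sumr_ge0 => i _; rewrite mulr_ge0 // exprn_ge0 ?sqr_ge0.
  apply: le_trans (_ : _ <= E k + E k * ((k 0 j)%:~R ^+ 2) ^+ m) _; last by rewrite lerDl.
  rewrite maxEle; case: ifP => _; first by rewrite lerDr.
  by rewrite expr1n mulr1 lerDl mulr_ge0 // exprn_ge0 ?sqr_ge0.
rewrite -mulr_sumr ler_wpM2l // big_split /= -natr1 mulrDl mul1r addrC; apply: lerD.
  rewrite exchange_big /= -[leRHS](_ : \sum_(j < d) B = _); last by rewrite sumr_const card_ord mulr_natl.
  by apply: ler_sum => j _; exact: (Dle_coef (hD j)).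
apply: le_trans (bessel cF uX) _; apply: (@le_trans _ _ (mean (fun=> B))); last by rewrite mean_cst.
by apply: mean_le => //; [exact: CPX|exact: CP_cst].
Qed.

Lemma Hle_ider j n P P' B : CP P -> CP P' -> ider j P P' -> Hle n.+1 P B -> Hle n P' B.
Proof.
move=> cP cP' hP h X uX; apply: le_trans (h X uX); apply: ler_sum => k _.
have [-> ->] := coef_ider k cP cP' hP; rewrite /wt [_ ^+ n.+1]exprS.
have -> : ((k 0 j)%:~R * fs P k) ^+ 2 + (- (k 0 j)%:~R * fc P k) ^+ 2 = (fc P k ^+ 2 + fs P k ^+ 2) * ((k 0 j)%:~R ^+ 2) :> R by ring.
rewrite -mulrA; apply: ler_wpM2l; first by rewrite addr_ge0 ?sqr_ge0.
rewrite mulrCA ler_wpM2l ?expR_ge0 // ler_wpM2r ?exprn_ge0 ?(ltW (jb_gt0 k)) //.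
have : (k 0 j)%:~R ^+ 2 <= (norm1 k)%:R ^+ 2 :> R.
  rewrite -[leLHS]real_normK ?num_real // -intr_norm -abszE lerXn2r ?nnegrE //.
  by rewrite ler_nat norm1_ge.
by rewrite /jb; lra.
Qed.

Lemma ider_tp j (X : seq Zd) (al be : Zd -> R) : ider j (tp X al be)
  (tp X (fun k => (k 0 j)%:~R * be k) (fun k => - (k 0 j)%:~R * al k)).
Proof.
rewrite /tp; elim: X => [|k X IH] th.
  rewrite big_nil; under eq_fun do rewrite big_nil; exact: is_derive_cst.
rewrite big_cons; under eq_fun do rewrite big_cons.
apply: is_deriveD; last exact: IH.
have := is_deriveD (is_deriveZ (al k) (ider_cos k j th)) (is_deriveZ (be k) (ider_sin k j th)).
by move/is_derive_eq; apply; rewrite /GRing.scale /=; ring.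
Qed.

Definition Ld : R := 6 + 32 * K.

Lemma Ld_ge1 : 1 <= Ld.
Proof. by rewrite /Ld; have := Kconv_gt0 (R := R) d m; lra. Qed.

(** The induction behind the composition estimate: differentiating g(th, V) P
    gives three terms of the same form, the factor P absorbing the derivatives
    of V by the product estimate. *)
Lemma Dle_comp j X al be a (u s0 M : R) n : (0 < m)%N -> uniq X -> 0 <= M -> 0 <= u -> u <= 1 -> u <= s0 -> (n <= m)%N ->
  \sum_(k <- X) (al k ^+ 2 + be k ^+ 2) * wt 0 m k <= u ^+ 2 ->
  (forall th, `|a + tp X al be th| <= u) ->
  forall q g P B, ctrl j s0 M n q g -> trig P -> Hle n P B ->
  Dle j n (fun th => g (th, a + tp X al be th) * P th) (Ld ^+ n * (M ^+ 2 * (u ^+ 2) ^+ q * B)).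
Proof.
move=> m0 uX M0 u0 u1 us nm hV hsup; set V := tp X al be.
have tV : trig V := trig_tp X al be.
have caV : CP (fun th => a + V th) by apply: CPD; [exact: CP_cst|exact: CP_tp].
have M2 : 0 <= M ^+ 2 by exact: sqr_ge0.
have L1 := Ld_ge1; have L0 : 0 <= Ld by lra.
elim: n nm => [|n IH] nm q g P B cg tP hP.
  have cP := trig_CP tP; have cgV := ctrl_CP cg caV.
  split; first exact: CPM.
  have [_ _ b] := ctrl_base cg.
  have p2 : mean (fun th => P th ^+ 2) <= B.
    apply: parseval_le => // Y uY; apply: le_trans (hP Y uY); apply: ler_sum => k _.
    by rewrite ler_peMr ?addr_ge0 ?sqr_ge0 // (wt_ge1 (lexx 0)).
  have U0 : 0 <= M ^+ 2 * (u ^+ 2) ^+ q by rewrite mulr_ge0 // exprn_ge0 // sqr_ge0.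
  rewrite expr0 mul1r; apply: le_trans (ler_wpM2l U0 p2); rewrite -meanZ; last exact: CPX.
  apply: mean_le; [by apply: CPX; exact: CPM|by apply: CPZ; exact: CPX|move=> th].
  rewrite exprMn ler_wpM2r ?sqr_ge0 // -exprM mulnC exprM -exprMn -[leLHS]real_normK ?num_real //.
  rewrite lerXn2r ?nnegrE ?mulr_ge0 ?exprn_ge0 //.
  apply: le_trans (b _ _ (le_trans (hsup th) us)) _; rewrite ler_wpM2l // lerXn2r ?nnegrE //.
have B0 := Hle_ge0 hP.
have cP := trig_CP tP.
have [[gc gp gb] [gj [gx [pd cj cx]]]] := cg.
have [P' [tP' dP _]] := trig_derive j tP.
pose V' := tp X (fun k => (k 0 j)%:~R * be k) (fun k => - (k 0 j)%:~R * al k).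
have dV : ider j V V' := ider_tp j X al be.
have tV' : trig V' := trig_tp _ _ _.
have daV : ider j (fun th => a + V th) V'.
  by move=> th; have := is_deriveD (is_derive_cst a (0 : R) (1 : R)) (dV th); rewrite add0r.
have [jc _ _] := ctrl_base cj.
have ch := iderM (chain_rule pd jc caV daV) dP.
split; first by apply: CPM => //; exact: (ctrl_CP cg caV).
have W2 : (wt 0 m.-1 : Zd -> R) = (wt 0 m.-1) by [].
have hV' : \sum_(k <- X) (((k 0 j)%:~R * be k) ^+ 2 + (- (k 0 j)%:~R * al k) ^+ 2) * wt 0 m.-1 k <= u ^+ 2.
  apply: le_trans hV; apply: ler_sum => k _.
  have -> : ((k 0 j)%:~R * be k) ^+ 2 + (- (k 0 j)%:~R * al k) ^+ 2 = (al k ^+ 2 + be k ^+ 2) * ((k 0 j)%:~R ^+ 2) :> R by ring.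
  rewrite -mulrA; apply: ler_wpM2l; first by rewrite addr_ge0 ?sqr_ge0.
  rewrite -[in leRHS](prednK m0) /wt [_ ^+ m.-1.+1]exprS mulrCA ler_wpM2l ?expR_ge0 // ler_wpM2r ?exprn_ge0 ?(ltW (jb_gt0 k)) //.
  have : (k 0 j)%:~R ^+ 2 <= (norm1 k)%:R ^+ 2 :> R.
    rewrite -[leLHS]real_normK ?num_real // -intr_norm -abszE lerXn2r ?nnegrE //.
    by rewrite ler_nat norm1_ge.
  by rewrite /jb; lra.
have hVP : Hle n (fun th => V' th * P th) (8 * K * (u ^+ 2 * B)).
  have := Hle_tp_mul (lexx 0) dm (leq_pred m) nm _ uX cP hV' hP.
  have e : (m.-1 + n.+1 - m = n)%N by rewrite addnS -addSn prednK // addKn.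
  by rewrite e; apply; rewrite addnS -addSn prednK // leq_addr.
have hP1 : Hle n P B.
  move=> Y uY; apply: le_trans (hP Y uY); apply: ler_sum => k _.
  rewrite ler_wpM2l ?addr_ge0 ?sqr_ge0 // /wt ler_wpM2l ?expR_ge0 // ler_weXn2l //; exact: jb_ge1.
have hP' : Hle n P' B := Hle_ider cP (trig_CP tP') dP hP.
have D1 := IH (ltnW nm) _ _ _ _ cj tP hP1.
have D2 := IH (ltnW nm) _ _ _ _ cx (trigM tV' tP) hVP.
have D3 := IH (ltnW nm) _ _ _ _ (ctrl_pred cg) tP' hP'.
exists (fun th => (gj (th, a + V th) * P th + gx (th, a + V th) * (V' th * P th)) + g (th, a + V th) * P' th).
  by move=> th; have := ch th; congr is_derive; ring.
apply: Dle_weaken (DleD (DleD D1 D2) D3).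
have U0 : 0 <= (u ^+ 2) ^+ q by rewrite exprn_ge0 // sqr_ge0.
have Uq : (u ^+ 2) ^+ q.-1 * u ^+ 2 <= (u ^+ 2) ^+ q.
  case: (q) => [|q'] /=; last by rewrite -exprSr.
  by rewrite expr0 mul1r -[leRHS](expr1n R 2) lerXn2r ?nnegrE.
have K0 := Kconv_gt0 (R := R) d m.
have T : Ld ^+ n * (M ^+ 2 * (u ^+ 2) ^+ q.-1 * (8 * K * (u ^+ 2 * B))) <= Ld ^+ n * (M ^+ 2 * (u ^+ 2) ^+ q * B) * (8 * K).
  have -> : Ld ^+ n * (M ^+ 2 * (u ^+ 2) ^+ q.-1 * (8 * K * (u ^+ 2 * B))) =
     (Ld ^+ n * M ^+ 2 * B * (8 * K)) * ((u ^+ 2) ^+ q.-1 * u ^+ 2) by ring.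
  have -> : Ld ^+ n * (M ^+ 2 * (u ^+ 2) ^+ q * B) * (8 * K) = (Ld ^+ n * M ^+ 2 * B * (8 * K)) * (u ^+ 2) ^+ q by ring.
  apply: (ler_wpM2l _ Uq).
  exact: (mulr_ge0 (mulr_ge0 (mulr_ge0 (exprn_ge0 _ L0) M2) B0) (mulr_ge0 (ler0n _ _) (ltW K0))).
have Z0 : 0 <= Ld ^+ n * (M ^+ 2 * (u ^+ 2) ^+ q * B).
  exact: (mulr_ge0 (exprn_ge0 _ L0) (mulr_ge0 (mulr_ge0 M2 U0) B0)).
have fin (x y k : R) : x <= y * (8 * k) -> 0 <= y -> 2 * (2 * (y + x) + y) <= (6 + 32 * k) * y by lra.
rewrite (_ : Ld ^+ n.+1 * _ = Ld * (Ld ^+ n * (M ^+ 2 * (u ^+ 2) ^+ q * B))); last by rewrite [Ld ^+ n.+1]exprS -[LHS]mulrA.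
exact: fin T Z0.
Qed.

Definition Cc (q : nat) : R := Num.sqrt ((1 + d%:R ^+ 2) ^+ m * (d.+1%:R * (Ld ^+ m * ((1 + Cs) ^+ 2) ^+ q))).

(** Composition with an element of H^m, by truncation of its Fourier series. *)
Lemma Hle_comp s0 M q g a V s : (0 < d)%N -> 0 <= M -> (forall j, ctrl j s0 M m q.+1 g) -> 0 < s ->
  (1 + Cs) * s <= 1 -> (1 + Cs) * s <= s0 -> `|a| <= s -> CP V -> Hle m V (s ^+ 2) ->
  Hle m (fun th => g (th, a + V th)) ((Cc q.+1 * M * s ^+ q.+1) ^+ 2).
Proof.
move=> d0 M0 cg s0' u1 us sa cV hV.
have m0 : (0 < m)%N by rewrite lt0n; apply/eqP => m0; move: dm; rewrite m0 muln0.
have Cp := Csup_gt0 (R := R) d m.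
set u := (1 + Cs) * s in u1 us.
have u0 : 0 <= u by rewrite mulr_ge0 ?addr_ge0 // ltW.
have caV : CP (fun th => a + V th) by apply: CPD => //; exact: CP_cst.
have c0 := cg (Ordinal d0).
have habs := Hle_abs (lexx 0) dm (ltW s0') hV.
have hsV := Hle_sup (lexx 0) dm cV (ltW s0') hV.
have su (y : R) : `|y| <= Cs * s -> `|a + y| <= u.
  by move=> h; apply: le_trans (ler_normD _ _) _; rewrite /u mulrDl mul1r lerD.
apply: Hle_lim; first exact: ctrl_CP c0 caV.
move=> e e0; have e1 : 0 < e / (M + 1) by rewrite divr_gt0 // ltr_wpDl.
have [/(_ _ e1)[N /(_ N (leqnn _)) hN] _] := fourier_series cV habs.
set T := tp _ _ _ in hN; exists (fun th => g (th, a + T th)).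
  by apply: ctrl_CP c0 _; apply: CPD; [exact: CP_cst|exact: CP_tp].
have hT th : `|a + T th| <= u.
  by apply: su; apply: le_trans (tp_norm_le _ _ _ _) _; apply: habs; exact: uniq_box.
split=> [th|].
  move: c0; case: (m) m0 => // n _ c0.
  apply: le_trans (ctrl_lip th M0 c0 us (su _ (hsV th)) (hT th)) _.
  have -> : a + V th - (a + T th) = V th - T th by ring.
  have := hN th; rewrite ler_pdivlMr; last by rewrite ltr_wpDl.
  have : M * u ^+ q <= M by rewrite ler_piMr // exprn_ile1.
  have := normr_ge0 (V th - T th); move: (M * u ^+ q) `|V th - T th| => y z; nra.
have -> : (Cc q.+1 * M * s ^+ q.+1) ^+ 2 = (1 + d%:R ^+ 2) ^+ m * (d.+1%:R * (Ld ^+ m * (M ^+ 2 * (u ^+ 2) ^+ q.+1))).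
  rewrite [(_ * s ^+ _) ^+ 2]exprMn [(_ * M) ^+ 2]exprMn /Cc sqr_sqrtr; last first.
    have L0 : 0 <= Ld by have := Ld_ge1; lra.
    by apply: mulr_ge0; [rewrite exprn_ge0 // addr_ge0 ?sqr_ge0|apply: mulr_ge0 => //; apply: mulr_ge0; rewrite exprn_ge0 ?sqr_ge0].
  by rewrite /u [(_ * s) ^+ 2]exprMn [(_ * s ^+ 2) ^+ _]exprMn [(s ^+ q.+1) ^+ 2]exprAC; ring.
have hw : \sum_(k <- box d N) (fc V k ^+ 2 + fs V k ^+ 2) * wt 0 m k <= u ^+ 2.
  apply: le_trans (hV _ (uniq_box d N)) _; rewrite lerXn2r ?nnegrE ?(ltW s0') //.
  by rewrite /u ler_peMl ?(ltW s0') //; lra.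
apply: Hle_of_Dle => //.
- by apply: ctrl_CP c0 _; apply: CPD; [exact: CP_cst|exact: CP_tp].
- move=> j.
  have h1 : Hle m (fun=> 1) 1 by have := Hle_cst 0 m (1 : R) (d := d); rewrite expr1n.
  have := Dle_comp m0 (uniq_box d N) M0 u0 u1 us (leqnn m) hw hT (cg j) (trig_cst 1) h1.
  by rewrite mulr1; under eq_fun do rewrite mulr1.
- move=> th; have [_ _ b] := ctrl_base c0.
  have hb := b th (a + T th) (le_trans (hT th) us).
  apply: (@le_trans _ _ (M ^+ 2 * (u ^+ 2) ^+ q.+1)); last first.
    by rewrite ler_peMl ?mulr_ge0 ?sqr_ge0 ?exprn_ge0 ?sqr_ge0 // exprn_ege1 // Ld_ge1.
  rewrite -exprM mulnC exprM -exprMn -[leLHS]real_normK ?num_real // lerXn2r ?nnegrE ?mulr_ge0 ?exprn_ge0 //.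
  by apply: le_trans hb _; rewrite ler_wpM2l // lerXn2r ?nnegrE.
Qed.

End Composition.

(** * Smooth forcing terms *)

Lemma derive_congr (R : realType) (V W : normedModType R) (f : V -> R) (g : W -> R) a b v w :
  (forall t : R, f (t *: v + a) = g (t *: w + b)) -> 'D_v f a = 'D_w g b.
Proof.
move=> H; have e : f a = g b by have := H 0; rewrite !scale0r !add0r.
rewrite /derive (_ : (fun t : R => _) = fun t : R => t^-1 *: ((g \o shift b) (t *: w) - g b)) //.
by apply/funext => t /=; rewrite H e.
Qed.

Section Smooth.
Context {R : realType} {d : nat}.
Local Notation rV := 'rV[R]_d.
Local Notation E := (rV * R)%type.

Let ex : E := (0, 1).
Let ej (j : 'I_d) : E := (evec j, 0).

Lemma derive_line (g : E -> R) (p v : E) : derivable g p v ->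
  is_derive (0 : R) (1 : R) (fun t : R => g (p + t *: v)) ('D_v g p).
Proof.
move=> gd.
have cv : h^-1 *: (g (p + (h *: (1 : R) + 0) *: v) - g (p + (0 : R) *: v)) @[h --> (0 : R)^'] --> 'D_v g p.
  rewrite (_ : (fun h : R => _) = fun h : R => h^-1 *: ((g \o shift p) (h *: v) - g p)); first exact: gd.
  by apply/funext => h; rewrite /= scale0r !addr0 /GRing.scale /= mulr1 [_ + p]addrC.
by apply: DeriveDef; [apply/cvg_ex; exists ('D_v g p)|exact: cvg_lim].
Qed.

Lemma derive_amplitude (g : E -> R) th x : derivable g (th, x) ex ->
  is_derive x (1 : R) (fun y : R => g (th, y)) ('D_ex g (th, x)).
Proof.
move=> /derive_line; rewrite -{1}(addNr x) -[in - x + x](mul1r x) => /is_derive_affine.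
rewrite mulr1; congr is_derive; apply/funext => y; congr g.
by rewrite /ex; congr pair; rewrite /= ?scaler0 ?addr0 // mul1r /GRing.scale /=; ring.
Qed.

Lemma derive1_amplitude (g : E -> R) th x : derive1 (fun y : R => g (th, y)) x = 'D_ex g (th, x).
Proof.
rewrite derive1E; apply: derive_congr => t; congr g.
by rewrite /ex; congr pair; rewrite /= scaler0 add0r.
Qed.

Lemma dirD_pder n (f : E -> R) vs j : Cn_on n setT f -> (size vs < n)%N ->
  pder j (dirD vs f) (dirD (ej j :: vs) f) (dirD (ex :: vs) f).
Proof.
move=> hf sn; have [_ /(_ sn) hd] := hf vs (ltnW sn).
split=> th x; last by apply: derive_amplitude; exact: hd.
have := derive_line (hd (th, x) (ej j) I); congr is_derive; apply/funext => t; congr (dirD vs f).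
by rewrite /ej; congr pair; rewrite /= scaler0 addr0.
Qed.

Lemma dirD_continuous n (f : E -> R) vs : Cn_on n setT f -> (size vs <= n)%N -> continuous (dirD vs f).
Proof. by move=> hf sn p; have [h _] := hf vs sn; exact: h. Qed.

Lemma dirD_periodic (f : E -> R) vs : (forall x, torus_periodic (fun th => f (th, x))) ->
  forall x, torus_periodic (fun th => dirD vs f (th, x)).
Proof.
move=> fp; suff H (k : 'rV[int]_d) : forall p, dirD vs f (p + (period id k, 0)) = dirD vs f p.
  by move=> x k th; rewrite -[RHS](H k); congr (dirD vs f); congr pair; rewrite /= addr0.
elim: vs => [|v vs IH] [th x] /=.
  rewrite -[RHS](fp x k th); congr f; congr pair; by rewrite /= addr0.
by apply: derive_congr => t; rewrite addrA.
Qed.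

Lemma ctrl_bounded n0 (f : E -> R) j : Cn_torus n0 f -> forall n vs, (size vs + n <= n0)%N ->
  exists2 M, 0 <= M & ctrl j 1 M n 0 (dirD vs f).
Proof.
move=> [hf fp]; elim=> [|n IH] vs sn.
all: have sn' : (size vs <= n0)%N by apply: leq_trans sn; exact: leq_addr.
all: have cf := dirD_continuous hf sn'; have pf := dirD_periodic vs fp.
all: have [M M0 hM] := strip_bounded cf pf.
  by exists M; [exact: ltW|split=> //; split=> // th x hx; rewrite expr0 mulr1; exact: hM].
have sn1 : (size vs + n < n0)%N by rewrite -addnS.
have [M1 M10 h1] := IH (ej j :: vs) sn1; have [M2 M20 h2] := IH (ex :: vs) sn1.
exists (M + (M1 + M2)); first by rewrite !addr_ge0 // ltW.
split.
  split=> // th x hx; rewrite expr0 mulr1; apply: le_trans (hM th x hx) _.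
  by rewrite lerDl addr_ge0.
exists (dirD (ej j :: vs) f), (dirD (ex :: vs) f); split.
- by apply: (dirD_pder (n := n0)) => //; apply: leq_ltn_trans sn1; exact: leq_addr.
- by apply: ctrl_weaken (lexx _) _ h1; lra.
- by apply: ctrl_weaken (lexx _) _ h2; lra.
Qed.

(** Subtracting the value at x = 0 gains one order of vanishing; the mean value theorem consumes the
    extra derivative that f has beyond order m. *)
Lemma ctrl_increment n0 (f : E -> R) j : Cn_torus n0 f -> forall n vs, (size vs + n < n0)%N ->
  exists2 M, 0 <= M & ctrl j 1 M n 1 (fun p => dirD vs f p - dirD vs f (p.1, 0)).
Proof.
move=> hF; have [hf fp] := hF; move=> n vs.
have base vs0 : (size vs0 < n0)%N -> exists2 M, 0 <= M &
   [/\ continuous (fun p : E => dirD vs0 f p - dirD vs0 f (p.1, 0)),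
      forall x, torus_periodic (fun th => dirD vs0 f (th, x) - dirD vs0 f (th, 0)) &
      forall th x, `|x| <= 1 -> `|dirD vs0 f (th, x) - dirD vs0 f (th, 0)| <= M * `|x| ^+ 1].
  move=> sn; have cf := dirD_continuous hf (ltnW sn); have pf := dirD_periodic vs0 fp.
  have cf' := dirD_continuous (vs := ex :: vs0) hf sn; have pf' := dirD_periodic (ex :: vs0) fp.
  have [M M0 hM] := strip_bounded cf' pf'; exists M; first exact: ltW.
  split=> [p|x k th|th x x1].
  - apply: (@continuousB R R E _ _ p); first exact: cf.
    apply: (@continuous_comp E E R (fun p => (p.1, 0)) (dirD vs0 f) p); last exact: cf.
    by apply: (cvg_pair (F := nbhs p) (G := nbhs p.1) (H := nbhs (0 : R))); [exact: cvg_fst|exact: cvg_cst].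
  - by rewrite !pf.
  - have [_ dx] := dirD_pder j hf sn.
    rewrite expr1; have := derive_lipschitz (a := 0) (b := x) (M := M) (dx th); rewrite subr0; apply=> z.
    rewrite ge_min le_max => zz; apply: hM.
    by move: x1 zz; rewrite !ler_norml => /andP[? ?] /andP[/orP[] ? /orP[] ?]; apply/andP; split; lra.
elim: n vs => [|n IH] vs sn.
  have [|M M0 hM] := base vs; first by rewrite addn0 in sn.
  by exists M.
have sn0 : (size vs < n0)%N by apply: leq_ltn_trans sn; exact: leq_addr.
have sn1 : (size (ej j :: vs) + n < n0)%N by rewrite addSnnS.
have [M M0 [h1 h2 h3]] := base vs sn0.
have [M1 M10 c1] := IH (ej j :: vs) sn1.
have sn2 : (size (ex :: vs) + n <= n0)%N by rewrite addSnnS ltnW.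
have [M2 M20 c2] := ctrl_bounded j hF sn2.
exists (M + (M1 + M2)); first by rewrite !addr_ge0.
split.
  split=> // th x hx; apply: le_trans (h3 th x hx) _.
  by rewrite expr1 ler_wpM2r // lerDl addr_ge0.
exists (fun p => dirD (ej j :: vs) f p - dirD (ej j :: vs) f (p.1, 0)), (dirD (ex :: vs) f); split.
- have [dj dx] := dirD_pder j hf sn0; split=> th x.
    by exact: (is_deriveB (dj th x) (dj th 0)).
  by have := is_deriveB (dx th x) (is_derive_cst (dirD vs f (th, 0)) x (1 : R)); rewrite subr0.
- by apply: ctrl_weaken (lexx _) _ c1; lra.
- by apply: ctrl_weaken (lexx _) _ c2; lra.
Qed.

(** Equality of mixed partial derivatives, through the second difference. *)
Lemma schwarz (phi ph1 ph2 ph12 ph21 : R -> R -> R) (r a b : R) : 0 < r ->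
  (forall s t, `|s - a| < r -> `|t - b| < r -> is_derive s (1 : R) (phi^~ t) (ph1 s t)) ->
  (forall s t, `|s - a| < r -> `|t - b| < r -> is_derive t (1 : R) (phi s) (ph2 s t)) ->
  (forall s t, `|s - a| < r -> `|t - b| < r -> is_derive t (1 : R) (ph1 s) (ph12 s t)) ->
  (forall s t, `|s - a| < r -> `|t - b| < r -> is_derive s (1 : R) (ph2^~ t) (ph21 s t)) ->
  (forall e : R, 0 < e -> exists2 dl : R, 0 < dl & forall s t, `|s - a| < dl -> `|t - b| < dl ->
     `|ph12 a b - ph12 s t| < e /\ `|ph21 a b - ph21 s t| < e) -> ph12 a b = ph21 a b.
Proof.
move=> r0 d1 d2 d12 d21 cont; apply/eqP; rewrite -subr_eq0; apply/eqP/eps_eq0 => e e0.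
have [dl dl0 hd] := cont (e / 2) (divr_gt0 e0 (ltr0n R 2)).
pose h := Num.min dl r / 2.
have mn : 0 < Num.min dl r by rewrite lt_min dl0.
have h0 : 0 < h by rewrite divr_gt0.
have hdl : h < dl by apply: (@lt_le_trans _ _ (Num.min dl r)); [rewrite /h; lra|rewrite ge_min lexx].
have hr : h < r by apply: (@lt_le_trans _ _ (Num.min dl r)); [rewrite /h; lra|rewrite ge_min lexx orbT].
have nb (c x : R) : Num.min c (c + h) <= x <= Num.max c (c + h) -> `|x - c| <= h.
  by rewrite min_l ?max_r ?lerDl ?(ltW h0) // ler_norml => /andP[? ?]; apply/andP; split; lra.
have rr (c : R) : `|c - c| < r by rewrite subrr normr0.
have rh (c : R) : `|c + h - c| < r by rewrite addrC addKr gtr0_norm.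
have [s1 hs1 e1] : exists2 s1, `|s1 - a| <= h &
    phi (a + h) (b + h) - phi (a + h) b - (phi a (b + h) - phi a b) = (ph1 s1 (b + h) - ph1 s1 b) * h.
  have [|c hc] := @MVT_local R (fun s => phi s (b + h) - phi s b) (fun s => ph1 s (b + h) - ph1 s b) a (a + h).
    move=> x /nb hx; have hx' : `|x - a| < r by apply: le_lt_trans hr.
    by apply: is_deriveB; apply: d1.
  by rewrite [a + h - a]addrC addKr => E1; exists c => //; exact: nb.
have [t1 ht1 e2] : exists2 t1, `|t1 - b| <= h & ph1 s1 (b + h) - ph1 s1 b = ph12 s1 t1 * h.
  have hs : `|s1 - a| < r by apply: le_lt_trans hr.
  have [|c hc] := @MVT_local R (ph1 s1) (ph12 s1) b (b + h).
    by move=> x /nb hx; apply: d12 => //; apply: le_lt_trans hr.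
  by rewrite [b + h - b]addrC addKr => E1; exists c => //; exact: nb.
have [t2 ht2 e3] : exists2 t2, `|t2 - b| <= h &
    phi (a + h) (b + h) - phi (a + h) b - (phi a (b + h) - phi a b) = (ph2 (a + h) t2 - ph2 a t2) * h.
  have [|c hc] := @MVT_local R (fun t => phi (a + h) t - phi a t) (fun t => ph2 (a + h) t - ph2 a t) b (b + h).
    move=> x /nb hx; have hx' : `|x - b| < r by apply: le_lt_trans hr.
    by apply: is_deriveB; apply: d2.
  rewrite [b + h - b]addrC addKr => E1; exists c; first exact: nb.
  by rewrite -E1; ring.
have [s2 hs2 e4] : exists2 s2, `|s2 - a| <= h & ph2 (a + h) t2 - ph2 a t2 = ph21 s2 t2 * h.
  have hs : `|t2 - b| < r by apply: le_lt_trans hr.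
  have [|c hc] := @MVT_local R (ph2^~ t2) (ph21^~ t2) a (a + h).
    by move=> x /nb hx; apply: d21 => //; apply: le_lt_trans hr.
  by rewrite [a + h - a]addrC addKr => E1; exists c => //; exact: nb.
have eq : ph12 s1 t1 = ph21 s2 t2.
  by apply: (mulIf (lt0r_neq0 h0)); apply: (mulIf (lt0r_neq0 h0)); rewrite -e2 -e1 -e4 -e3.
have [q1 _] := hd s1 t1 (le_lt_trans hs1 hdl) (le_lt_trans ht1 hdl).
have [_ q2] := hd s2 t2 (le_lt_trans hs2 hdl) (le_lt_trans ht2 hdl).
move: q1 q2; rewrite eq !ltr_norml ler_norml => /andP[? ?] /andP[? ?]; apply/andP; split; lra.
Qed.

(** Vanishing of the iterated derivatives in x, phrased so that one derivative peels off one level. *)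
Fixpoint vanish q (g : E -> R) : Prop :=
  if q is q'.+1 then (forall th, g (th, 0) = 0) /\ vanish q' ('D_ex g) else True.

Section Local.
Variables (N : nat) (r : R) (h : E -> R).
Hypothesis r0 : 0 < r.
Let U : set E := [set p | `|p.2| < r].
Hypothesis hU : Cn_on N U h.

Lemma near_strip (th : rV) (x : R) : `|x| < r -> \forall p \near (th, x), U p.
Proof.
move=> xr; have c0 : 0 < r - `|x| by rewrite subr_gt0.
exists (setT, ball x (r - `|x|)) => /=.
  by split; [exact: filterT|exact: nbhsx_ballx].
move=> [th' x'] [_ /= h1]; rewrite /U /=; have := ler_normD x (x' - x); rewrite addrC subrK distrC.
by move: h1; rewrite /ball /=; lra.
Qed.

Lemma vanish_ext q g g' : (forall th x, `|x| < r -> g (th, x) = g' (th, x)) -> vanish q g -> vanish q g'.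
Proof.
elim: q g g' => [//|q IH] g g' e [h1 h2]; split; first by move=> th; rewrite -e ?normr0.
apply: IH h2 => th x xr; apply: near_eq_derive; apply: filterS (near_strip th xr) => -[th' x'] h'.
exact: e.
Qed.

Lemma derive_angle (g : E -> R) j (th : rV) (s x : R) : derivable g (th + s *: evec j, x) (ej j) ->
  is_derive s (1 : R) (fun s : R => g (th + s *: evec j, x)) ('D_(ej j) g (th + s *: evec j, x)).
Proof.
move=> /derive_line; rewrite -{1}(addNr s) -[in - s + s](mul1r s) => /is_derive_affine.
rewrite mulr1; congr is_derive; apply/funext => y; congr g.
rewrite /ej; congr pair; rewrite /= ?scaler0 ?addr0 // -addrA -scalerDl mul1r; congr (_ + _ *: _); ring.
Qed.

Lemma mixed j vs (th : rV) (x : R) : (size vs + 2 <= N)%N -> `|x| < r ->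
  dirD (ej j :: ex :: vs) h (th, x) = dirD (ex :: ej j :: vs) h (th, x).
Proof.
rewrite addn2 => sN xr; set g := dirD vs h.
have s1 : (size vs < N)%N by exact: ltn_trans (ltnSn _) sN.
have [_ /(_ s1) dg] := hU (ltnW s1).
have [_ /(_ sN) dgx] := @hU (ex :: vs) s1.
have [_ /(_ sN) dgj] := @hU (ej j :: vs) s1.
have [cxj _] := @hU (ex :: ej j :: vs) sN.
have [cjx _] := @hU (ej j :: ex :: vs) sN.
have r'0 : 0 < r - `|x| by rewrite subr_gt0.
have inU s t : `|t - x| < r - `|x| -> U (th + s *: evec j, t).
  by move=> h1; rewrite /U /=; have := ler_normD (t - x) x; rewrite subrK; lra.
have := @schwarz (fun s t => g (th + s *: evec j, t)) (fun s t => 'D_(ej j) g (th + s *: evec j, t))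
  (fun s t => 'D_ex g (th + s *: evec j, t)) (fun s t => 'D_ex ('D_(ej j) g) (th + s *: evec j, t))
  (fun s t => 'D_(ej j) ('D_ex g) (th + s *: evec j, t)) (r - `|x|) 0 x r'0.
rewrite scale0r addr0 => H; apply/esym/H => {H}.
- by move=> s t _ ht; apply: derive_angle; apply: dg; exact: inU.
- by move=> s t _ ht; apply: derive_amplitude; apply: dg; exact: inU.
- by move=> s t _ ht; apply: derive_amplitude; apply: dgj; exact: inU.
- by move=> s t _ ht; apply: derive_angle; apply: dgx; exact: inU.
move=> e e0.
have [d1 d10 h1] := pair_near (cxj (th, x) xr) e0; have [d2 d20 h2] := pair_near (cjx (th, x) xr) e0.
exists (Num.min d1 d2); first by rewrite lt_min d10.
have cl (c t : R) : `|t| < c -> forall i, `|th 0 i - (th + t *: evec j) 0 i| < c.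
  move=> tc i; rewrite !mxE opprD addNKr normrN normrM.
  apply: le_lt_trans tc; rewrite -[leRHS]mulr1 ler_wpM2l //.
  by case: (_ && _); rewrite ?normr1 ?normr0.
move=> s t; rewrite subr0 !lt_min => /andP[s1' s2'] /andP[t1 t2]; split.
  by apply: h1; [exact: cl|rewrite distrC].
by apply: h2; [exact: cl|rewrite distrC].
Qed.

Lemma vanish_pred q g : vanish q g -> vanish q.-1 ('D_ex g).
Proof. by case: q => [|q] // []. Qed.

(** Differentiation along the torus preserves the order of vanishing. *)
Lemma vanish_angle j q vs : (size vs + q < N)%N -> vanish q (dirD vs h) -> vanish q (dirD (ej j :: vs) h).
Proof.
elim: q vs => [//|q IH] vs sN [h1 h2]; split.
  move=> th.
  have s1 : (size vs < N)%N by apply: leq_ltn_trans sN; exact: leq_addr.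
  have [_ /(_ s1) dg] := hU (ltnW s1).
  have u0 : U (th, 0) by rewrite /U /= normr0.
  have := derive_line (dg _ (ej j) u0).
  rewrite (_ : (fun t : R => _) = fun=> 0) => [D|]; last first.
    apply/funext => t; rewrite -[RHS](h1 (th + t *: evec j)); congr (dirD vs h).
    by rewrite /ej; congr pair; rewrite /= scaler0 addr0.
  by rewrite /= -(@derive_val _ _ _ _ _ _ _ D) derive_cst.
apply: (vanish_ext (g := dirD (ej j :: ex :: vs) h)).
  by move=> th x xr; apply: mixed => //; apply: leq_trans sN; rewrite addn2 addnS !ltnS leq_addr.
by apply: IH => //; rewrite addSnnS.
Qed.

Hypothesis bU : forall vs : seq E, (size vs <= N)%N -> exists M : R, forall p, U p -> `|dirD vs h p| <= M.

(** Each order of vanishing is one application of the mean value theorem in x. *)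
Lemma vanish_bound q vs : (size vs + q <= N)%N -> vanish q (dirD vs h) -> exists2 M, 0 <= M &
  forall th x, `|x| < r -> `|dirD vs h (th, x)| <= M * `|x| ^+ q.
Proof.
elim: q vs => [|q IH] vs sN hv.
  have [|M hM] := bU (vs := vs); first by rewrite addn0 in sN.
  exists `|M| => // th x xr; rewrite expr0 mulr1; apply: le_trans (hM (th, x) xr) (ler_norm _).
have [h1 h2] := hv; have [|M M0 hM] := IH (ex :: vs) _ h2; first by rewrite addSnnS.
exists M => // th x xr.
have s1 : (size vs < N)%N by apply: leq_trans sN; rewrite addnS ltnS leq_addr.
have [_ /(_ s1) dg] := hU (ltnW s1).
have le z : Num.min 0 x <= z <= Num.max 0 x -> `|z| <= `|x|.
  have [x0|x0] := lerP 0 x => /andP[z1 z2].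
    by rewrite !ger0_norm // (le_trans z1).
  by rewrite !ler0_norm ?(ltW x0) // lerN2.
have [|c hc] := @MVT_local R (fun y => dirD vs h (th, y)) (fun y => 'D_ex (dirD vs h) (th, y)) 0 x.
  by move=> z /le hz; apply: derive_amplitude; apply: dg; exact: le_lt_trans hz xr.
rewrite h1 !subr0 => ->; rewrite normrM exprSr mulrA ler_wpM2r //.
have cx := le c hc; apply: le_trans (hM th c (le_lt_trans cx xr)) _.
by rewrite ler_wpM2l // lerXn2r ?nnegrE.
Qed.

End Local.

(** Derivatives in the angle keep the order of vanishing and those in x lower it by one, as [ctrl]
    prescribes. *)
Lemma ctrl_vanishing n0 N (h : E -> R) (r : R) j l : Cn_torus n0 h -> 0 < r ->
  let U := [set p : E | `|p.2| < r] in Cn_on N U h ->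
  (forall vs : seq E, (size vs <= N)%N -> exists M : R, forall p, U p -> `|dirD vs h p| <= M) ->
  forall n vs q, (size vs + n <= n0)%N -> (size vs + n + l.+1 <= N)%N -> (q <= l.+1)%N ->
  vanish q (dirD vs h) -> exists2 M, 0 <= M & ctrl j (r / 2) M n q (dirD vs h).
Proof.
move=> [hf fp] r0 U hU bU; elim=> [|n IH] vs q sn sN ql hv.
all: have sn' : (size vs <= n0)%N by apply: leq_trans sn; exact: leq_addr.
all: have cf := dirD_continuous hf sn'; have pf := dirD_periodic vs fp.
all: have sq : (size vs + q <= N)%N by apply: leq_trans sN; rewrite -addnA leq_add2l (leq_trans ql) // leq_addl.
all: have [M M0 hM] := vanish_bound hU bU sq hv.
all: have hM' th x : `|x| <= r / 2 -> `|dirD vs h (th, x)| <= M * `|x| ^+ q by move=> hx; apply: hM; lra.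
  by exists M => //; split.
have sn1 : (size vs + n < n0)%N by rewrite -addnS.
have sN1 : ((size vs).+1 + n + l.+1 <= N)%N by rewrite addSnnS.
have hj : vanish q (dirD (ej j :: vs) h).
  apply: (vanish_angle r0 hU) => //.
  by move: (size vs) sN1 ql => k; clear; lia.
have [M1 M10 h1] := IH (ej j :: vs) q sn1 sN1 ql hj.
have [M2 M20 h2] := IH (ex :: vs) q.-1 sn1 sN1 (leq_trans (leq_pred q) ql) (vanish_pred hv).
exists (M + (M1 + M2)); first by rewrite !addr_ge0 // ltW.
split.
  split=> // th x hx; apply: le_trans (hM' th x hx) _.
  by rewrite ler_wpM2r ?exprn_ge0 // lerDl addr_ge0.
exists (dirD (ej j :: vs) h), (dirD (ex :: vs) h); split.
- by apply: (dirD_pder (n := n0)) => //; apply: leq_ltn_trans sn1; exact: leq_addr.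
- by apply: ctrl_weaken (lexx _) _ h1; lra.
- by apply: ctrl_weaken (lexx _) _ h2; lra.
Qed.

Lemma vanishes_vanish l N (h : E -> R) (r : R) : 0 < r -> (l < N)%N ->
  Cn_on N [set p : E | `|p.2| < r] h ->
  (forall theta j, (j <= l)%N -> derive1n j (fun x => h (theta, x)) 0 = 0) -> vanish l.+1 h.
Proof.
move=> r0 lN hU h0.
have jet i (th : rV) (x : R) : `|x| < r -> derive1n i (fun x => h (th, x)) x = dirD (nseq i ex) h (th, x).
  elim: i x => [//|i IH] x xr; rewrite derive1nS /= -derive1_amplitude !derive1E.
  apply: near_eq_derive.
  have c0 : 0 < r - `|x| by rewrite subr_gt0.
  apply: filterS (nbhsx_ballx x _ c0) => y; rewrite /ball /= => yx; apply: IH.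
  by have := ler_normD x (y - x); rewrite addrC subrK [`|y - x|]distrC; lra.
suff H q i : (i + q = l.+1)%N -> vanish q (dirD (nseq i ex) h) by exact: (H l.+1 0%N).
elim: q i => [//|q IH] i iq; split; last by apply: (IH i.+1); rewrite addSnnS.
move=> th; rewrite -jet ?normr0 //; apply: h0.
by rewrite -ltnS -iq addnS ltnS leq_addr.
Qed.

Lemma ctrl_uniform s0 n q (g : E -> R) : (forall j, exists2 M, 0 <= M & ctrl j s0 M n q g) ->
  exists2 M, 0 <= M & forall j, ctrl j s0 M n q g.
Proof.
move=> H; have H' j : exists M, 0 <= M /\ ctrl j s0 M n q g by have [M ? ?] := H j; exists M.
have [M hM] := choice H'; exists (\sum_j M j); first by apply: sumr_ge0 => j _; case: (hM j).
move=> j; have [M0 hj] := hM j; apply: ctrl_weaken (lexx _) _ hj.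
rewrite (bigD1 j) //= lerDl; apply: sumr_ge0 => i _; by case: (hM i).
Qed.

Lemma smooth_admissible l m p N (f h : E -> R) : (0 < d)%N -> (d < 2 * m)%N -> (1 <= p)%N ->
  Cn_torus (m + p) f -> Cn_torus (m + p) h -> (m + l.+2 <= N)%N -> vanishes_smooth l N h ->
  exists s0 M, [/\ 0 < s0, 0 < M & admissible l m 0 f h s0 M].
Proof.
move=> d0 dm p1 hf hh hN [h0 [r r0 /= [hU bU]]].
have m0 : (0 < m)%N by rewrite lt0n; apply/eqP => m0; move: dm; rewrite m0 muln0.
have mp : (m < m + p)%N by rewrite -addn1 leq_add2l.
have [Mf Mf0 cf] := ctrl_uniform (fun j => ctrl_increment j hf (n := m) (vs := [::]) mp).
have hv := vanishes_vanish r0 _ hU h0.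
have {}hv : vanish l.+1 (dirD [::] h).
  by apply: hv; apply: leq_trans hN; rewrite addnS ltnS (leq_trans _ (leq_addl m _)).
have hN' : (size (Nil E) + m + l.+1 <= N)%N by apply: leq_trans hN; rewrite add0n leq_add2l.
have [Mh Mh0 ch] := ctrl_uniform (fun j => ctrl_vanishing j hh r0 hU bU (n := m) (vs := [::]) (q := l.+1)
  (ltnW mp) hN' (leqnn _) hv).
have [M0 M00 c0] := ctrl_bounded (Ordinal d0) hf (n := 0) (vs := [::]) (leq0n _).
pose s1 := Num.min 1 (r / 2).
have s10 : 0 < s1 by rewrite lt_min ltr01 divr_gt0.
have Cp := Csup_gt0 (R := R) d m.
have C1 : 0 < 1 + Csup (R := R) d m by lra.
have Cc0 q : 0 <= Cc (R := R) d m q by exact: sqrtr_ge0.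
have a1 := mulr_ge0 (Cc0 1%N) Mf0; have a2 := mulr_ge0 (Cc0 l.+1) Mh0.
pose M := Cc d m 1 * Mf + Cc d m l.+1 * Mh + Mf + Mh + 1.
have s0s : s1 / (1 + Csup (R := R) d m) <= s1 by rewrite ler_pdivrMr // ler_peMr ?(ltW s10) //; lra.
have m11 : s1 <= 1 by rewrite ge_min lexx.
have m1r : s1 <= r / 2 by rewrite ge_min lexx orbT.
exists (s1 / (1 + Csup (R := R) d m)), M; split; first exact: divr_gt0.
  by rewrite /M; lra.
split.
- move=> V cV _; split; first exact: (ctrl_CP c0 cV).
  exact: (ctrl_CP (ch (Ordinal d0)) cV).
- move=> th x y s sp ss xs ys.
  have := cf (Ordinal d0); have := ch (Ordinal d0); case: (m) m0 => // m' _ ch' cf'.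
  have := ctrl_lip th Mf0 cf' (_ : s <= 1) xs ys; have := ctrl_lip th Mh0 ch' (_ : s <= r / 2) xs ys.
  rewrite expr0 mulr1 => L1 L2; split.
    have -> : f (th, x) - f (th, y) = f (th, x) - f (th, 0) - (f (th, y) - f (th, 0)) by ring.
    by apply: le_trans (L2 _) _; [lra|rewrite ler_wpM2r // /M; lra].
  apply: le_trans (L1 _) _; first by lra.
  by rewrite ler_wpM2r // ler_wpM2r ?exprn_ge0 // /M; lra.
- move=> th; have [_ _ b] := ctrl_base (ch (Ordinal d0)).
  by apply/eqP; rewrite -normr_le0; have := b th 0; rewrite normr0 exprS mul0r mulr0; apply; rewrite divr_ge0 // ltW.
- move=> a V s s00 ss sa cV hV.
  have us : (1 + Csup (R := R) d m) * s <= s1 by move: ss; rewrite ler_pdivlMr // mulrC.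
  have H q g Mg : 0 <= Mg -> (forall j, ctrl j s1 Mg m q.+1 g) ->
     Hle 0 m (fun th => g (th, a + V th)) ((Cc d m q.+1 * Mg * s ^+ q.+1) ^+ 2).
    by move=> Mg0 cg; apply: (Hle_comp dm d0 Mg0 cg s00) => //; lra.
  have weak (x y : R) : 0 <= x -> x <= y -> x ^+ 2 <= y ^+ 2.
    by move=> x0 xy; rewrite lerXn2r ?nnegrE // (le_trans x0).
  split.
    have := H 0%N _ Mf Mf0 (fun j => ctrl_weaken m11 (lexx _) (cf j)).
    apply: Hle_weaken; apply: weak; first by rewrite mulr_ge0 // exprn_ge0 // ltW.
    by rewrite expr1 ler_wpM2r ?(ltW s00) // /M; lra.
  have := H l _ Mh Mh0 (fun j => ctrl_weaken m1r (lexx _) (ch j)).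
  apply: Hle_weaken; apply: weak; first by rewrite mulr_ge0 // exprn_ge0 // ltW.
  by rewrite ler_wpM2r ?exprn_ge0 ?(ltW s00) // /M; lra.
Qed.

End Smooth.
(** * Closed differential forms on rectangles *)

Section Goursat.
Context {R : realType}.

Lemma primitive (P : R -> R) (a : R) : continuous P ->
  exists A : R -> R, forall x, a <= x -> is_derive x (1 : R) A (P x).
Proof.
move=> cP; exists (fun x => \int[lebesgue_measure]_(t in `[a - 1, x]) P t) => x ax.
have xu : x < x + 1 by rewrite ltrDl.
have ax1 : a - 1 < x by lra.
have [dA vA] := continuous_FTC1_closed xu (integrable_itv (a - 1) (x + 1) cP) ax1 (cP x).
by apply: DeriveDef; [exact: dA|rewrite -derive1E; exact: vA].
Qed.

Lemma nested_point (a b : nat -> R) : (forall n, a n <= a n.+1) -> (forall n, b n.+1 <= b n) ->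
  (forall n, a n <= b n) -> exists x, forall n, a n <= x <= b n.
Proof.
move=> ha hb ab.
have am n k : a n <= a (n + k)%N by elim: k => [|k IH]; rewrite ?addn0 // addnS (le_trans IH).
have bm n k : b (n + k)%N <= b n by elim: k => [|k IH]; rewrite ?addn0 // addnS (le_trans _ IH).
have anb n k : a n <= b k.
  apply: le_trans (am n k) _; apply: le_trans (ab _) _; rewrite addnC; exact: bm.
pose S := range a.
have bS k : ubound S (b k) by move=> _ [n _ <-]; exact: anb.
have hS : has_sup S by split; [exists (a 0%N), 0%N|exists (b 0%N)].
exists (sup S) => n; apply/andP; split; last by apply: ge_sup => //; exists (a 0%N), 0%N.
by apply: ub_le_sup; [exists (b 0%N)|exists n].
Qed.

(** The circulation of P dx + Q dy around [a, b] x [c, d], A being a primitive of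
    P in x and B a primitive of Q in y: with primitives the additivity under
    subdivision is a telescoping identity. *)
Definition circ (A B : R -> R -> R) (a b c d : R) :=
  (A b c - A a c) + (B b d - B b c) - (A b d - A a d) - (B a d - B a c).

Variables (P Q A B : R -> R -> R).

(** P dx + Q dy is closed at (x, y) to first order, relative to a <= x' <= b and c <= y' <= d. *)
Definition closed_at (a b c d x y : R) := exists p1 p2 q2 : R, forall e : R, 0 < e ->
  exists2 dl : R, 0 < dl & forall x' y', a <= x' <= b -> c <= y' <= d -> `|x' - x| < dl -> `|y' - y| < dl ->
    `|P x' y' - (P x y + p1 * (x' - x) + p2 * (y' - y))| <= e * (`|x' - x| + `|y' - y|) /\
    `|Q x' y' - (Q x y + p2 * (x' - x) + q2 * (y' - y))| <= e * (`|x' - x| + `|y' - y|).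

(** The circulation of the first-order part is zero, because the y-derivative of P and the
    x-derivative of Q agree; the remainder contributes at most the error times the perimeter. *)
Lemma circ_small (a b c d x y p0 p1 p2 q0 q2 M : R) : a <= x <= b -> c <= y <= d ->
  (forall x' y', a <= x' <= b -> c <= y' <= d -> is_derive x' (1 : R) (A^~ y') (P x' y')) ->
  (forall x' y', a <= x' <= b -> c <= y' <= d -> is_derive y' (1 : R) (B x') (Q x' y')) ->
  (forall x' y', a <= x' <= b -> c <= y' <= d ->
    `|P x' y' - (p0 + p1 * (x' - x) + p2 * (y' - y))| <= M /\
    `|Q x' y' - (q0 + p2 * (x' - x) + q2 * (y' - y))| <= M) ->
  `|circ A B a b c d| <= 2 * M * ((b - a) + (d - c)).
Proof.
move=> /andP[ax xb] /andP[cy yd] dA dB h.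
have ab : a <= b by exact: le_trans xb. have cd : c <= d by exact: le_trans yd.
pose tA x' y' := p0 * x' + p1 / 2 * (x' - x) ^+ 2 + p2 * (y' - y) * x'.
pose tB x' y' := q0 * y' + p2 * (x' - x) * y' + q2 / 2 * (y' - y) ^+ 2.
have sq (z0 z : R) : is_derive z (1 : R) (fun z : R => (z - z0) ^+ 2) (2 * (z - z0)).
  have dz : is_derive z (1 : R) (fun z : R => z - z0) 1.
    by have := is_deriveB (is_derive_id z (1 : R)) (is_derive_cst z0 z (1 : R)); rewrite subr0.
  by have := is_deriveM dz dz; move/is_derive_eq; apply; rewrite /GRing.scale /=; ring.
have dtA x' y' : is_derive x' (1 : R) (tA^~ y') (p0 + p1 * (x' - x) + p2 * (y' - y)).
  have di := is_derive_id x' (1 : R).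
  have := is_deriveD (is_deriveD (is_deriveZ p0 di) (is_deriveZ (p1 / 2) (sq x x'))) (is_deriveZ (p2 * (y' - y)) di).
  by move/is_derive_eq; apply; rewrite /GRing.scale /=; field.
have dtB x' y' : is_derive y' (1 : R) (tB x') (q0 + p2 * (x' - x) + q2 * (y' - y)).
  have di := is_derive_id y' (1 : R).
  have := is_deriveD (is_deriveD (is_deriveZ q0 di) (is_deriveZ (p2 * (x' - x)) di)) (is_deriveZ (q2 / 2) (sq y y')).
  by move/is_derive_eq; apply; rewrite /GRing.scale /=; field.
have kA y' : c <= y' <= d -> `|(A b y' - tA b y') - (A a y' - tA a y')| <= M * (b - a).
  move=> hy; have [|z hz ->] := @MVT_local R (fun x' => A x' y' - tA x' y') (fun x' => P x' y' - (p0 + p1 * (x' - x) + p2 * (y' - y))) a b.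
    move=> z; rewrite min_l ?max_r // => hz; exact: (is_deriveB (dA _ _ hz hy) (dtA _ _)).
  rewrite min_l ?max_r // in hz; rewrite normrM [`|b - a|]ger0_norm ?subr_ge0 // ler_wpM2r ?subr_ge0 //.
  by have [] := h z y' hz hy.
have kB x' : a <= x' <= b -> `|(B x' d - tB x' d) - (B x' c - tB x' c)| <= M * (d - c).
  move=> hx; have [|z hz ->] := @MVT_local R (fun y' => B x' y' - tB x' y') (fun y' => Q x' y' - (q0 + p2 * (x' - x) + q2 * (y' - y))) c d.
    move=> z; rewrite min_l ?max_r // => hz; exact: (is_deriveB (dB _ _ hx hz) (dtB _ _)).
  rewrite min_l ?max_r // in hz; rewrite normrM [`|d - c|]ger0_norm ?subr_ge0 // ler_wpM2r ?subr_ge0 //.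
  by have [] := h x' z hx hz.
have k1 := kA c; have k2 := kA d; have k3 := kB a; have k4 := kB b.
rewrite !lexx ab cd /= in k1 k2 k3 k4.
have -> : circ A B a b c d = ((A b c - tA b c) - (A a c - tA a c)) - ((A b d - tA b d) - (A a d - tA a d)) +
   (((B b d - tB b d) - (B b c - tB b c)) - ((B a d - tB a d) - (B a c - tB a c))) by rewrite /circ /tA /tB; field.
have {}k1 := k1 isT; have {}k2 := k2 isT; have {}k3 := k3 isT; have {}k4 := k4 isT.
apply: le_trans (ler_normD _ _) _; apply: le_trans (lerD (ler_normB _ _) (ler_normB _ _)) _.
by lra.
Qed.

(** Goursat's argument: differentiability at every point, without continuity of
    the derivatives, is enough for a closed form to be exact on a rectangle. *)
Lemma goursat (a b c d : R) : a <= b -> c <= d ->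
  (forall x y, a <= x <= b -> c <= y <= d -> is_derive x (1 : R) (A^~ y) (P x y)) ->
  (forall x y, a <= x <= b -> c <= y <= d -> is_derive y (1 : R) (B x) (Q x y)) ->
  (forall x y, a <= x <= b -> c <= y <= d -> closed_at a b c d x y) -> circ A B a b c d = 0.
Proof.
move=> ab cd dA dB cl.
pose C (q : R * R * R * R) := circ A B q.1.1.1 q.1.1.2 q.1.2 q.2.
pose ok (q : R * R * R * R) := q.1.1.1 <= q.1.1.2 /\ q.1.2 <= q.2.
pose sub (q' q : R * R * R * R) := [/\ q.1.1.1 <= q'.1.1.1 /\ q'.1.1.2 <= q.1.1.2, q.1.2 <= q'.1.2 /\ q'.2 <= q.2,
  q'.1.1.2 - q'.1.1.1 = (q.1.1.2 - q.1.1.1) / 2 /\ q'.2 - q'.1.2 = (q.2 - q.1.2) / 2 & `|C q| <= 4 * `|C q'|].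
have step q : exists q', ok q -> sub q' q.
  case: q => [[[a' b'] c'] d']; pose x := (a' + b') / 2; pose y := (c' + d') / 2.
  have eC : C (a', b', c', d') = (C (a', x, c', y) + C (x, b', c', y)) + (C (a', x, y, d') + C (x, b', y, d')).
    by rewrite /C /circ /=; ring.
  have n4 (u v w z : R) m : `|u| <= m -> `|v| <= m -> `|w| <= m -> `|z| <= m -> `|(u + v) + (w + z)| <= 4 * m.
    move=> hu hv hw hz; apply: le_trans (ler_normD _ _) _; apply: le_trans (lerD (ler_normD _ _) (ler_normD _ _)) _; lra.
  pose m := Num.max (Num.max `|C (a', x, c', y)| `|C (x, b', c', y)|) (Num.max `|C (a', x, y, d')| `|C (x, b', y, d')|).
  have hm : `|C (a', b', c', d')| <= 4 * m by rewrite eC; apply: n4; rewrite !le_max lexx ?orbT.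
  have : (m == `|C (a', x, c', y)|) || (m == `|C (x, b', c', y)|) || ((m == `|C (a', x, y, d')|) || (m == `|C (x, b', y, d')|)).
    by rewrite /m; case: (leP _ (Num.max _ _)) => _; case: (leP `|_| `|_|) => _; rewrite eqxx ?orbT.
  by case/orP => /orP[] /eqP em; rewrite em in hm; [exists (a', x, c', y)|exists (x, b', c', y)|exists (a', x, y, d')|exists (x, b', y, d')] => -[/= h1 h2];
    (split; last exact: hm); split; rewrite /= /x /y; move: h1 h2; clear; lra.
have [T hT] := choice step.
pose q n := iter n T (a, b, c, d).
have okq n : ok (q n).
  elim: n => [|n IH]; first by split.
  have [_ _ [e1 e2] _] := hT _ IH; case: IH => h1 h2.
  by split; rewrite -subr_ge0; [rewrite [X in _ <= X]e1|rewrite [X in _ <= X]e2]; rewrite divr_ge0 // subr_ge0.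
have sq n : sub (q n.+1) (q n) := hT _ (okq n).
have wq n : (q n).1.1.2 - (q n).1.1.1 = (b - a) * 2^-1 ^+ n /\ (q n).2 - (q n).1.2 = (d - c) * 2^-1 ^+ n.
  elim: n => [|n [IH1 IH2]]; first by rewrite /= expr0 !mulr1.
  have [_ _ [-> ->] _] := sq n; by rewrite IH1 IH2 exprS; move: (2^-1 ^+ n) => z; split; lra.
have Cq n : `|C (a, b, c, d)| <= 4 ^+ n * `|C (q n)|.
  elim: n => [|n IH]; first by rewrite expr0 mul1r.
  have [_ _ _ h] := sq n; apply: le_trans IH _; rewrite exprSr -mulrA ler_wpM2l // exprn_ge0 //.
have [x hx] : exists x, forall n, (q n).1.1.1 <= x <= (q n).1.1.2.
  apply: nested_point => n; [by have [[]] := sq n|by have [[]] := sq n|by have [] := okq n].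
have [y hy] : exists y, forall n, (q n).1.2 <= y <= (q n).2.
  apply: nested_point => n; [by have [_ []] := sq n|by have [_ []] := sq n|by have [] := okq n].
have inq n : a <= (q n).1.1.1 /\ (q n).1.1.2 <= b /\ c <= (q n).1.2 /\ (q n).2 <= d.
  elim: n => [//|n [h1 [h2 [h3 h4]]]]; have [[k1 k2] [k3 k4] _ _] := sq n.
  by split; [exact: le_trans k1|split; [exact: le_trans k2 h2|split; [exact: le_trans k3|exact: le_trans k4 h4]]].
have [p1 [p2 [q2 loc]]] := cl x y (hx 0%N) (hy 0%N).
apply: eps_eq0 => e e0; pose w := (b - a) + (d - c).
have w0 : 0 <= w by rewrite /w; lra.
have w2 : 0 < w + 1 := ltr_wpDl w0 ltr01.
have w1 : 0 < 2 * (w + 1) ^+ 2 by rewrite mulr_gt0 // exprn_gt0.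
have [dl dl0 hd] := loc (e / (2 * (w + 1) ^+ 2)) (divr_gt0 e0 w1).
have dl2 : 0 < dl / 2 by rewrite divr_gt0.
have [n hn] : exists n, w * 2^-1 ^+ n <= dl / 2.
  pose n := (Num.trunc (w / (dl / 2))).+1; exists n.
  have h : 0 <= w / (dl / 2) by rewrite divr_ge0 // ltW.
  have /andP[_] := trunc_itv h; rewrite -/n ltr_pdivrMr // => /ltW h'.
  have n2 : n%:R <= 2 ^+ n :> R by rewrite -natrX ler_nat ltnW // ltn_expl.
  rewrite exprVn ler_pdivrMr ?exprn_gt0 // mulrC; apply: le_trans h' _.
  by rewrite ler_wpM2r // ltW.
set z := 2^-1 ^+ n in hn; have z0 : 0 <= z by rewrite exprn_ge0.
have : [/\ (q n).1.1.1 <= x <= (q n).1.1.2, (q n).1.2 <= y <= (q n).2,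
    a <= (q n).1.1.1 /\ (q n).1.1.2 <= b, c <= (q n).1.2 /\ (q n).2 <= d &
    (q n).1.1.2 - (q n).1.1.1 = (b - a) * z /\ (q n).2 - (q n).1.2 = (d - c) * z].
  by have [i1 [i2 [i3 i4]]] := inq n; split=> //; exact: wq.
move: (Cq n); case: (q n) => [[[a' b'] c'] d'] /= Cn [hxn hyn [i1 i2] [i3 i4] [W1 W2]].
have near : forall x' y', a' <= x' <= b' -> c' <= y' <= d' ->
   `|x' - x| <= (b - a) * z /\ `|y' - y| <= (d - c) * z.
  move: hxn hyn => /andP[u1 u2] /andP[u3 u4] x' y' /andP[u5 u6] /andP[u7 u8]; rewrite -W1 -W2 !ler_norml.
  by move: u1 u2 u3 u4 u5 u6 u7 u8; clear; split; apply/andP; split; lra.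
have inA x' : a' <= x' <= b' -> a <= x' <= b.
  by move=> /andP[u1 u2]; rewrite (le_trans i1 u1) (le_trans u2 i2).
have inC y' : c' <= y' <= d' -> c <= y' <= d.
  by move=> /andP[u1 u2]; rewrite (le_trans i3 u1) (le_trans u2 i4).
have bz : 0 <= (b - a) * z by rewrite mulr_ge0 // subr_ge0.
have dz : 0 <= (d - c) * z by rewrite mulr_ge0 // subr_ge0.
have wz : w * z = (b - a) * z + (d - c) * z by rewrite -mulrDl.
have wdl : w * z < dl by move: hn dl0; clear; lra.
have ee : 0 <= e / (2 * (w + 1) ^+ 2) by rewrite divr_ge0 // ltW.
have small : `|C (a', b', c', d')| <= 2 * (e / (2 * (w + 1) ^+ 2) * (w * z)) * (w * z).
  have := @circ_small a' b' c' d' x y (P x y) p1 p2 (Q x y) q2 (e / (2 * (w + 1) ^+ 2) * (w * z)) hxn hyn.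
  rewrite W1 W2 -wz; apply.
  - by move=> x' y' /inA hx' /inC hy'; exact: dA.
  - by move=> x' y' /inA hx' /inC hy'; exact: dB.
  - move=> x' y' hx' hy'; have [n1 n2] := near x' y' hx' hy'.
    have s1 : `|x' - x| + `|y' - y| <= w * z by rewrite wz; exact: lerD.
    have l1 : `|x' - x| < dl by apply: le_lt_trans wdl; apply: le_trans n1 _; rewrite wz lerDl.
    have l2 : `|y' - y| < dl by apply: le_lt_trans wdl; apply: le_trans n2 _; rewrite wz lerDr.
    have [k1 k2] := hd x' y' (inA _ hx') (inC _ hy') l1 l2.
    by split; [apply: le_trans k1 _|apply: le_trans k2 _]; rewrite ler_wpM2l.
apply: le_trans Cn _.
have p4 : 0 <= 4 ^+ n :> R by rewrite exprn_ge0.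
apply: le_trans (ler_wpM2l p4 small) _.
have e4 : 4 ^+ n * (z * z) = 1.
  by rewrite /z -exprMn -exprMn (_ : 4 * (2^-1 * 2^-1) = 1 :> R) ?expr1n //; field.
have -> : 4 ^+ n * (2 * (e / (2 * (w + 1) ^+ 2) * (w * z)) * (w * z)) =
    4 ^+ n * (z * z) * (e * (w ^+ 2 / (w + 1) ^+ 2)).
  by field; exact: lt0r_neq0.
rewrite e4 mul1r -[leRHS]mulr1 ler_wpM2l ?(ltW e0) //.
by rewrite ler_pdivrMr ?exprn_gt0 // mul1r lerXn2r ?nnegrE ?(ltW w2) // lerDl.
Qed.

End Goursat.

(** * Holomorphic functions of one variable *)

Section Holomorphic.
Context {R : realType}.
Local Notation C := R[i].
Local Notation Re := complex.Re.
Local Notation Im := complex.Im.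
Local Open Scope complex_scope.

Definition cabs (z : C) : R := Normc.normc z.

Lemma cabsE (z : C) : cabs z = Num.sqrt (Re z ^+ 2 + Im z ^+ 2).
Proof. by case: z. Qed.

Lemma cabs_ge0 z : 0 <= cabs z.
Proof. by rewrite cabsE sqrtr_ge0. Qed.

Lemma cabsM z w : cabs (z * w) = cabs z * cabs w.
Proof. exact: Normc.normcM. Qed.

Lemma cabsD z w : cabs (z + w) <= cabs z + cabs w.
Proof. exact: le_normcD. Qed.

Lemma cabsN z : cabs (- z) = cabs z.
Proof. by case: z => a b; rewrite !cabsE /= !sqrrN. Qed.

Lemma cabsB z w : cabs (z - w) <= cabs z + cabs w.
Proof. by apply: le_trans (cabsD _ _) _; rewrite cabsN. Qed.

Lemma cabs0 : cabs 0 = 0. Proof. exact: Normc.normc0. Qed.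
Lemma cabs1 : cabs 1 = 1. Proof. exact: Normc.normc1. Qed.

Lemma cabs_eq0 z : cabs z = 0 -> z = 0. Proof. exact: Normc.eq0_normc. Qed.

Lemma cabs_real (x : R) : cabs x%:C = `|x|.
Proof. by rewrite cabsE /= expr0n addr0 sqrtr_sqr. Qed.

Lemma Re_le z : `|Re z| <= cabs z.
Proof. by rewrite cabsE -sqrtr_sqr ler_wsqrtr // lerDl sqr_ge0. Qed.

Lemma Im_le z : `|Im z| <= cabs z.
Proof. by rewrite cabsE -sqrtr_sqr ler_wsqrtr // lerDr sqr_ge0. Qed.

Lemma cabs_le z : cabs z <= `|Re z| + `|Im z|.
Proof.
rewrite cabsE -[leRHS](ger0_norm (addr_ge0 (normr_ge0 _) (normr_ge0 _))) -sqrtr_sqr ler_wsqrtr //.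
rewrite sqrrD !real_normK ?num_real // -addrA [X in _ <= _ + X]addrC addrA lerDl.
by rewrite mulrn_wge0 // mulr_ge0.
Qed.

Lemma ReD (z w : C) : Re (z + w) = Re z + Re w. Proof. by case: z w => ? ? []. Qed.
Lemma ImD (z w : C) : Im (z + w) = Im z + Im w. Proof. by case: z w => ? ? []. Qed.
Lemma ReB (z w : C) : Re (z - w) = Re z - Re w. Proof. by case: z w => ? ? []. Qed.
Lemma ImB (z w : C) : Im (z - w) = Im z - Im w. Proof. by case: z w => ? ? []. Qed.
Lemma ReM (z w : C) : Re (z * w) = Re z * Re w - Im z * Im w. Proof. by case: z w => ? ? []. Qed.
Lemma ImM (z w : C) : Im (z * w) = Re z * Im w + Im z * Re w. Proof. by case: z w => ? ? []. Qed.

Lemma complex_ext (z w : C) : Re z = Re w -> Im z = Im w -> z = w.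
Proof. by case: z w => a b [c e] /= -> ->. Qed.

(** The relative bound is stated for all small h, zero included, so that it composes without case
    analysis. *)
Definition hol (E : C -> C) (w D : C) := forall e : R, 0 < e -> exists2 dl : R, 0 < dl &
  forall h, cabs h < dl -> cabs (E (w + h) - E w - h * D) <= e * cabs h.

Lemma hol_lip E w D : hol E w D -> exists2 dl : R, 0 < dl &
  forall h, cabs h < dl -> cabs (E (w + h) - E w) <= (1 + cabs D) * cabs h.
Proof.
move=> /(_ 1 ltr01)[dl dl0 hd]; exists dl => // h hh.
rewrite -[E (w + h) - E w](subrK (h * D)); apply: le_trans (cabsD _ _) _.
by have := hd h hh; rewrite cabsM; lra.
Qed.

Lemma hol_ext E E' w D : (forall z, E z = E' z) -> hol E w D -> hol E' w D.
Proof. by move=> /funext ->. Qed.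

Lemma hol_affine (a c w : C) : hol (fun z => a + c * z) w c.
Proof.
move=> e e0; exists 1 => // h _.
rewrite (_ : a + c * (w + h) - (a + c * w) - h * c = 0); last by ring.
by rewrite cabs0 mulr_ge0 ?cabs_ge0 // ltW.
Qed.

Lemma holM E1 E2 w D1 D2 : hol E1 w D1 -> hol E2 w D2 ->
  hol (fun z => E1 z * E2 z) w (D1 * E2 w + E1 w * D2).
Proof.
move=> h1 h2 e e0.
have [l1 l10 hl1] := hol_lip h1; have [l2 l20 hl2] := hol_lip h2.
pose K := (1 + cabs D1) * (1 + cabs D2).
have a1 := cabs_ge0 D1; have a2 := cabs_ge0 D2; have a3 := cabs_ge0 (E1 w); have a4 := cabs_ge0 (E2 w).
have K0 : 0 < K by rewrite mulr_gt0 //; lra.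
pose e' := e / (3 * (1 + cabs (E1 w) + cabs (E2 w))).
have e'0 : 0 < e' by rewrite divr_gt0 // mulr_gt0 //; lra.
have [d1 d10 hd1] := h1 e' e'0; have [d2 d20 hd2] := h2 e' e'0.
exists (Num.min (Num.min (Num.min l1 l2) (Num.min d1 d2)) (e / (3 * K))).
  by rewrite !lt_min l10 l20 d10 d20 divr_gt0 // mulr_gt0.
move=> h; rewrite !lt_min => /andP[/andP[/andP[b1 b2] /andP[b3 b4]] b5].
have -> : E1 (w + h) * E2 (w + h) - E1 w * E2 w - h * (D1 * E2 w + E1 w * D2) =
  ((E1 (w + h) - E1 w - h * D1) * E2 w + E1 w * (E2 (w + h) - E2 w - h * D2)) +
  (E1 (w + h) - E1 w) * (E2 (w + h) - E2 w) by ring.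
have h0 := cabs_ge0 h.
have k1 := hd1 h b3; have k2 := hd2 h b4; have k3 := hl1 h b1; have k4 := hl2 h b2.
apply: le_trans (cabsD _ _) _; apply: le_trans (lerD (cabsD _ _) (lexx _)) _; rewrite !cabsM.
have t1 : cabs (E1 (w + h) - E1 w - h * D1) * cabs (E2 w) <= e' * cabs h * cabs (E2 w) by rewrite ler_wpM2r.
have t2 : cabs (E1 w) * cabs (E2 (w + h) - E2 w - h * D2) <= cabs (E1 w) * (e' * cabs h) by rewrite ler_wpM2l.
have t3 : cabs (E1 (w + h) - E1 w) * cabs (E2 (w + h) - E2 w) <= K * cabs h * cabs h.
  rewrite [leRHS](_ : _ = ((1 + cabs D1) * cabs h) * ((1 + cabs D2) * cabs h)); last by rewrite /K; ring.
  by apply: ler_pM; rewrite ?cabs_ge0.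
have t4 : K * cabs h * cabs h <= e / 3 * cabs h.
  have K3 : 0 < 3 * K by rewrite mulr_gt0.
  rewrite ler_wpM2r //; move: b5; rewrite ltr_pdivlMr // => /ltW b5; lra.
have t5 : e' * (1 + cabs (E1 w) + cabs (E2 w)) = e / 3.
  by rewrite /e'; field; lra.
have t6 : e' * cabs h * cabs (E2 w) + cabs (E1 w) * (e' * cabs h) <= e / 3 * cabs h.
  rewrite -t5 -subr_ge0 [X in 0 <= X](_ : _ = e' * cabs h); last by ring.
  by rewrite mulr_ge0 // ltW.
have t7 : 0 <= e * cabs h by rewrite mulr_ge0 // ltW.
lra.
Qed.

Lemma hol_comp E G w D1 D2 : hol G w D1 -> hol E (G w) D2 -> hol (fun z => E (G z)) w (D1 * D2).
Proof.
move=> h1 h2 e e0.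
have [l1 l10 hl1] := hol_lip h1.
have a1 := cabs_ge0 D1; have a2 := cabs_ge0 D2.
have q1 : 0 < 1 + cabs D1 by lra. have q2 : 0 < 1 + cabs D2 by lra.
have [d2 d20 hd2] := h2 (e / 2 / (1 + cabs D1)) (divr_gt0 (divr_gt0 e0 (ltr0n _ 2)) q1).
have [d1 d10 hd1] := h1 (e / 2 / (1 + cabs D2)) (divr_gt0 (divr_gt0 e0 (ltr0n _ 2)) q2).
exists (Num.min (Num.min l1 d1) (d2 / (1 + cabs D1))); first by rewrite !lt_min l10 d10 divr_gt0.
move=> h; rewrite !lt_min => /andP[/andP[b1 b2] b3].
set k := G (w + h) - G w.
have kh : cabs k <= (1 + cabs D1) * cabs h by exact: hl1.
have kd : cabs k < d2 by apply: le_lt_trans kh _; move: b3; rewrite ltr_pdivlMr // mulrC.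
have := hd2 k kd; rewrite /k [G w + _]addrC subrK -/k => h3; have h4 := hd1 h b2.
have -> : E (G (w + h)) - E (G w) - h * (D1 * D2) = (E (G (w + h)) - E (G w) - k * D2) + (k - h * D1) * D2 by ring.
apply: le_trans (cabsD _ _) _; rewrite cabsM.
have t1 : e / 2 / (1 + cabs D1) * cabs k <= e / 2 * cabs h.
  by rewrite mulrAC ler_pdivrMr // -[leRHS]mulrA ler_wpM2l ?divr_ge0 ?(ltW e0) // mulrC.
have t2 : cabs (k - h * D1) * cabs D2 <= e / 2 * cabs h.
  apply: le_trans (ler_wpM2r a2 h4) _.
  have -> : e / 2 / (1 + cabs D2) * cabs h * cabs D2 = e / 2 * cabs h * (cabs D2 / (1 + cabs D2)) by field; lra.
  rewrite ler_piMr ?mulr_ge0 ?divr_ge0 ?cabs_ge0 ?(ltW e0) // ler_pdivrMr // mul1r; lra.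
lra.
Qed.

(** The real functions t |-> e^(-tb) (p cos(ta) + q sin(ta)), among them the real and imaginary
    parts of e^(it(a+ib)), are closed under differentiation. *)
Definition expcos (a b p q t : R) := expR (- (t * b)) * (p * cos (t * a) + q * sin (t * a)).

Lemma is_derive_expcos a b p q (t : R) :
  is_derive t (1 : R) (expcos a b p q) (expcos a b (a * q - b * p) (- (b * q) - a * p) t).
Proof.
have lin (c : R) : is_derive t (1 : R) (fun t : R => t * c) c.
  by have := is_deriveM (is_derive_id t 1) (is_derive_cst c t 1); move/is_derive_eq; apply; rewrite /GRing.scale /=; ring.
have e1 : is_derive t (1 : R) (fun t : R => expR (- (t * b))) (- b * expR (- (t * b))).
  have -> : (fun t : R => expR (- (t * b))) = (fun t : R => expR (t * - b)) by apply/funext => x; rewrite mulrN.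
  have := is_derive1_comp (g := fun t : R => t * - b) (is_derive_expR (t * - b)) (lin (- b)); move/is_derive_eq; apply.
  by rewrite [t * - b]mulrN mulrC.
have c1 : is_derive t (1 : R) (fun t : R => cos (t * a)) (- a * sin (t * a)).
  by have := is_derive1_comp (g := fun t : R => t * a) (is_derive_cos (t * a)) (lin a); move/is_derive_eq; apply; ring.
have s1 : is_derive t (1 : R) (fun t : R => sin (t * a)) (a * cos (t * a)).
  by have := is_derive1_comp (g := fun t : R => t * a) (is_derive_sin (t * a)) (lin a); move/is_derive_eq; apply; ring.
have pc := is_deriveM (is_derive_cst p t 1) c1; have qs := is_deriveM (is_derive_cst q t 1) s1.
have := is_deriveM e1 (is_deriveD pc qs); move/is_derive_eq; apply.
rewrite -[(_ + _) t]/(p * cos (t * a) + q * sin (t * a)) /expcos /GRing.scale /=; ring.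
Qed.

Lemma expcos_le a b p q (t : R) : 0 <= t <= 1 -> `|expcos a b p q t| <= expR `|b| * (`|p| + `|q|).
Proof.
move=> /andP[t0 t1]; rewrite normrM ler_pM //.
  rewrite ger0_norm ?expR_ge0 // ler_expR -mulrN; have := ler_norm (- b); rewrite normrN => h.
  apply: le_trans (_ : t * `|b| <= _); first by rewrite ler_wpM2l.
  by rewrite -[leRHS]mul1r ler_wpM2r.
apply: le_trans (ler_normD _ _) _; rewrite !normrM lerD //.
  by rewrite -[leRHS]mulr1 ler_wpM2l // ler_norml cos_geN1 cos_le1.
by rewrite -[leRHS]mulr1 ler_wpM2l // ler_norml sin_geN1 sin_le1.
Qed.

Lemma expcos_taylor a b p q p1 q1 : p1 = a * q - b * p -> q1 = - (b * q) - a * p ->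
  `|expcos a b p q 1 - p - p1| <= expR `|b| * (`|a * q1 - b * p1| + `|- (b * q1) - a * p1|).
Proof.
move=> ep eq.
have z0 (u v : R) : expcos a b u v 0 = u by rewrite /expcos !mul0r oppr0 expR0 cos0 sin0; ring.
have [c] := MVT_local (a := 0) (b := 1) (fun x _ => is_derive_expcos a b p q x).
rewrite min_l // max_r // => /andP[c0 c1]; rewrite z0 subr0 mulr1 -ep -eq => ->.
have [e] := MVT_local (a := 0) (b := c) (fun x _ => is_derive_expcos a b p1 q1 x).
rewrite min_l // max_r // => /andP[e0 e1]; rewrite z0 subr0 => ->.
rewrite normrM [`|c|]ger0_norm // -[leRHS]mulr1 ler_pM //; apply: expcos_le.
by rewrite e0 (le_trans e1).
Qed.

(** e^(i w) *)
Definition ec (w : C) : C := (expR (- Im w))%:C * (cos (Re w) +i* sin (Re w)).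

Lemma ecD z w : ec (z + w) = ec z * ec w.
Proof.
rewrite /ec ReD ImD opprD expRD cosD sinD; apply: complex_ext; rewrite ?ReM ?ImM /=; ring.
Qed.

Lemma cabs_ec w : cabs (ec w) = expR (- Im w).
Proof.
rewrite /ec cabsM cabs_real ger0_norm ?expR_ge0 // cabsE /= cos2Dsin2 sqrtr1 mulr1 //.
Qed.

Lemma ec0 : ec 0 = 1.
Proof. by rewrite /ec /= oppr0 expR0 cos0 sin0; apply: complex_ext => /=; ring. Qed.

Lemma ec_taylor (w : C) : cabs (ec w - 1 - 'i * w) <= 4 * expR (cabs w) * cabs w ^+ 2.
Proof.
set a := Re w; set b := Im w.
have eb : expR `|b| <= expR (cabs w) by rewrite ler_expR Im_le.
have ab : a ^+ 2 + b ^+ 2 = cabs w ^+ 2 by rewrite cabsE sqr_sqrtr // addr_ge0 ?sqr_ge0.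
have aux (u v : R) : `|u| <= a ^+ 2 + b ^+ 2 -> `|v| <= a ^+ 2 + b ^+ 2 ->
   expR `|b| * (`|u| + `|v|) <= 2 * expR (cabs w) * cabs w ^+ 2.
  move=> hu hv; rewrite -ab [2 * _]mulrC -mulrA ler_pM ?expR_ge0 ?addr_ge0 //; lra.
have b1 : `|a ^+ 2 - b ^+ 2| <= a ^+ 2 + b ^+ 2.
  by rewrite ler_norml; apply/andP; split; have := sqr_ge0 a; have := sqr_ge0 b; lra.
have b2 : `|2 * a * b| <= a ^+ 2 + b ^+ 2.
  by rewrite ler_norml; apply/andP; split; have := sqr_ge0 (a + b); have := sqr_ge0 (a - b); nra.
apply: le_trans (cabs_le _) _.
have -> : 4 * expR (cabs w) * cabs w ^+ 2 = 2 * expR (cabs w) * cabs w ^+ 2 + 2 * expR (cabs w) * cabs w ^+ 2.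
  by move: (expR _) (_ ^+ 2) => u v; ring.
apply: lerD.
  have -> : Re (ec w - 1 - 'i * w) = expcos a b 1 0 1 - 1 - (a * 0 - b * 1).
    by rewrite /ec !ReB !ReM /expcos /= -/a -/b !mul1r; ring.
  apply: le_trans (expcos_taylor (a := a) (b := b) (p := 1) (q := 0) erefl erefl) _; apply: aux; rewrite -normrN.
    by rewrite (_ : - _ = a ^+ 2 - b ^+ 2) //; ring.
  by rewrite (_ : - _ = - (2 * a * b)) ?normrN //; ring.
have -> : Im (ec w - 1 - 'i * w) = expcos a b 0 1 1 - 0 - (a * 1 - b * 0).
  by rewrite /ec !ImB !ImM /expcos /= -/a -/b !mul1r; ring.
apply: le_trans (expcos_taylor (a := a) (b := b) (p := 0) (q := 1) erefl erefl) _; apply: aux.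
  by rewrite -normrN (_ : - _ = 2 * a * b) //; ring.
by rewrite -normrN (_ : - _ = a ^+ 2 - b ^+ 2) //; ring.
Qed.

Lemma hol_ec w : hol ec w ('i * ec w).
Proof.
move=> e e0; have E0 : 0 < cabs (ec w) by rewrite cabs_ec expR_gt0.
pose K := cabs (ec w) * (4 * expR 1); have K0 : 0 < K by rewrite (mulr_gt0 E0) // mulr_gt0 ?expR_gt0.
exists (Num.min 1 (e / K)); first by rewrite lt_min ltr01 divr_gt0.
move=> h; rewrite lt_min => /andP[/ltW h1 /ltW h2].
have -> : ec (w + h) - ec w - h * ('i * ec w) = ec w * (ec h - 1 - 'i * h) by rewrite ecD; ring.
rewrite cabsM; apply: le_trans (_ : K * cabs h * cabs h <= _); last first.
  by rewrite ler_wpM2r ?cabs_ge0 // mulrC -ler_pdivlMr.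
apply: le_trans (ler_wpM2l (ltW E0) (ec_taylor h)) _.
rewrite /K expr2 -!mulrA ler_wpM2l ?(ltW E0) // ler_wpM2l // ler_wpM2r ?mulr_ge0 ?cabs_ge0 //.
by rewrite ler_expR.
Qed.

Definition cpt (x y : R) : C := x +i* y.

Definition M1c (E : R -> C) : C := M1 (fun x => Re (E x)) +i* M1 (fun x => Im (E x)).

Lemma weight_sum1 (p q s : R) : `|p| + `|q| <= 2 + `|p| + 2 * `|q| + `|s| - 2.
Proof. have := normr_ge0 q; have := normr_ge0 s; lra. Qed.

Lemma weight_sum2 (p q s : R) : `|q| + `|s| <= 2 + `|p| + 2 * `|q| + `|s| - 2.
Proof. have := normr_ge0 q; have := normr_ge0 p; lra. Qed.

Lemma clip_lipschitz (s1 s2 y y' : R) :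
  `|Num.max s1 (Num.min y' s2) - Num.max s1 (Num.min y s2)| <= `|y' - y|.
Proof.
wlog yy : y y' / y <= y'.
  by move=> H; have [h|h] := leP y y'; [exact: H|rewrite distrC [`|y' - y|]distrC; exact/H/ltW].
have m1 : Num.min y s2 <= Num.min y' s2 by rewrite le_min !ge_min yy lexx orbT.
have m2 : Num.min y' s2 <= Num.min y s2 + (y' - y).
  rewrite -lerBlDr le_min; apply/andP; split; first by rewrite lerBlDr addrC subrK ge_min lexx.
  by rewrite lerBlDr; apply: le_trans (_ : s2 <= _); [rewrite ge_min lexx orbT|rewrite lerDl subr_ge0].
move: m1 m2; move: (Num.min y s2) (Num.min y' s2) => u v m1 m2.
rewrite !ger0_norm ?subr_ge0 //; last by rewrite ge_max !le_max lexx m1 orbT.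
rewrite lerBlDr ge_max addrC; apply/andP; split.
  by apply: le_trans (_ : Num.max s1 u <= _); [rewrite le_max lexx|rewrite lerDl subr_ge0].
by apply: le_trans m2 _; rewrite lerD2r le_max lexx orbT.
Qed.

Lemma shift_closed (P Q : R -> R -> R) (s1 s2 : R) : s1 <= s2 ->
  (forall x y, s1 <= y <= s2 -> exists p1 p2 q2 : R, forall e : R, 0 < e ->
    exists2 dl : R, 0 < dl & forall x' y', `|x' - x| < dl -> `|y' - y| < dl ->
    `|P x' y' - (P x y + p1 * (x' - x) + p2 * (y' - y))| <= e * (`|x' - x| + `|y' - y|) /\
    `|Q x' y' - (Q x y + p2 * (x' - x) + q2 * (y' - y))| <= e * (`|x' - x| + `|y' - y|)) ->
  (forall y, s1 <= y <= s2 -> Q (2 * pi) y = Q 0 y) ->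
  M1 (P^~ s1) = M1 (P^~ s2).
Proof.
move=> s12 cl per.
have p0 := twopi_gt0 (R := R).
pose c y := Num.max s1 (Num.min y s2).
have cin y : s1 <= c y <= s2 by rewrite le_max lexx /= ge_max s12 ge_min lexx orbT.
have cE y : s1 <= y <= s2 -> c y = y by move=> /andP[h1 h2]; rewrite /c min_l // max_r.
have clip y y' : `|c y' - c y| <= `|y' - y|.
  exact: clip_lipschitz.
have cont x y : s1 <= y <= s2 -> forall e : R, 0 < e -> exists2 dl : R, 0 < dl & forall x' y', `|x' - x| < dl -> `|y' - y| < dl ->
    `|P x y - P x' y'| < e /\ `|Q x y - Q x' y'| < e.
  move=> hy e e0; have [p1 [p2 [q2 /(_ 1 ltr01)[dl dl0 hd]]]] := cl x y hy.
  pose K := 2 + `|p1| + 2 * `|p2| + `|q2|.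
  have K0 : 0 < K by rewrite /K -!addrA ltr_pwDl ?addr_ge0 ?mulr_ge0.
  exists (Num.min dl (e / K)); first by rewrite lt_min dl0 divr_gt0.
  move=> x' y'; rewrite !lt_min => /andP[u1 u2] /andP[u3 u4]; have [h1 h2] := hd x' y' u1 u3.
  rewrite ltr_pdivlMr // in u2; rewrite ltr_pdivlMr // in u4.
  have tri (u v z : R) : `|u - (v + z)| <= 1 * (`|x' - x| + `|y' - y|) -> `|z| <= (K - 2) * Num.max `|x' - x| `|y' - y| -> `|v - u| < e.
    move=> g1 g2; have -> : v - u = - ((u - (v + z)) + z) by ring.
    rewrite normrN; apply: le_lt_trans (ler_normD _ _) _.
    have m2 : `|x' - x| + `|y' - y| <= 2 * Num.max `|x' - x| `|y' - y|.
      by rewrite mulr_natl mulr2n lerD // le_max lexx ?orbT.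
    apply: le_lt_trans (_ : K * Num.max `|x' - x| `|y' - y| < e); last by rewrite mulrC; case: (leP `|x' - x| `|y' - y|).
    apply: le_trans (lerD g1 g2) _; rewrite mul1r.
    have -> : K * Num.max `|x' - x| `|y' - y| = 2 * Num.max `|x' - x| `|y' - y| + (K - 2) * Num.max `|x' - x| `|y' - y|.
      by rewrite -mulrDl [2 + _]addrC subrK.
    by rewrite lerD2r.
  split.
    apply: (tri (P x' y') (P x y) (p1 * (x' - x) + p2 * (y' - y))); first by rewrite addrA.
    apply: le_trans (ler_normD _ _) _; rewrite !normrM.
    apply: le_trans (_ : `|p1| * Num.max `|x' - x| `|y' - y| + `|p2| * Num.max `|x' - x| `|y' - y| <= _).
      by apply: lerD; rewrite ler_wpM2l // le_max lexx ?orbT.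
    rewrite -mulrDl ler_wpM2r ?le_max ?normr_ge0 // /K; exact: weight_sum1.
  apply: (tri (Q x' y') (Q x y) (p2 * (x' - x) + q2 * (y' - y))); first by rewrite addrA.
  apply: le_trans (ler_normD _ _) _; rewrite !normrM.
  apply: le_trans (_ : `|p2| * Num.max `|x' - x| `|y' - y| + `|q2| * Num.max `|x' - x| `|y' - y| <= _).
    by apply: lerD; rewrite ler_wpM2l // le_max lexx ?orbT.
  rewrite -mulrDl ler_wpM2r ?le_max ?normr_ge0 // /K; exact: weight_sum2.
have cP y : continuous (fun x => P x (c y)).
  move=> x; apply/cvgrPdist_lt => e e0; have [dl dl0 hd] := cont x (c y) (cin y) e e0.
  near=> x'; have [| |h1 _] := hd x' (c y); last exact: h1.
    by near: x'; apply: cvgr_distC_lt.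
  by rewrite subrr normr0.
have cQ x : continuous (fun y => Q x (c y)).
  move=> y; apply/cvgrPdist_lt => e e0; have [dl dl0 hd] := cont x (c y) (cin y) e e0.
  near=> y'; have [| |_ h1] := hd x (c y'); last exact: h1.
    by rewrite subrr normr0.
  by apply: le_lt_trans (clip _ _) _; near: y'; apply: cvgr_distC_lt.
have [A hA] := choice (fun y => primitive 0 (cP y)).
have [B hB] := choice (fun x => primitive s1 (cQ x)).
have : circ (fun x y => A y x) B 0 (2 * pi) s1 s2 = 0.
  apply: (goursat (P := fun x y => P x (c y)) (Q := fun x y => Q x (c y)) (ltW p0) s12).
- by move=> x y /andP[x0 _] _; exact: hA.
- by move=> x y _ /andP[y0 _]; exact: hB.
- move=> x y _ hy; have [p1 [p2 [q2 loc]]] := cl x y hy; exists p1, p2, q2 => e e0.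
  have [dl dl0 hd] := loc e e0; exists dl => // x' y' _ hy' b1 b2; rewrite !cE //; exact: hd.
have eB : B (2 * pi) s2 - B (2 * pi) s1 = B 0 s2 - B 0 s1.
  have [|z hz] := @MVT_local R (fun y => B (2 * pi) y - B 0 y) (fun y => Q (2 * pi) (c y) - Q 0 (c y)) s1 s2.
    by move=> y; rewrite min_l // => /andP[y1 _]; exact: (is_deriveB (hB (2 * pi) y y1) (hB 0 y y1)).
  by rewrite per // subrr mul0r; lra.
have M1A y : s1 <= y <= s2 -> M1 (P^~ y) = (2 * pi)^-1 * (A y (2 * pi) - A y 0).
  move=> hy; rewrite -[in P^~ y](cE y hy); exact: M1_antiderivative (hA y) (cP y).
rewrite /circ !M1A ?lexx ?s12 // => h; congr (_ * _); lra.
Unshelve. all: by end_near.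
Qed.

(** E dz is closed, and by periodicity the vertical sides of a period rectangle cancel in its
    circulation, so the two horizontal sides are equal. *)
Lemma strip_shift (E : C -> C) (s1 s2 : R) : s1 <= s2 ->
  (forall x y, s1 <= y <= s2 -> exists D, hol E (cpt x y) D) ->
  (forall y, s1 <= y <= s2 -> E (cpt (2 * pi) y) = E (cpt 0 y)) ->
  M1c (fun x => E (cpt x s1)) = M1c (fun x => E (cpt x s2)).
Proof.
move=> s12 hE per.
have loc x y : s1 <= y <= s2 -> exists D : C, forall e : R, 0 < e ->
    exists2 dl : R, 0 < dl & forall x' y', `|x' - x| < dl -> `|y' - y| < dl ->
    `|Re (E (cpt x' y')) - (Re (E (cpt x y)) + Re D * (x' - x) + - Im D * (y' - y))| <= e * (`|x' - x| + `|y' - y|) /\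
    `|Im (E (cpt x' y')) - (Im (E (cpt x y)) + Im D * (x' - x) + Re D * (y' - y))| <= e * (`|x' - x| + `|y' - y|).
  move=> hy; have [D hD] := hE x y hy; exists D => e e0; have [dl dl0 hd] := hD e e0.
  exists (dl / 2); first by rewrite divr_gt0.
  move=> x' y' hx hy'; pose h := cpt (x' - x) (y' - y).
  have hle : cabs h <= `|x' - x| + `|y' - y| by exact: cabs_le.
  have hh : cabs h < dl by lra.
  have eh : cpt x y + h = cpt x' y' by apply: complex_ext => /=; ring.
  have := hd h hh; rewrite eh => k.
  have k2 : e * cabs h <= e * (`|x' - x| + `|y' - y|) by rewrite ler_wpM2l // ltW.
  have kR := le_trans (Re_le _) (le_trans k k2); have kI := le_trans (Im_le _) (le_trans k k2).
  move: kR kI; rewrite !ReB !ImB ReM ImM /= => kR kI; split.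
    by apply: le_trans kR; rewrite le_eqVlt; apply/orP; left; apply/eqP; congr (`|_|); ring.
  by apply: le_trans kI; rewrite le_eqVlt; apply/orP; left; apply/eqP; congr (`|_|); ring.
apply: complex_ext => /=.
  apply: (@shift_closed (fun x y => Re (E (cpt x y))) (fun x y => - Im (E (cpt x y))) s1 s2 s12) => [x y hy|y hy]; last by rewrite per.
  have [D hD] := loc x y hy; exists (Re D), (- Im D), (- Re D) => e e0; have [dl dl0 hd] := hD e e0.
  exists dl => // x' y' b1 b2; have [k1 k2] := hd x' y' b1 b2; split=> //.
  by rewrite -normrN; apply: le_trans k2; rewrite le_eqVlt; apply/orP; left; apply/eqP; congr (`|_|); ring.
apply: (@shift_closed (fun x y => Im (E (cpt x y))) (fun x y => Re (E (cpt x y))) s1 s2 s12) => [x y hy|y hy]; last by rewrite per.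
have [D hD] := loc x y hy; exists (Im D), (Re D), (- Im D) => e e0; have [dl dl0 hd] := hD e e0.
by exists dl => // x' y' b1 b2; have [k1 k2] := hd x' y' b1 b2.
Qed.


Lemma hol_continuous_line E y : (forall x, exists D, hol E (cpt x y) D) ->
  continuous (fun x => Re (E (cpt x y))) /\ continuous (fun x => Im (E (cpt x y))).
Proof.
move=> hE.
have H x : forall e : R, 0 < e -> exists2 dl : R, 0 < dl & forall x', `|x - x'| < dl -> cabs (E (cpt x' y) - E (cpt x y)) < e.
  move=> e e0; have [D /hol_lip[dl dl0 hd]] := hE x.
  have K0 : 0 < 1 + cabs D by have := cabs_ge0 D; lra.
  exists (Num.min dl (e / (1 + cabs D))); first by rewrite lt_min dl0 divr_gt0.
  move=> x'; rewrite lt_min => /andP[b1 b2]; pose h := (x' - x)%:C.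
  have ch : cabs h = `|x - x'| by rewrite cabs_real distrC.
  have := hd h; rewrite ch => /(_ b1); rewrite (_ : cpt x y + h = cpt x' y); last by apply: complex_ext => /=; ring.
  by move/le_lt_trans; apply; rewrite mulrC -ltr_pdivlMr.
split=> x; apply/cvgrPdist_lt => e e0; have [dl dl0 hd] := H x e e0; near=> x'.
  have hx : `|x - x'| < dl by near: x'; apply: cvgr_dist_lt.
  by rewrite distrC; apply: le_lt_trans (hd x' hx); rewrite -ReB; exact: Re_le.
have hx : `|x - x'| < dl by near: x'; apply: cvgr_dist_lt.
by rewrite distrC; apply: le_lt_trans (hd x' hx); rewrite -ImB; exact: Im_le.
Unshelve. all: by end_near.
Qed.

Lemma contD (f g : R -> R) : continuous f -> continuous g -> continuous (fun x => f x + g x).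
Proof. by move=> cf cg x; exact: (@continuousD R R R f g x (cf x) (cg x)). Qed.

Lemma contZ c (f : R -> R) : continuous f -> continuous (fun x => c * f x).
Proof. by move=> cf x; apply: (@continuousM R R (cst c) f x); [exact: cst_continuous|exact: cf]. Qed.

Lemma M1_dist (g h : R -> R) e : continuous g -> continuous h -> (forall x, `|g x - h x| <= e) ->
  `|M1 g - M1 h| <= e.
Proof.
move=> cg ch gh.
have ce : continuous (fun _ : R => e) by move=> x; exact: cst_continuous.
have cc (c : R) (u : R -> R) : continuous u -> continuous (fun x => c * u x + e).
  by move=> cu; apply: contD => //; exact: contZ.
have l1 : M1 g <= 1 * M1 h + M1 (fun=> e).
  rewrite -M1_lin //; apply: M1_le => // [|x]; first exact: cc.
  by have := gh x; rewrite ler_norml => /andP[_]; lra.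
have l2 : M1 h <= 1 * M1 g + M1 (fun=> e).
  rewrite -M1_lin //; apply: M1_le => // [|x]; first exact: cc.
  by have := gh x; rewrite ler_norml => /andP[]; lra.
by move: l1 l2; rewrite !M1_cst !mul1r ler_norml => ? ?; apply/andP; split; lra.
Qed.

Lemma ec_period w : ec (w + (2 * pi)%:C) = ec w.
Proof. by rewrite /ec ReD ImD /= addr0 mulr_natl cosD2pi sinD2pi. Qed.

Lemma ec_neg w : ec w * ec (- w) = 1.
Proof. by rewrite -ecD subrr ec0. Qed.

(** Cauchy's estimate: D r is the mean over the circle of E(w0 + r e^(i x)) e^(- i x),
    the mean being the same on all smaller circles. *)
Lemma cauchy_estimate E w0 (r M : R) D : 0 < r ->
  (forall h, cabs h <= r -> exists D, hol E (w0 + h) D) ->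
  (forall h, cabs h <= r -> cabs (E (w0 + h)) <= M) -> hol E w0 D -> cabs D <= 2 * M / r.
Proof.
move=> r0 hE bE hD.
pose G z := E (w0 + r%:C * ec z) * ec (- z).
have small z : 0 <= Im z -> cabs (r%:C * ec z) <= r.
  move=> z0; rewrite cabsM cabs_real gtr0_norm // cabs_ec ler_piMr ?(ltW r0) //.
  by rewrite -[leRHS]expR0 ler_expR oppr_le0.
have hG z : 0 <= Im z -> exists D', hol G z D'.
  move=> z0; have [D1 h1] := hE _ (small z z0).
  have ha : hol (fun z => w0 + r%:C * z) (ec z) r%:C := hol_affine w0 r%:C (ec z).
  have hn : hol (fun z => - z) z (- 1).
    by apply: hol_ext (hol_affine 0 (- 1) z) => w; ring.
  have := holM (hol_comp (hol_comp (hol_ec z) ha) h1) (hol_comp hn (hol_ec (- z))).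
  by move=> hh; eexists; exact: hh.
have cG s : 0 <= s -> continuous (fun x => Re (G (cpt x s))) /\ continuous (fun x => Im (G (cpt x s))).
  by move=> s0; apply: hol_continuous_line => x; exact: hG.
have GM x : cabs (G (cpt x 0)) <= M.
  rewrite /G cabsM cabs_ec /= opprK expR0 mulr1; apply: bE; exact: small.
have c0 (c : R) : continuous (fun _ : R => c) by move=> x; exact: cst_continuous.
have M0 := le_trans (cabs_ge0 _) (GM 0).
have bound : cabs (M1c (fun x => G (cpt x 0))) <= 2 * M.
  have [c1 c2] := cG 0 (lexx 0).
  apply: le_trans (cabs_le _) _; rewrite /= mulrDl mul1r; apply: lerD.
    have := M1_dist (e := M) c1 (c0 0); rewrite M1_cst subr0; apply=> x; rewrite subr0.
    exact: le_trans (Re_le _) (GM x).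
  have := M1_dist (e := M) c2 (c0 0); rewrite M1_cst subr0; apply=> x; rewrite subr0.
  exact: le_trans (Im_le _) (GM x).
rewrite ler_pdivlMr //; apply: (@eps_le R _ _ (2 * r)) => e e0.
have [dl dl0 hd] := hD e e0.
have [s s0 hs] : exists2 s, 0 <= s & r * expR (- s) < dl.
  exists (r / dl); first by rewrite divr_ge0 // ltW.
  rewrite expRN ltr_pdivrMr ?expR_gt0 // -ltr_pdivrMl // mulrC.
  by apply: lt_le_trans (expR_ge1Dx _); rewrite ltrDr.
have key x : cabs (G (cpt x s) - (E w0 * ec (- cpt x s) + r%:C * D)) <= e * r.
  have em := ec_neg (cpt x s).
  set h := r%:C * ec (cpt x s).
  have ch : cabs h = r * expR (- s) by rewrite /h cabsM cabs_real (gtr0_norm r0) cabs_ec.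
  have -> : G (cpt x s) - (E w0 * ec (- cpt x s) + r%:C * D) = (E (w0 + h) - E w0 - h * D) * ec (- cpt x s).
    rewrite /G -/h -{1}[r%:C]mulr1 -em /h; ring.
  have := hd h; rewrite ch => /(_ hs) k.
  rewrite cabsM cabs_ec /= opprK; apply: le_trans (ler_wpM2r (expR_ge0 _) k) _.
  by rewrite -!mulrA -expRD addNr expR0 mulr1.
have eE x : E w0 * ec (- cpt x s) = (expR s * (Re (E w0)) * cos (1%:~R * x) + expR s * Im (E w0) * sin (1%:~R * x)) +i*
   (expR s * Im (E w0) * cos (1%:~R * x) + - (expR s * Re (E w0)) * sin (1%:~R * x)).
  by apply: complex_ext; rewrite ?ReM ?ImM /ec /= mul1r cosN sinN opprK; ring.
have [c1 c2] := cG s s0.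
have ccs a b c : continuous (fun x : R => a * cos (1%:~R * x) + b * sin (1%:~R * x) + c).
  apply: contD => //; apply: contD; apply: contZ; [exact: continuous_cosM|exact: continuous_sinM].
have M1cs a b c : M1 (fun x : R => a * cos (1%:~R * x) + b * sin (1%:~R * x) + c) = c.
  under eq_fun do rewrite -[_ + _ * sin _]mul1r.
  rewrite M1_lin; first by rewrite (M1_comb a b 1) M1_cst mulr0 mulr0 add0r.
    by move=> x; have := ccs a b 0 x; under eq_fun do rewrite addr0.
  exact: c0.
have dR : `|M1 (fun x => Re (G (cpt x s))) - r * Re D| <= e * r.
  rewrite -(M1cs (expR s * (Re (E w0))) (expR s * Im (E w0)) (r * Re D)).
  apply: M1_dist => // x; apply: le_trans (key x); rewrite eE.
  apply: le_trans (Re_le _); by rewrite ReB ReD [Re (_%:C * D)]ReM [Re _%:C]/= [Im _%:C]/= mul0r subr0.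
have dI : `|M1 (fun x => Im (G (cpt x s))) - r * Im D| <= e * r.
  rewrite -(M1cs (expR s * Im (E w0)) (- (expR s * (Re (E w0)))) (r * Im D)).
  apply: M1_dist => // x; apply: le_trans (key x); rewrite eE.
  apply: le_trans (Im_le _); by rewrite ImB ImD [Im (_%:C * D)]ImM [Re _%:C]/= [Im _%:C]/= mul0r addr0.
have {}key : cabs (M1c (fun x => G (cpt x s)) - r%:C * D) <= 2 * r * e.
  apply: le_trans (cabs_le _) _; rewrite ReB ImB ReM ImM /= !mul0r subr0 addr0.
  by move: dR dI; move: (r * Re D) (r * Im D) => ? ?; lra.
have -> : cabs D * r = cabs (r%:C * D) by rewrite cabsM cabs_real gtr0_norm // mulrC.
have shift : M1c (fun x => G (cpt x 0)) = M1c (fun x => G (cpt x s)).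
  apply: strip_shift => // [x y /andP[y0 _]|y _]; first exact: hG.
  have e1 : cpt (2 * pi) y = cpt 0 y + (2 * pi)%:C by apply: complex_ext => /=; ring.
  have e2 : - cpt 0 y = - cpt (2 * pi) y + (2 * pi)%:C by rewrite e1; ring.
  by rewrite /G e2 ec_period e1 ec_period.
rewrite shift in bound.
rewrite -[r%:C * D](subrK (M1c (fun x => G (cpt x s)))) -opprB; apply: le_trans (cabsD _ _) _.
by rewrite cabsN addrC; exact: lerD.
Qed.

(** A bound together with holomorphy, in the form that [fdiff] preserves with a smaller radius. *)
Definition disc E w0 (r M : R) := forall h, cabs h < r -> (exists D, hol E (w0 + h) D) /\ cabs (E (w0 + h)) <= M.

Lemma hol_is_derive E w D : hol E w D ->
  is_derive (0 : R) (1 : R) (fun t : R => Re (E (w + t%:C))) (Re D) /\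
  is_derive (0 : R) (1 : R) (fun t : R => Im (E (w + t%:C))) (Im D).
Proof.
move=> hD; split; apply: is_derive_slope => e e0; have [dl dl0 hd] := hD e e0; exists dl => // h hh;
  have := hd h%:C; rewrite cabs_real => /(_ hh) k; rewrite add0r addr0.
  by apply: le_trans k; apply: le_trans (Re_le _); rewrite !ReB ReM /= mul0r subr0.
by apply: le_trans k; apply: le_trans (Im_le _); rewrite !ImB ImM /= mul0r addr0.
Qed.

Lemma disc_lip E w0 r M h (t : R) : 0 < r -> disc E w0 r M -> 0 <= t -> cabs h + t < r / 2 ->
  cabs (E (w0 + h + t%:C) - E (w0 + h)) <= 16 * M / r * t.
Proof.
move=> r0 hE t0 ht.
have dd s : 0 <= s <= t -> exists D, hol E (w0 + h + s%:C) D /\ cabs D <= 8 * M / r.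
  move=> /andP[s0 st].
  have hs : cabs (h + s%:C) <= cabs h + t by apply: le_trans (cabsD _ _) _; rewrite cabs_real ger0_norm // lerD2l.
  have [|[D hD] _] := hE (h + s%:C); first by lra.
  exists D; rewrite -addrA; split=> //.
  have r4 : 0 < r / 4 by rewrite divr_gt0.
  rewrite (_ : 8 * M / r = 2 * M / (r / 4)); last by field; exact: lt0r_neq0.
  apply: (cauchy_estimate r4 _ _ hD) => k hk; rewrite -addrA;
  have [|] := hE (h + s%:C + k) => //; apply: le_lt_trans (cabsD _ _) _; lra.
have H (P : C -> R) (hPb : forall z : C, `|P z| <= cabs z)
   (hPd : forall w D, hol E w D -> is_derive (0 : R) (1 : R) (fun t : R => P (E (w + t%:C))) (P D)) :
   `|P (E (w0 + h + t%:C)) - P (E (w0 + h))| <= 8 * M / r * t.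
  have dd' s : exists D, 0 <= s <= t -> hol E (w0 + h + s%:C) D /\ cabs D <= 8 * M / r.
    case: (boolP (0 <= s <= t)) => [/dd[D hD]|_]; first by exists D.
    by exists 0.
  have [D hD] := choice dd'.
  have [|c] := @MVT_local R (fun s => P (E (w0 + h + s%:C))) (fun s => P (D s)) 0 t.
    move=> s; rewrite min_l // max_r // => hs; have [h1 _] := hD s hs.
    have := hPd _ _ h1; rewrite -{1}(addNr s) -[in - s + s](mul1r s) => /is_derive_affine.
    rewrite mulr1; congr is_derive; apply/funext => x; congr (P (E _)).
    by apply: complex_ext; rewrite ?ReD ?ImD /=; ring.
  rewrite min_l // max_r // subr0 addr0 => hc ->; rewrite normrM (ger0_norm t0) ler_wpM2r //.
  have [_ h2] := hD c hc; exact: le_trans (hPb _) h2.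
apply: le_trans (cabs_le _) _; rewrite ReB ImB.
have h1 := H (fun z : C => Re z) Re_le (fun w D hh => (hol_is_derive hh).1).
have h2 := H (fun z : C => Im z) Im_le (fun w D hh => (hol_is_derive hh).2).
have e16 : 16 * M / r * t = 2 * (8 * M / r * t) by ring.
by rewrite e16; move: h1 h2; clear; lra.
Qed.

Definition fdiff (t : R) (E : C -> C) : C -> C := fun w => E (w + t%:C) - E w.

Lemma holB E1 E2 w D1 D2 : hol E1 w D1 -> hol E2 w D2 -> hol (fun z => E1 z - E2 z) w (D1 - D2).
Proof.
move=> h1 h2 e e0; have e2 : 0 < e / 2 by rewrite divr_gt0.
have [d1 d10 hd1] := h1 _ e2; have [d2 d20 hd2] := h2 _ e2.
exists (Num.min d1 d2); first by rewrite lt_min d10.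
move=> h; rewrite lt_min => /andP[b1 b2].
have -> : E1 (w + h) - E2 (w + h) - (E1 w - E2 w) - h * (D1 - D2) =
  (E1 (w + h) - E1 w - h * D1) - (E2 (w + h) - E2 w - h * D2) by ring.
by apply: le_trans (cabsB _ _) _; have := hd1 h b1; have := hd2 h b2; lra.
Qed.

Lemma hol_fdiff t E w D1 D2 : hol E (w + t%:C) D1 -> hol E w D2 -> hol (fdiff t E) w (D1 - D2).
Proof.
move=> h1 h2; apply: holB => // e e0; have [dl dl0 hd] := h1 e e0; exists dl => // h hh.
by rewrite (_ : w + h + t%:C = w + t%:C + h); [exact: hd|ring].
Qed.

(** Each difference gains a factor t by [disc_lip], at the price of a smaller disc. *)
Lemma fdiff_bound q : forall r : R, 0 < r -> exists t0 K : R, [/\ 0 < t0, 0 <= K & forall E w0 M t,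
  0 <= M -> 0 < t -> t <= t0 -> disc E w0 r M -> cabs (iter q (fdiff t) E w0) <= K * M * t ^+ q].
Proof.
elim: q => [|q IH] r r0.
  exists 1, 1; split=> // E w0 M t M0 _ _ hE; rewrite expr0 mulr1 mul1r.
  by have [|_] := hE 0; rewrite ?cabs0 // addr0.
have r4 : 0 < r / 4 by rewrite divr_gt0.
have [t0 [K [t00 K0 hK]]] := IH (r / 4) r4.
exists (Num.min t0 (r / 8)), (K * (16 / r)); split.
- by rewrite lt_min t00 divr_gt0.
- by rewrite mulr_ge0 // divr_ge0 // ltW.
move=> E w0 M t M0 tp; rewrite le_min => /andP[t1 t2] hE; rewrite iterSr.
have tl := ltW tp.
have M1 : 0 <= 16 * M / r * t by rewrite !mulr_ge0 ?invr_ge0 ?(ltW r0).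
apply: le_trans (hK _ w0 _ t M1 tp t1 _) _; last first.
  by rewrite exprS le_eqVlt; apply/orP; left; apply/eqP; field; exact: lt0r_neq0.
move=> h hh.
have ct : cabs t%:C = t by rewrite cabs_real ger0_norm.
split; last by apply: disc_lip => //; lra.
have [|[D1 h1] _] := hE (h + t%:C); first by apply: le_lt_trans (cabsD _ _) _; rewrite ct; lra.
have [|[D2 h2] _] := hE h; first by lra.
by exists (D1 - D2); apply: hol_fdiff => //; rewrite -addrA.
Qed.

End Holomorphic.

(** * Periodic holomorphic functions of several variables *)

Section SeveralVariables.
Context {R : realType} {n : nat}.
Local Notation C := R[i].
Local Notation Re := complex.Re.
Local Notation Im := complex.Im.
Local Notation rV := 'rV[R]_n.
Local Notation cV := 'rV[R[i]]_n.
Local Notation Zd := 'rV[int]_n.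
Local Notation mean := (@torus_mean R n).
Local Open Scope complex_scope.

Definition cvec (x y : rV) : cV := \row_j cpt (x 0 j) (y 0 j).
Definition cev j : cV := delta_mx 0 j.

Definition CPc (u : rV -> C) := CP (fun x => Re (u x)) /\ CP (fun x => Im (u x)).
Definition cm (u : rV -> C) : C := mean (fun x => Re (u x)) +i* mean (fun x => Im (u x)).

Lemma CPcM u v : CPc u -> CPc v -> CPc (fun x => u x * v x).
Proof.
move=> [u1 u2] [v1 v2]; split.
  by under eq_fun do rewrite ReM; apply: CPB; apply: CPM.
by under eq_fun do rewrite ImM; apply: CPD; apply: CPM.
Qed.

Lemma CPcB u v : CPc u -> CPc v -> CPc (fun x => u x - v x).
Proof.
move=> [u1 u2] [v1 v2]; split.
  by under eq_fun do rewrite ReB; apply: CPB.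
by under eq_fun do rewrite ImB; apply: CPB.
Qed.

Lemma CPc_shift u v : CPc u -> CPc (fun x => u (x + v)).
Proof. by move=> [u1 u2]; split; [exact: (CP_shift v u1)|exact: (CP_shift v u2)]. Qed.

Lemma cm_shiftr u v : CPc u -> cm (fun x => u (x + v)) = cm u.
Proof. by move=> [u1 u2]; apply: complex_ext; rewrite /= ?(mean_shift v u1) ?(mean_shift v u2). Qed.

Lemma cmB u v : CPc u -> CPc v -> cm (fun x => u x - v x) = cm u - cm v.
Proof.
move=> [u1 u2] [v1 v2]; apply: complex_ext; rewrite ?ReB ?ImB /= -meanB //; congr mean;
by apply/funext => x; rewrite ?ReB ?ImB.
Qed.

Lemma cmZ c u : CPc u -> cm (fun x => c * u x) = c * cm u.
Proof.
move=> [u1 u2]; apply: complex_ext; rewrite ?ReM ?ImM /=.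
  rewrite -!meanZ // -meanB; [|exact: CPZ|exact: CPZ].
  by congr mean; apply/funext => x; rewrite ReM.
rewrite -!meanZ // -meanD; [|exact: CPZ|exact: CPZ].
by congr mean; apply/funext => x; rewrite ImM.
Qed.

Lemma cabs_cm u M : CPc u -> (forall x, cabs (u x) <= M) -> cabs (cm u) <= 2 * M.
Proof.
move=> [u1 u2] h; apply: le_trans (cabs_le _) _; rewrite mulrDl mul1r; apply: lerD.
  by apply: mean_norm_le => // x; exact: le_trans (Re_le _) (h x).
by apply: mean_norm_le => // x; exact: le_trans (Im_le _) (h x).
Qed.

Lemma cvecD j (x y : rV) (a b : R) :
  cvec (x + a *: evec j) (y + b *: evec j) = cvec x y + cpt a b *: cev j.
Proof.
apply/rowP => i; rewrite !mxE; case: (_ && _) => /=; apply: complex_ext; rewrite ?ReD ?ImD ?ReM ?ImM /=; ring.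
Qed.

Lemma cvec_real j (x y : rV) (a : R) : cvec (x + a *: evec j) y = cvec x y + a%:C *: cev j.
Proof. by rewrite -[y in LHS]addr0 -(scale0r (evec j)) cvecD. Qed.

(** The imaginary parts range over a product of sets that contain 0 and are
    star-shaped with respect to 0. *)
Variable I : 'I_n -> R -> Prop.
Hypothesis I0 : forall j, I j 0.
Hypothesis Istar : forall j s t, I j s -> (0 <= t <= s) || (s <= t <= 0) -> I j t.
Definition inI (y : rV) := forall j, I j (y 0 j).

(** Separate holomorphy in each angle and periodicity, over imaginary parts in the product of the I j:
    enough to move one angle at a time. Continuity is required on real tori only. *)
Definition hfun (u : cV -> C) := [/\
  forall x y j, inI y -> exists D, hol (fun w => u (cvec x y + w *: cev j)) 0 D,
  forall x y j, inI y -> u (cvec x y + (2 * pi)%:C *: cev j) = u (cvec x y) &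
  forall y, inI y -> CPc (fun x => u (cvec x y))].

Lemma hfunM u v : hfun u -> hfun v -> hfun (fun z => u z * v z).
Proof.
move=> [u1 u2 u3] [v1 v2 v3]; split=> [x y j hy|x y j hy|y hy].
- have [D1 h1] := u1 x y j hy; have [D2 h2] := v1 x y j hy.
  by eexists; exact: holM h1 h2.
- by rewrite u2 // v2.
- exact: CPcM (u3 y hy) (v3 y hy).
Qed.

(** The mean over the torus is a mean of means over lines in direction j by [mean_swap]; the line
    means are moved by [strip_shift]. *)
Lemma cm_shift1 u (y : rV) j s : hfun u -> inI y -> y 0 j = 0 -> I j s ->
  cm (fun x => u (cvec x y)) = cm (fun x => u (cvec x (y + s *: evec j))).
Proof.
move=> [u1 u2 u3] hy yj js.
have inIb b : I j b -> inI (y + b *: evec j).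
  move=> jb i; rewrite !mxE eqxx /=; case: eqP => [->|_]; last by rewrite mulr0 addr0.
  by rewrite yj add0r mulr1.
have c1 := u3 y hy; have c2 := u3 _ (inIb s js).
have ext x a b : u (cvec (x + a *: evec j) (y + b *: evec j)) = u (cvec x y + cpt a b *: cev j) by rewrite cvecD.
have slice x : M1c (fun t => u (cvec (x + t *: evec j) y)) = M1c (fun t => u (cvec (x + t *: evec j) (y + s *: evec j))).
  pose E w := u (cvec x y + w *: cev j).
  have hE a b : I j b -> exists D, hol E (cpt a b) D.
    move=> jb; have [D hD] := u1 (x + a *: evec j) (y + b *: evec j) j (inIb b jb).
    have e1 h : u (cvec (x + a *: evec j) (y + b *: evec j) + h *: cev j) = E (cpt a b + h).
      by rewrite cvecD -addrA -scalerDl.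
    exists D => e e0; have [dl dl0 hd] := hD e e0; exists dl; first exact: dl0.
    by move=> h hh; have := hd h hh; rewrite !e1 add0r addr0.
  have pE b : I j b -> E (cpt (2 * pi) b) = E (cpt 0 b).
    move=> jb; have := u2 x (y + b *: evec j) j (inIb b jb).
    rewrite -[x in cvec x]addr0 -(scale0r (evec j)) cvecD -addrA -scalerDl /E.
    by congr (u (_ + _ *: _) = _); apply: complex_ext => /=; ring.
  have eE b : (fun t => u (cvec (x + t *: evec j) (y + b *: evec j))) = fun t => E (cpt t b).
    by apply/funext => t; rewrite cvecD.
  have := eE 0; rewrite scale0r addr0 => ->; rewrite eE.
  have [s0|s0] := leP 0 s.
    apply: (strip_shift s0) => [a b hb|b hb]; [apply: hE|apply: pE]; by apply: (Istar js); rewrite hb.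
  apply/esym; apply: (strip_shift (ltW s0)) => [a b hb|b hb]; [apply: hE|apply: pE];
  by apply: (Istar js); rewrite hb orbT.
apply: complex_ext => /=.
  rewrite -(mean_swap j c1.1).2 -(mean_swap j c2.1).2; congr mean; apply/funext => x.
  exact: (congr1 (fun z : C => Re z) (slice x)).
rewrite -(mean_swap j c1.2).2 -(mean_swap j c2.2).2; congr mean; apply/funext => x.
exact: (congr1 (fun z : C => Im z) (slice x)).
Qed.

(** One angle at a time; the star shape keeps the intermediate points in the domain. *)
Lemma cm_shift u (y : rV) : hfun u -> inI y -> cm (fun x => u (cvec x 0)) = cm (fun x => u (cvec x y)).
Proof.
move=> hu hy; pose ys (s : seq 'I_n) : rV := \row_i (if i \in s then y 0 i else 0).
suff H s : uniq s -> cm (fun x => u (cvec x 0)) = cm (fun x => u (cvec x (ys s))).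
  rewrite (H (enum 'I_n)) ?enum_uniq //; congr cm; apply/funext => x; congr (u (cvec x _)).
  by apply/rowP => i; rewrite mxE mem_enum.
elim: s => [_|j s IH /= /andP[js us]].
  by congr cm; apply/funext => x; congr (u (cvec x _)); apply/rowP => i; rewrite !mxE.
rewrite (IH us) (@cm_shift1 u (ys s) j (y 0 j)) //.
- congr cm; apply/funext => x; congr (u (cvec x _)); apply/rowP => i.
  rewrite !mxE inE eqxx /=; case: (eqVneq i j) => [->|_]; last by rewrite mulr0 addr0.
  by rewrite (negbTE js) add0r mulr1.
- by move=> i; rewrite mxE; case: ifP => _.
- by rewrite mxE (negbTE js).
Qed.

(** e^(- i k z) *)
Definition chr (k : Zd) (z : cV) : C := ec (- \sum_j (k 0 j)%:~R * z 0 j).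

Lemma chr_cvec k x y : chr k (cvec x y) = ec (- cpt (dotp k x) (dotp k y)).
Proof.
congr (ec (- _)); rewrite /dotp; elim: (index_enum _) => [|j s IH]; first by rewrite !big_nil.
rewrite !big_cons IH mxE; have -> : (k 0 j)%:~R = ((k 0 j)%:~R : R)%:C :> C by rewrite rmorph_int.
by apply: complex_ext; rewrite ?ReD ?ImD ?ReM ?ImM /=; ring.
Qed.

Lemma chr_shift k z w j : chr k (z + w *: cev j) = ec (- \sum_i (k 0 i)%:~R * z 0 i + (- (k 0 j)%:~R) * w).
Proof.
congr ec; rewrite (_ : \sum_i (k 0 i)%:~R * (z + w *: cev j) 0 i = \sum_i (k 0 i)%:~R * z 0 i + (k 0 j)%:~R * w).
  by rewrite opprD mulNr.
under eq_bigr do rewrite !mxE mulrDr; rewrite big_split /=; congr (_ + _).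
rewrite (bigD1 j) //= !eqxx mulr1 big1 ?addr0 // => i ij.
by rewrite (negbTE ij) !mulr0.
Qed.

Lemma ec_period_int (w : C) (p : int) : ec (w + p%:~R * (2 * pi)%:C) = ec w.
Proof.
have -> : p%:~R * (2 * pi)%:C = (2 * pi * p%:~R)%:C :> C.
  have -> : p%:~R = (p%:~R : R)%:C :> C by rewrite rmorph_int.
  by rewrite -rmorphM mulrC.
by rewrite /ec ReD ImD /= addr0 cosDint sinDint.
Qed.

Lemma hfun_chr k : hfun (chr k).
Proof.
split=> [x y j _|x y j _|y _].
- pose a := - \sum_i (k 0 i)%:~R * cvec x y 0 i.
  have h := hol_comp (hol_affine a (- (k 0 j)%:~R) 0) (hol_ec _).
  by eexists; apply: hol_ext h => w; rewrite chr_shift.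
- have := chr_shift k (cvec x y) (2 * pi)%:C j; rewrite -intrN ec_period_int => ->.
  by [].
- have h x : chr k (cvec x y) = (expR (dotp k y))%:C * (cos (dotp k x) -i* sin (dotp k x)).
    by rewrite chr_cvec /ec /= opprK cosN sinN.
  split; under eq_fun do rewrite h ?ReM ?ImM /= mul0r ?subr0 ?addr0; apply: CPZ; first exact: CP_cos.
  by apply: CPN; exact: CP_sin.
Qed.

Definition ccoef u k := cm (fun x => u (cvec x 0) * chr k (cvec x 0)).

Lemma cabs_chr k x y : cabs (chr k (cvec x y)) = expR (dotp k y).
Proof. by rewrite chr_cvec cabs_ec /= opprK. Qed.

Lemma ccoef_shift u k y : hfun u -> inI y -> ccoef u k = cm (fun x => u (cvec x y) * chr k (cvec x y)).
Proof. by move=> hu hy; exact: (cm_shift (hfunM hu (hfun_chr k)) hy). Qed.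

(** Choosing y with signs opposite to those of k makes the factor exponentially small. *)
Lemma ccoef_bound u k y M : hfun u -> inI y -> (forall x, cabs (u (cvec x y)) <= M) ->
  cabs (ccoef u k) <= 2 * M * expR (dotp k y).
Proof.
move=> hu hy hM; rewrite (ccoef_shift k hu hy) -mulrA; apply: cabs_cm.
  by have [_ _ h] := hfunM hu (hfun_chr k); exact: h.
by move=> x; rewrite cabsM cabs_chr ler_wpM2r ?expR_ge0.
Qed.

Definition tdiff (t : R) j (u : cV -> C) : cV -> C := fun z => u (z + t%:C *: cev j) - u z.

Lemma hfun_tdiff t j u : hfun u -> hfun (tdiff t j u).
Proof.
move=> [u1 u2 u3]; split=> [x y i hy|x y i hy|y hy].
- have [D1 h1] := u1 (x + t *: evec j) y i hy; have [D2 h2] := u1 x y i hy.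
  exists (D1 - D2); apply: hol_ext (holB h1 h2) => w.
  by rewrite /tdiff cvec_real addrAC.
- have e1 : cvec x y + (2 * pi)%:C *: cev i + t%:C *: cev j = cvec (x + t *: evec j) y + (2 * pi)%:C *: cev i.
    rewrite cvec_real; exact: addrAC.
  by rewrite /tdiff e1 -(cvec_real j x y t); congr (_ - _); exact: u2.
- have h := CPcB (CPc_shift (t *: evec j) (u3 y hy)) (u3 y hy).
  by move: h; congr CPc; apply/funext => x; rewrite /tdiff cvec_real.
Qed.

Lemma ccoef_tdiff t j u k : hfun u -> ccoef (tdiff t j u) k = (ec ((k 0 j)%:~R * t)%:C - 1) * ccoef u k.
Proof.
move=> hu; have y0 : inI 0 by move=> i; rewrite mxE.
pose v x := u (cvec x 0) * chr k (cvec x 0).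
have cv : CPc v by have [_ _ h] := hfunM hu (hfun_chr k); exact: h.
have e x : tdiff t j u (cvec x 0) * chr k (cvec x 0) = ec ((k 0 j)%:~R * t)%:C * v (x + t *: evec j) - v x.
  rewrite /v /tdiff -cvec_real mulrBl; congr (_ - _).
  rewrite [RHS]mulrCA; congr (_ * _); rewrite !chr_cvec -ecD; congr ec.
  rewrite dotpDr dotpZ dotp_evec !dotp0r; apply: complex_ext; rewrite ?ReD ?ImD /=; ring.
rewrite /ccoef; under eq_fun do rewrite e.
have cs := CPc_shift (t *: evec j) cv.
rewrite cmB //; last first.
  by have := CPcM (u := fun=> ec ((k 0 j)%:~R * t)%:C) _ cs; apply; split; exact: CP_cst.
by rewrite cmZ // cm_shiftr // mulrBl mul1r.
Qed.

Lemma iter_tdiff q t j u : hfun u -> hfun (iter q (tdiff t j) u) /\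
  (forall k, ccoef (iter q (tdiff t j) u) k = (ec ((k 0 j)%:~R * t)%:C - 1) ^+ q * ccoef u k) /\
  (forall z w, iter q (tdiff t j) u (z + w *: cev j) = iter q (fdiff t) (fun w => u (z + w *: cev j)) w).
Proof.
move=> hu; elim: q => [|q [h1 [h2 h3]]]; first by split=> //; split=> // k; rewrite expr0 mul1r.
rewrite !iterS; split; first exact: hfun_tdiff; split=> [k|z w].
  by rewrite ccoef_tdiff // h2 exprS mulrA.
by rewrite /tdiff /fdiff -addrA -scalerDl !h3.
Qed.

(** Polynomial decay of the coefficients in the direction j, on top of the
    exponential decay, when u continues to a fixed neighbourhood in that direction. *)
Lemma ccoef_decay u j (eta M : R) q : 0 < eta -> 0 <= M -> hfun u ->
  (forall x y : rV, (forall i, 0 <= x 0 i <= 2 * pi) -> inI y -> disc (fun w => u (cvec x y + w *: cev j)) 0 eta M) ->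
  exists2 K : R, 0 <= K & forall (k : Zd) (y : rV), inI y -> `|(k 0 j)%:~R| ^+ q * cabs (ccoef u k) <= K * expR (dotp k y).
Proof.
move=> eta0 M0 hu hd; have [t0 [K [t00 K0 hK]]] := fdiff_bound q eta0.
have cell v (B : R) : hfun v -> (forall x y : rV, (forall i, 0 <= x 0 i <= 2 * pi) -> inI y -> cabs (v (cvec x y)) <= B) ->
    forall x y : rV, inI y -> cabs (v (cvec x y)) <= B.
  move=> [_ _ hv] hB x y hy; have [[_ c1] [_ c2]] := hv y hy; have [k hk] := shift_into_box 0 x.
  rewrite (_ : v (cvec x y) = v (cvec (x + period id k) y)).
    by apply: hB => // i; have := hk i; rewrite add0r.
  by apply: complex_ext; rewrite ?c1 ?c2.
have p0 := pi_gt0 R.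
have P0 : 0 <= pi / t0 by rewrite divr_ge0 // ltW.
exists (2 * (K * M * pi ^+ q) + (pi / t0) ^+ q * (2 * M)).
  by rewrite addr_ge0 // !mulr_ge0 // exprn_ge0 // ltW.
move=> k y hy; rewrite mulrDl.
have E0 := expR_ge0 (dotp k y).
have tB : 0 <= 2 * (K * M * pi ^+ q) * expR (dotp k y) by rewrite !mulr_ge0 // exprn_ge0 // ltW.
have tA : 0 <= (pi / t0) ^+ q * (2 * M) * expR (dotp k y) by rewrite !mulr_ge0 // exprn_ge0.
have [kj|kj] := leP `|(k 0 j)%:~R : R| (pi / t0).
  apply: le_trans (_ : (pi / t0) ^+ q * (2 * M) * expR (dotp k y) <= _); last by rewrite lerDr.
  rewrite -mulrA; apply: ler_pM; rewrite ?exprn_ge0 ?cabs_ge0 //.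
    by rewrite lerXn2r ?nnegrE.
  apply: ccoef_bound => // x; apply: cell hy => // x' y' hx' hy'.
  by have [|_] := hd x' y' hx' hy' 0; rewrite ?cabs0 // addr0 scale0r addr0.
apply: le_trans (_ : 2 * (K * M * pi ^+ q) * expR (dotp k y) <= _); last by rewrite lerDl.
have k0 : 0 < `|(k 0 j)%:~R : R| by apply: le_lt_trans kj.
pose t : R := pi / `|(k 0 j)%:~R|.
have tp0 : 0 < t by rewrite divr_gt0.
have tt0 : t <= t0 by rewrite /t ler_pdivrMr // mulrC -ler_pdivrMr // ltW.
have [h1 [h2 h3]] := iter_tdiff q t j hu.
have ekt : ec ((k 0 j)%:~R * t)%:C = -1.
  have [kn|kn] := leP 0 ((k 0 j)%:~R : R).
    rewrite (_ : (k 0 j)%:~R * t = pi); last by rewrite /t ger0_norm // mulrCA mulfV ?mulr1 // gt_eqF // -(ger0_norm kn).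
    by apply: complex_ext; rewrite /ec ?ReM ?ImM /= cospi sinpi oppr0 expR0; ring.
  rewrite (_ : (k 0 j)%:~R * t = - pi); last by rewrite /t ltr0_norm // invrN mulrN mulrN mulrCA mulfV ?mulr1 // lt_eqF.
  by apply: complex_ext; rewrite /ec ?ReM ?ImM /= cosN sinN cospi sinpi oppr0 expR0; ring.
have bq : cabs (ccoef (iter q (tdiff t j) u) k) <= 2 * (K * M * t ^+ q) * expR (dotp k y).
  apply: ccoef_bound => // x; apply: cell hy => // x' y' hx' hy'.
  have := h3 (cvec x' y') 0; rewrite scale0r addr0 => ->.
  by apply: hK => //; exact: hd.
move: bq; rewrite h2 ekt cabsM => bq.
have e2 : cabs ((-1 - 1) ^+ q : C) = 2 ^+ q.
  have c2 : cabs (-1 - 1 : C) = 2 by rewrite (_ : -1 - 1 = (-2)%:C :> C) ?cabs_real ?normrN ?normr_nat //; apply: complex_ext => /=; ring.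
  by elim: (q) => [|i IH]; rewrite ?expr0 ?cabs1 // !exprS cabsM IH c2.
rewrite e2 in bq.
have two1 : 1 <= 2 ^+ q :> R by rewrite exprn_ege1 // ler1n.
have kq : 0 <= `|(k 0 j)%:~R : R| ^+ q by rewrite exprn_ge0.
apply: (@le_trans _ _ (`|(k 0 j)%:~R| ^+ q * (2 * (K * M * t ^+ q) * expR (dotp k y)))).
  by rewrite ler_wpM2l //; apply: le_trans bq; rewrite ler_peMl ?cabs_ge0.
rewrite le_eqVlt; apply/orP; left; apply/eqP.
have -> : pi ^+ q = `|(k 0 j)%:~R| ^+ q * t ^+ q :> R by rewrite -exprMn /t mulrCA mulfV ?mulr1 // gt_eqF.
by ring.
Qed.

End SeveralVariables.
(** * Expansion of an analytic forcing *)

(** The summand is odd in k and the box is symmetric. *)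
Lemma even_tp (R : realType) d N (al be : 'rV[int]_d -> R) x : (forall k, al (- k) = - al k) -> (forall k, be (- k) = be k) ->
  tp (box d N) al be x = 0.
Proof.
move=> ha hb; set S := tp _ _ _ _.
have pe : perm_eq (map -%R (box d N)) (box d N).
  apply: uniq_perm; [by rewrite map_inj_uniq ?uniq_box //; exact: oppr_inj|exact: uniq_box|].
  move=> k; apply/mapP/idP => [[l hl ->]|hk]; first exact: symm_box.
  by exists (- k); rewrite ?opprK //; exact: symm_box.
have : S = - S.
  rewrite {1}/S /tp -(perm_big _ pe) big_map -sumrN; apply: eq_bigr => k _.
  by rewrite ha hb dotpNl cosN sinN; ring.
by move/eqP; rewrite -addr_eq0 -mulr2n mulrn_eq0 /= => /eqP.
Qed.


Lemma half_radius_aux (R : realType) (u v q a b : R) : a <= q / 8 -> b <= q / 8 -> 0 < q -> - u <= a -> v <= b -> a + (v - u) < q / 2.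
Proof. lra. Qed.

Lemma half_sum_aux (R : realType) (p q a b c e : R) : q <= b + e -> p <= a + c ->
  2^-1 * p + 2^-1 * q <= 2^-1 * (a + b + (c + e)).
Proof. lra. Qed.

Lemma half_le_aux (R : realType) (x a b c : R) : x <= 2^-1 * (a + b) -> a <= c -> b <= c -> x <= c.
Proof. lra. Qed.

Section AnalyticData.
Context {R : realType} {d : nat}.
Local Notation C := R[i].
Local Notation Re := complex.Re.
Local Notation Im := complex.Im.
Local Notation rV := 'rV[R]_d.
Local Open Scope complex_scope.

Lemma pos_real (e : Cx R) : 0 < e -> e = toCx (Re e) /\ 0 < Re e.
Proof. by case: e => a b; rewrite /toCx ltcE /= => /andP[/eqP -> a0]. Qed.

Lemma cabs_lt (z : Cx R) (e : R) : (`|z| < toCx e) = (cabs z < e).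
Proof. by rewrite /toCx -ltcR; case: z. Qed.

Lemma cabs_le_norm (z : Cx R) (e : R) : (`|z| <= toCx e) = (cabs z <= e).
Proof. by rewrite /toCx -lecR; case: z. Qed.

Lemma near_box (P : 'rV[Cx R]_d * Cx R -> Prop) (z0 : 'rV[Cx R]_d) (w0 : Cx R) :
  (\forall q \near (z0, w0), P q) -> exists2 dl : R, 0 < dl & forall (z : 'rV[Cx R]_d) (w : Cx R),
    (forall j, cabs (z 0 j - z0 0 j) < dl) -> cabs (w - w0) < dl -> P (z, w).
Proof.
case=> -[A B] /= [nA nB] sub.
have [e1 /= e10 hA] := (@nbhs_ballP (Cx R) 'rV[Cx R]_d z0 A).1 nA.
have [e2 /= e20 hB] := (@nbhs_ballP (Cx R) (Cx R) w0 B).1 nB.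
have [E1 p1] := pos_real e10; have [E2 p2] := pos_real e20.
exists (Num.min (Re e1) (Re e2)); first by rewrite lt_min p1.
move=> z w hz hw; apply: (sub (z, w)); split=> /=.
  apply: hA; rewrite /ball/=; split=> // i j; rewrite ord1 E1 /ball /= cabs_lt -cabsN opprB.
  by apply: lt_le_trans (hz j) _; rewrite ge_min lexx.
apply: hB; rewrite E2 /ball /= cabs_lt -cabsN opprB.
by apply: lt_le_trans hw _; rewrite ge_min lexx orbT.
Qed.

Lemma derivable_hol (F : 'rV[Cx R]_d * Cx R -> Cx R) (q v : 'rV[Cx R]_d * Cx R) : derivable F q v ->
  exists D, hol (fun w : C => F (q + w *: v)) 0 D.
Proof.
move=> dF; have [D hD] : exists D : Cx R, h^-1 *: ((F \o shift q) (h *: v) - F q) @[h --> (0 : Cx R)^'] --> D.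
  by eexists; exact: dF.
exists D => e e0; have e0' : 0 < toCx e by rewrite /toCx ltcR.
move: hD => /cvgrPdist_le/(_ _ e0')[dl /= dl0 hd]; have [E1 p1] := pos_real dl0.
exists (Re dl) => // h hh; rewrite add0r scale0r addr0.
have [->|h0] := eqVneq h 0; first by rewrite scale0r addr0 subrr mul0r subr0 cabs0 mulr0.
have := hd h; rewrite /ball_ /= sub0r normrN E1 => /(_ _ h0).
rewrite (cabs_lt h) => /(_ hh); rewrite cabs_le_norm [h *: v + q]addrC => k.
have -> : F (q + h *: v) - F q - h * D = - (h * (D - h^-1 *: (F (q + h *: v) - F q))).
  rewrite /GRing.scale /= mulrBr mulrA divff // mul1r opprB; ring.
by rewrite cabsN cabsM mulrC ler_wpM2r ?cabs_ge0.
Qed.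

Lemma diff_hol (F : 'rV[Cx R]_d * Cx R -> Cx R) (z : 'rV[Cx R]_d) (w : Cx R) : differentiable F (z, w) ->
  (exists D, hol (fun v : C => F (z, v)) w D) /\
  forall j, exists D, hol (fun v : C => F (z + v *: cev j, w)) 0 D.
Proof.
move=> dF; split=> [|j].
  have [D hD] := derivable_hol (@diff_derivable (Cx R) _ _ F (z, w) (0 : 'rV[Cx R]_d, 1 : Cx R) dF); exists D => e e0.
  have [dl dl0 hd] := hD e e0; exists dl => // h hh; have := hd h hh.
  rewrite add0r scale0r addr0; congr (cabs (F _ - _ - _) <= _).
  by congr pair; rewrite /= ?scaler0 ?addr0 // /GRing.scale /= mulr1.
have [D hD] := derivable_hol (@diff_derivable (Cx R) _ _ F (z, w) (cev j : 'rV[Cx R]_d, 0 : Cx R) dF); exists D.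
apply: hol_ext hD => v; congr F; congr pair; by rewrite /= scaler0 addr0.
Qed.

Variables (rho r : R) (F : 'rV[Cx R]_d * Cx R -> Cx R).
Hypothesis rho0 : 0 < rho.
Hypothesis r0 : 0 < r.
Hypothesis F_diff : forall p, strip rho p.1 -> `|p.2| < toCx r -> \forall q \near p, differentiable F q.
Hypothesis F_per : forall (k : 'rV[int]_d) p, strip rho p.1 -> `|p.2| < toCx r ->
  F (p.1 + period (@toCx R) k, p.2) = F p.

Lemma strip_cvec (x y : rV) : (forall j, `|y 0 j| <= rho) -> strip rho (cvec x y : 'rV[Cx R]_d).
Proof. by move=> h j; rewrite mxE; exact: h. Qed.

Lemma F_local (z0 : 'rV[Cx R]_d) (w0 : Cx R) : strip rho z0 -> cabs w0 < r ->
  exists2 dl : R, 0 < dl & forall (z : 'rV[Cx R]_d) (w : Cx R),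
    (forall j, cabs (z 0 j - z0 0 j) < dl) -> cabs (w - w0) < dl ->
    differentiable F (z, w) /\ cabs (F (z, w)) <= cabs (F (z0, w0)) + 1.
Proof.
move=> hz hw; have w0r : `|w0| < toCx r by rewrite cabs_lt.
have nd := F_diff (p := (z0, w0)) hz w0r.
have dF : differentiable F (z0, w0) := nbhs_singleton nd.
have [d1 d10 h1] := near_box nd.
have e1 : 0 < toCx 1 :> Cx R by rewrite /toCx ltcR.
have [d2 d20 h2] := near_box (@cvgr_dist_lt _ _ _ _ _ _ _ (differentiable_continuous dF) _ e1).
exists (Num.min d1 d2); first by rewrite lt_min d10.
move=> z w hz' hw'; split.
  by apply: h1 => [j|]; [apply: lt_le_trans (hz' j) _|apply: lt_le_trans hw' _]; rewrite ge_min lexx.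
have := h2 z w _ _; rewrite /= cabs_lt => k.
rewrite -[F (z, w)](subrK (F (z0, w0))) addrC; apply: le_trans (cabsD _ _) _; rewrite lerD2l ltW //.
rewrite -cabsN opprB; apply: k => [j|]; [apply: lt_le_trans (hz' j) _|apply: lt_le_trans hw' _]; by rewrite ge_min lexx orbT.
Qed.

Lemma F_continuous (z0 : 'rV[Cx R]_d) (w0 : Cx R) (e : R) : strip rho z0 -> cabs w0 < r -> 0 < e ->
  exists2 dl : R, 0 < dl & forall (z : 'rV[Cx R]_d) (w : Cx R),
    (forall j, cabs (z 0 j - z0 0 j) < dl) -> cabs (w - w0) < dl -> cabs (F (z, w) - F (z0, w0)) < e.
Proof.
move=> hz hw e0; have w0r : `|w0| < toCx r by rewrite cabs_lt.
have dF : differentiable F (z0, w0) := nbhs_singleton (F_diff (p := (z0, w0)) hz w0r).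
have e0' : 0 < toCx e :> Cx R by rewrite /toCx ltcR.
have [d2 d20 h2] := near_box (@cvgr_dist_lt _ _ _ _ _ _ _ (differentiable_continuous dF) _ e0').
by exists d2 => // z w hz' hw'; have := h2 z w hz' hw'; rewrite /= cabs_lt -cabsN opprB.
Qed.

(** Strictly inside the disc of radius r, so that the closed disc of radius R0 and a neighbourhood
    of it are available. *)
Definition R0 : R := r / 3.

Lemma R0_gt0 : 0 < R0. Proof. by rewrite divr_gt0. Qed.

(** By compactness F continues, in each angle, to a neighbourhood of fixed size. *)
Lemma F_uniform : exists eta M : R, [/\ 0 < eta, 0 <= M & forall (x y : rV) (w : C) j h,
  (forall i, 0 <= x 0 i <= 2 * pi) -> (forall i, `|y 0 i| <= rho) -> cabs w <= R0 -> cabs h < eta ->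
  (exists D, hol (fun v : C => F (cvec x y + v *: cev j, w)) h D) /\ cabs (F (cvec x y + h *: cev j, w)) <= M].
Proof.
pose X := ((rV * rV) * (R * R))%type.
pose bx (a b : R) : set rV := [set v | forall i, `[a, b]%classic (v ord0 i)].
pose K : set X := (bx 0 (2 * pi) `*` bx (- rho) rho) `*` (`[- R0, R0]%classic `*` `[- R0, R0]%classic).
have cbx a b : compact (bx a b) by apply: (rV_compact (A := fun=> `[a, b]%classic)) => i; exact: segment_compact.
have cK : compact K.
  by apply: compact_setX; [apply: compact_setX; exact: cbx|apply: compact_setX; exact: segment_compact].
pose P (N : nat) (p : X) := forall j h, cabs h < N.+1%:R^-1 ->
  differentiable F (cvec p.1.1 p.1.2 + h *: cev j : 'rV[Cx R]_d, cpt p.2.1 p.2.2 : Cx R) /\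
  cabs (F (cvec p.1.1 p.1.2 + h *: cev j : 'rV[Cx R]_d, cpt p.2.1 p.2.2 : Cx R)) <= N%:R.
have [] := (compact_near_coveringP K).1 cK nat \oo P _.
- move=> [[x y] [a b]] [[/= hx hy] [/= ha hb]].
  have hs : strip rho (cvec x y : 'rV[Cx R]_d).
    by apply: strip_cvec => i; have := hy i; rewrite /= in_itv /= ler_norml.
  have hw : cabs (cpt a b) < r.
    apply: le_lt_trans (cabs_le _) _ => /=; have := r0; move: ha hb; rewrite !in_itv /= -!ler_norml /R0 => ha hb; lra.
  have [dl dl0 hd] := F_local hs hw.
  pose n0 := maxn (Num.trunc (4 / dl)) (Num.trunc (cabs (F (cvec x y : 'rV[Cx R]_d, cpt a b : Cx R)) + 1)).+1.
  have dl4 : 0 < dl / 4 by rewrite divr_gt0.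
  exists (ball ((x, y), (a, b)) (dl / 4), [set N | (n0 <= N)%N]).
    by split; [exact: nbhsx_ballx|exists n0].
  move=> [[[x' y'] [a' b']] N] /= [[[[_ bx'] [_ by']] [ba bb]] nN] j h hh.
  have hN : N.+1%:R^-1 <= dl / 4.
    rewrite invf_ple ?posrE // invf_div; apply/ltW; have h4 : 0 <= 4 / dl by rewrite divr_ge0 // ltW.
    have /andP[_ k] := trunc_itv h4; apply: lt_le_trans k _; rewrite ler_nat ltnS.
    by apply: leq_trans nN; rewrite leq_maxl.
  have c1 i : cabs ((cvec x' y' + h *: cev j) 0 i - cvec x y 0 i) < dl.
    have -> : (cvec x' y' + h *: cev j) 0 i - cvec x y 0 i = cpt (x' 0 i - x 0 i) (y' 0 i - y 0 i) + h * (cev j : 'rV[C]_d) 0 i.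
      by rewrite !mxE; apply: complex_ext; rewrite ?ReD ?ImD ?ReM ?ImM /=; ring.
    apply: le_lt_trans (cabsD _ _) _; apply: le_lt_trans (lerD (cabs_le _) (lexx _)) _ => /=.
    have : cabs (h * (cev j : 'rV[C]_d) 0 i) <= cabs h.
      rewrite cabsM !mxE; case: (_ && _); rewrite ?cabs1 ?cabs0 ?mulr1 ?mulr0 ?cabs_ge0 //.
    have k1 : `|x' 0 i - x 0 i| < dl / 4 by rewrite distrC; exact: bx'.
    have k2 : `|y' 0 i - y 0 i| < dl / 4 by rewrite distrC; exact: by'.
    by move=> k3; move: k1 k2 k3 (lt_le_trans hh hN) dl0; clear; lra.
  have c2 : cabs (cpt a' b' - cpt a b) < dl.
    apply: le_lt_trans (cabs_le _) _ => /=; move: ba bb; rewrite /ball /= distrC [`|b - _|]distrC; lra.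
  have [k1 k2] := hd _ _ c1 c2; split=> //; apply: le_trans k2 _.
  have hc : 0 <= cabs (F (cvec x y : 'rV[Cx R]_d, cpt a b : Cx R)) + 1 by rewrite addr_ge0 ?cabs_ge0.
  have /andP[_ k] := trunc_itv hc; apply: le_trans (ltW k) _; rewrite ler_nat.
  by apply: leq_trans nN; rewrite leq_maxr.
- move=> N _ /(_ N (leqnn N)) hK; exists N.+1%:R^-1, N%:R; split=> // x y w j h hx hy hw hh.
  have inK : K ((x, y), (Re w, Im w)).
    split=> /=; split=> /=.
    + by move=> i; rewrite /= in_itv /=; exact: hx.
    + by move=> i; rewrite /= in_itv /= -ler_norml; exact: hy.
    + by rewrite in_itv /= -ler_norml; exact: le_trans (Re_le _) hw.
    + by rewrite in_itv /= -ler_norml; exact: le_trans (Im_le _) hw.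
  have [] := hK _ inK j h hh; rewrite (_ : cpt (Re w) (Im w) = w); last by case: (w).
  move=> dF bF; split=> //; have [_ /(_ j)[D hD]] := diff_hol dF.
  exists D => e e0; have [dl dl0 hd] := hD e e0; exists dl => // k hk; have := hd k hk.
  by rewrite /= add0r scale0r addr0 -(addrA (cvec x y)) -scalerDl.
Qed.

(** The angle 0 is the argument of w = R0 e^(i zeta), whose imaginary part ranges
    over [0, +oo); the other angles have imaginary parts in [- rho, rho]. *)
Definition Iang (j : 'I_d.+1) (s : R) : Prop := if j == ord0 then 0 <= s else `|s| <= rho.

Definition ucirc (z : 'rV[C]_d.+1) : C :=
  F ((\row_j z 0 (lift ord0 j)) : 'rV[Cx R]_d, (R0%:C * ec (z 0 ord0)) : Cx R).

Let rest (x : 'rV[R]_d.+1) : rV := \row_j x 0 (lift ord0 j).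

Lemma ucirc_cvec x y : ucirc (cvec x y) =
  F (cvec (rest x) (rest y) : 'rV[Cx R]_d, (R0%:C * ec (cpt (x 0 ord0) (y 0 ord0))) : Cx R).
Proof. by rewrite /ucirc mxE; congr (F (_, _)); apply/rowP => j; rewrite !mxE. Qed.

Lemma circle_small (x y : R) : 0 <= y -> cabs (R0%:C * ec (cpt x y)) <= R0.
Proof.
move=> y0; rewrite cabsM cabs_real (gtr0_norm R0_gt0) cabs_ec /= ler_piMr ?(ltW R0_gt0) //.
by rewrite -[leRHS]expR0 ler_expR oppr_le0.
Qed.

Lemma R0_lt : R0 < r.
Proof. by rewrite /R0; have := r0; lra. Qed.

Lemma inI_rest y : inI Iang y -> 0 <= y 0 ord0 /\ forall i, `|rest y 0 i| <= rho.
Proof.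
by move=> hy; split=> [|i]; [have := hy ord0|have := hy (lift ord0 i); rewrite mxE]; rewrite /Iang.
Qed.

Lemma ucirc_per (k : 'rV[int]_d.+1) x y : inI Iang y -> ucirc (cvec (x + period id k) y) = ucirc (cvec x y).
Proof.
move=> /inI_rest[y0 hy]; rewrite !ucirc_cvec.
have -> : cpt ((x + period id k) 0 ord0) (y 0 ord0) = cpt (x 0 ord0) (y 0 ord0) + (k 0 ord0)%:~R * (2 * pi)%:C.
  have -> : (k 0 ord0)%:~R = ((k 0 ord0)%:~R : R)%:C :> C by rewrite rmorph_int.
  by rewrite !mxE; apply: complex_ext; rewrite ?ReD ?ImD ?ReM ?ImM /=; ring.
rewrite ec_period_int -[RHS](F_per (\row_j k 0 (lift ord0 j))) /=.
- congr (F (_, _)); apply/rowP => j; rewrite !mxE; apply: complex_ext; rewrite ?ReD ?ImD /=; ring.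
- exact: strip_cvec.
- by rewrite cabs_lt; apply: le_lt_trans (circle_small _ y0) R0_lt.
Qed.

Lemma ucirc_hfun : hfun Iang ucirc.
Proof.
have slice z (w : C) : strip rho z -> cabs w < r -> differentiable F (z, w : Cx R).
  by move=> hz hw; apply: (nbhs_singleton (F_diff (p := (z, w : Cx R)) hz _)); rewrite cabs_lt.
split=> [x y j hy|x y j hy|y hy]; have [y0 hr] := inI_rest hy.
- have cw : cabs (R0%:C * ec (cpt (x 0 ord0) (y 0 ord0))) < r by apply: le_lt_trans (circle_small _ y0) R0_lt.
  have [hw hz] := diff_hol (slice _ _ (strip_cvec (rest x) hr) cw).
  have [i ->|->] := unliftP ord0 j.
    have [D hD] := hz i; exists D; apply: hol_ext hD => v; rewrite /ucirc; congr (F (_, _)); last by rewrite !mxE /= mulr0 addr0.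
    by apply/rowP => l; rewrite !mxE (inj_eq lift_inj).
  have [D hD] := hw.
  have h1 := hol_comp (hol_affine (cpt (x 0 ord0) (y 0 ord0)) 1 0) (hol_ec _).
  have h2 := hol_comp h1 (hol_affine 0 R0%:C _).
  have h3 := hol_comp (E := fun v : C => F (cvec (rest x) (rest y) : 'rV[Cx R]_d, v : Cx R)) (D2 := D) h2.
  rewrite mulr0 addr0 add0r in h3; eexists; apply: hol_ext (h3 hD) => w.
  rewrite /ucirc; congr (F (_, _)); last by rewrite add0r !mxE /= mulr1 mul1r.
  by apply/rowP => l; rewrite !mxE /= mulr0 addr0.
- have := ucirc_per (delta_mx 0 j) x hy.
  have -> : period id (delta_mx 0 j : 'rV[int]_d.+1) = (2 * pi) *: evec j :> 'rV[R]_d.+1.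
    by apply/rowP => i; rewrite !mxE; case: (_ && _); rewrite ?mulr1 ?mulr0 // mulr0z mulr0.
  by rewrite cvec_real.
- have cont : forall (th : 'rV[R]_d.+1) (e : R), 0 < e -> exists2 dl : R, 0 < dl & forall th' : 'rV[R]_d.+1,
      (forall j, `|th 0 j - th' 0 j| < dl) -> cabs (ucirc (cvec th' y) - ucirc (cvec th y)) < e.
    move=> th e e0; pose w := R0%:C * ec (cpt (th 0 ord0) (y 0 ord0)).
    have hw : cabs w < r by apply: le_lt_trans (circle_small _ y0) R0_lt.
    have [dl dl0 hd] := F_continuous (strip_cvec (rest th) hr) hw e0.
    have h2 := hol_comp (hol_ec (cpt (th 0 ord0) (y 0 ord0))) (hol_affine 0 R0%:C _).
    have [dl' dl'0 hd'] := hol_lip h2.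
    set L := 1 + cabs _ in hd'; have L0 : 0 < L by rewrite ltr_pwDl ?cabs_ge0.
    exists (Num.min dl (Num.min dl' (dl / L))); first by rewrite !lt_min dl0 dl'0 divr_gt0.
    move=> th' h; rewrite !ucirc_cvec; apply: hd => [j|].
      rewrite !mxE; have -> : cpt (th' 0 (lift ord0 j)) (y 0 (lift ord0 j)) - cpt (th 0 (lift ord0 j)) (y 0 (lift ord0 j)) =
         (th' 0 (lift ord0 j) - th 0 (lift ord0 j))%:C.
        by apply: complex_ext; rewrite ?ReB ?ImB /=; ring.
      by rewrite cabs_real distrC; have := h (lift ord0 j); rewrite lt_min => /andP[].
    have := h ord0; rewrite !lt_min => /andP[_ /andP[b1 b2]].
    have ch : cabs (th' 0 ord0 - th 0 ord0)%:C = `|th 0 ord0 - th' 0 ord0| by rewrite cabs_real distrC.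
    have := hd' (th' 0 ord0 - th 0 ord0)%:C; rewrite ch => /(_ b1).
    rewrite (_ : cpt (th 0 ord0) (y 0 ord0) + (th' 0 ord0 - th 0 ord0)%:C = cpt (th' 0 ord0) (y 0 ord0)); last first.
      by apply: complex_ext; rewrite ?ReD ?ImD /=; ring.
    rewrite !add0r => k; apply: le_lt_trans k _; rewrite mulrC -ltr_pdivlMr //.
  split; (split; last by move=> k x; rewrite ucirc_per); apply: rV_continuous => th e e0;
    have [dl dl0 hd] := cont th e e0; exists dl => // th' h; apply: le_lt_trans (hd th' h).
    by rewrite distrC -ReB; exact: Re_le.
  by rewrite distrC -ImB; exact: Im_le.
Qed.

Lemma Iang0 j : Iang j 0.
Proof. by rewrite /Iang normr0; case: ifP => // _; exact: ltW. Qed.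

Lemma Iang_star j s t : Iang j s -> (0 <= t <= s) || (s <= t <= 0) -> Iang j t.
Proof.
rewrite /Iang; case: ifP => _ hs /orP[] /andP[h1 h2] //; first exact: le_trans h1.
  by rewrite ger0_norm //; apply: le_trans h2 (le_trans (ler_norm _) hs).
by rewrite ler0_norm //; apply: le_trans hs; rewrite -normrN; apply: le_trans (ler_norm _); rewrite lerN2.
Qed.

Definition cpk (p : int) (k : 'rV[int]_d) : C := ccoef ucirc (consrv p k).

Lemma dotp_consrvE p (k : 'rV[int]_d) (y : 'rV[R]_d.+1) :
  dotp (consrv p k) y = p%:~R * y 0 ord0 + dotp k (rest y).
Proof.
rewrite /dotp big_ord_recl consrv0; congr (_ + _); apply: eq_bigr => j _.
by rewrite consrvS mxE.
Qed.

Lemma ucirc_decay q (i : 'I_d) : exists2 K : R, 0 <= K & forall (p : int) (k : 'rV[int]_d) (y : 'rV[R]_d.+1), inI Iang y ->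
  `|(k 0 i)%:~R| ^+ q * cabs (cpk p k) <= K * expR (p%:~R * y 0 ord0 + dotp k (rest y)).
Proof.
have [eta [M [eta0 M0 hM]]] := F_uniform.
have hd : forall x y : 'rV[R]_d.+1, (forall i, 0 <= x 0 i <= 2 * pi) -> inI Iang y ->
    disc (fun w => ucirc (cvec x y + w *: cev (lift ord0 i))) 0 eta M.
  move=> x y hx hy h hh; have [y0 hr] := inI_rest hy.
  have hx' j : 0 <= rest x 0 j <= 2 * pi by rewrite mxE.
  have [[D hD] bD] := hM (rest x) (rest y) _ i h hx' hr (circle_small (x 0 ord0) y0) hh.
  have e v : ucirc (cvec x y + v *: cev (lift ord0 i)) =
     F (cvec (rest x) (rest y) + v *: cev i, R0%:C * ec (cpt (x 0 ord0) (y 0 ord0))).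
    rewrite /ucirc; congr (F (_, _)); last by rewrite !mxE /= mulr0 addr0.
    by apply/rowP => l; rewrite !mxE (inj_eq lift_inj).
  rewrite add0r; split; last by rewrite e.
  by exists D; apply: hol_ext hD => v; rewrite e.
have [K K0 hK] := ccoef_decay Iang0 Iang_star q eta0 M0 ucirc_hfun hd.
exists K => // p k y hy; have := hK (consrv p k) y hy.
by rewrite consrvS dotp_consrvE.
Qed.

(** The frequencies of zeta are nonnegative: let the imaginary part of zeta tend to infinity. *)
Lemma cpk_neg p k : (0 < d)%N -> (p < 0)%R -> cpk p k = 0.
Proof.
move=> d0 p0; have [K K0 hK] := ucirc_decay 0 (Ordinal d0).
apply: cabs_eq0; apply: eps_eq0 => e e0; rewrite ger0_norm ?cabs_ge0 //.
pose s := K / e; have s0 : 0 <= s by rewrite divr_ge0 // ltW.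
pose y : 'rV[R]_d.+1 := consrv s 0.
have ry : rest y = 0 by apply/rowP => j; rewrite mxE consrvS.
have hy : inI Iang y.
  by move=> j; have [i ->|->] := unliftP ord0 j; rewrite /Iang /y ?consrvS ?consrv0 ?mxE ?normr0 //= ltW.
have := hK p k y hy; rewrite expr0 mul1r ry dotp0r addr0 consrv0; move/le_trans; apply.
have p1 : p%:~R <= -1 :> R by rewrite -(intrN _ 1) ler_int; move: p0; clear; lia.
apply: (@le_trans _ _ (K * expR (- s))).
  by rewrite ler_wpM2l // ler_expR -mulN1r ler_wpM2r.
rewrite expRN ler_pdivrMr ?expR_gt0 // mulrC -ler_pdivrMr //.
by apply: le_trans (expR_ge1Dx _); rewrite lerDr.
Qed.

(** At the corner y_j = - rho sign(k_j) of the strip the exponential factor is e^(- rho |k|); the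
    largest coordinate of k supplies the powers of |k|. *)
Lemma cpk_decay m : (0 < d)%N -> exists2 K : R, 0 <= K & forall p k,
  jb k ^+ m * cabs (cpk p k) <= K * expR (- (rho * (norm1 k)%:R)).
Proof.
move=> d0; have [K0 K00 hK0] := ucirc_decay 0 (Ordinal d0).
have H i : exists Ki, 0 <= Ki /\ forall (p : int) (k : 'rV[int]_d) (y : 'rV[R]_d.+1), inI Iang y ->
  `|(k 0 i)%:~R| ^+ (2 * m) * cabs (cpk p k) <= Ki * expR (p%:~R * y 0 ord0 + dotp k (rest y)).
  by have [Ki ? ?] := ucirc_decay (2 * m) i; exists Ki.
have [Kf hKf] := choice H.
pose S := K0 + \sum_i Kf i.
have S0 : 0 <= S by rewrite addr_ge0 // sumr_ge0 // => i _; case: (hKf i).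
have d2 : 0 <= 1 + d%:R ^+ 2 :> R by rewrite addr_ge0 ?sqr_ge0.
exists ((1 + d%:R ^+ 2) ^+ m * S); first by rewrite mulr_ge0 // exprn_ge0.
move=> p k; have [i hi] := jb_le_coord (R := R) k (Ordinal d0).
pose y : 'rV[R]_d.+1 := consrv 0 (\row_j (- rho * Num.sg ((k 0 j)%:~R))).
have hy : inI Iang y.
  move=> j; have [l ->|->] := unliftP ord0 j; rewrite /Iang /y ?consrvS ?consrv0 ?mxE //=.
  by rewrite normrM normrN (gtr0_norm rho0) normr_sg; case: (_ != 0); rewrite ?mulr1 ?mulr0 // ltW.
have ey : p%:~R * y 0 ord0 + dotp k (rest y) = - (rho * (norm1 k)%:R).
  rewrite /y consrv0 mulr0 add0r /dotp /norm1 natr_sum mulr_sumr -sumrN; apply: eq_bigr => j _.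
  rewrite mxE consrvS mxE; have -> : `|k ord0 j|%:R = `|(k 0 j)%:~R : R| by rewrite -intr_norm -abszE.
  by rewrite normrEsg; ring.
have h1 := hK0 p k y hy; have [Ki0 hKi] := hKf i; have h2 := hKi p k y hy.
rewrite ey expr0 mul1r in h1; rewrite ey in h2.
have E0 := expR_ge0 (- (rho * (norm1 k)%:R)).
have c0 := cabs_ge0 (cpk p k).
apply: (@le_trans _ _ ((1 + d%:R ^+ 2) ^+ m * ((1 + `|(k 0 i)%:~R| ^+ (2 * m)) * cabs (cpk p k)))).
  rewrite mulrA ler_wpM2r //.
  apply: (@le_trans _ _ (((1 + d%:R ^+ 2) * Num.max 1 ((k 0 i)%:~R ^+ 2)) ^+ m)).
    by rewrite lerXn2r ?nnegrE ?(ltW (jb_gt0 k)) // (le_trans _ hi) // ltW // jb_gt0.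
  rewrite exprMn ler_wpM2l ?exprn_ge0 // exprM real_normK ?num_real //.
  have k0 : 0 <= ((k 0 i)%:~R ^+ 2) ^+ m :> R by rewrite exprn_ge0 // sqr_ge0.
  rewrite maxEle; case: ifP => _; first by rewrite lerDr.
  by rewrite expr1n lerDl.
rewrite -mulrA ler_wpM2l ?exprn_ge0 // mulrDl mul1r [leRHS]mulrDl; apply: lerD => //.
apply: le_trans h2 _; rewrite ler_wpM2r // (bigD1 i) //= lerDl.
by apply: sumr_ge0 => j _; case: (hKf j).
Qed.

Hypothesis d0 : (0 < d)%N.
Variable f : rV * R -> R.
Hypothesis F_real : forall (th : rV) (x : R), `|x| < r -> F (map_mx (@toCx R) th, toCx x) = toCx (f (th, x)).

(** The partial sums of the expansion of f in powers of x and in Fourier modes. *)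
Definition fsum N (th : rV) (x : R) : R := \sum_(i <- iota 0 N.+1)
  (x / R0) ^+ i * tp (box d N) (fun k => Re (cpk i k)) (fun k => - Im (cpk i k)) th.

Let wgt (K : R) m (k : 'rV[int]_d.+1) : R :=
  if 0 <= k 0 ord0 then K * 2^-1 ^+ `|k 0%R ord0|%N * (jb ((\row_j k 0 (lift ord0 j)) : 'rV[int]_d))^-1 ^+ m else 0.

Lemma sum_zrange (g : int -> R) N : (forall i : nat, g (- i.+1%:Z) = 0) ->
  \sum_(p <- zrange N) g p = \sum_(i <- iota 0 N.+1) g i%:Z.
Proof.
move=> g0; have -> : \sum_(p <- zrange N) g p = \sum_(p <- [seq i%:Z | i <- iota 0 N.+1]) g p + \sum_(p <- [seq - i.+1%:Z | i <- iota 0 N]) g p.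
  exact: big_cat.
by rewrite !big_map [X in _ + X]big1 ?addr0.
Qed.

Lemma sum_wgt K m X : 0 <= K -> (d < 2 * m)%N -> uniq X -> \sum_(k <- X) wgt K m k <= K * (2 * Sjb m d).
Proof.
move=> K0 dm uX; have [N XN] := subset_box X.
have w0 k : 0 <= wgt K m k.
  rewrite /wgt; case: ifP => // _; rewrite mulr_ge0 ?mulr_ge0 ?exprn_ge0 ?invr_ge0 ?(ltW (jb_gt0 _)) //.
apply: le_trans (ler_sum_subset uX (uniq_box d.+1 N) XN w0) _.
rewrite boxS big_allpairs_dep /=.
apply: (@le_trans _ _ (\sum_(p <- zrange N) (if 0 <= p then K * 2^-1 ^+ `|p|%N else 0) * Sjb m d)).
  apply: ler_sum => p _.
  apply: (@le_trans _ _ (\sum_(k <- box d N) (if 0 <= p then K * 2^-1 ^+ `|p|%N else 0) * (jb k)^-1 ^+ m)).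
    apply: ler_sum => k _; rewrite /wgt consrv0.
    have -> : (\row_j consrv p k 0 (lift ord0 j)) = k by apply/rowP => j; rewrite mxE consrvS.
    by case: ifP; rewrite ?mul0r.
  rewrite -mulr_sumr ler_wpM2l ?sum_jb ?uniq_box //.
  by case: ifP => // _; rewrite mulr_ge0 // exprn_ge0.
rewrite -mulr_suml [leRHS]mulrA ler_wpM2r ?(ltW (Sjb_gt0 _ _)) //.
rewrite sum_zrange //= -/(iota 0 N.+1).
rewrite -mulr_sumr ler_wpM2l //.
have -> : \sum_(i <- iota 0 N.+1) 2^-1 ^+ `|i%:Z|%N = \sum_(i < N.+1) 2^-1 ^+ i :> R.
  by rewrite -(big_mkord xpredT (fun i => 2^-1 ^+ i)) /index_iota subn0.
elim: (N.+1) => [|M IH]; first by rewrite big_ord0.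
have : \sum_(i < M) 2^-1 ^+ i <= 2 - 2 * 2^-1 ^+ M :> R.
  elim: (M) => [|M' IH']; first by rewrite big_ord0 expr0; lra.
  by rewrite big_ord_recr /= exprS; lra.
rewrite big_ord_recr /=; have : 0 <= 2^-1 ^+ M :> R by rewrite exprn_ge0.
by move: (2^-1 ^+ M) => z; lra.
Qed.

Let resti (k : 'rV[int]_d.+1) : 'rV[int]_d := \row_j k 0 (lift ord0 j).

Lemma consrv_rest (k : 'rV[int]_d.+1) : consrv (k 0 ord0) (resti k) = k.
Proof. by apply/rowP => j; have [i ->|->] := unliftP ord0 j; rewrite ?consrvS ?consrv0 ?mxE. Qed.

Lemma ccoefK k : ccoef ucirc k = cpk (k 0 ord0) (resti k).
Proof. by rewrite /cpk consrv_rest. Qed.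

(** Coefficients of the expansion at x = R0 t. *)
Let al (t : R) (k : 'rV[int]_d.+1) := if 0 <= k 0 ord0 then t ^+ `|k 0%R ord0|%N * Re (ccoef ucirc k) else 0.
Let be (t : R) (k : 'rV[int]_d.+1) := if 0 <= k 0 ord0 then - (t ^+ `|k 0%R ord0|%N * Im (ccoef ucirc k)) else 0.

Lemma mode_le m : exists2 K : R, 0 <= K & forall t k, `|t| <= 2^-1 -> `|al t k| + `|be t k| <= wgt K m k.
Proof.
have [K K0 hK] := cpk_decay m d0; exists (2 * K); first by rewrite mulr_ge0.
move=> t k ht; rewrite /al /be /wgt; case: ifP => k0; last by rewrite normr0 addr0.
rewrite ccoefK -/(resti k); have := hK (k 0 ord0) (resti k); move: (cpk _ _) => c hc.
rewrite normrN !normrM -mulrDr normrX.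
have J0 : 0 < jb (resti k) ^+ m :> R by rewrite exprn_gt0 // jb_gt0.
have -> : 2 * K * 2^-1 ^+ `|k 0%R ord0|%N * (jb (resti k))^-1 ^+ m = 2^-1 ^+ `|k 0%R ord0|%N * (2 * K * (jb (resti k))^-1 ^+ m) by ring.
apply: ler_pM; rewrite ?exprn_ge0 ?addr_ge0 // ?lerXn2r ?nnegrE //.
rewrite exprVn ler_pdivlMr // mulrC.
have : K * expR (- (rho * (norm1 (resti k))%:R)) <= K.
  by rewrite ler_piMr // -[leRHS]expR0 ler_expR oppr_le0 mulr_ge0 // ltW.
have h1 := Re_le c; have h2 := Im_le c.
have : jb (resti k) ^+ m * (`|Re c| + `|Im c|) <= jb (resti k) ^+ m * (2 * cabs c) by rewrite ler_wpM2l ?(ltW J0) //; lra.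
by move: hc; move: (jb (resti k) ^+ m) => J; lra.
Qed.

Lemma fsum_tp N th x : fsum N th x = tp (box d.+1 N) (al (x / R0)) (be (x / R0)) (consrv 0 th).
Proof.
rewrite /tp boxS big_allpairs_dep sum_zrange; last first.
  by move=> i; apply: big1 => k _; rewrite /al /be consrv0 /= !mul0r addr0.
apply: eq_bigr => i _; rewrite /tp mulr_sumr; apply: eq_bigr => k _.
have -> : dotp (consrv i%:Z k) (consrv 0 th) = dotp k th.
  by rewrite dotp_consrvE consrv0 mulr0 add0r; congr dotp; apply/rowP => j; rewrite mxE consrvS.
by rewrite /al /be consrv0 /= -/(cpk i k); ring.
Qed.

(** At height s of the first angle the coefficients of index p are those at height 0 times
    e^(- p s). The real part of the complex series is the real Fourier series of Re ucirc plus a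
    combination, odd in k, that cancels over symmetric boxes. *)
Lemma circle_expansion m (s : R) (x : 'rV[R]_d.+1) : (d < 2 * m)%N -> expR (- s) <= 2^-1 -> forall e : R, 0 < e ->
  exists N0, forall N, (N0 <= N)%N ->
  `|Re (ucirc (cvec x (consrv s 0))) - tp (box d.+1 N) (al (expR (- s))) (be (expR (- s))) x| <= e.
Proof.
move=> dm hs.
have s0 : 0 <= s.
  have : expR (- s) <= expR 0 by rewrite expR0; lra.
  by rewrite ler_expR oppr_le0.
pose y : 'rV[R]_d.+1 := consrv s 0.
have ry : rest y = 0 by apply/rowP => j; rewrite mxE consrvS.
have hy : inI Iang y.
  by move=> j; have [i ->|->] := unliftP ord0 j; rewrite /Iang /y ?consrvS ?consrv0 ?mxE ?normr0 //= ltW.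
have [_ _ /(_ y hy)[]] := ucirc_hfun.
set V := (fun x => Re _); set V2 := (fun x => Im _) => cV cV2.
have dky k : dotp k y = (k 0 ord0)%:~R * s by rewrite -[k]consrv_rest dotp_consrvE ry dotp0r addr0 !consrv0.
have ek (k : 'rV[int]_d.+1) : expR (- ((k 0 ord0)%:~R * s)) * Re (ccoef ucirc k) = fc V k + fs V2 k /\
            expR (- ((k 0 ord0)%:~R * s)) * Im (ccoef ucirc k) = fc V2 k - fs V k.
  rewrite (ccoef_shift Iang0 Iang_star k ucirc_hfun hy).
  have h x' : ucirc (cvec x' y) * chr k (cvec x' y) = expR ((k 0 ord0)%:~R * s) *
      (V x' * cos (dotp k x') + V2 x' * sin (dotp k x')) +i* (expR ((k 0 ord0)%:~R * s) * (V2 x' * cos (dotp k x') - V x' * sin (dotp k x'))).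
    rewrite chr_cvec dky /ec /= opprK cosN sinN /V /V2.
    move: (ucirc _) (expR _) (cos _) (sin _) => [a b] E' c' s'.
    by apply: complex_ext => /=; ring.
  have c1 := CP_gcos k cV; have c2 := CP_gsin k cV; have c3 := CP_gcos k cV2; have c4 := CP_gsin k cV2.
  have hR x' : Re (ucirc (cvec x' y) * chr k (cvec x' y)) = expR ((k 0 ord0)%:~R * s) *
      (V x' * cos (dotp k x') + V2 x' * sin (dotp k x')) by rewrite h.
  have hI x' : Im (ucirc (cvec x' y) * chr k (cvec x' y)) = expR ((k 0 ord0)%:~R * s) *
      (V2 x' * cos (dotp k x') - V x' * sin (dotp k x')) by rewrite h.
  have mR : Re (cm (fun x' => ucirc (cvec x' y) * chr k (cvec x' y))) = expR ((k 0 ord0)%:~R * s) * (fc V k + fs V2 k).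
    rewrite /fc /fs -meanD // -meanZ; last exact: CPD.
    by rewrite -(funext hR).
  have mI : Im (cm (fun x' => ucirc (cvec x' y) * chr k (cvec x' y))) = expR ((k 0 ord0)%:~R * s) * (fc V2 k - fs V k).
    rewrite /fc /fs -meanB // -meanZ; last exact: CPB.
    by rewrite -(funext hI).
  by rewrite mR mI !mulrA -expRD addNr expR0 !mul1r.
have ea k : al (expR (- s)) k = fc V k + fs V2 k /\ be (expR (- s)) k = - (fc V2 k - fs V k).
  have [<- <-] := ek k; rewrite /al /be; case: ifP => k0; last first.
    by rewrite ccoefK cpk_neg // ?ltNge ?k0 //= !mulr0 oppr0.
  suff -> : expR (- s) ^+ `|k 0%R ord0|%N = expR (- ((k 0 ord0)%:~R * s)) by [].
  by rewrite -expRM_natl mulrN; congr (expR (- (_ * s))); rewrite natr_absz ger0_norm.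
have [K K0 hK] := mode_le m.
have es : `|expR (- s)| <= 2^-1 by rewrite ger0_norm ?expR_ge0.
have sumAB X : uniq X -> \sum_(k <- X) (`|al (expR (- s)) k| + `|be (expR (- s)) k|) <= K * (2 * Sjb m d).
  by move=> uX; apply: le_trans (sum_wgt K0 dm uX); apply: ler_sum => k _; exact: hK.
have sumV X : uniq X -> \sum_(k <- X) (`|fc V k| + `|fs V k|) <= K * (2 * Sjb m d).
  move=> uX; have uX' : uniq [seq - k | k <- X] by rewrite map_inj_uniq //; exact: oppr_inj.
  have h1 := sumAB X uX; have := sumAB _ uX'; rewrite big_map => h2.
  have : \sum_(k <- X) (`|fc V k| + `|fs V k|) <= 2^-1 * (\sum_(k <- X) (`|al (expR (- s)) k| + `|be (expR (- s)) k|) +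
       \sum_(k <- X) (`|al (expR (- s)) (- k)| + `|be (expR (- s)) (- k)|)).
    rewrite -big_split mulr_sumr; apply: ler_sum => k _ /=.
    have [a1 b1] := ea k; have [a2 b2] := ea (- k); rewrite fcN (fsN _ cV2) in a2; rewrite fcN (fsN _ cV) in b2.
    have -> : fc V k = 2^-1 * (al (expR (- s)) k + al (expR (- s)) (- k)) by rewrite a1 a2; field.
    have -> : fs V k = 2^-1 * (be (expR (- s)) k - be (expR (- s)) (- k)) by rewrite b1 b2; field.
    rewrite !normrM ger0_norm ?invr_ge0 //.
    have := ler_normD (al (expR (- s)) k) (al (expR (- s)) (- k)); have := ler_normB (be (expR (- s)) k) (be (expR (- s)) (- k)).
    exact: half_sum_aux.
  by move=> h; exact: half_le_aux h h1 h2.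
move=> e e0; have [/(_ e e0)[N0 hN0] _] := fourier_series cV sumV.
exists N0 => N NN; have := hN0 N NN x; rewrite -/(V x).
have -> : tp (box d.+1 N) (al (expR (- s))) (be (expR (- s))) x =
   tp (box d.+1 N) (fc V) (fs V) x + tp (box d.+1 N) (fs V2) (fun k => - fc V2 k) x.
  rewrite /tp -big_split; apply: eq_bigr => k _ /=; have [-> ->] := ea k; ring.
rewrite [tp _ (fs V2) _ x]even_tp; first by rewrite addr0.
  by move=> k; exact: fsN.
by move=> k; rewrite fcN.
Qed.

Lemma map_cvec (th : rV) : map_mx (@toCx R) th = cvec th 0.
Proof. by apply/rowP => j; rewrite !mxE. Qed.

Lemma cosDnpi (k : nat) (y : R) : cos (k%:~R * pi + y) = (-1) ^+ k * cos y /\ sin (k%:~R * pi + y) = (-1) ^+ k * sin y.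
Proof.
elim: k => [|k [IH1 IH2]]; first by rewrite mul0r add0r expr0 !mul1r.
have -> : k.+1%:~R * pi + y = k%:~R * pi + y + pi by rewrite -addn1 PoszD intrD; ring.
by rewrite cosDpi sinDpi IH1 IH2 exprS; split; ring.
Qed.

(** A real x <> 0 lies on the circle of radius R0 e^(- s) with s = ln (R0 / |x|), at the angle 0 or pi
    according to its sign. The tail is summable uniformly in x, and x = 0 follows by continuity. *)
Lemma fsum_limit m : (d < 2 * m)%N -> forall e : R, 0 < e -> exists N0, forall N, (N0 <= N)%N ->
  forall th x, `|x| <= R0 / 2 -> `|f (th, x) - fsum N th x| <= e.
Proof.
move=> dm e e0; have [K K0 hK] := mode_le m; have R00 := R0_gt0.
have w0 k : 0 <= wgt K m k.
  rewrite /wgt; case: ifP => // _; rewrite mulr_ge0 ?mulr_ge0 ?exprn_ge0 ?invr_ge0 ?(ltW (jb_gt0 _)) //.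
have [N0 hN0] := bounded_series w0 (fun X uX => sum_wgt K0 dm uX) e0.
exists N0 => N NN.
have main th x : x != 0 -> `|x| <= R0 / 2 -> `|f (th, x) - fsum N th x| <= e.
  move=> x0 hx; apply: (@eps_le R _ _ 1) => e1 e10; rewrite mul1r.
  pose s := ln (R0 / `|x|); have x0' : 0 < `|x| by rewrite normr_gt0.
  have es : expR (- s) = `|x| / R0 by rewrite expRN lnK ?posrE ?divr_gt0 // invf_div.
  have es2 : expR (- s) <= 2^-1 by rewrite es ler_pdivrMr //; lra.
  have xr : `|x| < r by apply: le_lt_trans hx _; have := R0_lt; lra.
  have [xh [hF htp]] : exists xh, Re (ucirc (cvec xh (consrv s 0))) = f (th, x) /\
     (forall M, tp (box d.+1 M) (al (expR (- s))) (be (expR (- s))) xh = fsum M th x).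
    have val a : R0%:C * ec (cpt a s) = x%:C -> Re (ucirc (cvec (consrv a th) (consrv s 0))) = f (th, x).
      move=> ha; rewrite ucirc_cvec !consrv0 ha.
      have -> : rest (consrv a th) = th by apply/rowP => j; rewrite mxE consrvS.
      have -> : rest (consrv s 0) = 0 by apply/rowP => j; rewrite mxE consrvS.
      by rewrite -map_cvec -/(toCx x) F_real.
    have [xp|xn] := ltP 0 x.
      exists (consrv 0 th); split=> [|M]; last by rewrite fsum_tp es (gtr0_norm xp).
      apply: val; rewrite /ec /= es (gtr0_norm xp) cos0 sin0.
      by apply: complex_ext; rewrite ?ReM ?ImM /=; field; exact: lt0r_neq0.
    exists (consrv pi th); split=> [|M].
      apply: val; rewrite /ec /= es (ler0_norm xn) cospi sinpi.
      by apply: complex_ext; rewrite ?ReM ?ImM /=; field; exact: lt0r_neq0.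
    rewrite fsum_tp; apply: eq_bigr => k _; rewrite /al /be; case: ifP => k0; last by rewrite !mul0r.
    rewrite es (ler0_norm xn) !dotp_consrv -/(resti k) mulr0 add0r.
    have -> : (k 0 ord0)%:~R * pi = `|k 0%R ord0|%N%:~R * pi :> R by rewrite gez0_abs.
    have [-> ->] := cosDnpi `|k 0%R ord0|%N (dotp (resti k) th).
    have -> : (- x / R0) ^+ `|k 0%R ord0|%N = (-1) ^+ `|k 0%R ord0|%N * (x / R0) ^+ `|k 0%R ord0|%N.
      by rewrite -exprMn mulNr mulN1r.
    have sg : (-1) ^+ `|k 0%R ord0|%N * (-1) ^+ `|k 0%R ord0|%N = 1 :> R by rewrite -exprMn mulrNN mulr1 expr1n.
    move: sg; move: ((-1) ^+ _) ((x / R0) ^+ _) (Re _) (Im _) (cos _) (sin _) => g z a b c' s' sg.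
    have -> : g * z * a * (g * c') + - (g * z * b) * (g * s') = (g * g) * (z * a * c' + - (z * b) * s') by ring.
    by rewrite sg mul1r.
  have [N1 hN1] := circle_expansion xh dm es2 e10.
  have := hN1 (maxn N N1) (leq_maxr _ _); rewrite hF htp => h1.
  have [X [uX nX hX]] := tp_box_sub (al (x / R0)) (be (x / R0)) (leq_maxl N N1).
  rewrite fsum_tp hX -fsum_tp in h1.
  have tx : `|x / R0| <= 2^-1 by rewrite normrM normfV (gtr0_norm R00) ler_pdivrMr //; lra.
  have h2 : `|tp X (al (x / R0)) (be (x / R0)) (consrv 0 th)| <= e.
    apply: le_trans (tp_norm_le _ _ _ _) _.
    apply: le_trans (hN0 X uX _); last first.
      by move=> k kX; apply: contra (nX k kX); apply: box_subset.
    by apply: ler_sum => k _; exact: hK.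
  move: h1 h2; move: (tp X _ _ _) (fsum _ _ _) => u v h1 h2.
  have -> : f (th, x) - v = f (th, x) - (v + u) + u by ring.
  by apply: le_trans (ler_normD _ _) _; lra.
move=> th x hx; have [->|x0] := eqVneq x 0; last exact: main.
pose S := \sum_(i <- iota 0 N.+1) `|tp (box d N) (fun k => Re (cpk i k)) (fun k => - Im (cpk i k)) th|.
have S0 : 0 <= S by apply: sumr_ge0.
apply: (@eps_le R _ _ (1 + S)) => e1 e10.
have h0 : cabs (0 : C) < r by rewrite cabs0.
have hs : strip rho (cvec th 0 : 'rV[Cx R]_d) by apply: strip_cvec => j; rewrite mxE normr0 ltW.
have [dl dl0 hd] := F_continuous hs h0 e10.
pose x' := Num.min (Num.min (dl / 2) (R0 / 2)) (R0 * Num.min e1 1).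
have e11 : 0 < Num.min e1 1 by rewrite lt_min e10 ltr01.
have x'0 : 0 < x' by rewrite !lt_min !divr_gt0 //= mulr_gt0.
have x'1 : x' <= dl / 2 by rewrite !ge_min lexx.
have x'2 : x' <= R0 / 2 by rewrite !ge_min lexx orbT.
have x'3 : x' <= R0 * Num.min e1 1 by rewrite ge_min lexx orbT.
have x'a : `|x'| = x' by rewrite gtr0_norm.
have hx' : `|x'| <= R0 / 2 by rewrite x'a.
have h1 := main th x' (lt0r_neq0 x'0) hx'.
have h2 : `|f (th, x') - f (th, 0)| <= e1.
  have xr : `|x'| < r by apply: le_lt_trans hx' _; have := R0_lt; lra.
  have := hd (cvec th 0) (toCx x') _ _.
  rewrite -map_cvec F_real // (_ : (0 : C) = toCx 0) // F_real ?normr0 // => k.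
  have {}k : cabs (toCx (f (th, x')) - toCx (f (th, 0))) < e1.
    apply: k => [j|]; first by rewrite subrr cabs0.
    by rewrite /toCx subr0 cabs_real x'a; lra.
  by move: k; rewrite /toCx -rmorphB cabs_real => /ltW.
have h3 : `|fsum N th x' - fsum N th 0| <= S * e1.
  rewrite /fsum -sumrB; apply: le_trans (ler_norm_sum _ _ _) _.
  rewrite /S mulr_suml; apply: ler_sum => i _; rewrite -mulrBl normrM mulrC ler_wpM2l //.
  have t0 : 0 <= x' / R0 by rewrite divr_ge0 // ltW.
  have t1 : x' / R0 <= Num.min e1 1 by rewrite ler_pdivrMr // mulrC.
  have me : Num.min e1 1 <= e1 by rewrite ge_min lexx.
  have m1 : Num.min e1 1 <= 1 by rewrite ge_min lexx orbT.
  rewrite mul0r; case: i => [|i]; first by rewrite !expr0 subrr normr0 ltW.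
  rewrite (expr0n _ i.+1) subr0 ger0_norm ?exprn_ge0 // exprS.
  apply: le_trans (_ : _ <= x' / R0) _; last by lra.
  by rewrite ler_piMr // exprn_ile1 //; lra.
move: h1 h2 h3; move: (fsum _ _ _) (fsum _ _ _) (f _) (f _) => a b c' d'.
by rewrite !ler_norml => /andP[? ?] /andP[? ?] /andP[? ?]; apply/andP; split; lra.
Qed.

Lemma F_lipschitz : exists2 L : R, 0 <= L & forall (th : rV) (x y : R), `|x| <= R0 / 8 -> `|y| <= R0 / 8 ->
  `|f (th, x)| <= L /\ `|f (th, x) - f (th, y)| <= L * `|x - y|.
Proof.
have [eta [M [eta0 M0 hM]]] := F_uniform; have R00 := R0_gt0; have Rr := R0_lt.
have j0 : 'I_d := Ordinal d0.
have bnd (th : rV) (w : C) : cabs w <= R0 -> cabs (F (cvec th 0 : 'rV[Cx R]_d, w : Cx R)) <= M.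
  move=> hw; have [k hk] := shift_into_box 0 th.
  have hs : strip rho (cvec th 0 : 'rV[Cx R]_d) by apply: strip_cvec => j; rewrite mxE normr0 ltW.
  have wr : `|w : Cx R| < toCx r by rewrite cabs_lt; apply: le_lt_trans hw Rr.
  rewrite -(F_per k (p := (cvec th 0, w)) hs wr) /=.
  have := (hM (th + period id k) 0 w j0 0 _ _ hw _).2; rewrite scale0r addr0 cabs0.
  have -> : (cvec th 0 + period (@toCx R) k : 'rV[Cx R]_d) = cvec (th + period id k) 0.
    by apply/rowP => j; rewrite !mxE; apply: complex_ext; rewrite ?ReD ?ImD /=; ring.
  apply=> // i; first by have := hk i; rewrite add0r.
  by rewrite mxE normr0 ltW.
pose L := M + 16 * M / R0.
have L1 : 0 <= 16 * M / R0 by rewrite divr_ge0 ?mulr_ge0 // ltW.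
exists L; first by rewrite addr_ge0.
move=> th x y hx hy.
have ev z : `|z| <= R0 / 8 -> F (cvec th 0 : 'rV[Cx R]_d, (z%:C : C) : Cx R) = toCx (f (th, z)).
  by move=> hz; rewrite -map_cvec F_real //; apply: le_lt_trans hz _; lra.
split.
  rewrite -[`|_|]cabs_real -/(toCx _) -ev //; apply: le_trans (bnd th _ _) _; last by rewrite lerDl.
  by rewrite cabs_real; lra.
have hd : disc (fun v : C => F (cvec th 0 : 'rV[Cx R]_d, v : Cx R)) 0 R0 M.
  move=> h hh; rewrite add0r; split; last by apply: bnd; exact: ltW.
  have hs : strip rho (cvec th 0 : 'rV[Cx R]_d) by apply: strip_cvec => j; rewrite mxE normr0 ltW.
  have hr : `|h : Cx R| < toCx r by rewrite cabs_lt; apply: lt_trans hh Rr.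
  by have [] := diff_hol (nbhs_singleton (F_diff (p := (cvec th 0, h)) hs hr)).
have key u v : `|u| <= R0 / 8 -> `|v| <= R0 / 8 -> u <= v -> `|f (th, v) - f (th, u)| <= 16 * M / R0 * (v - u).
  move=> hu hv uv.
  have := disc_lip (h := u%:C) R00 hd (_ : 0 <= v - u); rewrite cabs_real add0r subr_ge0 => /(_ uv) k.
  have e1 : u%:C + (v - u)%:C = v%:C :> C by rewrite -rmorphD addrC subrK.
  rewrite e1 !ev // /toCx -rmorphB cabs_real in k; apply: k.
  have := ler_norm v; have := ler_norm (- u); rewrite normrN; exact: half_radius_aux.
have [xy|xy] := leP x y.
  rewrite distrC [`|x - y|]distrC [`|y - x|]ger0_norm ?subr_ge0 //; apply: le_trans (key x y hx hy xy) _.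
  by rewrite ler_wpM2r ?subr_ge0 // lerDr.
rewrite [`|x - y|]ger0_norm ?subr_ge0 ?(ltW xy) //; apply: le_trans (key y x hy hx (ltW xy)) _.
by rewrite ler_wpM2r ?subr_ge0 ?(ltW xy) // lerDr.
Qed.

Lemma fsum_Hle m : (d < 2 * m)%N -> exists2 B : R, 0 < B & forall N (i : nat),
  Hle rho m (tp (box d N) (fun k => Re (cpk i k)) (fun k => - Im (cpk i k))) (B ^+ 2).
Proof.
move=> dm; have [K K0 hK] := cpk_decay m d0.
have S0 := Sjb_gt0 (R := R) m d.
pose A := 8 * Kconv d m * (K ^+ 2 * Sjb m d * 1).
have A0 : 0 <= A by rewrite mulr_ge0 ?mulr_ge0 ?sqr_ge0 ?(ltW (Kconv_gt0 _ _)) // ltW.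
exists (Num.sqrt A + 1); first by rewrite ltr_pwDr ?sqrtr_ge0.
move=> N i; apply: (@Hle_weaken _ _ _ _ _ A).
  rewrite -[leLHS](sqr_sqrtr A0) lerXn2r ?nnegrE ?addr_ge0 ?sqrtr_ge0 //; lra.
have c1 : Hle rho m (fun _ : rV => 1) 1 by have := Hle_cst rho m (1 : R) (d := d); rewrite expr1n.
have := Hle_tp_mul (ltW rho0) dm (leqnn m) (leqnn m) (leq_addr m m) (uniq_box d N) (CP_cst d 1) _ c1.
rewrite addnK => /(_ (fun k => Re (cpk i k)) (fun k => - Im (cpk i k)) (K ^+ 2 * Sjb m d)).
under [fun th => _ * 1]eq_fun do rewrite mulr1; apply.
apply: le_trans (_ : \sum_(k <- box d N) K ^+ 2 * (jb k)^-1 ^+ m <= _); last first.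
  by rewrite -mulr_sumr ler_wpM2l ?sqr_ge0 // sum_jb ?uniq_box.
apply: ler_sum => k _; have := hK i k; have := cabsE (cpk i k); move: (cpk i k) => c ec hc.
have J0 : 0 < jb k ^+ m :> R by rewrite exprn_gt0 // jb_gt0.
have -> : Re c ^+ 2 + (- Im c) ^+ 2 = cabs c ^+ 2 by rewrite ec sqr_sqrtr ?sqrrN // addr_ge0 ?sqr_ge0.
have E0 := expR_gt0 (rho * (norm1 k)%:R).
have eW : wt rho m k = (expR (rho * (norm1 k)%:R)) ^+ 2 * jb k ^+ m.
  by rewrite /wt -expRM_natl -mulrA.
have h2 : cabs c * (expR (rho * (norm1 k)%:R) * jb k ^+ m) <= K.
  have := ler_wpM2r (ltW E0) hc; rewrite expRN.
  have -> : K * (expR (rho * (norm1 k)%:R))^-1 * expR (rho * (norm1 k)%:R) = K by rewrite mulrVK // unitfE lt0r_neq0.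
  by rewrite -[jb k ^+ m * _ * _]mulrA [jb k ^+ m * _]mulrC -mulrA.
rewrite eW exprVn ler_pdivlMr //.
have -> : cabs c ^+ 2 * (expR (rho * (norm1 k)%:R) ^+ 2 * jb k ^+ m) * jb k ^+ m = (cabs c * (expR (rho * (norm1 k)%:R) * jb k ^+ m)) ^+ 2.
  by move: (jb k ^+ m) => J; ring.
by rewrite lerXn2r ?nnegrE ?mulr_ge0 ?cabs_ge0 ?(ltW E0) ?(ltW J0).
Qed.

End AnalyticData.
(** * Composition with convergent power series *)

Section PowerSeries.
Context {R : realType} {d m : nat} {rho : R}.
Local Notation rV := 'rV[R]_d.
Hypothesis rho0 : 0 <= rho.
Hypothesis dm : (d < 2 * m)%N.
Local Notation Kalg := (Kalg (R := R) d m).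

(** The i-th term is bounded by a geometric sequence of ratio at most 1/2; the partial sums of the
    bounds are of the form 3 - 2 2^(-n). *)
Lemma Hle_power_sum (T : nat -> rV -> R) (W : rV -> R) (B q : R) N : CP W -> 0 < q -> q <= 2^-1 -> 0 < B ->
  Hle rho m W ((q / Kalg) ^+ 2) -> (forall i, CP (T i) /\ Hle rho m (T i) (B ^+ 2)) ->
  CP (fun th => \sum_(0 <= i < N) W th ^+ i.+1 * T i.+1 th) /\
  Hle rho m (fun th => \sum_(0 <= i < N) W th ^+ i.+1 * T i.+1 th) ((3 * Kalg * B * q) ^+ 2).
Proof.
move=> cW q0 q1 B0 hW hT; have K1 := Kalg_ge1 (R := R) d m; have K0 : 0 < Kalg by apply: lt_le_trans K1.
pose c n := Kalg * B * q * (3 - 2 * 2^-1 ^+ n).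
have P0 : 0 < Kalg * B * q by rewrite !mulr_gt0.
have p1 n : 0 < 2^-1 ^+ n :> R by rewrite exprn_gt0.
have p2 n : 2^-1 ^+ n <= 1 :> R by rewrite exprn_ile1 //; lra.
have c0 n : 0 < c n by rewrite mulr_gt0 //; have := p2 n; lra.
suff main n : CP (fun th => \sum_(0 <= i < n) W th ^+ i.+1 * T i.+1 th) /\
  Hle rho m (fun th => \sum_(0 <= i < n) W th ^+ i.+1 * T i.+1 th) (c n ^+ 2).
  have [h1 h2] := main N; split => //; apply: Hle_weaken h2.
  rewrite lerXn2r ?nnegrE ?(ltW (c0 _)) //; first by rewrite -!mulrA mulr_ge0 // !mulrA ltW.
  rewrite /c mulrC -!mulrA ler_wpM2r //; first by rewrite !mulrA ltW.
  by have := p1 N; lra.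
elim: n => [|n [cS hS]].
  under [fun th => _]eq_fun do rewrite big_nil.
  by split; [exact: CP_cst | apply: Hle_weaken (sqr_ge0 _) _; have := Hle_cst rho m (0 : R) (d := d); rewrite expr0n].
under [fun th => _]eq_fun do rewrite big_nat_recr //=.
have [cT hT'] := hT n.+1; have cX := CPX n.+1 cW.
split; first exact: CPD cS (CPM cX cT).
have hX : Hle rho m (fun th => W th ^+ n.+1) ((q ^+ n.+1) ^+ 2).
  have qK0 : 0 <= q / Kalg by rewrite divr_ge0 ?ltW.
  by have := HleX rho0 dm n.+1 cW qK0 hW; rewrite [Kalg * _]mulrC divfK ?lt0r_neq0.
have t0 : 0 < Kalg * q ^+ n.+1 * B by rewrite !mulr_gt0 ?exprn_gt0.
have := HleD cS (CPM cX cT) (c0 n) t0 hS (HleM rho0 dm cX cT (exprn_ge0 _ (ltW q0)) (ltW B0) hX hT').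
apply: Hle_weaken; rewrite lerXn2r ?nnegrE ?(ltW (c0 _)) ?addr_ge0 ?(ltW t0) ?(ltW (c0 _)) //.
have -> : c n.+1 = c n + Kalg * B * q * 2^-1 ^+ n by rewrite /c exprS; field.
rewrite lerD2l exprS -!mulrA ler_wpM2l ?(ltW K0) // [B * _]mulrC -!mulrA ler_wpM2l ?(ltW q0) //.
by rewrite ler_wpM2r ?(ltW B0) // lerXn2r ?nnegrE ?invr_ge0 // ltW.
Qed.

(** For real x with |x| <= R0 / 2 the function is a uniform limit of polynomials in [x / R0] whose
    coefficients stay in one ball of the algebra of functions with finite weighted norm. *)
Definition power_series (f : rV * R -> R) (R0 B : R) : Prop := exists T : nat -> nat -> rV -> R,
  (forall N i, CP (T N i) /\ Hle rho m (T N i) (B ^+ 2)) /\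
  (forall e : R, 0 < e -> exists N, forall th x, `|x| <= R0 / 2 ->
     `|f (th, x) - \sum_(i <- iota 0 N.+1) (x / R0) ^+ i * T N i th| <= e).

Section Composition.
Variables (f : rV * R -> R) (R0 B : R).
Hypotheses (R00 : 0 < R0) (B0 : 0 < B) (pf : power_series f R0 B).

Lemma power_series_CP W : CP W -> (forall th, `|W th| <= R0 / 2) -> CP (fun th => f (th, W th)).
Proof.
move=> cW hW; have [T [hT lim]] := pf; apply: CP_of_approx => e e0; have [N hN] := lim e e0.
exists (fun th => \sum_(i <- iota 0 N.+1) (W th / R0) ^+ i * T N i th); last by move=> th; exact: hN.
apply: CP_sum => i; apply: CPM; last by have [] := hT N i.
by apply: CPX; apply: CPM cW (CP_cst _ _).
Qed.

Lemma power_series_split N (T : nat -> rV -> R) th x : \sum_(i <- iota 0 N.+1) (x / R0) ^+ i * T i th =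
  T 0%N th + \sum_(0 <= i < N) (x / R0) ^+ i.+1 * T i.+1 th.
Proof. by rewrite /= big_cons expr0 mul1r -[iota 1 N]/(iota (1 + 0) N) iotaDl big_map /index_iota subn0. Qed.

Lemma power_series_0 : CP (fun th => f (th, 0)) /\ Hle rho m (fun th => f (th, 0)) (B ^+ 2).
Proof.
have c0 : CP (fun th => f (th, 0)).
  by apply: (power_series_CP (CP_cst d 0)) => th; rewrite normr0 divr_ge0 ?ltW.
split => //; apply: Hle_lim => // e e0; have [T [hT lim]] := pf; have [N hN] := lim e e0.
have [cT hT'] := hT N 0%N; exists (T N 0%N) => //; split => // th.
have := hN th 0; rewrite power_series_split big1 ?addr0; last by move=> i _; rewrite mul0r expr0n mul0r.
by apply; rewrite normr0 divr_ge0 ?ltW.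
Qed.

Lemma power_series_Hle W (c : R) : CP W -> (forall th, `|W th| <= R0 / 2) -> 0 < c -> Kalg * c / R0 <= 2^-1 ->
  Hle rho m W (c ^+ 2) ->
  Hle rho m (fun th => f (th, W th) - f (th, 0)) ((3 * Kalg * B * (Kalg * c / R0)) ^+ 2).
Proof.
move=> cW bW c0 q1 hW; have K1 := Kalg_ge1 (R := R) d m; have K0 : 0 < Kalg by apply: lt_le_trans K1.
have [T [hT lim]] := pf; have [cf0 _] := power_series_0.
have cfW := power_series_CP cW bW.
apply: Hle_lim; first exact: CPB.
move=> e e0; have [N hN] := lim (e / 2) (divr_gt0 e0 (ltr0n R 2)).
have cW' : CP (fun th => W th / R0) by exact: CPM cW (CP_cst _ _).
have q0 : 0 < Kalg * c / R0 by rewrite divr_gt0 // mulr_gt0.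
have hW' : Hle rho m (fun th => W th / R0) ((Kalg * c / R0 / Kalg) ^+ 2).
  under [fun th => _]eq_fun do rewrite mulrC.
  have -> : Kalg * c / R0 / Kalg = R0^-1 * c by field; rewrite !lt0r_neq0.
  exact: HleZ.
have [cS hS] := Hle_power_sum N cW' q0 q1 B0 hW' (hT N).
exists (fun th => \sum_(0 <= i < N) (W th / R0) ^+ i.+1 * T N i.+1 th) => //; split => // th.
have := hN th 0; rewrite power_series_split big1 ?addr0; last by move=> i _; rewrite mul0r expr0n mul0r.
rewrite normr0 (divr_ge0 (ltW R00)) // => /(_ isT); have := hN th (W th) (bW th); rewrite power_series_split.
move: (\sum_(_ <= _ < _) _) (T _ _ _) (f _) (f _) => S t x y h1 h2.
have -> : y - x - S = (y - (t + S)) - (x - t) by ring.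
by apply: le_trans (ler_normB _ _) _; lra.
Qed.

End Composition.
End PowerSeries.

Section AnalyticAdmissible.
Context {R : realType} {d m : nat} {rho : R}.
Local Notation rV := 'rV[R]_d.
Hypothesis rho0 : 0 < rho.
Hypothesis dm : (d < 2 * m)%N.
Hypothesis d0 : (0 < d)%N.

Lemma analytic_power_series r (f : rV * R -> R) : 0 < r -> analytic_on rho r f ->
  exists B L : R, [/\ 0 < B, 0 < L, power_series (m := m) (rho := rho) f (R0 r) B &
    forall (th : rV) (x y : R), `|x| <= R0 r / 8 -> `|y| <= R0 r / 8 ->
      `|f (th, x)| <= L /\ `|f (th, x) - f (th, y)| <= L * `|x - y|].
Proof.
move=> r0 [F [F1 F2 F3]].
have [B B0 hB] := fsum_Hle rho0 r0 F1 F2 d0 dm.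
have [L L0 hL] := F_lipschitz rho0 r0 F1 F2 d0 F3.
exists B, (L + 1); split => //; first by rewrite ltr_wpDl.
  exists (fun N i => tp (box d N) (fun k => complex.Re (cpk r F i k)) (fun k => - complex.Im (cpk r F i k))).
  split=> [N i|e e0]; first by split; [exact: CP_tp | exact: hB].
  have [N hN] := fsum_limit rho0 r0 F1 F2 d0 F3 dm e0.
  by exists N => th x hx; exact: hN.
move=> th x y hx hy; have [h1 h2] := hL th x y hx hy; split; first by rewrite ler_wpDr.
by apply: le_trans h2 _; rewrite ler_wpM2r // lerDl.
Qed.

Lemma power_lipschitz n (s x y : R) : 0 <= s -> `|x| <= s -> `|y| <= s ->
  `|x ^+ n.+1 - y ^+ n.+1| <= n.+1%:R * s ^+ n * `|x - y|.
Proof.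
move=> s0 hx hy; rewrite subrXX normrM /= mulrC ler_wpM2r //; apply: le_trans (ler_norm_sum _ _ _) _.
apply: le_trans (_ : \sum_(i < n.+1) s ^+ n <= _); last by rewrite sumr_const card_ord mulr_natl.
apply: ler_sum => i _; rewrite normrM !normrX.
apply: le_trans (_ : s ^+ (n - i) * s ^+ i <= _).
  by rewrite ler_pM ?exprn_ge0 // lerXn2r ?nnegrE.
by rewrite -exprD subnK // -ltnS.
Qed.

(** Only the factor H of h = x^(l+1) H is expanded: the factor x^(l+1) gives the order of vanishing by
    itself. *)
Lemma analytic_admissible l r (f h : rV * R -> R) : 0 < r -> analytic_on rho r f ->
  vanishes_analytic l rho r h ->
  exists s0 M : R, [/\ 0 < s0, 0 < M, s0 < r & admissible l m rho f h s0 M].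
Proof.
move=> r0 af [H [aH hH]].
have [B [L [B0 L0 pf Lf]]] := analytic_power_series r0 af.
have [B' [L' [B'0 L'0 pH LH]]] := analytic_power_series r0 aH.
have K1 := Kalg_ge1 (R := R) d m; pose K : R := Kalg d m; rewrite -/K in K1.
have K0 : 0 < K by apply: lt_le_trans K1.
have S0 := Csup_gt0 (R := R) d m; pose S : R := Csup d m; rewrite -/S in S0.
pose q := R0 r; have q0 : 0 < q := R0_gt0 r0; have qr : q < r := R0_lt r0.
rewrite -/q in pf Lf pH LH.
pose s0 := Num.min 1 (Num.min (q / 8 / (1 + S)) (q / (4 * K))).
have s00 : 0 < s0 by rewrite !lt_min ltr01 (divr_gt0 (divr_gt0 q0 _) (addr_gt0 _ S0)) //= (divr_gt0 q0) // mulr_gt0.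
have s1 : s0 <= 1 by rewrite ge_min lexx.
have s2 : (1 + S) * s0 <= q / 8.
  by rewrite mulrC -ler_pdivlMr ?addr_gt0 // !ge_min lexx orbT.
have s3 : 4 * K * s0 <= q.
  by rewrite mulrC -ler_pdivlMr ?mulr_gt0 // !ge_min lexx !orbT.
have s8 : s0 <= q / 8 by have : 0 <= S * s0 by [rewrite mulr_ge0 ?ltW]; move: s2; lra.
pose M1 := 6 * K ^+ 2 * B / q; pose M1' := 6 * K ^+ 2 * B' / q.
have M10 : 0 < M1 by rewrite divr_gt0 // !mulr_gt0 // exprn_gt0.
have M10' : 0 < M1' by rewrite divr_gt0 // !mulr_gt0 // exprn_gt0.
pose M2 := l.+2%:R * L'; have M20 : 0 < M2 by rewrite mulr_gt0.
pose M3 := K * (K * 2) ^+ l.+1 * (M1' + B').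
have M30 : 0 < M3 by rewrite (mulr_gt0 (mulr_gt0 K0 _) (addr_gt0 M10' B'0)) // exprn_gt0 // mulr_gt0.
exists s0, (L + M1 + M2 + M3).
have M0 : 0 < L + M1 + M2 + M3 by rewrite !addr_gt0.
have q2 : q / 8 <= q / 2 by lra.
have hE th x : `|x| <= q / 8 -> h (th, x) = x ^+ l.+1 * H (th, x) by move=> hx; apply: hH; lra.
have s0r : s0 < r by lra.
split => //; split.
- move=> V cV hV; have b8 th : `|V th| <= q / 8 := le_trans (hV th) s8.
  have b2 th : `|V th| <= q / 2 := le_trans (b8 th) q2.
  split; first exact: power_series_CP pf _ cV b2.
  under [fun th => h _]eq_fun do rewrite (hE _ _ (b8 _)).
  by apply: CPM (CPX _ cV) _; exact: power_series_CP pH _ cV b2.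
- move=> th x y s sg sle hx hy.
  have x8 : `|x| <= q / 8 := le_trans hx (le_trans sle s8).
  have y8 : `|y| <= q / 8 := le_trans hy (le_trans sle s8).
  have [_ f1] := Lf th x y x8 y8; have [H0 H1] := LH th x y x8 y8.
  split; first by apply: le_trans f1 _; rewrite ler_wpM2r // -!addrA lerDl !addr_ge0 ?ltW.
  rewrite !hE //.
  have -> : x ^+ l.+1 * H (th, x) - y ^+ l.+1 * H (th, y) =
    (x ^+ l.+1 - y ^+ l.+1) * H (th, x) + y ^+ l.+1 * (H (th, x) - H (th, y)) by ring.
  apply: le_trans (_ : M2 * s ^+ l * `|x - y| <= _); last first.
    rewrite ler_wpM2r // ler_wpM2r ?exprn_ge0 // [_ + M2]addrC -addrA lerDl !addr_ge0 ?ltW //.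
  apply: le_trans (ler_normD _ _) _; rewrite !normrM.
  have p1 := power_lipschitz l sg hx hy.
  have p2 : `|y ^+ l.+1| <= s ^+ l.
    rewrite normrX exprS; apply: le_trans (_ : 1 * s ^+ l <= _); last by rewrite mul1r.
    by rewrite ler_pM ?exprn_ge0 ?lerXn2r ?nnegrE // ?(le_trans hy) // (le_trans sle).
  have a1 := ler_pM (normr_ge0 _) (normr_ge0 _) p1 H0.
  have a2 := ler_pM (normr_ge0 _) (normr_ge0 _) p2 H1.
  apply: le_trans (lerD a1 a2) _; rewrite /M2 -[l.+2]addn1 natrD.
  by move: (s ^+ l) `|x - y| => u v; rewrite le_eqVlt; apply/orP; left; apply/eqP; ring.
- by move=> th; rewrite hE ?normr0 ?divr_ge0 ?ltW // exprS !mul0r.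
- move=> a V s sg sle ha cV hV.
  have bV th : `|a + V th| <= q / 8.
    apply: le_trans (ler_normD _ _) _; have := Hle_sup (ltW rho0) dm cV (ltW sg) hV th.
    have : (1 + S) * s <= (1 + S) * s0 by rewrite ler_wpM2l // addr_ge0 ?ltW.
    by rewrite -/S; move: s2 ha; lra.
  have bV2 th : `|a + V th| <= q / 2 := le_trans (bV th) q2.
  have ca : CP (fun _ : rV => a) := CP_cst d a.
  have cU : CP (fun th => a + V th) by exact: CPD.
  have hU : Hle rho m (fun th => a + V th) ((2 * s) ^+ 2).
    have -> : 2 * s = s + s by ring.
    by apply: HleD => //; exact: Hle_sq_abs ha (Hle_cst _ _ _).
  have sg2 : 0 < 2 * s by rewrite mulr_gt0.
  have qle : K * (2 * s) / q <= 2^-1.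
    rewrite ler_pdivrMr //; have : K * s <= K * s0 by rewrite ler_wpM2l ?(ltW K0).
    by move: s3; lra.
  have hf := power_series_Hle (ltW rho0) dm q0 B0 pf cU bV2 sg2 qle hU.
  have hHd := power_series_Hle (ltW rho0) dm q0 B'0 pH cU bV2 sg2 qle hU.
  have [cH0 hH0] := power_series_0 q0 pH.
  have cHU := power_series_CP pH cU bV2.
  have e1 (b : R) : 3 * K * b * (K * (2 * s) / q) = 6 * K ^+ 2 * b / q * s by ring.
  rewrite -/K e1 -/M1 in hf; rewrite -/K e1 -/M1' in hHd.
  split.
    apply: Hle_sq_abs hf; rewrite ger0_norm ?(mulr_ge0 (ltW M10) (ltW sg)) // ler_wpM2r ?(ltW sg) //.
    by rewrite -!addrA addrCA lerDl !addr_ge0 ?ltW.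
  have hHU : Hle rho m (fun th => H (th, a + V th)) ((M1' * s + B') ^+ 2).
    have := HleD (CPB cHU cH0) cH0 (mulr_gt0 M10' sg) B'0 hHd hH0.
    by under [fun th => _ - _ + _]eq_fun do rewrite subrK.
  under [fun th => h _]eq_fun do rewrite (hE _ _ (bV _)).
  have hX := HleX (ltW rho0) dm l.+1 cU (ltW sg2) hU.
  have X0 : 0 <= (K * (2 * s)) ^+ l.+1 by rewrite exprn_ge0 // mulr_ge0 ?ltW.
  have Y0 : 0 <= M1' * s + B' by exact: addr_ge0 (mulr_ge0 (ltW M10') (ltW sg)) (ltW B'0).
  apply: Hle_sq_abs (HleM (ltW rho0) dm (CPX l.+1 cU) cHU X0 Y0 hX hHU); rewrite -/K.
  rewrite (ger0_norm (mulr_ge0 (mulr_ge0 (ltW K0) X0) Y0)).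
  apply: le_trans (_ : M3 * s ^+ l.+1 <= _); last first.
    by rewrite ler_wpM2r ?exprn_ge0 ?(ltW sg) // lerDr !addr_ge0 ?ltW.
  have -> : M3 * s ^+ l.+1 = K * (K * (2 * s)) ^+ l.+1 * (M1' + B').
    by rewrite mulrA [(K * 2 * s) ^+ _]exprMn /M3; ring.
  by rewrite (ler_wpM2l (mulr_ge0 (ltW K0) X0)) // lerD2r -[leRHS]mulr1 ler_wpM2l ?(ltW M10') // (le_trans sle s1).
Qed.

End AnalyticAdmissible.
(** * Holomorphic extension to the strip *)

Section ComplexSums.
Context {R : realType} {d : nat}.
Local Notation C := R[i].
Local Notation Re := complex.Re.
Local Notation Im := complex.Im.
Local Notation Zd := 'rV[int]_d.
Local Open Scope complex_scope.

Lemma cabs_sum (I : Type) (X : seq I) (a : I -> C) : cabs (\sum_(k <- X) a k) <= \sum_(k <- X) cabs (a k).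
Proof.
elim: X => [|k X IH]; first by rewrite !big_nil cabs0.
by rewrite !big_cons; apply: le_trans (cabsD _ _) _; rewrite lerD2l.
Qed.

Lemma Re_sum (I : Type) (X : seq I) (a : I -> C) : Re (\sum_(k <- X) a k) = \sum_(k <- X) Re (a k).
Proof. by elim: X => [|k X IH]; rewrite ?big_nil // !big_cons ReD IH. Qed.

Lemma Im_sum (I : Type) (X : seq I) (a : I -> C) : Im (\sum_(k <- X) a k) = \sum_(k <- X) Im (a k).
Proof. by elim: X => [|k X IH]; rewrite ?big_nil // !big_cons ImD IH. Qed.

(** Convergence along boxes of lattice points, as a relation so that linear combinations of limits need
    no chosen limit operator. *)
Definition csums (a : Zd -> C) (s : C) := forall e : R, 0 < e -> exists N0, forall N, (N0 <= N)%N ->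
  cabs (s - \sum_(k <- box d N) a k) <= e.

Lemma real_sums (a b : Zd -> R) C0 : (forall k, `|a k| <= b k) -> (forall X, uniq X -> \sum_(k <- X) b k <= C0) ->
  exists s : R, forall e : R, 0 < e -> exists N0, forall N, (N0 <= N)%N -> `|s - \sum_(k <- box d N) a k| <= e.
Proof.
move=> ab hb; have tail := bounded_series (fun k => le_trans (normr_ge0 _) (ab k)) hb.
have [|V _ hV] := @uniform_limit R d (fun N _ => \sum_(k <- box d N) a k) (fun N => CP_cst d _).
  move=> e e0; have [N0 hN] := tail e e0; exists N0 => N NN _; rewrite (box_outer _ NN) opprD addNKr normrN.
  apply: le_trans (ler_norm_sum _ _ _) _; apply: le_trans (hN _ (uniq_outer N0 N) (fun k => @outer_out _ N0 N k)).
  exact: ler_sum.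
by exists (V 0) => e e0; have [N0 hN] := hV e e0; exists N0 => N NN; exact: hN.
Qed.

Lemma csums_ex (a : Zd -> C) (b : Zd -> R) C0 : (forall k, cabs (a k) <= b k) ->
  (forall X, uniq X -> \sum_(k <- X) b k <= C0) -> exists s, csums a s.
Proof.
move=> ab hb.
have [x hx] := real_sums (fun k => le_trans (Re_le (a k)) (ab k)) hb.
have [y hy] := real_sums (fun k => le_trans (Im_le (a k)) (ab k)) hb.
exists (x +i* y) => e e0; have e2 : 0 < e / 2 by rewrite divr_gt0.
have [N1 h1] := hx _ e2; have [N2 h2] := hy _ e2.
exists (maxn N1 N2) => N; rewrite geq_max => /andP[NN1 NN2].
apply: le_trans (cabs_le _) _; rewrite ReB ImB Re_sum Im_sum /=.
by have := h1 N NN1; have := h2 N NN2; move: `|_| `|_| => u v; lra.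
Qed.

Lemma csumsD a b s t : csums a s -> csums b t -> csums (fun k => a k + b k) (s + t).
Proof.
move=> ha hb e e0; have e2 : 0 < e / 2 by rewrite divr_gt0.
have [N1 h1] := ha _ e2; have [N2 h2] := hb _ e2.
exists (maxn N1 N2) => N; rewrite geq_max => /andP[NN1 NN2]; rewrite big_split /= opprD addrACA.
apply: le_trans (cabsD _ _) _.
by have := h1 N NN1; have := h2 N NN2; move: (cabs _) (cabs _) => u v; lra.
Qed.

Lemma csumsZ c a s : csums a s -> csums (fun k => c * a k) (c * s).
Proof.
move=> ha e e0; have c0 := cabs_ge0 c; have c1 : 0 < 1 + cabs c by lra.
have [N0 h] := ha (e / (1 + cabs c)) (divr_gt0 e0 c1); exists N0 => N NN.
rewrite -mulr_sumr -mulrBr cabsM; apply: le_trans (ler_wpM2l c0 (h N NN)) _.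
by rewrite mulrCA ger_pMr // ler_pdivrMr // mul1r lerDr.
Qed.

Lemma csums0 : csums (fun=> 0) 0.
Proof. by move=> e e0; exists 0%N => N _; rewrite big1 // subrr cabs0 ltW. Qed.

Lemma csums_sum (I : Type) (r : seq I) (a : I -> Zd -> C) (s : I -> C) : (forall i, csums (a i) (s i)) ->
  csums (fun k => \sum_(i <- r) a i k) (\sum_(i <- r) s i).
Proof.
move=> h; elim: r => [|i r IH].
  by rewrite big_nil; under [fun k => _]eq_fun do rewrite big_nil; exact: csums0.
by rewrite big_cons; under [fun k => _]eq_fun do rewrite big_cons; exact: csumsD.
Qed.

Lemma csums_le a s c : csums a s -> (forall N, \sum_(k <- box d N) cabs (a k) <= c) -> cabs s <= c.
Proof.
move=> h hc; apply/ler_addgt0Pr => e e0; have [N /(_ N (leqnn _)) hN] := h e e0.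
rewrite -[s](subrK (\sum_(k <- box d N) a k)); apply: le_trans (cabsD _ _) _.
by rewrite addrC lerD //; apply: le_trans (cabs_sum _ _) (hc N).
Qed.

Lemma csums_unique a s t : csums a s -> csums a t -> s = t.
Proof.
move=> hs ht; apply/eqP; rewrite -subr_eq0; apply/eqP/cabs_eq0/eqP; rewrite eq_le cabs_ge0 andbT.
have := csumsD hs (csumsZ (-1) ht); rewrite mulN1r => h; apply: csums_le h _ => N.
by rewrite big1 // => k _; rewrite mulN1r subrr cabs0.
Qed.

End ComplexSums.

Section Frechet.
Context {R : realType} {d : nat}.
Local Notation Re := complex.Re.
Local Notation Im := complex.Im.
Local Notation cV := 'rV[Cx R]_d.
Local Open Scope complex_scope.

Lemma coord_norm_lt (h : cV) (t : R) j : `|h| < toCx t -> cabs (h 0 j) < t.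
Proof.
move=> hh; have : ball_ Num.norm (0 : cV) (toCx t) h by rewrite /ball_ /= sub0r normrN.
rewrite ball_normE => -[_ /(_ ord0 j)]; rewrite mxE /ball /= sub0r normrN.
by rewrite cabs_lt.
Qed.

Lemma norm_real (h : cV) : `|h| = toCx (Re `|h|) /\ 0 <= Re `|h|.
Proof.
have := normr_ge0 h; case: (`|h|) => a b; rewrite /toCx lecE /= => /andP[/eqP -> a0].
by [].
Qed.

Lemma coord_norm_le (h : cV) j : cabs (h 0 j) <= Re `|h|.
Proof.
apply/ler_addgt0Pr => e e0; apply/ltW/coord_norm_lt; rewrite (norm_real h).1 /toCx ltcR.
by rewrite ltrDl.
Qed.

(** A quadratic remainder gives Frechet differentiability; the linear part is given by its
    coordinates c. *)
Lemma differentiable_quadratic (U : cV -> Cx R) (z : cV) (c : 'I_d -> Cx R) (K dl : R) : 0 < dl -> 0 <= K ->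
  (forall (h : cV) (t : R), (forall j, cabs (h 0 j) <= t) -> 0 <= t -> t <= dl ->
     cabs (U (z + h) - U z - \sum_j h 0 j * c j) <= K * t ^+ 2) -> differentiable U z.
Proof.
move=> dl0 K0 hU.
pose L (h : cV) : Cx R := \sum_j h 0 j * c j.
have linL : linear L.
  move=> a u v; rewrite /L scaler_sumr -big_split; apply: eq_bigr => j _ /=.
  by rewrite !mxE mulrDl /GRing.scale /= mulrA.
pose L' : {linear cV -> Cx R} := HB.pack L (GRing.isLinear.Build _ _ _ _ L linL).
have cL0 : continuous L.
  have t1 j : continuous (fun h : cV => h 0 j * c j : Cx R).
    by move=> y; have h1 := @coord_continuous (Cx R) 1 d ord0 j y; apply: (cvgM h1 (cvg_cst (c j))).
  have h := @continuous_big (Cx R) _ +%R 0 xpredT _ cV (index_enum 'I_d) (fun j (h : cV) => h 0 j * c j : Cx R) (fun j _ => t1 j).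
  by apply: h; exact: add_continuous.
have cL : continuous L' by exact: cL0.
have dxf : U \o shift z = cst (U z) + L +o_ (0 : cV) id.
  apply/eqaddoP => e e0; have [E1 p1] := pos_real e0.
  have r0 : 0 < Num.min dl (Re e / (K + 1)) by rewrite lt_min dl0 divr_gt0 // ltr_wpDl.
  suff : \forall h \near (0 : cV), `|U (h + z) - (U z + L h)| <= e * `|h| by [].
  apply/nbhs_normP; exists (toCx (Num.min dl (Re e / (K + 1)))) => /=; first by rewrite /toCx ltcR.
  move=> h; rewrite /ball_ /= sub0r normrN (norm_real h).1; have [_ n0] := norm_real h.
  have := coord_norm_le h; move: (Re `|h|) n0 => t t0 ht; rewrite {1}/toCx ltcR lt_min => /andP[t1 t2].
  rewrite E1 /toCx -rmorphM -/(toCx _) cabs_le_norm.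
  have := hU h t ht t0 (ltW t1); rewrite opprD addrA [h + z]addrC => k.
  apply: le_trans k _; rewrite expr2 mulrA ler_wpM2r //.
  have h1 : 0 < K + 1 by rewrite ltr_wpDl.
  have : t * (K + 1) < Re e by rewrite -ltr_pdivlMr.
  by move: t0; lra.
apply/diff_locallyP; rewrite (diff_unique cL dxf); split=> //.
Qed.

End Frechet.

Section StripExtension.
Context {R : realType} {d m : nat} {rho : R}.
Local Notation C := R[i].
Local Notation Re := complex.Re.
Local Notation Im := complex.Im.
Local Notation rV := 'rV[R]_d.
Local Notation cV := 'rV[C]_d.
Local Notation Zd := 'rV[int]_d.
Local Open Scope complex_scope.
Hypothesis rho0 : 0 < rho.
Hypothesis dm : (d < 2 * m)%N.

Definition phase (k : Zd) (z : cV) : C := - \sum_j (k 0 j)%:~R * z 0 j.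

Lemma phaseD k z h : phase k (z + h) = phase k z + phase k h.
Proof.
rewrite /phase -opprD -big_split; congr (- _); apply: eq_bigr => j _ /=.
by rewrite !mxE mulrDr.
Qed.

Lemma intC (p : int) : p%:~R = (p%:~R : R)%:C :> C.
Proof. by rewrite rmorph_int. Qed.

Lemma phase_le k (h : cV) t : (forall j, cabs (h 0 j) <= t) -> cabs (phase k h) <= (norm1 k)%:R * t.
Proof.
move=> hh; rewrite cabsN; apply: le_trans (cabs_sum _ _) _; rewrite /norm1 natr_sum mulr_suml.
apply: ler_sum => j _; rewrite cabsM intC cabs_real natr_absz -intr_norm ler_wpM2l //.
Qed.

Lemma Im_phase_le k (z : cV) s : (forall j, `|Im (z 0 j)| <= s) -> `|Im (phase k z)| <= (norm1 k)%:R * s.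
Proof.
move=> hz; rewrite /phase.
have -> : Im (- \sum_j (k 0 j)%:~R * z 0 j) = - \sum_j (k 0 j)%:~R * Im (z 0 j).
  have ImN (w : C) : Im (- w) = - Im w by case: w.
  rewrite ImN Im_sum; congr (- _); apply: eq_bigr => j _.
  by rewrite intC ImM /= mul0r addr0.
rewrite normrN; apply: le_trans (ler_norm_sum _ _ _) _; rewrite /norm1 natr_sum mulr_suml.
by apply: ler_sum => j _; rewrite normrM natr_absz -intr_norm ler_wpM2l.
Qed.

Lemma cabs_chr_le k (z : cV) s : (forall j, `|Im (z 0 j)| <= s) -> cabs (chr k z) <= expR ((norm1 k)%:R * s).
Proof.
move=> hz; rewrite cabs_ec ler_expR; have := Im_phase_le k hz.
by rewrite -normrN; apply: le_trans; exact: ler_norm.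
Qed.

(** The remainder costs two powers of |k| and a slightly larger exponential, both of which a margin
    inside the strip absorbs. *)
Lemma chr_taylor k (z h : cV) s t : (forall j, `|Im (z 0 j)| <= s) -> (forall j, cabs (h 0 j) <= t) ->
  cabs (chr k (z + h) - chr k z - chr k z * ('i * phase k h)) <=
  4 * expR ((norm1 k)%:R * (s + t)) * ((norm1 k)%:R * t) ^+ 2.
Proof.
move=> hz hh; have hc := cabs_chr_le k hz; have hp := phase_le k hh.
have -> : chr k (z + h) - chr k z - chr k z * ('i * phase k h) = chr k z * (ec (phase k h) - 1 - 'i * phase k h).
  rewrite /chr -!/(phase k _) phaseD ecD; ring.
rewrite cabsM; apply: le_trans (ler_pM (cabs_ge0 _) (cabs_ge0 _) hc (ec_taylor _)) _.
rewrite mulrDr expRD [leRHS](_ : _ = expR ((norm1 k)%:R * s) * (4 * expR ((norm1 k)%:R * t) * ((norm1 k)%:R * t) ^+ 2)); last first.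
  by move: (expR _) (expR _) (_ ^+ 2) => u v w; ring.
rewrite ler_wpM2l ?expR_ge0 // ler_pM ?mulr_ge0 ?expR_ge0 ?exprn_ge0 ?cabs_ge0 //.
  by rewrite ler_wpM2l // ler_expR.
by rewrite lerXn2r ?nnegrE ?cabs_ge0 // (le_trans (cabs_ge0 _) hp).
Qed.

(** Half of the exponent 2 rho |k| of the weight is spent here, the power of |k| by Cauchy-Schwarz. *)
Lemma Hle_strip_sum (V : rV -> R) B : 0 <= B -> Hle rho m V (B ^+ 2) -> forall X : seq Zd, uniq X ->
  \sum_(k <- X) (`|fc V k| + `|fs V k|) * expR ((norm1 k)%:R * rho) <= Csup d m * B.
Proof.
move=> B0 hV X uX.
have aux (a : Zd -> R) : (forall X, uniq X -> \sum_(k <- X) a k ^+ 2 * wt rho m k <= B ^+ 2) ->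
   \sum_(k <- X) `|a k| * expR ((norm1 k)%:R * rho) <= (1 + Sjb m d) * B.
  move=> ha; have := @sum_abs_le R d m 0 (lexx 0) dm (fun k => a k * expR ((norm1 k)%:R * rho)) B B0 _ X uX.
  under eq_bigr do rewrite normrM [`|expR _|]ger0_norm ?expR_ge0 //.
  apply => Y uY; apply: le_trans (ha Y uY); apply: ler_sum => k _.
  rewrite exprMn /wt -expRM_natl mulr0 mul0r expR0 mul1r -mulrA.
  by rewrite -[_ * jb k ^+ m]mulrA [rho * _]mulrC.
under eq_bigr do rewrite mulrDl.
rewrite big_split /= /Csup -mulrA mulr_natl mulr2n.
by apply: lerD; apply: aux; [exact: Hle_c|exact: Hle_s].
Qed.

Variables (V : rV -> R) (B : R).
Hypotheses (cV0 : CP V) (B0 : 0 <= B) (hV : Hle rho m V (B ^+ 2)).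

Definition fcoef (k : Zd) : C := fc V k +i* fs V k.

Let b (k : Zd) : R := cabs (fcoef k) * expR ((norm1 k)%:R * rho).

Lemma b_ge0 k : 0 <= b k.
Proof. by rewrite mulr_ge0 ?cabs_ge0 ?expR_ge0. Qed.

Lemma b_sum X : uniq X -> \sum_(k <- X) b k <= Csup d m * B.
Proof.
move=> uX; apply: le_trans (Hle_strip_sum B0 hV uX); apply: ler_sum => k _.
by rewrite ler_wpM2r ?expR_ge0 // (le_trans (cabs_le _)).
Qed.

Lemma term_le (z : cV) k : (forall j, `|Im (z 0 j)| <= rho) -> cabs (fcoef k * chr k z) <= b k.
Proof. by move=> hz; rewrite cabsM ler_wpM2l ?cabs_ge0 // cabs_chr_le. Qed.

Lemma ext_ex (z : cV) : exists s : C, (forall j, `|Im (z 0 j)| <= rho) -> csums (fun k => fcoef k * chr k z) s.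
Proof.
have [hz|hz] := pselect (forall j, `|Im (z 0 j)| <= rho); last by exists 0.
have [s hs] := csums_ex (fun k => term_le k hz) b_sum; by exists s.
Qed.

(** Outside the closed strip the value is irrelevant. *)
Definition ext (z : 'rV[Cx R]_d) : Cx R := projT1 (cid (ext_ex z)).

Lemma extP (z : cV) : (forall j, `|Im (z 0 j)| <= rho) -> csums (fun k => fcoef k * chr k z) (ext z).
Proof. by rewrite /ext; case: cid. Qed.

Lemma ext_uniform (e : R) : 0 < e -> exists N, forall z : cV, (forall j, `|Im (z 0 j)| <= rho) ->
  cabs (ext z - \sum_(k <- box d N) fcoef k * chr k z) <= e.
Proof.
move=> e0; have e2 : 0 < e / 2 by rewrite divr_gt0.
have [N0 tail] := bounded_series b_ge0 b_sum e2; exists N0 => z hz.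
have [N1 h1] := extP hz e2; have := h1 _ (leq_maxl N1 N0).
rewrite (box_outer _ (leq_maxr N1 N0)) => h2.
have := tail _ (uniq_outer N0 (maxn N1 N0)) (fun k => @outer_out _ N0 (maxn N1 N0) k) => h3.
set S := \sum_(k <- box d N0) _; rewrite -/S in h2.
set T := \sum_(k <- outer _ _) _ in h2.
have hT : cabs T <= e / 2.
  by apply: le_trans h3; apply: le_trans (cabs_sum _ _) _; apply: ler_sum => k _; exact: term_le.
have -> : ext z - S = ext z - (S + T) + T by ring.
by apply: le_trans (cabsD _ _) _; move: h2 hT; move: (cabs _) (cabs _) => u v; lra.
Qed.

(** The imaginary part of each box sum is odd in k and cancels. *)
Lemma ext_real (th : rV) : ext (map_mx (@toCx R) th) = toCx (V th).
Proof.
have hz j : `|Im ((map_mx (@toCx R) th : cV) 0 j)| <= rho by rewrite mxE /= normr0 ltW.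
apply: csums_unique (extP hz) _ => e e0.
have [/(_ e e0)[N0 hN] _] := fourier_series cV0 (Hle_abs (ltW rho0) dm B0 hV).
exists N0 => N NN; have := hN N NN th.
have -> : toCx (V th) - \sum_(k <- box d N) fcoef k * chr k (map_mx (@toCx R) th) = (V th - tp (box d N) (fc V) (fs V) th)%:C.
  have e1 k : fcoef k * chr k (map_mx (@toCx R) th) =
     (fc V k * cos (dotp k th) + fs V k * sin (dotp k th)) +i* (fs V k * cos (dotp k th) + - fc V k * sin (dotp k th)).
    rewrite map_cvec chr_cvec; have -> : dotp k (0 : rV) = 0 by rewrite /dotp big1 // => j _; rewrite mxE mulr0.
    rewrite /ec /fcoef; apply: complex_ext; rewrite !(ReM, ImM) /= oppr0 oppr0 expR0 cosN sinN; ring.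
  rewrite (eq_bigr _ (fun k _ => e1 k)).
  apply: complex_ext; rewrite (ReB, ImB) (Re_sum, Im_sum) /=; first by [].
  rewrite -[\sum_(_ <- _) _]/(tp (box d N) (fs V) (fun k => - fc V k) th) even_tp ?subrr //.
    by move=> k; exact: fsN.
  by move=> k; rewrite fcN.
by rewrite cabs_real.
Qed.

Lemma ext_period (k : Zd) (z : cV) : strip rho (z : 'rV[Cx R]_d) -> ext (z + period (@toCx R) k) = ext z.
Proof.
move=> hz; have hz' j : `|Im ((z + period (@toCx R) k : cV) 0 j)| <= rho by rewrite !mxE ImD /= addr0; exact: hz.
apply: csums_unique (extP hz') _; have := extP hz.
suff e1 l : chr l (z + period (@toCx R) k : cV) = chr l z by under [X in _ -> csums X _]eq_fun do rewrite e1.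
rewrite /chr -!/(phase l _) phaseD.
have -> : phase l (period (@toCx R) k) = (- \sum_j l 0 j * k 0 j)%:~R * (2 * pi)%:C.
  rewrite /phase rmorphN rmorph_sum mulNr mulr_suml; congr (- _); apply: eq_bigr => j _ /=.
  by rewrite mxE intrM !intC /toCx !rmorphM /= -!rmorphM; congr (_ %:C); ring.
by rewrite ec_period_int.
Qed.

Lemma ext_continuous : {within strip rho, continuous ext}.
Proof.
apply/subspace_continuousP => z hz; apply/cvgrPdist_le => e0' e0p.
have [E1 e0] := pos_real e0p; rewrite E1; set e := Re e0' in e0 *.
have e3 : 0 < e / 3 by rewrite divr_gt0.
have [N hN] := ext_uniform e3.
pose K (k : Zd) : R := cabs (fcoef k) * (expR ((norm1 k)%:R * rho) * (norm1 k)%:R +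
   4 * expR ((norm1 k)%:R * (rho + 1)) * (norm1 k)%:R ^+ 2).
have K0 k : 0 <= K k by rewrite mulr_ge0 ?cabs_ge0 // addr_ge0 ?mulr_ge0 ?expR_ge0 ?exprn_ge0.
pose S := \sum_(k <- box d N) K k; have S0 : 0 <= S by apply: sumr_ge0.
pose dl := Num.min 1 (e / 3 / (S + 1)); have dl0 : 0 < dl by rewrite lt_min ltr01 divr_gt0 // ltr_wpDl.
rewrite near_withinE.
suff : \forall y \near (z : 'rV[Cx R]_d), strip rho y -> `|ext z - ext y| <= toCx e by [].
apply/nbhs_normP; exists (toCx dl); first by rewrite /= /toCx ltcR.
move=> y; rewrite /ball_ /= -normrN opprB => yz hy.
have [h0 h1] := norm_real (y - z); rewrite h0 in yz; have ht := coord_norm_le (y - z).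
move: (Re _) h1 yz ht => t t0; rewrite /toCx ltcR => td ht.
rewrite -/(toCx e) cabs_le_norm.
have a1 := hN z hz; have a2 := hN y hy.
have a3 : cabs (\sum_(k <- box d N) fcoef k * chr k (z : cV) - \sum_(k <- box d N) fcoef k * chr k (y : cV)) <= e / 3.
  rewrite -sumrB; apply: le_trans (cabs_sum _ _) _.
  apply: le_trans (_ : S * t <= _); last first.
    apply: le_trans (ler_wpM2l S0 (ltW td)) _; apply: le_trans (_ : S * (e / 3 / (S + 1)) <= _).
      by rewrite ler_wpM2l // ge_min lexx orbT.
    by rewrite mulrCA ger_pMr // ler_pdivrMr ?mul1r ?lerDl // ltr_wpDl.
  rewrite mulr_suml; apply: ler_sum => k _; rewrite -mulrBr cabsM /K -mulrA ler_wpM2l ?cabs_ge0 //.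
  rewrite -cabsN opprB; have zy : (z : cV) + (y - z) = y by rewrite addrC subrK.
  have := chr_taylor k hz ht; rewrite zy => k1.
  have k2 : cabs (chr k (z : cV) * ('i * phase k (y - z))) <= expR ((norm1 k)%:R * rho) * (norm1 k)%:R * t.
    rewrite cabsM -mulrA ler_pM ?cabs_ge0 // ?cabs_chr_le //.
    by rewrite cabsM (_ : cabs 'i = 1) ?mul1r ?phase_le // cabsE /= expr0n expr1n add0r sqrtr1.
  rewrite -[chr k (y : cV) - _](subrK (chr k (z : cV) * ('i * phase k (y - z)))) mulrDl addrC.
  apply: le_trans (cabsD _ _) _; rewrite lerD //; apply: le_trans k1 _.
  have t1 : t <= 1 by apply: ltW; apply: lt_le_trans td _; rewrite ge_min lexx.
  rewrite -!mulrA ler_wpM2l // ler_pM ?expR_ge0 ?exprn_ge0 ?mulr_ge0 //.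
    by rewrite ler_expR ler_wpM2l // lerD2l.
  by rewrite exprMn expr2 -mulrA !ler_wpM2l // expr2 -[leRHS]mul1r ler_wpM2r.
have -> : ext z - ext y = (ext z - \sum_(k <- box d N) fcoef k * chr k (z : cV)) +
   ((\sum_(k <- box d N) fcoef k * chr k (z : cV) - \sum_(k <- box d N) fcoef k * chr k (y : cV)) -
    (ext y - \sum_(k <- box d N) fcoef k * chr k (y : cV))) by ring.
apply: le_trans (cabsD _ _) _; apply: le_trans (lerD (lexx _) (cabsB _ _)) _.
by move: a1 a2 a3; move: (cabs _) (cabs _) (cabs _) => u v w; lra.
Qed.

(** Half of the distance from z to the boundary of the strip pays for the powers of |k| in the second
    order remainder of each mode, the other half for the displacement h. *)
Lemma ext_differentiable z : open_strip rho z -> differentiable ext z.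
Proof.
move=> hz.
have [s [s0 sr hs]] : exists s : R, [/\ 0 <= s, s < rho & forall j, `|Im (z 0 j)| <= s].
  exists (\big[Num.max/0]_(j < d) `|Im (z 0 j)|); split.
  - by apply: bigmax_ge_id.
  - by apply/bigmax_ltP; split => // j _; exact: hz.
  - by move=> j; apply: le_bigmax.
pose eta := (rho - s) / 2; have eta0 : 0 < eta by rewrite divr_gt0 // subr_gt0.
have es : s + eta + eta = rho by rewrite /eta; field.
have srho : s <= rho := ltW sr.
have hz' j : `|Im (z 0 j)| <= rho := le_trans (hs j) srho.
have lin (k : Zd) : (norm1 k)%:R * (eta / 2) <= expR ((norm1 k)%:R * (eta / 2)) :> R.
  by apply: le_trans (expR_ge1Dx _); rewrite lerDr.

have n2 (k : Zd) : (norm1 k)%:R = 2 / eta * ((norm1 k)%:R * (eta / 2)) :> R by move: (_%:R) => n; field; rewrite lt0r_neq0.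
have lin1 (k : Zd) : (norm1 k)%:R * expR ((norm1 k)%:R * s) <= 2 / eta * expR ((norm1 k)%:R * rho).
  rewrite [X in X * _ <= _]n2 -[X in X <= _]mulrA (ler_wpM2l (divr_ge0 (ler0n R 2) (ltW eta0))) //.
  have h := ler_wpM2r (expR_ge0 ((norm1 k)%:R * s)) (lin k).
  apply: (le_trans h).
  by rewrite -expRD ler_expR -mulrDr ler_wpM2l //; lra.
have quad (k : Zd) : expR ((norm1 k)%:R * (s + eta)) * (norm1 k)%:R ^+ 2 <= 4 / eta ^+ 2 * expR ((norm1 k)%:R * rho).
  have e2 : (norm1 k)%:R ^+ 2 = 4 / eta ^+ 2 * ((norm1 k)%:R * (eta / 2)) ^+ 2 :> R.
    by move: (_%:R) => n; field; rewrite lt0r_neq0.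
  rewrite e2 mulrCA ler_wpM2l ?divr_ge0 ?exprn_ge0 ?(ltW eta0) //.
  apply: le_trans (ler_wpM2l (expR_ge0 _) (_ : _ <= expR ((norm1 k)%:R * (eta / 2)) ^+ 2)) _.
    by rewrite lerXn2r ?nnegrE ?expR_ge0 // (mulr_ge0 _ (divr_ge0 (ltW eta0) _)).
  by rewrite -expRM_natl -expRD ler_expR; move: (_%:R) => n; rewrite -es; lra.
have cex j : exists c : C, csums (fun k => fcoef k * (chr k (z : cV) * ('i * - (k 0 j)%:~R))) c.
  apply: (csums_ex (b := fun k => 2 / eta * b k) (C0 := 2 / eta * (Csup d m * B))); last first.
    by move=> X uX; rewrite -mulr_sumr ler_wpM2l ?b_sum // divr_ge0 ?(ltW eta0).
  move=> k; rewrite /b [2 / eta * _]mulrCA cabsM [cabs (chr _ _ * _)]cabsM [cabs (_ * - _)]cabsM ler_wpM2l ?cabs_ge0 //.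
  rewrite (_ : cabs 'i = 1) ?mul1r; last by rewrite cabsE /= expr0n expr1n add0r sqrtr1.
  apply: le_trans (lin1 k); rewrite mulrC ler_pM ?cabs_ge0 ?cabs_chr_le //.
  by rewrite cabsN intC cabs_real -intr_norm -natr_absz ler_nat norm1_ge.
pose c j := projT1 (cid (cex j)); have cP j : csums (fun k => fcoef k * (chr k (z : cV) * ('i * - (k 0 j)%:~R))) (c j).
  by rewrite /c; case: cid.
apply: (@differentiable_quadratic _ _ ext z c (16 / eta ^+ 2 * (Csup d m * B)) eta) => //.
  exact: mulr_ge0 (divr_ge0 (ler0n R 16) (exprn_ge0 2 (ltW eta0))) (mulr_ge0 (ltW (Csup_gt0 _ _)) B0).
move=> h t ht t0 te.
have hzh j : `|Im ((z + h : cV) 0 j)| <= rho.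
  rewrite mxE ImD; apply: le_trans (ler_normD _ _) _; have := hs j; have := ht j; have := Im_le (h 0 j : C).
  by rewrite -es; lra.
have sumE := csumsD (csumsD (extP hzh) (csumsZ (-1) (extP hz')))
  (csumsZ (-1) (csums_sum (index_enum 'I_d) (fun j => csumsZ (h 0 j) (cP j)))).
have -> : ext (z + h) - ext z - \sum_j h 0 j * c j = ext (z + h) + -1 * ext z + -1 * (\sum_j h 0 j * c j) by rewrite !mulN1r.
apply: csums_le sumE _ => N.
apply: le_trans (_ : \sum_(k <- box d N) 16 / eta ^+ 2 * t ^+ 2 * b k <= _); last first.
  rewrite -mulr_sumr mulrAC ler_wpM2r ?exprn_ge0 //.
  by rewrite (ler_wpM2l (divr_ge0 (ler0n R 16) (exprn_ge0 2 (ltW eta0)))) // b_sum ?uniq_box.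
apply: ler_sum => k _.
have -> : fcoef k * chr k (z + h : cV) + -1 * (fcoef k * chr k (z : cV)) +
   -1 * (\sum_j h 0 j * (fcoef k * (chr k (z : cV) * ('i * - (k 0 j)%:~R)))) =
   fcoef k * (chr k (z + h : cV) - chr k (z : cV) - chr k (z : cV) * ('i * phase k h)).
  have -> : \sum_j h 0 j * (fcoef k * (chr k (z : cV) * ('i * - (k 0 j)%:~R))) = fcoef k * (chr k (z : cV) * ('i * phase k h)).
    rewrite /phase -sumrN !mulr_sumr; apply: eq_bigr => j _; ring.
  ring.
rewrite cabsM /b [16 / _ * _ * _]mulrCA ler_wpM2l ?cabs_ge0 //; apply: le_trans (chr_taylor k hs ht) _.
have -> : 16 / eta ^+ 2 * t ^+ 2 * expR ((norm1 k)%:R * rho) = 4 * (4 / eta ^+ 2 * expR ((norm1 k)%:R * rho)) * t ^+ 2.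
  by move: (expR _) => u; field; rewrite lt0r_neq0.
rewrite [(_ * t) ^+ 2]exprMn [leLHS]mulrA (ler_wpM2r (exprn_ge0 2 t0)) // -[leLHS]mulrA ler_wpM2l //; apply: le_trans (quad k).
by rewrite ler_wpM2r ?exprn_ge0 // ler_expR ler_wpM2l // lerD2l.
Qed.

Lemma Hle_strip_extension : strip_extension rho V.
Proof.
exists ext; split; [exact: ext_differentiable|exact: ext_continuous| |exact: ext_real].
exact: ext_period.
Qed.

End StripExtension.
Theorem theorem25 (R : realType) (l d m : nat) (hl : (2 <= l)%N)
    (hd : (1 <= d)%N) :
  (* (i) analytic case *)
  (forall rho : R, 0 < rho -> (d < m)%N ->
   exists2 kappa : R, 0 < kappa &
   forall (omega : 'rV[R]_d) (f h : 'rV[R]_d * R -> R) (r : R),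
     nonresonant omega -> 0 < r ->
     analytic_on rho r f -> analytic_on rho r h ->
     vanishes_analytic l rho r h ->
     avg f 0 != 0 ->
     in_H rho m (osc f 0) -> Hnorm rho m (osc f 0) <= kappa * `|avg f 0| ->
     exists eps0 A : R, [/\ 0 < eps0, 0 < A &
       forall eps a delta : R, eps_range l (avg f 0) eps0 eps ->
         a ^+ l + eps * avg f 0 = 0 ->
         0 <= delta ^+ 2 + 2 * l%:R * a ^+ l.-1 ->
         exists V : 'rV[R]_d -> R,
           locally_unique_response l m rho omega f h [set x | `|x| < r]
             delta eps a A V])
  /\
  (* (ii) finitely differentiable case *)
  ((d < 2 * m)%N ->
   exists (kappa : R) (N : nat), 0 < kappa /\
   forall (omega : 'rV[R]_d) (f h : 'rV[R]_d * R -> R) (p : nat),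
     nonresonant omega -> (1 <= p)%N ->
     Cn_torus (m + p) f -> Cn_torus (m + p) h ->
     vanishes_smooth l N h ->
     avg f 0 != 0 ->
     in_H 0 m (osc f 0) -> Hnorm 0 m (osc f 0) <= kappa * `|avg f 0| ->
     exists eps0 A : R, [/\ 0 < eps0, 0 < A &
       forall eps a delta : R, eps_range l (avg f 0) eps0 eps ->
         a ^+ l + eps * avg f 0 = 0 ->
         0 <= delta ^+ 2 + 2 * l%:R * a ^+ l.-1 ->
         exists V : 'rV[R]_d -> R,
           locally_unique_response l m 0 omega f h setT
             delta eps a A V]).
Proof.
have eta0 (k : nat) : 0 < eta l d k / 2 :> R by have [e0 _ _ _ _] := eta_spec (R := R) l d k; rewrite divr_gt0.
split=> [rho rho0 dm|dm].
  have dm2 : (d < 2 * m)%N by rewrite (leq_trans dm) // leq_pmull.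
  exists (eta l d m / 2) => // om f h r nr r0 af _ vh f0 fH fk.
  have [cO hO] := in_HP (mulr_ge0 (ltW (eta0 m)) (normr_ge0 _)) fH fk.
  have [s0 [M [s00 M0 s0r adm]]] := analytic_admissible rho0 dm2 hd r0 af vh.
  apply: (response hl (ltW rho0) dm2 nr s00 M0 adm _ f0 cO hO).
    by move=> x hx; apply: le_lt_trans hx s0r.
  by move=> V B cV B0 hV _; exact: (Hle_strip_extension rho0 dm2 cV B0 hV).
exists (eta l d m / 2), (m + l.+2)%N; split=> // om f h p nr p1 fC hC vh f0 fH fk.
have [cO hO] := in_HP (mulr_ge0 (ltW (eta0 m)) (normr_ge0 _)) fH fk.
have [s0 [M [s00 M0 adm]]] := smooth_admissible hd dm p1 fC hC (leqnn _) vh.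
apply: (response hl (lexx 0) dm nr s00 M0 adm _ f0 cO hO) => //.
by move=> V B _ _ _; rewrite ltxx.
Qed.
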